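(* Let $(K,\Omega+\Theta)$ be a 2-shifted symplectic Lie group with corresponding quadratic Lie algebra $(\mathfrak{k},\langle\cdot,\cdot\rangle_\Omega)$. Let $\mathcal{H}\rightrightarrows N$ be a Lie groupoid, $\Phi:\mathcal{H}\to K$ a Lie groupoid morphism, and $\varphi=\mathrm{Lie}(\Phi):A_{\mathcal{H}}\to\mathfrak{k}$. Then: (a) If $\sigma+\eta$ is an isotropic structure on $\Phi$, then $(\lambda_\sigma,\eta)$ is an isotropic structure on $\varphi$, where $\lambda_\sigma:A_{\mathcal{H}}\to T^*N$ is given by $\lambda_\sigma(u)=(i_u\sigma)|_{TN}$. (b) The correspondence between isotropic structures on $\Phi$ and isotropic structures on $\varphi$ given in (a), $\sigma+\eta\mapsto(\lambda_\sigma,\eta)$, is bijective provided $\mathcal{H}$ is source-simply-connected.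
   Context: Everything is real and $C^\infty$. For a Lie groupoid $\mathcal{H}\rightrightarrows N$, $\mathtt{s},\mathtt{t}$ are source and target, $\mathtt{m}:\mathcal{H}_{(2)}=\{(g,h):\mathtt{s}(g)=\mathtt{t}(h)\}\to\mathcal{H}$ is the multiplication, $\epsilon:N\to\mathcal{H}$ the unit map ($N$ is identified with its image). The Lie algebroid is $A_{\mathcal{H}}=\ker(T\mathtt{s})|_N$ with anchor $\mathtt{a}=T\mathtt{t}$ and bracket induced by right-invariant vector fields (the same convention is used for Lie groups). $\mathfrak{k}_N=N\times\mathfrak{k}$. 2-shifted symplectic Lie group: a Lie group $K$ with $\Omega\in\Omega^2(K\times K)$, whose pullbacks along $k\mapsto(1,k)$ and $k\mapsto(k,1)$ vanish, and $\Theta\in\Omega^3(K)$, such that $\delta\Omega=0$, $\delta\Theta=\mathrm{pr}_1^*\Theta+\mathrm{pr}_2^*\Theta-\mathtt{m}^*\Theta=-d\Omega$, $d\Theta=0$, where $\delta\Omega=(k_2,k_3)^*\Omega-(k_1k_2,k_3)^*\Omega+(k_1,k_2k_3)^*\Omega-(k_1,k_2)^*\Omega$ on $K^3$, and such that the symmetric ad-invariant bilinear form on $\mathfrak{k}$, $\langle u,v\rangle_\Omega=-\Omega_{(1,1)}((u,0),(0,v))+\Omega_{(1,1)}((0,u),(v,0))$, is nondegenerate. Then $(\mathfrak{k},\langle\cdot,\cdot\rangle_\Omega)$ is the corresponding quadratic Lie algebra. An isotropic structure on a groupoid morphism $\Phi:\mathcal{H}\to K$ is $\sigma+\eta$ with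 $\sigma\in\Omega^2(\mathcal{H})$ satisfying $\epsilon^*\sigma=0$ (normalized) and $\eta\in\Omega^3(N)$ such that $\mathrm{pr}_1^*\sigma+\mathrm{pr}_2^*\sigma-\mathtt{m}^*\sigma=\Phi^*\Omega$ on $\mathcal{H}_{(2)}$, $\Phi^*\Theta=\mathtt{s}^*\eta-\mathtt{t}^*\eta-d\sigma$, and $d\eta=0$. An isotropic structure on a Lie algebroid morphism $\varphi:A\to\mathfrak{k}$ ($A\to N$ a Lie algebroid with anchor $\mathtt{a}$, $(\mathfrak{k},\langle\cdot,\cdot\rangle)$ a quadratic Lie algebra) is a pair $(\lambda,\eta)$ with $\lambda:A\to T^*N$ a vector bundle map over $\mathrm{id}_N$ and $\eta\in\Omega^3(N)$ closed, such that for all $u,v\in\Gamma(A)$: $\lambda([u,v])=\mathcal{L}_{\mathtt{a}(u)}\lambda(v)-i_{\mathtt{a}(v)}d\lambda(u)+i_{\mathtt{a}(v)}i_{\mathtt{a}(u)}\eta+\langle d\varphi(u),\varphi(v)\rangle$ and $-\langle\varphi(u),\varphi(v)\rangle=i_{\mathtt{a}(u)}\lambda(v)+i_{\mathtt{a}(v)}\lambda(u)$. *)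

(* Defs.v *)
From HB Require Import structures.
From mathcomp Require Import all_boot all_order all_algebra.
From mathcomp Require Import all_classical all_reals all_analysis.
Set Implicit Arguments.
Unset Strict Implicit.
Unset Printing Implicit Defensive.
Import Order.TTheory GRing.Theory Num.Theory.
Import numFieldNormedType.Exports.
Local Open Scope classical_set_scope.
Local Open Scope ring_scope.

Fixpoint Ck (R : realType) (n k : nat) (V : set 'rV[R]_n) (F : 'rV[R]_n -> R)
    : Prop :=
  if k is k'.+1 then
    (forall x, V x -> differentiable F x) /\ forall v, Ck k' V ('D_v F)
  else forall x, V x -> {for x, continuous F}.

Definition smooth_on (R : realType) (n : nat) (V : set 'rV[R]_n)
    (F : 'rV[R]_n -> R) : Prop :=
  forall k, Ck k V F.

(* A topological space with a distinguished set of real functions.  Besides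
   manifolds, this covers products and subsets of manifolds (in particular the
   space of composable pairs of a groupoid), which thus need no atlas. *)
Record smoothSpace (R : realType) := SmoothSpace {
  stop :> topologicalType;
  Cinf : set (stop -> R) }.

Arguments SmoothSpace {R}.
Arguments Cinf {R} s.

(* cinv is only meaningful on the open set cmap @` cdom. *)
Record chart (R : realType) (M : topologicalType) (n : nat) := Chart {
  cdom : set M;
  cmap : M -> 'rV[R]_n;
  cinv : 'rV[R]_n -> M;
  cdom_open : open cdom;
  cimg_open : open (cmap @` cdom);
  cmapK : forall x, cdom x -> cinv (cmap x) = x;
  cmap_cts : {within cdom, continuous cmap};
  cinv_cts : {within cmap @` cdom, continuous cinv} }.

Definition chart_compat (R : realType) (M : topologicalType) (n : nat)
    (c d : chart R M n) : Prop :=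
  forall i : 'I_n,
    smooth_on (cmap c @` (cdom c `&` cdom d))
              (fun x => cmap d (cinv c x) ord0 i).

Record manifold (R : realType) := Manifold {
  mtop : topologicalType;
  mdim : nat;
  atlas : set (chart R mtop mdim);
  mhausdorff : hausdorff_space mtop;
  mcountable : @second_countable mtop;
  atlas_cover : forall x : mtop, exists2 c, atlas c & cdom c x;
  atlas_compat : forall c d, atlas c -> atlas d -> chart_compat c d }.

Definition mfd_space (R : realType) (M : manifold R) : smoothSpace R :=
  SmoothSpace (mtop M)
    [set f : mtop M -> R | forall c, atlas c ->
             smooth_on (cmap c @` cdom c) (f \o cinv c)].

Coercion mfd_space : manifold >-> smoothSpace.

(* Functions which are locally smooth functions of finitely many elements of
   G.  For the pullbacks to M * N of smooth functions of two manifolds,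
   this is C^oo(M * N): local coordinates extend to global smooth functions. *)
Definition generated (R : realType) (T : topologicalType) (G : set (T -> R))
    : set (T -> R) :=
  [set f | forall x : T, exists k (g : 'I_k -> T -> R) (F : 'rV[R]_k -> R),
    [/\ forall i, G (g i), smooth_on setT F &
        \forall y \near x, f y = F (\row_i g i y)]].

Definition prodS (R : realType) (M N : smoothSpace R) : smoothSpace R :=
  SmoothSpace (M * N)%type
    (generated ([set f \o fst | f in Cinf M] `|` [set f \o snd | f in Cinf N])).

(* Functions on A which locally extend to smooth functions on M; for an
   embedded submanifold A this is C^oo(A). *)
Definition subS (R : realType) (M : smoothSpace R) (A : set M) : smoothSpace R :=
  SmoothSpace (set_type A)
    [set f | forall x : set_type A, exists2 F, Cinf M F &
                       \forall y \near x, f y = F (set_val y)].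

Definition smooth_map (R : realType) (M N : smoothSpace R) (f : M -> N) : Prop :=
  forall g, Cinf N g -> Cinf M (g \o f).

(* Tangent vectors as derivations of C^oo(M).  They are functions on all of
   M -> R, required to vanish outside C^oo(M) so that equality of tangent
   vectors is Leibniz equality; tangent p is a linear subspace of tvec M. *)

Section Tangent.
Context {R : realType}.
Implicit Types M N : smoothSpace R.

Definition tvec M : Type := (M -> R) -> R.
HB.instance Definition _ M := GRing.Lmodule.copy (tvec M) ((M -> R) -> R^o).

Definition on_smooth M (D : (M -> R) -> R) : tvec M := patch (fun=> 0) (Cinf M) D.

Definition tangent M (p : M) : set (tvec M) :=
  [set v | [/\ forall f, ~ Cinf M f -> v f = 0,
               forall (a : R) f g, Cinf M f -> Cinf M g ->
                 v (fun x => a * f x + g x) = a * v f + v g &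
               forall f g, Cinf M f -> Cinf M g ->
                 v (fun x => f x * g x) = f p * v g + v f * g p]].

(* A nonzero tangent vector determines its base point, so none is recorded. *)
Definition Tmap M N (f : M -> N) (v : tvec M) : tvec N :=
  on_smooth (fun g => v (g \o f)).

Definition submersion M N (f : M -> N) : Prop :=
  forall p w, tangent (f p) w -> exists2 v, tangent p v & Tmap f v = w.

Definition vfield M (X : M -> tvec M) : Prop :=
  (forall p, tangent p (X p)) /\
  forall f, Cinf M f -> Cinf M (fun p => X p f).

Definition bracket M (X Y : M -> tvec M) (p : M) : tvec M :=
  on_smooth (fun f => X p (fun q => Y q f) - Y p (fun q => X q f)).

Definition preform M k : Type := M -> ('I_k -> tvec M) -> R.
HB.instance Definition _ M k :=
  GRing.Zmodule.copy (preform M k) (M -> ('I_k -> tvec M) -> R^o).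

(* The first clause makes equality of forms Leibniz equality. *)
Definition is_form M k (w : preform M k) : Prop :=
  [/\ forall p v, ~ (forall i, tangent p (v i)) -> w p v = 0,
      forall p (v : 'I_k -> tvec M) i (a : R) x y,
        (forall j, tangent p (v j)) -> tangent p x -> tangent p y ->
        w p [eta v with i |-> a *: x + y] =
        a * w p [eta v with i |-> x] + w p [eta v with i |-> y],
      forall p v i j, (forall l, tangent p (v l)) -> i != j -> v i = v j ->
        w p v = 0 &
      forall X : 'I_k -> M -> tvec M, (forall i, vfield (X i)) ->
        Cinf M (fun p => w p (fun i => X i p))].

(* equality as forms, for expressions not known to vanish off tangent vectors *)
Definition form_eq M k (w w' : preform M k) : Prop :=
  forall p v, (forall i, tangent p (v i)) -> w p v = w' p v.

Definition pullback M N (f : M -> N) k (w : preform N k) : preform M k :=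
  fun p v => w (f p) (fun i => Tmap f (v i)).

Definition iprod M (X : M -> tvec M) k (w : preform M k.+1) : preform M k :=
  fun p v => w p (fun l => if unlift ord0 l is Some j then v j else X p).

(* Koszul's formula for dw(X_0, ..., X_k).  The bracket [X_i, X_j], i < j, is
   inserted in place of X_i, not in front; this turns the sign (-1)^(i+j) of
   the usual formula into (-1)^j. *)
Definition koszul M k (w : preform M k) (X : 'I_k.+1 -> M -> tvec M) (p : M)
    : R :=
  \sum_(i < k.+1) (-1) ^+ i * X i p (fun q => w q (fun l => X (lift i l) q)) +
  \sum_(i < k.+1) \sum_(j < k.+1 | (i < j)%N)
     (-1) ^+ j * w p (fun l => if lift j l == i then bracket (X i) (X j) p
                               else X (lift j l) p).

(* Koszul's formula does not depend on how the vectors are extended. *)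
Definition extd M k (w : preform M k) : preform M k.+1 := fun p v =>
  koszul w (fun i => xget (fun=> 0) [set X | vfield X /\ X p = v i]) p.

(* Cartan's formula *)
Definition lie_deriv M (X : M -> tvec M) k (w : preform M k.+1)
    : preform M k.+1 :=
  extd (iprod X w) + iprod X (extd w).

End Tangent.

Record lieGroup (R : realType) (K : manifold R) := LieGroup {
  gmul : K -> K -> K;
  gone : K;
  ginv : K -> K;
  gmulA : forall x y z, gmul x (gmul y z) = gmul (gmul x y) z;
  gmul1g : forall x, gmul gone x = x;
  gmulVg : forall x, gmul (ginv x) x = gone;
  gmul_smooth : smooth_map (M := prodS K K) (fun p => gmul p.1 p.2);
  ginv_smooth : smooth_map ginv }.

Section Shifted.
Context {R : realType} {K : manifold R} (G : lieGroup K).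
Local Notation K2 := (prodS K K).
Local Notation K3 := (prodS K2 K).
Local Notation mu := (gmul G).
Local Notation e := (gone G).

(* l u = (u, 0) and r v = (0, v) in T_(1,1)(K * K) *)
Definition pairing (Omega : preform K2 2) (u v : tvec K) : R :=
  let l := @Tmap R K K2 (fun k => (k, e)) in
  let r := @Tmap R K K2 (fun k => (e, k)) in
  - Omega (e, e) (tnth [tuple l u; r v]) + Omega (e, e) (tnth [tuple r u; l v]).

Definition delta2 (Omega : preform K2 2) : preform K3 2 :=
  @pullback R K3 K2 (fun p => (p.1.2, p.2)) 2 Omega
  - @pullback R K3 K2 (fun p => (mu p.1.1 p.1.2, p.2)) 2 Omega
  + @pullback R K3 K2 (fun p => (p.1.1, mu p.1.2 p.2)) 2 Omega
  - @pullback R K3 K2 (fun p => (p.1.1, p.1.2)) 2 Omega.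

Definition delta1 (Theta : preform K 3) : preform K2 3 :=
  @pullback R K2 K (fun p => p.1) 3 Theta
  + @pullback R K2 K (fun p => p.2) 3 Theta
  - @pullback R K2 K (fun p => mu p.1 p.2) 3 Theta.

Definition shifted2_symplectic (Omega : preform K2 2) (Theta : preform K 3)
    : Prop :=
  [/\ is_form Omega /\ is_form Theta,
      form_eq (@pullback R K K2 (fun k => (e, k)) 2 Omega) 0 /\
      form_eq (@pullback R K K2 (fun k => (k, e)) 2 Omega) 0,
      [/\ form_eq (delta2 Omega) 0,
          form_eq (delta1 Theta) (- extd Omega) &
          form_eq (extd Theta) 0] &
      forall u, tangent e u ->
        (forall v, tangent e v -> pairing Omega u v = 0) -> u = 0].

End Shifted.

(* gcomp g h is only meaningful for src g = tgt h; it is then the product gh. *)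
Record lieGroupoid (R : realType) (H N : manifold R) := LieGroupoid {
  src : H -> N;
  tgt : H -> N;
  unit_at : N -> H;
  inv_of : H -> H;
  gcomp : H -> H -> H;
  src_smooth : smooth_map src;
  tgt_smooth : smooth_map tgt;
  unit_smooth : smooth_map unit_at;
  inv_smooth : smooth_map inv_of;
  gcomp_smooth :
    smooth_map (M := subS (M := prodS H H) [set p | src p.1 = tgt p.2])
               (fun p => gcomp (set_val p).1 (set_val p).2);
  src_submersion : submersion src;
  tgt_submersion : submersion tgt;
  src_unit : forall x, src (unit_at x) = x;
  tgt_unit : forall x, tgt (unit_at x) = x;
  src_comp : forall g h, src g = tgt h -> src (gcomp g h) = src h;
  tgt_comp : forall g h, src g = tgt h -> tgt (gcomp g h) = tgt g;
  gcompA : forall g h k, src g = tgt h -> src h = tgt k ->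
    gcomp g (gcomp h k) = gcomp (gcomp g h) k;
  gcomp_unitl : forall g, gcomp (unit_at (tgt g)) g = g;
  gcomp_unitr : forall g, gcomp g (unit_at (src g)) = g;
  src_inv : forall g, src (inv_of g) = tgt g;
  tgt_inv : forall g, tgt (inv_of g) = src g;
  gcomp_invl : forall g, gcomp (inv_of g) g = unit_at (src g);
  gcomp_invr : forall g, gcomp g (inv_of g) = unit_at (tgt g) }.

Section Groupoid.
Context {R : realType} {H N : manifold R} (G : lieGroupoid H N).
Local Notation s := (src G).
Local Notation t := (tgt G).
Local Notation eps := (unit_at G).

Definition composable : smoothSpace R :=
  subS (M := prodS H H) [set p | s p.1 = t p.2].

Definition comp_fst (p : composable) : H := (set_val p).1.
Definition comp_snd (p : composable) : H := (set_val p).2.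
Definition comp_mul (p : composable) : H := gcomp G (comp_fst p) (comp_snd p).

Definition source_fibre (x : N) : smoothSpace R := subS (M := H) [set g | s g = x].

Definition groupoid_morphism (K : manifold R) (GK : lieGroup K) (Phi : H -> K)
    : Prop :=
  smooth_map Phi /\
  forall g h, s g = t h -> Phi (gcomp G g h) = gmul GK (Phi g) (Phi h).

Definition algd (x : N) : set (tvec H) :=
  [set u | tangent (eps x) u /\ Tmap s u = 0].

Definition algd_section (u : N -> tvec H) : Prop :=
  (forall x, algd x (u x)) /\ forall f, Cinf H f -> Cinf N (fun x => u x f).

Definition anchor (u : N -> tvec H) : N -> tvec N := fun x => Tmap t (u x).

Definition rtrans (g : H) (h : source_fibre (t g)) : H := gcomp G (set_val h) g.

(* u^R(g) = TR_g (u(t(g))), where u(t(g)) is viewed as a vector tangent to the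
   source fibre on which R_g is defined *)
Definition right_inv (u : N -> tvec H) (g : H) : tvec H :=
  Tmap (@rtrans g)
    (xget 0 [set w : tvec (source_fibre (t g)) |
       (exists2 h : source_fibre (t g), set_val h = eps (t g) & tangent h w) /\
       @Tmap R (source_fibre (t g)) H set_val w = u (t g)]).

Definition algd_bracket (u v : N -> tvec H) : N -> tvec H :=
  fun x => bracket (right_inv u) (right_inv v) (eps x).

Definition unit_interval : set R := `[0, 1]%classic.
Local Notation I := unit_interval.

(* nonempty, path connected, and every loop contracts to its base point *)
Definition simply_connected (X : topologicalType) (S : set X) : Prop :=
  [/\ S !=set0,
      forall x y, S x -> S y -> exists c : R -> X,
        [/\ {within I, continuous c}, c @` I `<=` S, c 0 = x & c 1 = y] &
      forall c : R -> X, {within I, continuous c} -> c @` I `<=` S ->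
        c 0 = c 1 ->
        exists h : R * R -> X,
          [/\ {within I `*` I, continuous h}, h @` (I `*` I) `<=` S,
              forall r, I r -> h (0, r) = c r /\ h (1, r) = c 0 &
              forall r, I r -> h (r, 0) = c 0 /\ h (r, 1) = c 0]].

Definition source_simply_connected : Prop :=
  forall x : N, simply_connected [set g : H | s g = x].

End Groupoid.

Section Isotropic.
Context {R : realType} {K H N : manifold R}.
Context (GK : lieGroup K) (Omega : preform (prodS K K) 2) (Theta : preform K 3).
Context (G : lieGroupoid H N) (Phi : H -> K).
Local Notation C2 := (composable G).
Local Notation pr := (pairing GK Omega).

Definition isotropic_groupoid : set (preform H 2 * preform N 3) :=
  [set se | let sigma := se.1 in let eta := se.2 in
   [/\ is_form sigma /\ is_form eta,
       form_eq (pullback (unit_at G) sigma) 0,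
       form_eq (pullback (@comp_fst _ _ _ G) sigma
                + pullback (@comp_snd _ _ _ G) sigma
                - pullback (@comp_mul _ _ _ G) sigma)
               (@pullback R C2 (prodS K K)
                  (fun p => (Phi (comp_fst p), Phi (comp_snd p))) 2 Omega),
       form_eq (pullback Phi Theta)
               (pullback (src G) eta - pullback (tgt G) eta - extd sigma) &
       form_eq (extd eta) 0]].

(* Maps A_H -> T^*N over the identity: lam x u w is the value of the covector
   lam_x(u) on w in T_xN, and is required to vanish for other u, w. *)
Definition covec_map : Type := N -> tvec H -> tvec N -> R.

Definition is_bundle_map (lam : covec_map) : Prop :=
  [/\ forall x u w, ~ (algd G x u /\ tangent x w) -> lam x u w = 0,
      forall x (a : R) u v w, algd G x u -> algd G x v -> tangent x w ->
        lam x (a *: u + v) w = a * lam x u w + lam x v w,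
      forall x (a : R) u w z, algd G x u -> tangent x w -> tangent x z ->
        lam x u (a *: w + z) = a * lam x u w + lam x u z &
      forall u X, algd_section G u -> vfield X ->
        Cinf N (fun x => lam x (u x) (X x))].

Definition lam_form (lam : covec_map) (u : N -> tvec H) : preform N 1 :=
  fun x w => lam x (u x) (w ord0).

Definition lie_morphism (u : N -> tvec H) : N -> tvec K :=
  fun x => Tmap Phi (u x).

(* derivative along w of a function with values in a tangent space of K *)
Definition vec_deriv (w : tvec N) (F : N -> tvec K) : tvec K :=
  on_smooth (fun f => w (fun x => F x f)).

(* <d phi(u), phi(v)> *)
Definition dpairing (u v : N -> tvec H) : preform N 1 := fun x w =>
  pr (vec_deriv (w ord0) (lie_morphism u)) (lie_morphism v x).

Definition isotropic_algebroid : set (covec_map * preform N 3) :=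
  [set le | let lam := le.1 in let eta := le.2 in
   [/\ is_bundle_map lam,
       is_form eta,
       form_eq (extd eta) 0,
       forall u v, algd_section G u -> algd_section G v ->
         form_eq (lam_form lam (algd_bracket G u v))
                 (lie_deriv (anchor G u) (lam_form lam v)
                  - iprod (anchor G v) (extd (lam_form lam u))
                  + iprod (anchor G v) (iprod (anchor G u) eta)
                  + dpairing u v) &
       forall u v, algd_section G u -> algd_section G v -> forall x,
         - pr (lie_morphism u x) (lie_morphism v x) =
         lam x (v x) (anchor G u x) + lam x (u x) (anchor G v x)]].

Definition lambda_of (sigma : preform H 2) : covec_map := fun x u w =>
  if `[< algd G x u /\ tangent x w >]
  then sigma (unit_at G x) (tnth [tuple u; Tmap (unit_at G) w]) else 0.

End Isotropic.

(* Main.v *)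
(** Write u^R for the right-invariant vector field of a section u of A_H, and let
    beta_c, for c in k, be the 1-form on K whose value at k is Omega_(1,k) on
    (c, 0) and (0, -).  Multiplicativity of sigma at the pair (1, g) gives
    i_(u^R) sigma = theta_u, where theta_u := t^* lambda(u) - Phi^* beta_phi(u),
    while d sigma = chi := s^* eta - t^* eta - Phi^* Theta.  Cartan's formula for
    these two identities yields the axioms of an isotropic structure on phi, by way
    of an identity on K between d beta, Theta and the bracket of k.

    Conversely these axioms say that i_(u^R) sigma = theta_u and
    i_(u^R) (d sigma - chi) = 0 can be solved locally on H (by a Poincare lemma
    along the source fibres), and two local solutions differ by an s-basic form.
    Since the source fibres are simply connected, local solutions can be modified
    by basic forms so as to agree along each fibre, starting with a form which
    vanishes on N; this gives a global solution.  A form which is horizontal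
    together with its differential, and which vanishes along a section of a
    submersion with connected fibres, is zero.  Applied to s this gives
    d sigma = chi and uniqueness; applied to the second projection of the space
    of composable pairs it gives multiplicativity. *)

From HB Require Import structures.
Require Import Defs.
From mathcomp Require Import all_boot all_order all_algebra.
From mathcomp Require Import all_classical all_reals all_analysis.
From mathcomp Require Import ring lra.
Set Implicit Arguments.
Unset Strict Implicit.
Unset Printing Implicit Defensive.
Import Order.TTheory GRing.Theory Num.Theory.
Import numFieldNormedType.Exports.
Local Open Scope classical_set_scope.
Local Open Scope ring_scope.

(** * Calculus on R^n *)

Section SmoothRn.
Context {R : realType}.
Implicit Types n k m : nat.

(** Locally, both i_(u^R) sigma and i_(u^R) d sigma are prescribed. The first equation is algebraic:
    theta_u(v^R) is skew in u and v, so a coframe dual to right-invariant fields gives a solution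
    w0. Cartan's formula and the axioms then make d w0 - chi vanish on pairs of vertical vectors. As
    it is closed, its part with one vertical argument is a closed 1-form along the fibres with
    values in 2-forms of the base, and the Poincare lemma is needed in degree one only, with
    parameters.

    The same reduction makes the gluing a matter of the fundamental group: on the fibre over x, and
    for two fixed vectors at x, local solutions differ by locally constant real functions. The
    constants are found one fibre at a time, with no control over their dependence on x; smoothness
    is obtained near the units, where the normalization fixes them, and carried along the fibres box
    by box.

    Composable pairs come without an atlas. Calculus is therefore set up on spaces having local
    coordinates made of global smooth functions, a class which contains manifolds, products and
    fibre products along submersions. *)

Lemma Ck_sub n k (V V' : set 'rV[R]_n) F : V' `<=` V -> Ck k V F -> Ck k V' F.
Proof.
move=> sV; elim: k F => [|k IH] F /=; first by move=> H x /sV; apply: H.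
by move=> [H1 H2]; split=> [x /sV|v]; [exact: H1|exact: IH].
Qed.

Lemma CkW n k (V : set 'rV[R]_n) F : Ck k.+1 V F -> Ck k V F.
Proof.
elim: k F => [|k IH] F [H1 H2].
  by move=> x /H1 /differentiable_continuous.
by split=> // v; apply: IH.
Qed.

Lemma frechetW n (F : 'rV[R]_n -> R) x e : differentiable F x -> 0 < e ->
  \forall h \near 0, `|F (x + h) - F x - 'd F x h| <= e * `|h|.
Proof.
move=> /diff_locallyxP [_ dF] e0.
have /eqaddoP/(_ e e0) : (fun h => F (h + x)) = (cst (F x) + 'd F x) +o_ (0:'rV[R]_n) id.
  by apply/eqaddoE; apply/funext => h; rewrite dF.
by apply: filterS => h; rewrite !fctE /= opprD addrA [x + h]addrC.
Qed.

Lemma frechetP n (F : 'rV[R]_n -> R) (x : 'rV[R]_n) (L : {linear 'rV[R]_n -> R}) :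
  continuous L ->
  (forall e : R, 0 < e -> \forall h \near (0 : 'rV[R]_n), `|F (x + h) - F x - L h| <= e * `|h|) ->
  differentiable F x /\ ('d F x : 'rV[R]_n -> R) = L.
Proof.
move=> cL H.
have E : F \o shift x = cst (F x) + L +o_ (0 : 'rV[R]_n) id.
  apply/eqaddoP => e e0; apply: filterS (H e e0) => h.
  by rewrite !fctE /= opprD addrA [h + x]addrC.
have D := diff_unique cL E; split=> //.
by apply/diff_locallyP; rewrite D.
Qed.

Lemma near_eq_differentiable n (F G : 'rV[R]_n -> R) x :
  (\near x, F x = G x) -> differentiable F x ->
  differentiable G x /\ ('d G x : 'rV[R]_n -> R) = 'd F x.
Proof.
move=> FG dF.
have Fx : F x = G x by exact: nbhs_singleton FG.
apply: frechetP; first exact: diff_continuous.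
move=> e e0; have := frechetW dF e0.
move: FG; rewrite (near_shift (0 : 'rV[R]_n)) /=; apply: filterS2 => h.
by rewrite /= subr0 Fx (addrC h) => ->.
Qed.

Lemma Ck_eq n k (V : set 'rV[R]_n) F G : open V ->
  (forall x, V x -> F x = G x) -> Ck k V F -> Ck k V G.
Proof.
move=> oV; elim: k F G => [|k IH] F G FG /=.
  move=> H x Vx; have := H x Vx; rewrite /prop_for /continuous_at -(FG _ Vx).
  apply: cvg_trans; apply: (@near_eq_cvg _ _ (nbhs x)).
  by apply: filterS (open_nbhs_nbhs (conj oV Vx)) => y /FG.
have nFG x : V x -> \near x, F x = G x.
  by move=> Vx; apply: filterS (open_nbhs_nbhs (conj oV Vx)) => y /FG.
move=> [H1 H2]; split=> [x Vx|v].
  by have [] := near_eq_differentiable (nFG x Vx) (H1 x Vx).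
by apply: (IH ('D_v F)) => // x Vx; exact: near_eq_derive (nFG x Vx).
Qed.

Lemma Ck_cst n k (V : set 'rV[R]_n) (c : R) : Ck k V (fun=> c).
Proof.
elim: k c => [|k IH] c /=; first by move=> x _; exact: cst_continuous.
split=> [x _|v]; first exact: differentiable_cst.
suff -> : 'D_v (fun=> c) = (fun=> 0) :> ('rV[R]_n -> R) by exact: IH.
by apply/funext => x; exact: derive_cst.
Qed.

Lemma Ck_add n k (V : set 'rV[R]_n) F G : open V ->
  Ck k V F -> Ck k V G -> Ck k V (fun x => F x + G x).
Proof.
move=> oV; elim: k F G => [|k IH] F G /=.
  by move=> H1 H2 x Vx; exact: (continuousD (H1 x Vx) (H2 x Vx)).
move=> [F1 F2] [G1 G2]; split=> [x Vx|v].
  by apply: (@differentiableD _ _ _ F G); [exact: F1|exact: G1].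
apply: (Ck_eq oV _ (IH _ _ (F2 v) (G2 v))) => x Vx.
by rewrite (@deriveD _ _ _ F G) //; apply: diff_derivable; [exact: F1|exact: G1].
Qed.

Lemma Ck_mul n k (V : set 'rV[R]_n) F G : open V ->
  Ck k V F -> Ck k V G -> Ck k V (fun x => F x * G x).
Proof.
move=> oV; elim: k F G => [|k IH] F G.
  by move=> H1 H2 x Vx; exact: (continuousM (H1 x Vx) (H2 x Vx)).
move=> CF CG; have [F1 F2] := CF; have [G1 G2] := CG; split=> [x Vx|v].
  by apply: (@differentiableM _ _ F G); [exact: F1|exact: G1].
apply: (Ck_eq oV _ (Ck_add oV (IH _ _ (CkW CF) (G2 v)) (IH _ _ (CkW CG) (F2 v)))).
move=> x Vx.
by rewrite (@deriveM _ _ F G) //; apply: diff_derivable; [exact: F1|exact: G1].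
Qed.

Lemma Ck_sum n k (V : set 'rV[R]_n) (I : Type) (r : seq I) (P : pred I) F : open V ->
  (forall i, P i -> Ck k V (F i)) -> Ck k V (fun x => \sum_(i <- r | P i) F i x).
Proof.
move=> oV H.
have -> : (fun x => \sum_(i <- r | P i) F i x) = \sum_(i <- r | P i) F i.
  by apply/funext => x; rewrite fct_sumE.
apply: (big_ind (Ck k V)) => //; first exact: Ck_cst.
by move=> f g; exact: Ck_add.
Qed.

Lemma Ck_coord n k (V : set 'rV[R]_n) i : Ck k V (fun x => x 0 i).
Proof.
case: k => [|k] /=; first by move=> x _; exact: coord_continuous.
split=> [x _|v]; first exact: differentiable_coord.
have -> : 'D_v (fun x : 'rV[R]_n => x 0 i) = fun=> v 0 i; last exact: Ck_cst.
apply/funext => x.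
have dv : derivable (id : 'rV[R]_n -> _) x v by exact: derivable_id.
have := derive_mx dv; rewrite derive_id.
by move=> /(congr1 (fun M : 'rV[R]_n => M 0 i)); rewrite mxE.
Qed.

Definition pd n (i : 'I_n) (F : 'rV[R]_n -> R) := 'D_(delta_mx 0 i : 'rV[R]_n) F.

Lemma derive_pd n (F : 'rV[R]_n -> R) (x v : 'rV[R]_n) : differentiable F x ->
  'D_v F x = \sum_i v 0 i * pd i F x.
Proof.
move=> dF; rewrite deriveE // {1}[v]row_sum_delta linear_sum /=.
by apply: eq_bigr => i _; rewrite linearZ /= /pd deriveE.
Qed.

Lemma differentiable_row n m (g : 'I_m -> 'rV[R]_n -> R) (x : 'rV[R]_n) :
  (forall i, differentiable (g i) x) -> differentiable (fun y => \row_i g i y) x.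
Proof.
move=> H; have -> : (fun y => \row_i g i y) =
    \sum_i (fun y => g i y *: (delta_mx 0 i : 'rV[R]_m)).
  apply/funext => y; rewrite fct_sumE [LHS]row_sum_delta.
  by apply: eq_bigr => i _; rewrite mxE.
by apply: differentiable_sum => i; exact: differentiableZl.
Qed.

Lemma derive_comp_row n m (F : 'rV[R]_m -> R) (g : 'I_m -> 'rV[R]_n -> R)
    (x v : 'rV[R]_n) :
  (forall i, differentiable (g i) x) -> differentiable F (\row_i g i x) ->
  differentiable (fun y => F (\row_i g i y)) x /\
  'D_v (fun y => F (\row_i g i y)) x = \sum_i pd i F (\row_i g i x) * 'D_v (g i) x.
Proof.
move=> dg dF; have dr := differentiable_row dg.
have dc : differentiable (F \o (fun y => \row_i g i y)) x by exact: differentiable_comp.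
split=> //.
rewrite -[LHS]/('D_v (F \o (fun y => \row_i g i y)) x) deriveE // diff_comp //=.
rewrite -deriveE // derive_pd // -(deriveE v dr) derive_mx; last exact: diff_derivable.
 apply: eq_bigr => i _; rewrite mxE mulrC.
by congr (_ * _); congr (derive _ x v); apply/funext => y; rewrite mxE.
Qed.

Lemma continuous_row (T : topologicalType) m (g : 'I_m -> T -> R) (x : T) :
  (forall i, {for x, continuous (g i)}) -> {for x, continuous (fun y => \row_i g i y : 'rV[R]_m)}.
Proof.
move=> cg A [P /= nP sPA]; apply: filterS sPA _.
have H : \forall y \near x, forall j, P ord0 j (g j y).
  apply: filter_forall => j; apply: cg; have := nP ord0 j; by rewrite mxE.
by apply: filterS H => y H i j; rewrite mxE (ord1 i).
Qed.

Lemma Ck_comp n m k (V : set 'rV[R]_n) (W : set 'rV[R]_m) F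
    (g : 'I_m -> 'rV[R]_n -> R) : open V ->
  (forall x, V x -> W (\row_i g i x)) -> (forall i, Ck k V (g i)) -> Ck k W F ->
  Ck k V (fun x => F (\row_i g i x)).
Proof.
move=> oV VW; elim: k F => [|k IH] F.
  move=> Cg CF x Vx.
  by apply: (@continuous_comp _ _ _ (fun y => \row_i g i y) F); [apply: continuous_row => i; exact: Cg|exact/CF/VW].
move=> Cg CF; have CF' := CkW CF; have [F1 F2] := CF; split=> [x Vx|v].
  have dg i : differentiable (g i) x by have [+ _] := Cg i; apply.
  by have [] := derive_comp_row 0 dg (F1 _ (VW _ Vx)).
apply: (@Ck_eq _ _ _ (fun x => \sum_i pd i F (\row_i g i x) * 'D_v (g i) x)) => //.
  move=> x Vx; have dg i : differentiable (g i) x by have [+ _] := Cg i; apply.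
  by have [_ ->] := derive_comp_row v dg (F1 _ (VW _ Vx)).
apply: Ck_sum => // i _; apply: Ck_mul => //; last by have [_ +] := Cg i; apply.
by apply: IH => [j|]; [apply: CkW; exact: Cg|exact: F2].
Qed.

Lemma smooth_on_comp n m (V : set 'rV[R]_n) (W : set 'rV[R]_m) F
    (g : 'I_m -> 'rV[R]_n -> R) : open V ->
  (forall x, V x -> W (\row_i g i x)) -> (forall i, smooth_on V (g i)) ->
  smooth_on W F -> smooth_on V (fun x => F (\row_i g i x)).
Proof. by move=> oV VW sg sF k; apply: (Ck_comp oV VW) => [i|]; [exact: sg|exact: sF]. Qed.

Lemma smooth_on_diff n (V : set 'rV[R]_n) F x : smooth_on V F -> V x -> differentiable F x.
Proof. by move=> /(_ 1%N) [+ _]; apply. Qed.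

Lemma smooth_on_pd n (V : set 'rV[R]_n) F i : smooth_on V F -> smooth_on V (pd i F).
Proof. by move=> sF k; have [_ +] := sF k.+1; apply. Qed.

Lemma smooth_on_deriv n (V : set 'rV[R]_n) F v : smooth_on V F -> smooth_on V ('D_v F).
Proof. by move=> sF k; have [_ +] := sF k.+1; apply. Qed.

Lemma smooth_on_cts n (V : set 'rV[R]_n) F x : smooth_on V F -> V x -> {for x, continuous F}.
Proof. by move=> /(_ 0%N); apply. Qed.

Lemma Ck_local n k (V : set 'rV[R]_n) F :
  (forall x, V x -> exists2 W, W x & Ck k W F) -> Ck k V F.
Proof.
elim: k F => [|k IH] F H /=.
  by move=> x Vx; have [W Wx] := H x Vx; apply.
split=> [x Vx|v]; first by have [W Wx [+ _]] := H x Vx; apply.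
by apply: IH => x Vx; have [W Wx [_ CW]] := H x Vx; exists W => //; exact: CW.
Qed.

Lemma smooth_on_local n (V : set 'rV[R]_n) F :
  (forall x, V x -> exists W G, [/\ open W, W x, smooth_on W G &
     forall y, W y -> F y = G y]) -> smooth_on V F.
Proof.
move=> H k; apply: Ck_local => x /H [W [G [oW Wx sG FG]]]; exists W => //.
by apply: (Ck_eq oW _ (sG k)) => y /FG.
Qed.

(** Induction on the order, for all members of the class at once. It serves where higher derivatives
    have no convenient closed form, as for the functions [flat]. *)
Lemma Ck_deriv_closed n (V : set 'rV[R]_n) (S : set ('rV[R]_n -> R)) :
  (forall F, S F -> forall x, V x -> differentiable F x) ->
  (forall F v, S F -> S ('D_v F)) -> forall F, S F -> smooth_on V F.
Proof.
move=> dS DS F SF k; elim: k F SF => [|k IH] F SF.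
  by move=> x Vx; apply/differentiable_continuous/dS.
by split=> [|v]; [exact: dS|apply/IH/DS].
Qed.

End SmoothRn.

(** * Bump functions and extension of smooth functions *)

Section Bump.
Context {R : realType}.
Implicit Types n k m : nat.

Lemma derive_coord n (x v : 'rV[R]_n) i : 'D_v (fun y : 'rV[R]_n => y 0 i) x = v 0 i.
Proof.
have dv : derivable (id : 'rV[R]_n -> _) x v by exact: derivable_id.
have := derive_mx dv; rewrite derive_id.
by move=> /(congr1 (fun M : 'rV[R]_n => M 0 i)); rewrite mxE.
Qed.

Lemma Ck_inv n k (V : set 'rV[R]_n) (F : 'rV[R]_n -> R) : open V -> (forall x, V x -> F x != 0) ->
  Ck k V F -> Ck k V (fun x => (F x)^-1).
Proof.
move=> oV F0; elim: k => [|k IH].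
  move=> CF x Vx; exact: (continuousV (F0 x Vx) (CF x Vx)).
move=> CF; have IV := IH (CkW CF); have [F1 F2] := CF; split=> [x Vx|v].
  by apply: differentiableV; [exact: F1|exact: F0].
apply: (@Ck_eq _ _ _ _ (fun x => (-1 * ((F x)^-1 * (F x)^-1)) * 'D_v F x)) => //.
  move=> x Vx; rewrite deriveV ?F0 //; last by apply: diff_derivable; exact: F1.
  by rewrite /GRing.scale /= mulN1r -invfM expr2.
apply: Ck_mul; [by []| |exact: F2].
apply: (@Ck_mul _ _ _ _ (fun=> -1)); [by []|exact: Ck_cst|exact: (Ck_mul oV IV IV)].
Qed.

(** The function exp(-1/x), extended by zero. The factor x^-k makes the linear span of the family
    stable under differentiation. *)
Definition flat k (x : R) : R := if 0 < x then (x^-1) ^+ k * expR (- x^-1) else 0.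

(** With y = 1/x this is exp y >= y^(k+1) / (k+1)!; the exponent exceeds that of the factor y^k by
    one, so that a factor x is left over. *)
Lemma flat_le k x : `|flat k x| <= (k.+1)`!%:R * `|x|.
Proof.
rewrite /flat; case: ifPn => [x0|_]; last by rewrite normr0 mulr_ge0.
rewrite (gtr0_norm x0) ger0_norm; last first.
  by rewrite mulr_ge0 ?exprn_ge0 ?expR_ge0 ?invr_ge0 // (ltW x0).
have y0 : 0 < x^-1 by rewrite invr_gt0.
rewrite expRN; set y := x^-1 in y0 *; have -> : x = y^-1 by rewrite /y invrK.
have := expR_ge1Dxn k (ltW y0); set E := expR y => H.
have E0 : 0 < E by exact: expR_gt0.
have f0 : 0 < (k.+1)`!%:R :> R by rewrite ltr0n fact_gt0.
rewrite ler_pdivrMr // mulrAC ler_pdivlMr // -exprSr mulrC -ler_pdivrMr //.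
by apply: le_trans H; rewrite lerDr.
Qed.

Lemma flat_derive k (x : R) : is_derive x (1 : R) (flat k) (- k%:R * flat k.+1 x + flat k.+2 x).
Proof.
have [x0|x0|x0] := ltgtP 0 x.
- apply: (@near_eq_is_derive R R R (fun y : R => (y^-1) ^+ k * expR (- y^-1) : R)).
    have : \near x, 0 < x by exact: lt_nbhsr.
    by apply: filterS => y y0; rewrite /flat y0.
  rewrite /flat x0.
  have xn0 : x != 0 by rewrite gt_eqF.
  have d1 : is_derive x 1 (fun y : R => y^-1) (- x ^- 2 *: 1).
    by apply: is_deriveV.
  have d2 : is_derive x^-1 1 (fun y : R => y ^+ k * expR (- y))
     (k%:R * x^-1 ^+ k.-1 * expR (- x^-1) - x^-1 ^+ k * expR (- x^-1)).
    have d3 : is_derive x^-1 1 (fun y : R => y ^+ k) (k%:R *: (x^-1) ^+ k.-1 *: 1).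
      by split; [exact: exprn_derivable|rewrite exp_derive].
    have d4 : is_derive x^-1 1 (fun y : R => expR (- y)) (expR (- x^-1) * - 1).
      exact: is_derive1_comp.
    apply: (is_derive_eq (is_deriveM d3 d4)).
    rewrite /GRing.scale /=; ring.
  apply: (is_derive_eq (is_derive1_comp d2 d1)).
  case: k {d2} => [|k]; rewrite /GRing.scale /= ?expr0 ?exprS; field => //.
- apply: (@near_eq_is_derive R R R (fun=> 0 : R)).
    have : \near x, x < 0 by exact: lt_nbhsl.
    by apply: filterS => y y0; rewrite /flat ltNge (ltW y0).
  rewrite /flat ltNge (ltW x0) /= mulr0 addr0; exact: is_derive_cst.
subst x; rewrite {2 3}/flat ltxx mulr0 addr0.
have H : (fun h : R => h^-1 *: ((flat k \o shift 0) (h *: 1) - flat k 0)) @ 0^' --> 0.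
  apply/cvgrPdist_le => e e0.
  have c0 : 0 < (k.+2)`!%:R :> R by rewrite ltr0n fact_gt0.
  near=> h; have h0 : h != 0 by near: h; exact: nbhs_dnbhs_neq.
  rewrite sub0r normrN /= addr0 /GRing.scale /= mulr1 {2}/flat ltxx subr0.
  (* The difference quotient at 0 is the next member of the family; by [flat_le] it tends to 0. *)
  have -> : h^-1 * flat k h = flat k.+1 h.
    by rewrite /flat; case: ifP => _; rewrite ?mulr0 // exprS mulrA.
  apply: le_trans (flat_le _ _) _.
  rewrite mulrC -ler_pdivlMr //; near: h; apply: dnbhs0_le; exact: divr_gt0.
by split; [apply/cvg_ex; exists 0|exact/cvg_lim].
Unshelve. all: by end_near. Qed.

Lemma flat_smooth n (V : set 'rV[R]_n) F k : open V -> smooth_on V F ->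
  smooth_on V (fun x => flat k (F x)).
Proof.
move=> oV sF.
(* Finite combinations of the [flat j], closed under derivatives as [Ck_deriv_closed] requires. They
   live on ['rV[R]_1], since [smooth_on] concerns functions of row vectors. *)
pose S := [set f : 'rV[R]_1 -> R | exists s : seq (R * nat),
  f = fun y => \sum_(c <- s) c.1 * flat c.2 (y 0 0)].
have dflat j (y : 'rV[R]_1) :
    differentiable (fun y : 'rV[R]_1 => flat j (y 0 0)) y /\ forall v,
    'D_v (fun y : 'rV[R]_1 => flat j (y 0 0)) y =
    v 0 0 * (- j%:R * flat j.+1 (y 0 0) + flat j.+2 (y 0 0)).
  have dc : differentiable (fun y : 'rV[R]_1 => y 0 0) y by exact: differentiable_coord.
  have [df vf] := flat_derive j (y 0 0).
  have df' : differentiable (flat j) (y 0 0) by apply/derivable1_diffP.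
  have dd := differentiable_comp dc df'; split=> // v.
  rewrite -[LHS]/('D_v (flat j \o (fun y : 'rV[R]_1 => y 0 0)) y) deriveE // diff_comp //=.
  rewrite diff1E // derive1E vf -deriveE //.
  by rewrite derive_coord.
have sS f : S f -> smooth_on setT f.
  apply: Ck_deriv_closed => {f} [_ [s ->] x _|_ v [s ->]].
    have -> : (fun y : 'rV[R]_1 => \sum_(c <- s) c.1 * flat c.2 (y 0 0)) =
       \sum_(i < size s) ((tnth (in_tuple s) i).1 \*: (fun y : 'rV[R]_1 => flat (tnth (in_tuple s) i).2 (y 0 0))).
      by apply/funext => y; rewrite fct_sumE big_tnth.
    by apply: differentiable_sum => i; apply: differentiableZ; have [] := dflat (tnth (in_tuple s) i).2 x.
  exists (flatten [seq [:: (v 0 0 * c.1 * - c.2%:R, c.2.+1); (v 0 0 * c.1, c.2.+2)] | c <- s]).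
  apply/funext => y.
  have -> : (fun y : 'rV[R]_1 => \sum_(c <- s) c.1 * flat c.2 (y 0 0)) =
       \sum_(i < size s) ((tnth (in_tuple s) i).1 \*: (fun y : 'rV[R]_1 => flat (tnth (in_tuple s) i).2 (y 0 0))).
    by apply/funext => z; rewrite fct_sumE big_tnth.
  rewrite derive_sum; last first.
    by move=> i; apply: derivableZ; apply: diff_derivable; have [] := dflat (tnth (in_tuple s) i).2 y.
  rewrite big_flatten big_map [RHS]big_tnth; apply: eq_bigr => i _.
  rewrite deriveZ; last by apply: diff_derivable; have [] := dflat (tnth (in_tuple s) i).2 y.
  have [_ ->] := dflat (tnth (in_tuple s) i).2 y.
  rewrite big_cons big_cons big_nil /= addr0 /GRing.scale /=; ring.
have sf : smooth_on setT (fun y : 'rV[R]_1 => flat k (y 0 0)).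
  by apply: sS; exists [:: (1, k)]; apply/funext => y; rewrite big_seq1 mul1r.
have := @smooth_on_comp R _ _ V setT _ (fun=> F) oV (fun _ _ => Logic.I) (fun=> sF) sf.
by congr (smooth_on _ _); apply/funext => x; rewrite mxE.
Qed.

Lemma smooth_cst n (V : set 'rV[R]_n) (c : R) : smooth_on V (fun=> c).
Proof. by move=> k; exact: Ck_cst. Qed.

Lemma smooth_coord n (V : set 'rV[R]_n) i : smooth_on V (fun x => x 0 i).
Proof. by move=> k; exact: Ck_coord. Qed.

Lemma smooth_add n (V : set 'rV[R]_n) F G : open V ->
  smooth_on V F -> smooth_on V G -> smooth_on V (fun x => F x + G x).
Proof. by move=> oV sF sG k; apply: Ck_add. Qed.

Lemma smooth_mul n (V : set 'rV[R]_n) F G : open V ->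
  smooth_on V F -> smooth_on V G -> smooth_on V (fun x => F x * G x).
Proof. by move=> oV sF sG k; apply: Ck_mul. Qed.

Lemma smooth_sum n (V : set 'rV[R]_n) (I : Type) (r : seq I) (P : pred I)
    (F : I -> 'rV[R]_n -> R) : open V ->
  (forall i, P i -> smooth_on V (F i)) -> smooth_on V (fun x => \sum_(i <- r | P i) F i x).
Proof. by move=> oV sF k; apply: Ck_sum => // i Pi; exact: sF. Qed.

Lemma smooth_prod n (V : set 'rV[R]_n) (I : Type) (r : seq I) (P : pred I)
    (F : I -> 'rV[R]_n -> R) : open V ->
  (forall i, P i -> smooth_on V (F i)) -> smooth_on V (fun x => \prod_(i <- r | P i) F i x).
Proof.
move=> oV sF; have -> : (fun x => \prod_(i <- r | P i) F i x) = \prod_(i <- r | P i) F i.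
  by apply/funext => x; elim/big_rec2: _ => // i y1 y2 _ ->.
by apply: (big_ind (smooth_on V)) => //; [exact: smooth_cst|move=> f g; exact: smooth_mul].
Qed.

Lemma smooth_inv n (V : set 'rV[R]_n) (F : 'rV[R]_n -> R) : open V -> (forall x, V x -> F x != 0) ->
  smooth_on V F -> smooth_on V (fun x => (F x)^-1).
Proof. by move=> oV F0 sF k; apply: Ck_inv. Qed.

Lemma smooth_sub n (V W : set 'rV[R]_n) F : W `<=` V -> smooth_on V F -> smooth_on W F.
Proof. by move=> WV sF k; exact: Ck_sub (sF k). Qed.

Lemma smooth_eq n (V : set 'rV[R]_n) F G : open V -> (forall x, V x -> F x = G x) ->
  smooth_on V F -> smooth_on V G.
Proof. by move=> oV FG sF k; exact: Ck_eq (sF k). Qed.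

Definition step (x : R) : R := flat 0 x / (flat 0 x + flat 0 (1 - x)).

Lemma step0 x : x <= 0 -> step x = 0.
Proof. by move=> x0; rewrite /step {1}/flat ltNge x0 mul0r. Qed.

Lemma flat_gt0 k x : 0 < x -> 0 < flat k x.
Proof. by move=> x0; rewrite /flat x0 mulr_gt0 ?expR_gt0 ?exprn_gt0 ?invr_gt0. Qed.

Lemma flat_ge0 k x : 0 <= flat k x.
Proof. by case: (ltP 0 x) => x0; [exact/ltW/flat_gt0|rewrite /flat ltNge x0]. Qed.

Lemma step1 x : 1 <= x -> step x = 1.
Proof.
move=> x1; rewrite /step {3}/flat subr_gt0 ltNge x1 /= addr0 divff //.
by rewrite gt_eqF // flat_gt0 // (lt_le_trans _ x1).
Qed.

Lemma step_smooth n (V : set 'rV[R]_n) F : open V -> smooth_on V F ->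
  smooth_on V (fun x => step (F x)).
Proof.
move=> oV sF.
have sG : smooth_on V (fun x => 1 - F x).
  apply: smooth_add => //; first exact: smooth_cst.
  by apply: (@smooth_eq _ _ (fun x => -1 * F x)) => [//|x _|]; [rewrite mulN1r|apply: smooth_mul => //; exact: smooth_cst].
apply: smooth_mul => //; first exact: flat_smooth.
apply: smooth_inv => //; last by apply: smooth_add => //; exact: flat_smooth.
move=> x _; rewrite gt_eqF //; case: (ltP 0 (F x)) => F0.
  by rewrite ltr_wpDr ?flat_ge0 ?flat_gt0.
by rewrite ltr_wpDl ?flat_ge0 ?flat_gt0 // subr_gt0 (le_lt_trans F0).
Qed.

Lemma mx_norm_leP n (x : 'rV[R]_n) e : 0 <= e ->
  reflect (forall i, `|x 0 i| <= e) (`|x| <= e).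
Proof.
move=> e0; apply: (iffP idP) => [xe i|H].
  apply: le_trans xe; rewrite [leRHS]mx_normrE.
  by apply: (@le_bigmax _ _ _ 0 (fun i : 'I_1 * 'I_n => `|x i.1 i.2|) (0, i)).
rewrite [leLHS]mx_normrE; apply/bigmax_leP; split=> // -[i j] _ /=.
by rewrite (ord1 i).
Qed.

Lemma mx_norm_ltP n (x : 'rV[R]_n) e : 0 < e ->
  reflect (forall i, `|x 0 i| < e) (`|x| < e).
Proof.
move=> e0; apply: (iffP idP) => [xe i|H].
  by apply: le_lt_trans xe; apply/mx_norm_leP.
rewrite [ltLHS]mx_normrE; apply/bigmax_ltP; split=> // -[i j] _ /=.
by rewrite (ord1 i).
Qed.

(** The norm of a row vector is the largest absolute value of an entry, so cutoffs in each
    coordinate multiply to a bump on a ball. With c = (y_i - p_i) / r, the factors step(2 - c) and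
    step(2 + c) are both 1 for |c| <= 1, and one of them is 0 for |c| >= 2. *)
Lemma bump_exists n (p : 'rV[R]_n) r : 0 < r ->
  exists b : 'rV[R]_n -> R, [/\ smooth_on setT b,
    forall y, `|y - p| <= r -> b y = 1 &
    forall y, 2 * r <= `|y - p| -> b y = 0].
Proof.
move=> r0.
pose c (i : 'I_n) (y : 'rV[R]_n) := (y 0 i - p 0 i) / r.
exists (fun y => \prod_i (step (2 - c i y) * step (2 + c i y))); split.
- have sc (s : R) i : smooth_on setT (fun y => 2 + s * c i y).
    apply: smooth_add => //; [exact: openT|exact: smooth_cst|].
    apply: smooth_mul; [exact: openT|exact: smooth_cst|].
    apply: smooth_mul; [exact: openT| |exact: smooth_cst].
    by apply: smooth_add; [exact: openT|exact: smooth_coord|exact: smooth_cst].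
  apply: smooth_prod; first exact: openT.
  move=> i _; apply: smooth_mul; first exact: openT.
    apply: step_smooth; first exact: openT.
    by apply: (smooth_eq openT _ (sc (-1) i)) => y _; rewrite mulN1r.
  apply: step_smooth; first exact: openT.
  by apply: (smooth_eq openT _ (sc 1 i)) => y _; rewrite mul1r.
- move=> y /(mx_norm_leP _ (ltW r0)) H; rewrite big1 // => i _.
  have := H i; rewrite !mxE ler_norml => /andP[H1 H2].
  have c1 : c i y <= 1 by rewrite /c ler_pdivrMr // mul1r.
  have c2 : -1 <= c i y by rewrite /c ler_pdivlMr // mulN1r.
  by rewrite !step1 ?mul1r //; lra.
move=> y H; have r20 : 0 < 2 * r by rewrite mulr_gt0.
have /existsNP [i /negP] : ~ forall i, `|(y - p) 0 i| < 2 * r.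
  by move/(mx_norm_ltP _ r20); rewrite ltNge H.
rewrite -leNgt !mxE => Hi; rewrite (bigD1 i) //=.
have [c0|c0] := leP 0 (y 0 i - p 0 i).
  rewrite (@step0 (2 - _)) ?mul0r // subr_le0 /c ler_pdivlMr //.
  by rewrite -(ger0_norm c0).
rewrite (@step0 (2 + c i y)) ?mulr0 ?mul0r // addrC -lerBrDr sub0r /c ler_pdivrMr //.
by rewrite mulNr lerNr -(ltr0_norm c0).
Qed.

Lemma smooth_extend n (V : set 'rV[R]_n) F (p : 'rV[R]_n) r : open V -> 0 < r ->
  (forall y, `|y - p| <= 2 * r -> V y) -> smooth_on V F ->
  exists2 G, smooth_on setT G & forall y, `|y - p| <= r -> G y = F y.
Proof.
move=> oV r0 pV sF; have [b [sb b1 b0]] := bump_exists p r0.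
exists (fun y => b y * F y); last by move=> y /b1 ->; rewrite mul1r.
apply: smooth_on_local => y _; have [yr|yr] := leP `|y - p| (2 * r).
  exists V, (fun y => b y * F y); split=> //; first exact: pV.
  by apply: smooth_mul => //; exact: smooth_sub sb.
(* Beyond distance 2r the product is identically 0, whatever [F] is there. *)
exists [set z | 2 * r < `|z - p|], (fun=> 0); split=> //; last first.
- by move=> z /ltW /b0 ->; rewrite mul0r.
- exact: smooth_cst.
have : open ((fun z : 'rV[R]_n => `|z - p|) @^-1` [set t | 2 * r < t]).
  apply: open_comp; last exact: open_gt.
  by move=> z _; apply: continuous_comp; [apply: continuousB; [exact: cvg_id|exact: cst_continuous]|exact: norm_continuous].
by [].
Qed.

End Bump.

(** * Strict differentiability and integrals depending on a parameter *)

Section ParamIntegral.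
Context {R : realType}.
Implicit Types n k m : nat.

Lemma line_derive n (F : 'rV[R]_n -> R) (w k : 'rV[R]_n) (t : R) :
  differentiable F (w + t *: k) ->
  is_derive t (1 : R) (fun t => F (w + t *: k)) ('D_k F (w + t *: k)).
Proof.
move=> dF; have df := @diff_derivable _ _ _ _ _ k dF.
have E : (fun h : R => h^-1 *: (((fun t : R => F (w + t *: k)) \o shift t) (h *: 1) - F (w + t *: k)))
   = (fun h => h^-1 *: ((F \o shift (w + t *: k)) (h *: k) - F (w + t *: k))).
  apply/funext => h /=; congr (_ *: (F _ - _)).
  by have -> : h%:A = h :> R by [exact: mulr1]; rewrite scalerDl addrCA.
split; first by rewrite /derivable E.
by rewrite /derive E.
Qed.

Lemma line_MVT n (F : 'rV[R]_n -> R) (w k : 'rV[R]_n) :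
  (forall t : R, 0 <= t <= 1 -> differentiable F (w + t *: k)) ->
  exists2 t : R, 0 <= t <= 1 & F (w + k) - F w = 'D_k F (w + t *: k).
Proof.
move=> dF.
have H (t : R) : 0 <= t <= 1 -> is_derive t (1 : R) (fun t => F (w + t *: k)) ('D_k F (w + t *: k)).
  by move=> t01; apply: line_derive; exact: dF.
case: (@MVT_segment R (fun t => F (w + t *: k)) (fun t => 'D_k F (w + t *: k)) 0 1 ler01).
- move=> x; rewrite in_itv /= => /andP[x0 x1]; apply: H; by rewrite !ltW.
- apply: derivable_within_continuous => x; rewrite in_itv /= => x01.
  by have [] := H x x01.
- move=> t t01 E; exists t; first by move: t01; rewrite in_itv.
  by move: E; rewrite scale1r scale0r addr0 subr0 mulr1.
Qed.

Lemma derive_osc n (F : 'rV[R]_n -> R) (V : set 'rV[R]_n) (w0 : 'rV[R]_n) (e : R) :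
  open V -> V w0 -> smooth_on V F -> 0 < e ->
  exists2 d : R, 0 < d & forall w : 'rV[R]_n, `|w - w0| < d ->
    V w /\ forall k : 'rV[R]_n, `|'D_k F w - 'D_k F w0| <= e * `|k|.
Proof.
(* Each of the n partial derivatives may vary by e'. Division by [n.+1] keeps e' positive also in
   dimension 0. *)
move=> oV Vw0 sF e0; pose e' := e / n.+1%:R.
have e'0 : 0 < e' by rewrite divr_gt0.
have H : \forall w \near w0, V w /\ forall i, `|pd i F w0 - pd i F w| < e'.
  near=> w; split; first by near: w; exact: open_nbhs_nbhs.
  near: w; apply: filter_forall => i.
  by have /cvgrPdist_lt := smooth_on_cts (smooth_on_pd i sF) Vw0; apply.
have /nbhs_ballP [d d0 Hd] := H; exists d => // w wd.
have [Vw Hw] : V w /\ forall i, `|pd i F w0 - pd i F w| < e'.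
  by apply: Hd; rewrite -ball_normE /= distrC.
split=> // k; rewrite !derive_pd; try exact: smooth_on_diff sF _.
rewrite -sumrB; apply: le_trans (ler_norm_sum _ _ _) _.
apply: (@le_trans _ _ (\sum_(i < n) `|k| * e')).
  apply: ler_sum => i _; rewrite -mulrBr normrM ler_pM //.
    by have /mx_norm_leP := lexx `|k|; apply.
  by rewrite distrC ltW.
rewrite sumr_const card_ord -mulrnAr mulrC ler_wpM2r //.
rewrite -[_ *+ n]mulr_natr /e' -mulrA mulrC ler_piMl //; first exact: ltW.
by rewrite mulrC ler_pdivrMr // mul1r ler_nat.
Unshelve. all: by end_near. Qed.

(** Here the base point w moves as well. The mean value theorem on the segment from w to w + k
    reduces the estimate to the continuity of the derivative. It lies behind both the inverse
    function theorem and differentiation under the integral sign. *)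
Lemma strict_diff0 n (F : 'rV[R]_n -> R) (V : set 'rV[R]_n) (w0 : 'rV[R]_n) (e : R) :
  open V -> V w0 -> smooth_on V F -> 0 < e ->
  exists2 d : R, 0 < d & forall w k : 'rV[R]_n, `|w - w0| < d -> `|k| < d ->
    `|F (w + k) - F w - 'D_k F w0| <= e * `|k|.
Proof.
move=> oV Vw0 sF e0; have [d d0 Hd] := derive_osc oV Vw0 sF e0.
exists (d / 2); first by rewrite divr_gt0.
move=> w k wd kd.
have win (t : R) : 0 <= t <= 1 -> `|w + t *: k - w0| < d.
  move=> /andP[t0 t1]; rewrite addrAC; apply: le_lt_trans (ler_normD _ _) _.
  by rewrite (splitr d) ltrD // normrZ (ger0_norm t0) (le_lt_trans _ kd) // ler_piMl.
have [t t01 ->] : exists2 t : R, 0 <= t <= 1 & F (w + k) - F w = 'D_k F (w + t *: k).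
  by apply: line_MVT => t /win /Hd [Vt _]; exact: smooth_on_diff Vt.
by have [_] := Hd _ (win t t01); apply.
Qed.

Lemma strict_diff n (F : 'rV[R]_n -> R) (V : set 'rV[R]_n) (w0 : 'rV[R]_n) (e : R) :
  open V -> V w0 -> smooth_on V F -> 0 < e ->
  exists2 d : R, 0 < d & forall w k : 'rV[R]_n, `|w - w0| < d -> `|k| < d ->
    `|F (w + k) - F w - 'D_k F w| <= e * `|k|.
Proof.
move=> oV Vw0 sF e0; have e20 : 0 < e / 2 by rewrite divr_gt0.
have [d d0 Hd] := derive_osc oV Vw0 sF e20.
have [d' d'0 Hd'] := strict_diff0 oV Vw0 sF e20.
exists (Num.min d d'); first by rewrite lt_min d0.
move=> w k; rewrite !lt_min => /andP[wd wd'] /andP[_ kd'].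
rewrite -(subrKA ('D_k F w0)) (splitr e) mulrDl.
apply: le_trans (ler_normD _ _) _; rewrite lerD //; first exact: Hd'.
by rewrite distrC; have [_] := Hd w wd; apply.
Qed.

Definition It (f : R -> R) : R := \int[lebesgue_measure]_(t in `[0%R, 1%R]) f t.

Lemma It_int (f : R -> R) : continuous f ->
  (@lebesgue_measure R).-integrable `[0%R, 1%R] (EFin \o f).
Proof.
move=> cf; apply: continuous_compact_integrable; first exact: segment_compact.
exact: continuous_subspaceT.
Qed.

Lemma ItB (f g : R -> R) : continuous f -> continuous g -> It (fun t => f t - g t) = It f - It g.
Proof. by move=> cf cg; rewrite /It RintegralB //; exact: It_int. Qed.

Lemma ItD (f g : R -> R) : continuous f -> continuous g -> It (fun t => f t + g t) = It f + It g.
Proof. by move=> cf cg; rewrite /It RintegralD //; exact: It_int. Qed.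

Lemma ItZ (c : R) (f : R -> R) : continuous f -> It (fun t => c * f t) = c * It f.
Proof. by move=> cf; rewrite /It RintegralZl //; exact: It_int. Qed.

Lemma It_eq (f g : R -> R) : (forall t : R, 0 <= t <= 1 -> f t = g t) -> It f = It g.
Proof. by move=> fg; apply: eq_Rintegral => t; rewrite inE /= in_itv => /fg. Qed.

Lemma It_le (f : R -> R) (e : R) : continuous f -> (forall t : R, 0 <= t <= 1 -> `|f t| <= e) -> `|It f| <= e.
Proof.
move=> cf fe; apply: le_trans (le_normr_Rintegral _ (It_int cf)) _ => //.
have <- : \int[@lebesgue_measure R]_(t in `[0%R, 1%R]%classic) (cst e t : R) = e.
  rewrite Rintegral_cst //= (@lebesgue_measure_itv R `[0%R, 1%R]) /= lte_fin ltr01 /=.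
  by rewrite oppr0 addr0 mulr1.
apply: le_Rintegral => //.
- apply: (@It_int (fun t => `|f t|)) => t; apply: continuous_comp; first exact: cf.
  exact: norm_continuous.
- by apply: (@It_int (fun=> e)) => t; exact: cst_continuous.
Qed.

Lemma It_sum n (a : 'I_n -> R) (f : 'I_n -> R -> R) : (forall i, continuous (f i)) ->
  It (fun t => \sum_i a i * f i t) = \sum_i a i * It (f i).
Proof.
move=> cf; have cs (r : seq 'I_n) : continuous (fun t => \sum_(i <- r) a i * f i t).
  have -> : (fun t => \sum_(i <- r) a i * f i t) = \sum_(i <- r) (fun t => a i * f i t).
    by apply/funext => t; rewrite fct_sumE.
  apply: (big_ind (fun g : R -> R => continuous g)); first by move=> t; exact: cst_continuous.
    by move=> g h cg ch t; exact: (continuousD (cg t) (ch t)).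
  move=> i _ t; apply: (@continuousM _ _ (fun=> a i)); [exact: cst_continuous|exact: cf].
elim: (index_enum _) => [|i r IH].
  rewrite big_nil; have := @ItZ 0 (fun=> 0) (@cst_continuous _ _ _).
  move=> E0; rewrite -[RHS](mul0r (It (fun=> 0))) -E0; apply: It_eq => t _; by rewrite big_nil mul0r.
rewrite big_cons -IH -ItZ // -ItD //; last first.
  move=> t; apply: (@continuousM _ _ (fun=> a i)); [exact: cst_continuous|exact: cf].
by apply: It_eq => t _; rewrite big_cons.
Qed.

Lemma It_FTC (f df : R -> R) : (forall t : R, is_derive t (1 : R) f (df t)) -> continuous df ->
  It df = f 1 - f 0.
Proof.
move=> Df cdf; have cf (t : R) : {for t, continuous f}.
  by apply: differentiable_continuous; apply/derivable1_diffP; have [] := Df t.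
have := @continuous_FTC2 R df f 0 1 ltr01.
rewrite /It /Rintegral => -> //; first exact: continuous_subspaceT.
  split; first by move=> t _; have [] := Df t.
  - by apply: cvg_at_right_filter; exact: cf.
  - by apply: cvg_at_left_filter; exact: cf.
by move=> t _; rewrite derive1E; have [_ ->] := Df t.
Qed.

(** Declared linear below, so that it can be offered as a differential to [frechetP]. *)
Definition lform n (c : 'I_n -> R) (v : 'rV[R]_n) : R := \sum_i v 0 i * c i.

Lemma lform_is_linear n (c : 'I_n -> R) : linear (lform c : 'rV[R]_n -> R^o).
Proof.
move=> a u v; rewrite /lform scaler_sumr -big_split; apply: eq_bigr => i _ /=.
by rewrite !mxE mulrDl /GRing.scale /= mulrA.
Qed.

HB.instance Definition _ n (c : 'I_n -> R) :=
  GRing.isLinear.Build R 'rV[R]_n R _ (lform c) (@lform_is_linear n c).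

Lemma lform_continuous n (c : 'I_n -> R) : continuous (lform c).
Proof.
move=> x; rewrite /lform.
have := @smooth_on_cts R n setT (fun v => \sum_i v 0 i * c i) x.
apply=> //; apply: smooth_sum; first exact: openT.
move=> i _; apply: smooth_mul; [exact: openT|exact: smooth_coord|exact: smooth_cst].
Qed.

Lemma mulmx_bound n m (A : 'M[R]_(n, m)) :
  exists2 C : R, 0 < C & forall v : 'rV[R]_n, `|v *m A| <= C * `|v|.
Proof.
exists (1 + \sum_i \sum_j `|A i j|); first by rewrite ltr_wpDr // sumr_ge0 // => i _; exact: sumr_ge0.
move=> v; apply/mx_norm_leP.
  by rewrite mulr_ge0 // addr_ge0 // sumr_ge0 // => i _; exact: sumr_ge0.
move=> j; rewrite mxE; apply: le_trans (ler_norm_sum _ _ _) _.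
rewrite mulrDl mul1r; apply: ler_wpDl => //; rewrite mulr_suml ler_sum // => i _.
rewrite normrM mulrC ler_pM //; last by have /mx_norm_leP := lexx `|v|; apply.
by rewrite (bigD1 j) //= lerDl sumr_ge0.
Qed.

Variables (n m : nat) (P Q : 'M[R]_(n, m)).
Let ga (t : R) : 'M[R]_(n, m) := P + t *: Q.

(* The weight [t ^+ j] makes this family of operators stable under
   differentiation, see [J_diff]. *)
Definition J j (F : 'rV[R]_m -> R) (z : 'rV[R]_n) : R := It (fun t => t ^+ j * F (z *m ga t)).

Lemma J_cts j (F : 'rV[R]_m -> R) z : smooth_on setT F ->
  continuous (fun t : R => t ^+ j * F (z *m ga t)).
Proof.
move=> sF t; have c1 : {for t, continuous (fun t : R => t ^+ j)} by exact: exprn_continuous.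
suff c2 : {for t, continuous (fun t : R => F (z *m ga t))} by exact: continuousM c1 c2.
apply: (@continuous_comp _ _ _ (fun t => z *m ga t) F); last exact: smooth_on_cts sF _.
have -> : (fun t => z *m ga t) = (fun t => z *m P + t *: (z *m Q)).
  by apply/funext => u; rewrite /ga mulmxDr scalemxAr.
by apply: continuousD; [exact: cst_continuous|exact: scalel_continuous].
Qed.

Lemma ga_bound : exists2 C : R, 0 < C & forall (v : 'rV[R]_n) (t : R), 0 <= t <= 1 -> `|v *m ga t| <= C * `|v|.
Proof.
have [C1 C10 H1] := mulmx_bound P; have [C2 C20 H2] := mulmx_bound Q.
exists (C1 + C2); first exact: addr_gt0.
move=> v t /andP[t0 t1]; rewrite /ga mulmxDr -scalemxAr.
apply: le_trans (ler_normD _ _) _; rewrite mulrDl lerD // normrZ ger0_norm //.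
by apply: le_trans (H2 v); rewrite ler_piMl.
Qed.

(** The estimate holds near each t0 by strict differentiability at [z *m ga t0]; compactness of
    [0, 1] makes it uniform in t, so that it may be integrated. *)
Lemma J_strict (F : 'rV[R]_m -> R) (z : 'rV[R]_n) e : smooth_on setT F -> 0 < e ->
  \forall h \near (0 : 'rV[R]_n), forall t : R, 0 <= t <= 1 ->
    `|F ((z + h) *m ga t) - F (z *m ga t) - 'D_(h *m ga t) F (z *m ga t)| <= e * `|h|.
Proof.
move=> sF e0; have [C C0 HC] := ga_bound.
have /compact_near_coveringP cov := @segment_compact R 0 1.
pose X (h : 'rV[R]_n) (t : R) := 0 <= t <= 1 -> `|F ((z + h) *m ga t) - F (z *m ga t) - 'D_(h *m ga t) F (z *m ga t)| <= e * `|h|.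
suff : \forall h \near (0 : 'rV[R]_n), `[0%R, 1%R]%classic `<=` X h.
  by apply: filterS => h H t t01; apply: H => //; rewrite /= in_itv.
apply: (cov _ (nbhs (0 : 'rV[R]_n)) X _); move=> t0; rewrite /= in_itv /= => t01.
  have [d d0 Hd] := @strict_diff _ F setT (z *m ga t0) (e / C) openT Logic.I sF (divr_gt0 e0 C0).
  exists ([set t | `|z *m ga t - z *m ga t0| < d], [set h | C * `|h| < d]) => /=.
    split; last first.
      rewrite nbhs_simpl; near=> h; rewrite /= mulrC -ltr_pdivlMr //.
      by near: h; apply: (@nbhs0_lt R 'rV[R]_n); exact: divr_gt0.
    have : {for t0, continuous (fun t => z *m ga t)}.
      have -> : (fun t => z *m ga t) = (fun t => z *m P + t *: (z *m Q)).
        by apply/funext => u; rewrite /ga mulmxDr scalemxAr.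
      by apply: continuousD; [exact: cst_continuous|exact: scalel_continuous].
    move=> /cvgrPdist_lt /(_ d d0); apply: filterS => t; by rewrite distrC.
  move=> [t h] /= [td hd] t01'; rewrite mulmxDl.
  apply: le_trans (Hd _ _ td _) _; first exact: le_lt_trans (HC h t t01') hd.
  by rewrite -mulrA ler_pM2l // ler_pdivrMl // HC.
Unshelve. all: by end_near. Qed.

(** D_(v (P + t Q)) = D_(v P) + t D_(v Q): the extra factor t is absorbed by raising the
    exponent. *)
Definition Jd j (F : 'rV[R]_m -> R) (v : 'rV[R]_n) (z : 'rV[R]_n) : R :=
  J j ('D_(v *m P) F) z + J j.+1 ('D_(v *m Q) F) z.

Lemma J_diff j (F : 'rV[R]_m -> R) (z : 'rV[R]_n) : smooth_on setT F ->
  differentiable (J j F) z /\ forall v, 'D_v (J j F) z = Jd j F v z.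
Proof.
move=> sF; pose c i := Jd j F (delta_mx 0 i) z.
have dF (w : 'rV[R]_m) : differentiable F w by exact: smooth_on_diff sF _.
have Dga v t : t ^+ j * 'D_(v *m ga t) F (z *m ga t) =
    t ^+ j * 'D_(v *m P) F (z *m ga t) + t ^+ j.+1 * 'D_(v *m Q) F (z *m ga t).
  have -> : v *m ga t = v *m P + t *: (v *m Q) by rewrite mulmxDr scalemxAr.
  rewrite (deriveE _ (dF _)) linearD linearZ /= -!(deriveE _ (dF _)).
  by rewrite mulrDr exprSr mulrA.
have cJ w i : continuous (fun t : R => t ^+ i * 'D_w F (z *m ga t)).
  by apply: (@J_cts i ('D_w F)); exact: smooth_on_deriv.
have E v : It (fun t => t ^+ j * 'D_(v *m ga t) F (z *m ga t)) = Jd j F v z.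
  by rewrite /Jd /J -ItD //; apply: It_eq => t _; rewrite Dga.
have cD v : continuous (fun t : R => t ^+ j * 'D_(v *m ga t) F (z *m ga t)).
  have -> : (fun t => t ^+ j * 'D_(v *m ga t) F (z *m ga t)) = (fun t =>
     t ^+ j * 'D_(v *m P) F (z *m ga t) + t ^+ j.+1 * 'D_(v *m Q) F (z *m ga t)).
    by apply/funext => t; rewrite Dga.
  move=> t; exact: (continuousD (cJ (v *m P) j t) (cJ (v *m Q) j.+1 t)).
have L v : lform c v = Jd j F v z.
  rewrite -E /lform; under eq_bigr do rewrite /c -E.
  rewrite -It_sum; last by move=> i; exact: cD.
  apply: It_eq => t _; rewrite [in RHS](row_sum_delta v) mulmx_suml.
  rewrite (deriveE _ (dF _)) linear_sum /= mulr_sumr; apply: eq_bigr => i _.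
  by rewrite -scalemxAl linearZ /= -(deriveE _ (dF _)) mulrCA.
have [df Edf] : differentiable (J j F) z /\ ('d (J j F) z : 'rV[R]_n -> R) = lform c.
  apply: frechetP; first exact: lform_continuous.
  move=> e e0; apply: filterS (J_strict z sF e0) => h H.
  have c1 := @J_cts j F (z + h) sF; have c2 := @J_cts j F z sF.
  have c12 : continuous (fun t : R => t ^+ j * F ((z + h) *m ga t) - t ^+ j * F (z *m ga t)).
    by move=> t; exact: (continuousB (c1 t) (c2 t)).
  rewrite -[X in _ - X]/(lform c h) L -E /J -!ItB; try exact: J_cts; try exact: cD.
  - apply: It_le; first by move=> t; exact: (continuousB (c12 t) (cD h t)).
    move=> t /[dup] t01 /andP[t0 t1]; rewrite -!mulrBr normrM.
    apply: le_trans (H t t01); rewrite ler_piMl // ger0_norm ?exprn_ge0 //.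
    by rewrite exprn_ile1.
  - exact: c12.
by split=> // v; rewrite deriveE // Edf L.
Qed.

Lemma J_smooth j (F : 'rV[R]_m -> R) : smooth_on setT F -> smooth_on setT (J j F).
Proof.
move=> sF k; elim: k j F sF => [|k IH] j F sF.
  by move=> x _; apply: differentiable_continuous; have [] := J_diff j x sF.
split=> [x _|v]; first by have [] := J_diff j x sF.
have -> : 'D_v (J j F) = Jd j F v by apply/funext => z; have [_ ->] := J_diff j z sF.
apply: Ck_add; [exact: openT|apply: IH; exact: smooth_on_deriv..].
Qed.

End ParamIntegral.

(** * Hadamard's lemma *)

Section Hadamard.
Context {R : realType}.

Lemma smooth_shift n (F : 'rV[R]_n -> R) (c : 'rV[R]_n) :
  smooth_on setT F -> smooth_on setT (fun y => F (y + c)).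
Proof.
move=> sF.
have sg i : smooth_on setT (fun y : 'rV[R]_n => y 0 i + c 0 i).
  by apply: smooth_add; [exact: openT|exact: smooth_coord|exact: smooth_cst].
have := @smooth_on_comp R n n setT setT F _ openT (fun _ _ => Logic.I) sg sF.
congr (smooth_on _ _); apply/funext => y; congr F.
by apply/rowP => i; rewrite !mxE.
Qed.

Lemma derive_shift n (F : 'rV[R]_n -> R) (c v y : 'rV[R]_n) :
  'D_v (fun y => F (y + c)) y = 'D_v F (y + c).
Proof.
have E : (fun h : R => h^-1 *: (((fun y => F (y + c)) \o shift y) (h *: v) - F (y + c)))
   = (fun h => h^-1 *: ((F \o shift (y + c)) (h *: v) - F (y + c))).
  by apply/funext => h /=; rewrite addrA.
by rewrite /derive E.
Qed.

(** The derivative of F is integrated along the segment from y0 to y, so that [G i] is an averaged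
    partial derivative. This turns the Leibniz rule into a chain rule for derivations, see
    [tan_chain]. *)
Lemma hadamard k (F : 'rV[R]_k -> R) (y0 : 'rV[R]_k) : smooth_on setT F ->
  exists G : 'I_k -> 'rV[R]_k -> R, [/\ forall i, smooth_on setT (G i),
    forall y, F y = F y0 + \sum_i (y 0 i - y0 0 i) * G i y &
    forall i, G i y0 = pd i F y0].
Proof.
move=> sF; pose F' := fun z => F (z + y0).
have sF' : smooth_on setT F' by exact: smooth_shift.
pose G' i := J 0 1%:M 0 (pd i F').
have sG' i : smooth_on setT (G' i) by apply: J_smooth; exact: smooth_on_pd.
have HF' z : F' z = F' 0 + \sum_i z 0 i * G' i z.
  have E : It (fun t => 'D_z F' (t *: z)) = F' z - F' 0.
    have := @It_FTC R (fun t => F' (0 + t *: z)) (fun t => 'D_z F' (t *: z)).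
    rewrite scale1r scale0r !add0r; apply.
      move=> t; have := @line_derive R k F' 0 z t; rewrite add0r; apply.
      exact: smooth_on_diff sF' _.
    move=> t; have c1 : {for t, continuous (fun t : R => t *: z)} by exact: scalel_continuous.
    have c2 : {for t *: z, continuous ('D_z F')} by exact: smooth_on_cts (smooth_on_deriv z sF') _.
    exact: continuous_comp c1 c2.
  apply/eqP; rewrite addrC -subr_eq -E; apply/eqP.
  rewrite /G' /J -It_sum; last by move=> i; apply: J_cts; exact: smooth_on_pd.
  apply: It_eq => t _; rewrite derive_pd; last exact: smooth_on_diff sF' _.
  by apply: eq_bigr => i _; rewrite expr0 mul1r add0r -scalemxAr mulmx1.
exists (fun i y => G' i (y - y0)); split.
- by move=> i; exact: smooth_shift.
- move=> y; have := HF' (y - y0); rewrite /F' subrK add0r => ->; congr (_ + _).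
  by apply: eq_bigr => i _; rewrite !mxE.
move=> i; rewrite subrr /G' /J.
rewrite (@It_eq _ _ (fun=> pd i F y0)); last first.
  by move=> t _; rewrite expr0 mul1r mul0mx /pd /F' derive_shift add0r.
have := @It_FTC R (fun t => pd i F y0 * t) (fun=> pd i F y0).
rewrite mulr1 mulr0 subr0; apply; last by move=> t; exact: cst_continuous.
move=> t; have := @is_deriveZ R R R id (pd i F y0) t 1 1 (is_derive_id _ _).
by rewrite /GRing.scale /= mulr1.
Qed.

Lemma pd_coord n (i j : 'I_n) (x : 'rV[R]_n) :
  pd i (fun y : 'rV[R]_n => y 0 j) x = (j == i)%:R.
Proof. by rewrite /pd derive_coord mxE eqxx. Qed.

End Hadamard.

(** * The Poincare lemma for 1-forms with parameters *)

Section Poincare.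
Context {R : realType}.

(** The first n coordinates x are parameters. With p moved to the origin, the primitive is radial in
    the last k coordinates y: f(x, y) = sum_a y_a int_0^1 ze_a(x, t y) dt. *)
Lemma poincare n k (ze : 'I_k -> 'rV[R]_(n + k) -> R) (p : 'rV[R]_(n + k)) r :
  (forall a, smooth_on setT (ze a)) ->
  (forall y, `|y - p| < r -> forall a b,
     pd (rshift n a) (ze b) y = pd (rshift n b) (ze a) y) ->
  exists2 f, smooth_on setT f &
    forall y, `|y - p| < r -> forall a, pd (rshift n a) f y = ze a y.
Proof.
move=> sz cz; pose z' a := fun y => ze a (y + p).
have sz' a : smooth_on setT (z' a) by exact: smooth_shift.
have z'E a v (y : 'rV[R]_(n + k)) : 'D_v (z' a) y = 'D_v (ze a) (y + p) by exact: derive_shift.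
have cz' (y : 'rV[R]_(n + k)) : `|y| < r -> forall a b,
     pd (rshift n a) (z' b) y = pd (rshift n b) (z' a) y.
  by move=> yr a b; rewrite /pd !z'E; apply: cz; rewrite addrK.
(* z (P + t Q) = (x, t y) for z = (x, y), so that the integrals are values of [J]. *)
pose P : 'M[R]_(n + k) := block_mx 1%:M 0 0 0.
pose Q : 'M[R]_(n + k) := block_mx 0 0 0 1%:M.
have zP (z : 'rV[R]_(n + k)) : z *m P = row_mx (lsubmx z) 0.
  by rewrite -{1}[z]hsubmxK mul_row_block !mulmx0 mulmx1 !addr0.
have zQ (z : 'rV[R]_(n + k)) : z *m Q = row_mx 0 (rsubmx z).
  by rewrite -{1}[z]hsubmxK mul_row_block !mulmx0 mulmx1 !add0r.
have eP b : (delta_mx 0 (rshift n b) : 'rV[R]_(n + k)) *m P = 0.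
  rewrite zP -row_mx0; congr row_mx; apply/rowP => i; rewrite !mxE.
  by rewrite (eq_lrshift i b) andbF.
have eQ b : (delta_mx 0 (rshift n b) : 'rV[R]_(n + k)) *m Q = delta_mx 0 (rshift n b).
  rewrite zQ; apply/rowP => i; rewrite mxE; case: splitP => j Ej; rewrite !mxE.
    have -> : i = lshift k j by apply/val_inj.
    by rewrite eq_lrshift andbF.
  by have -> : i = rshift n j by apply/val_inj.
pose g (z : 'rV[R]_(n + k)) := \sum_a z 0 (rshift n a) * J P Q 0 (z' a) z.
have sg : smooth_on setT g.
  apply: smooth_sum => [|a _]; first exact: openT.
  by apply: smooth_mul; [exact: openT|exact: smooth_coord|exact: J_smooth].
suff Hg (z : 'rV[R]_(n + k)) : `|z| < r -> forall a, pd (rshift n a) g z = z' a z.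
  exists (fun y => g (y - p)); first exact: smooth_shift.
  move=> y yr a; have := Hg (y - p) yr a; rewrite /z' subrK => <-; exact: derive_shift.
move=> zr b.
have dz' a (w : 'rV[R]_(n + k)) : differentiable (z' a) w by exact: smooth_on_diff (sz' a) _.
have gaE (t : R) : z *m (P + t *: Q) = z *m P + t *: (z *m Q).
  by rewrite mulmxDr scalemxAr.
(* Passing from (x, y) to (x, t y) does not increase the maximum norm, so closedness is used only
   inside the ball. *)
have small (t : R) : 0 <= t <= 1 -> `|z *m (P + t *: Q)| < r.
  move=> /andP[t0 t1]; apply: le_lt_trans zr; apply/mx_norm_leP => // i.
  rewrite gaE zP zQ mxE [X in _ + X]mxE.
  have zi : `|z 0 i| <= `|z| by have /mx_norm_leP := lexx `|z|; apply.
  apply: le_trans zi.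
  rewrite !mxE; case: splitP => j Ej; rewrite !mxE ?mulr0 ?addr0 ?add0r.
    by have -> : lshift k j = i by apply/val_inj.
  have -> : rshift n j = i by apply/val_inj.
  by rewrite normrM ger0_norm // ler_piMl.
have D1 (f h : 'rV[R]_(n + k) -> R) : differentiable f z -> differentiable h z ->
    pd (rshift n b) (fun y => f y * h y) z = f z * pd (rshift n b) h z + h z * pd (rshift n b) f z.
  by move=> df dh; rewrite /pd (@deriveM _ _ f h) //; apply: diff_derivable.
have dJ a : differentiable (J P Q 0 (z' a)) z by have [] := J_diff P Q 0 z (sz' a).
have D2 : pd (rshift n b) g z = \sum_a (z 0 (rshift n a) * J P Q 1 (pd (rshift n b) (z' a)) z
    + (a == b)%:R * J P Q 0 (z' a) z).
  have -> : g = \sum_a (fun z : 'rV[R]_(n + k) => z 0 (rshift n a) * J P Q 0 (z' a) z).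
    by apply/funext => y; rewrite fct_sumE.
  rewrite /pd derive_sum; last first.
    move=> a; apply: diff_derivable; apply: differentiableM => //.
    exact: differentiable_coord.
  apply: eq_bigr => a _; rewrite -/(pd _ _ _) D1 //; last exact: differentiable_coord.
  rewrite pd_coord eq_rshift; congr (_ + _); last exact: mulrC.
  congr (_ * _); rewrite /pd; have [_ ->] := J_diff P Q 0 z (sz' a).
  rewrite /Jd eP eQ -[RHS]add0r; congr (_ + _); rewrite /J.
  have := @ItZ R 0 (fun=> 0) (@cst_continuous _ _ _); rewrite [RHS]mul0r => <-.
  by apply: It_eq => t _; rewrite derive0 !mulr0.
rewrite D2 big_split /=.
have -> : \sum_a (a == b)%:R * J P Q 0 (z' a) z = J P Q 0 (z' b) z.
  by rewrite (bigD1 b) //= eqxx mul1r big1 ?addr0 // => a /negPf ->; rewrite mul0r.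
rewrite /J -It_sum; last by move=> a; apply: J_cts; exact: smooth_on_pd.
have cF : continuous (fun t : R => \sum_a z 0 (rshift n a) * (t ^+ 1 * pd (rshift n b) (z' a) (z *m (P + t *: Q)))).
  have -> : (fun t : R => \sum_a z 0 (rshift n a) * (t ^+ 1 * pd (rshift n b) (z' a) (z *m (P + t *: Q)))) =
      \sum_a (fun t : R => z 0 (rshift n a) * (t ^+ 1 * pd (rshift n b) (z' a) (z *m (P + t *: Q)))).
    by apply/funext => t; rewrite fct_sumE.
  apply: (big_ind (fun f : R -> R => continuous f)); first by move=> t; exact: cst_continuous.
    by move=> f h cf ch t; exact: (continuousD (cf t) (ch t)).
  move=> a _ t; have c1 := @J_cts R _ _ P Q 1 _ z (smooth_on_pd (rshift n b) (sz' a)).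
  exact: (continuousM (@cst_continuous _ _ (z 0 (rshift n a)) t) (c1 t)).
rewrite -ItD //; last by apply: J_cts; exact: sz'.
(* Once closedness has exchanged the indices a and b, the integrand is the t-derivative of t ze_b(x,
   t y). *)
have lD (t : R) : is_derive t (1 : R) (fun t => t * z' b (z *m P + t *: (z *m Q)))
    (t * 'D_(z *m Q) (z' b) (z *m (P + t *: Q)) + z' b (z *m (P + t *: Q)) * 1).
  have := is_deriveM (is_derive_id t (1:R)) (@line_derive R _ (z' b) (z *m P) (z *m Q) t (dz' b _)).
  by rewrite -gaE.
have := @It_FTC R _ _ lD; rewrite mul1r mul0r subr0 scale1r -mulmxDr.
have -> : P + Q = 1%:M.
  by rewrite /P /Q add_block_mx !addr0 !add0r -scalar_mx_block.
rewrite mulmx1 => <-; last first.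
  have c1 := @J_cts R _ _ P Q 1 ('D_(z *m Q) (z' b)) z (smooth_on_deriv _ (sz' b)).
  have c0 := @J_cts R _ _ P Q 0 (z' b) z (sz' b).
  have -> : (fun t : R => t * 'D_(z *m Q) (z' b) (z *m (P + t *: Q)) + z' b (z *m (P + t *: Q)) * 1)
      = (fun t : R => t ^+ 1 * 'D_(z *m Q) (z' b) (z *m (P + t *: Q))) +
        (fun t : R => t ^+ 0 * z' b (z *m (P + t *: Q))).
    by apply/funext => u; rewrite !fctE expr1 expr0 mul1r mulr1.
  by move=> t; exact: (continuousD (c1 t) (c0 t)).
apply: It_eq => t t01; rewrite expr0 mul1r mulr1; congr (_ + _).
have -> : 'D_(z *m Q) (z' b) (z *m (P + t *: Q)) =
    \sum_a z 0 (rshift n a) * pd (rshift n a) (z' b) (z *m (P + t *: Q)).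
  rewrite derive_pd // big_split_ord /= big1 ?add0r; last first.
    by move=> i _; rewrite zQ row_mxEl mxE mul0r.
  by apply: eq_bigr => a _; rewrite zQ row_mxEr mxE.
rewrite mulr_sumr; apply: eq_bigr => a _.
rewrite expr1 mulrCA; congr (_ * (_ * _)).
by apply: cz'; exact: small.
Qed.
End Poincare.

Section NormBalls.
Context {R : realType}.

Lemma cts_norm_sub n (p y : 'rV[R]_n) : {for y, continuous (fun z : 'rV[R]_n => `|z - p|)}.
Proof.
apply: continuous_comp; last exact: norm_continuous.
by apply: continuousB; [exact: cvg_id|exact: cst_continuous].
Qed.

Lemma open_nball n (p : 'rV[R]_n) (r : R) : open [set y | `|y - p| < r].
Proof.
have : open ((fun y : 'rV[R]_n => `|y - p|) @^-1` [set t | t < r]).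
  by apply: open_comp; [move=> z _; exact: cts_norm_sub|exact: open_lt].
by [].
Qed.

Lemma closed_nball n (p : 'rV[R]_n) (r : R) : closed [set y | `|y - p| <= r].
Proof.
have : closed ((fun y : 'rV[R]_n => `|y - p|) @^-1` [set t | t <= r]).
  by apply: preimage_closed => [z _|]; [exact: cts_norm_sub|exact: closed_le].
by [].
Qed.

End NormBalls.

(** * The inverse function theorem *)

Section InverseFunction.
Context {R : realType}.
Variables (m : nat) (W : 'I_m -> 'rV[R]_m -> R) (p : 'rV[R]_m).
Hypothesis sW : forall i, smooth_on setT (W i).

Let Wv (y : 'rV[R]_m) : 'rV[R]_m := \row_i W i y.
Let M (y : 'rV[R]_m) : 'M[R]_m := \matrix_(i, j) pd i (W j) y.

Hypothesis Mp : M p \in unitmx.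

Lemma det_smooth n k (A : 'rV[R]_n -> 'M[R]_k) :
  (forall i j, smooth_on setT (fun y => A y i j)) -> smooth_on setT (fun y => \det (A y)).
Proof.
move=> sA; apply: smooth_sum => [|s _]; first exact: openT.
apply: smooth_mul; [exact: openT|exact: smooth_cst|].
by apply: smooth_prod => [|i _]; first exact: openT.
Qed.

Lemma row_derive_mulmx (y k : 'rV[R]_m) : \row_i 'D_k (W i) y = k *m M y.
Proof.
apply/rowP => i; rewrite !mxE derive_pd; last exact: smooth_on_diff (sW i) _.
by apply: eq_bigr => j _; rewrite mxE.
Qed.

Lemma W_strict (e : R) : 0 < e -> exists2 d : R, 0 < d &
  forall w k : 'rV[R]_m, `|w - p| < d -> `|k| < d ->
    `|Wv (w + k) - Wv w - k *m M p| <= e * `|k|.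
Proof.
move=> e0.
have H i : \forall d \near 0^'+, forall w k : 'rV[R]_m, `|w - p| < d -> `|k| < d ->
    `|W i (w + k) - W i w - 'D_k (W i) p| <= e * `|k|.
  have [d d0 Hd] := @strict_diff0 R m (W i) setT p e openT Logic.I (sW i) e0.
  near=> d' => w k wd kd.
  have dd' : d' < d by near: d'; exact: nbhs_right_lt.
  by apply: Hd; apply: lt_trans dd'.
have [d [d0 Hd]] : exists d : R, 0 < d /\ forall i (w k : 'rV[R]_m), `|w - p| < d -> `|k| < d ->
    `|W i (w + k) - W i w - 'D_k (W i) p| <= e * `|k|.
  have K := filter_forall _ H.
  near (0 : R)^'+ => d; exists d; split; first by near: d; exact: nbhs_right_gt.
  by near: d; exact: K.
exists d => // w k wd kd; apply/mx_norm_leP; first by rewrite mulr_ge0 // ltW.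
by move=> i; rewrite -row_derive_mulmx !mxE; exact: Hd.
Unshelve. all: by end_near. Qed.

Let B := invmx (M p).

(** Solutions of W y = c are the fixed points of f_c(y) = y - (W y - c) M(p)^-1, a contraction with
    factor 1/2 near p. *)
Lemma inverse_local : exists C d : R, [/\ 0 < C, 0 < d,
  forall y, `|y - p| < d -> \det (M y) != 0,
  forall y z, `|y - p| < d -> `|z - p| < d -> `|y - z| <= C * `|Wv y - Wv z| &
  forall c, C * `|c - Wv p| < d -> exists2 y, `|y - p| < d & Wv y = c].
Proof.
have [C0 C00 HC0] := mulmx_bound B.
(* Multiplication by the inverse of M(p) costs a factor C0; this choice of e makes the contraction
   factor C0 e = 1/2. *)
have e0 : 0 < (2 * C0)^-1 by rewrite invr_gt0 mulr_gt0.
have [d1 d10 H1] := W_strict e0.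
have [d2 d20 H2] : exists2 d2 : R, 0 < d2 & forall y, `|y - p| < d2 -> \det (M y) != 0.
  have cd : {for p, continuous (fun y => \det (M y))}.
    apply: (@smooth_on_cts _ _ setT) => //; apply: det_smooth => i j.
    have -> : (fun y => M y i j) = pd i (W j) by apply/funext => y; rewrite mxE.
    exact: smooth_on_pd.
  have d0 : \det (M p) != 0 by rewrite -unitfE -unitmxE.
  have nb : nbhs (\det (M p)) [set t | t != 0].
    by apply: open_nbhs_nbhs; split=> //; exact: open_neq.
  have : \forall y \near p, \det (M y) != 0 by exact: cd nb.
  by move=> /nbhs_ballP [d2 d20 Hd]; exists d2 => // y yd; apply: Hd; rewrite -ball_normE /= distrC.
pose d := Num.min (d1 / 4) d2.
have d0 : 0 < d by rewrite lt_min d20 divr_gt0.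
have dd1 : 4 * d <= d1.
  by rewrite mulrC -ler_pdivlMr // ge_min lexx.
pose f c y := y - (Wv y - c) *m B.
have fL c y z : `|y - p| <= d -> `|z - p| <= d -> `|f c y - f c z| <= 2^-1 * `|y - z|.
  move=> yd zd.
  have -> : f c y - f c z = - ((Wv (z + (y - z)) - Wv z - (y - z) *m M p) *m B).
    rewrite mulmxBl -mulmxA mulmxV // mulmx1 (addrC z) subrK /f !mulmxBl.
    move: (Wv y *m B) (Wv z *m B) (c *m B) => a b e.
    by apply/rowP => i; rewrite !mxE; ring.
  rewrite normrN; apply: le_trans (HC0 _) _.
  have yz : `|y - z| < d1.
    rewrite -(subrKA p); apply: le_lt_trans (ler_normD _ _) _.
    have := lerD yd zd; rewrite [`|z - p|]distrC => h; apply: le_lt_trans h _; lra.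
  have zd1 : `|z - p| < d1 by lra.
  have := H1 z (y - z) zd1 yz; rewrite -(ler_pM2l C00) => h; apply: le_trans h _.
  by rewrite mulrA invfM mulrCA mulfV ?gt_eqF // mulr1.
have fdiff c y z : y - z = (f c y - f c z) + (Wv y - Wv z) *m B.
  by rewrite /f !mulmxBl; apply/rowP => i; rewrite !mxE; ring.
exists (4 * C0), d; split=> //; first by rewrite mulr_gt0.
- by move=> y; rewrite lt_min => /andP[_ /H2].
- move=> y z yd zd; have := fL 0 y z (ltW yd) (ltW zd).
  have := HC0 (Wv y - Wv z); have := ler_normD (f 0 y - f 0 z) ((Wv y - Wv z) *m B).
  rewrite -fdiff; have := normr_ge0 (Wv y - Wv z).
  have : 0 <= C0 * `|Wv y - Wv z| by rewrite mulr_ge0 // ltW.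
  rewrite -mulrA; lra.
move=> c cd.
pose U : set 'rV[R]_m := [set y | `|y - p| <= d].
have fp : `|f c p - p| < d / 2.
  rewrite /f addrAC subrr add0r normrN; apply: le_lt_trans (HC0 _) _.
  by rewrite distrC; lra.
have fU : set_fun U U (f c).
  move=> y yU; rewrite /U /= -(subrKA (f c p)); apply: le_trans (ler_normD _ _) _.
  have pU : `|p - p| <= d by rewrite subrr normr0 ltW.
  have := fL c y p yU pU; move: yU; rewrite /U /=; lra.
have cf : continuous (fun y => `|f c y - y|).
  move=> y; apply: continuous_comp; last exact: norm_continuous.
  have -> : (fun y => f c y - y) = fun y => \row_i (- ((Wv y - c) *m B) 0 i).
    by apply/funext => u; apply/rowP => i; rewrite /f !mxE; ring.
  apply: continuous_row => i; apply: (@continuousN _ _ _ (fun u => ((Wv u - c) *m B) 0 i)).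
  apply: (@smooth_on_cts _ _ setT) => //.
  have -> : (fun u => ((Wv u - c) *m B) 0 i) = fun u => \sum_j (W j u + - c 0 j) * B j i.
    by apply/funext => u; rewrite !mxE; apply: eq_bigr => j _; rewrite !mxE.
  apply: smooth_sum => [|j _]; first exact: openT.
  apply: smooth_mul; [exact: openT| |exact: smooth_cst].
  by apply: smooth_add; [exact: openT|exact: sW|exact: smooth_cst].
have pU0 : U p by rewrite /U /= subrr normr0 ltW.
have kU : compact U.
  apply: bounded_closed_compact; last exact: closed_nball.
  exists (`|p| + d); split=> [|M0]; first exact: num_real.
  move=> hM y yU; apply: ltW; apply: le_lt_trans hM.
  by rewrite -(subrK p y) addrC; apply: le_trans (ler_normD _ _) _; rewrite lerD2l.
(* A minimum of |f_c y - y| on the compact ball is a fixed point, since applying f_c once more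
   halves this quantity. *)
have [y yU ymin] := EVT_min_rV (ex_intro _ p pU0) kU (continuous_subspaceT cf).
have {}yU : U y by rewrite inE in yU.
have fy : y = f c y.
  apply/eqP; rewrite eq_sym -subr_eq0 -normr_eq0; apply/eqP.
  have := ymin (f c y); rewrite inE => /(_ (fU _ yU)).
  have := fL c (f c y) y (fU _ yU) yU; have := normr_ge0 (f c y - y); lra.
exists y.
  rewrite {1}fy -(subrKA (f c p)); apply: le_lt_trans (ler_normD _ _) _.
  have pU : `|p - p| <= d by rewrite subrr normr0 ltW.
  have := fL c y p yU pU; move: yU; rewrite /U /=; lra.
have : (Wv y - c) *m B = 0 
  by move: fy; rewrite /f => /eqP; rewrite eq_sym -subr_eq0 addrAC subrr add0r oppr_eq0 => /eqP.
move=> /(congr1 (fun z => z *m M p)); rewrite -mulmxA mulVmx // mulmx1 mul0mx.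
by move=> /eqP; rewrite subr_eq0 => /eqP.
Qed.

(** The local inverse is extended to smooth functions [G i] on the whole space, the kind of
    functions which may be composed with coordinates, see [C_comp]. *)
Theorem inverse_function : exists (G : 'I_m -> 'rV[R]_m -> R) (A : set 'rV[R]_m) (r : R),
  [/\ 0 < r, open A /\ A p, forall i, smooth_on setT (G i),
    forall y, A y -> \row_i G i (Wv y) = y &
    forall c, `|c - Wv p| < r -> A (\row_i G i c) /\ Wv (\row_i G i c) = c].
Proof.
have [C [d [C0 d0 Md inj surj]]] := inverse_local.
pose r := d / (2 * C); have r0 : 0 < r by rewrite divr_gt0 // mulr_gt0.
pose Bl : set 'rV[R]_m := [set c | `|c - Wv p| < d / C].
have oB : open Bl by exact: open_nball.
pose g c := xget p [set y | `|y - p| < d /\ Wv y = c].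
have gP c : Bl c -> `|g c - p| < d /\ Wv (g c) = c.
  by rewrite /Bl /= ltr_pdivlMr // mulrC => /surj [y yd yc]; rewrite /g; case: xgetP => [z _|/(_ y)] //; case.
have gK y : `|y - p| < d -> g (Wv y) = y.
  move=> yd; rewrite /g; case: xgetP => [z _ [zd zy]|/(_ y)]; last by case.
  have := inj z y zd yd; rewrite zy subrr normr0 mulr0 normr_le0 subr_eq0.
  by move=> /eqP.
have gD c : Bl c -> forall i, differentiable (fun c => g c 0 i) c /\
    forall v, 'D_v (fun c => g c 0 i) c = (v *m invmx (M (g c))) 0 i.
  move=> Bc i; have [gd gc] := gP c Bc.
  have Mu : M (g c) \in unitmx by rewrite unitmxE unitfE; exact: Md.
  set N := invmx (M (g c)).
  have [C1 C10 HC1] := mulmx_bound N.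
  have L (v : 'rV[R]_m) : lform (N^~ i) v = (v *m N) 0 i by rewrite mxE.
  suff [df Edf] : differentiable (fun c => g c 0 i) c /\
      ('d (fun c => g c 0 i) c : 'rV[R]_m -> R) = lform (N^~ i).
    by split=> // v; rewrite deriveE // Edf L.
  apply: frechetP; first exact: lform_continuous.
  (* With k the increment of g for an increment h of c, [inj] gives |k| <= C |h|, and multiplication
     by [N] costs another factor C1. *)
  move=> e e0; pose e' := e / (C1 * C).
  have e'0 : 0 < e' by rewrite divr_gt0 // mulr_gt0.
  have H : \forall k \near (0 : 'rV[R]_m), `|Wv (g c + k) - Wv (g c) - k *m M (g c)| <= e' * `|k|.
    have H j : \forall k \near (0 : 'rV[R]_m), `|W j (g c + k) - W j (g c) - 'd (W j) (g c) k| <= e' * `|k|.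
      by apply: frechetW e'0; exact: smooth_on_diff (sW j) _.
    apply: filterS (filter_forall (nbhs_filter _) H) => k Hk; apply/mx_norm_leP; first by rewrite mulr_ge0 // ltW.
    move=> j; have := Hk j; rewrite -row_derive_mulmx !mxE deriveE //.
    exact: smooth_on_diff (sW j) _.
  have [rho rho0 Hrho] : exists2 rho : R, 0 < rho & forall k : 'rV[R]_m, `|k| < rho ->
      `|Wv (g c + k) - Wv (g c) - k *m M (g c)| <= e' * `|k|.
    move: H => /nbhs_ballP [rho rho0 Hr]; exists rho => // k kr; apply: Hr.
    by rewrite -ball_normE /= sub0r normrN.
  have Bn : \forall h \near (0 : 'rV[R]_m), Bl (h + c).
    have : \forall z \near c, Bl z by exact: open_nbhs_nbhs.
    by rewrite (near_shift (0 : 'rV[R]_m)) /= subr0.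
  near=> h.
  have Bh : Bl (c + h) by rewrite addrC; near: h; exact: Bn.
  have [hd hc] := gP _ Bh; set k := g (c + h) - g c.
  have gk : g (c + h) = g c + k by rewrite /k addrCA subrr addr0.
  have hk : `|k| <= C * `|h|.
    have := inj (g (c + h)) (g c) hd gd; rewrite hc gc -/k.
    by rewrite (addrC c) addrK.
  have krho : `|k| < rho.
    apply: le_lt_trans hk _; rewrite mulrC -ltr_pdivlMr //.
    by near: h; apply: (@nbhs0_lt R 'rV[R]_m); exact: divr_gt0.
  have Hk := Hrho k krho; rewrite -gk hc gc (addrC c) addrK in Hk.
  have E : k - h *m N = - ((h - k *m M (g c)) *m N).
    by rewrite mulmxBl -mulmxA mulmxV // mulmx1 opprB.
  rewrite -[X in _ - X]/(lform (N^~ i) h) L.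
  have -> : g (c + h) 0 i - g c 0 i - (h *m N) 0 i = (k - h *m N) 0 i.
    by rewrite /k; move: (h *m N) (g (c + h)) (g c) => a b1 b2; rewrite !mxE.
  have /mx_norm_leP : `|k - h *m N| <= e * `|h|.
    rewrite E normrN; apply: le_trans (HC1 _) _.
    have h1 : C1 * `|h - k *m M (g c)| <= C1 * (e' * (C * `|h|)).
      rewrite ler_pM2l //; apply: le_trans Hk _; by rewrite ler_pM2l.
    apply: le_trans h1 _; rewrite /e' le_eqVlt; apply/orP; left; apply/eqP.
    by field; rewrite !gt_eqF.
  by apply; rewrite mulr_ge0 // ltW.
(* Bootstrap: the derivative of g is a smooth function of g itself, namely the inverse of M at g, so
   g of class C^k is of class C^(k+1). *)
have gC k : forall i, Ck k Bl (fun c => g c 0 i).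
  elim: k => [|k IH] i; first by move=> c /gD /(_ i) [dc _]; exact: differentiable_continuous.
  split=> [c /gD /(_ i) [] //|v].
  pose U : set 'rV[R]_m := [set y | \det (M y) != 0].
  have sM a b : smooth_on setT (fun y => M y a b).
    have -> : (fun y => M y a b) = pd a (W b) by apply/funext => y; rewrite mxE.
    exact: smooth_on_pd.
  have sdet := det_smooth sM.
  have oU : open U.
    have : open ((fun y => \det (M y)) @^-1` [set t | t != 0]).
      apply: open_comp; last exact: open_neq.
      by move=> y _; exact: smooth_on_cts sdet _.
    by [].
  have sN a b : smooth_on U (fun y => invmx (M y) a b).
    apply: (@smooth_eq _ _ _ (fun y => (\det (M y))^-1 * ((-1) ^+ (b + a) * \det (row' b (col' a (M y))))) _ oU).
      by move=> y Uy; rewrite /invmx unitmxE unitfE Uy !mxE /cofactor.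
    apply: smooth_mul => //; first by apply: smooth_inv => //; exact: smooth_sub sdet.
    apply: (@smooth_sub _ _ setT) => //; apply: smooth_mul; [exact: openT|exact: smooth_cst|].
    apply: det_smooth => a' b'.
    have -> : (fun y => row' b (col' a (M y)) a' b') = fun y => M y (lift b a') (lift a b').
      by apply/funext => y; rewrite !mxE.
    exact: sM.
  apply: (@Ck_eq _ _ _ _ (fun c => \sum_a v 0 a * invmx (M (\row_j g c 0 j)) a i)) => //.
    move=> c Bc; have [_ ->] := gD c Bc i; rewrite mxE; apply: eq_bigr => a _.
    congr (_ * invmx (M _) a i); by apply/rowP => j; rewrite mxE.
  apply: Ck_sum => // a _; apply: Ck_mul => //; first exact: Ck_cst.
  apply: (@Ck_comp _ _ _ _ Bl U (fun y => invmx (M y) a i) (fun j c => g c 0 j)) => //; last exact: (sN a i).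
  move=> c Bc; have -> : \row_j g c 0 j = g c by apply/rowP => j; rewrite mxE.
  by apply: Md; have [] := gP c Bc.
(* [smooth_extend] needs the ball of radius 2r' = r inside [Bl], and agrees with g on the ball of
   radius r' only. *)
pose r' := r / 2; have r'0 : 0 < r' by rewrite divr_gt0.
have Bsub y : `|y - Wv p| <= 2 * r' -> Bl y.
  rewrite /r' mulrCA mulfV // mulr1 /r => h; rewrite /Bl /=.
  apply: le_lt_trans h _; rewrite ltr_pM2l // ltf_pV2 ?posrE ?mulr_gt0 //.
  by rewrite ltr_pMl // ltr1n.
have ex i := smooth_extend oB r'0 Bsub (fun k => gC k i).
pose G i := sval (cid2 (ex i)).
have sG i : smooth_on setT (G i) by rewrite /G; case: cid2.
have GE c : `|c - Wv p| <= r' -> \row_i G i c = g c.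
  by move=> cr; apply/rowP => i; rewrite mxE /G; case: cid2 => /= f _ ->.
exists G, [set y | `|y - p| < d /\ `|Wv y - Wv p| < r'], r'; split=> //.
- split; last by rewrite /= !subrr !normr0.
  have o1 : open [set y : 'rV[R]_m | `|y - p| < d] by exact: open_nball.
  have o2 : open ((fun y : 'rV[R]_m => `|Wv y - Wv p|) @^-1` [set t | t < r']).
    apply: open_comp; last exact: open_lt.
    move=> z _; apply: continuous_comp; last exact: norm_continuous.
    apply: continuousB; last exact: cst_continuous.
    by apply: continuous_row => i; exact: smooth_on_cts (sW i) _.
  exact: openI o1 o2.
- by move=> y [yd /ltW yr]; rewrite GE // gK.
move=> c cr; rewrite GE ?ltW //; have [] := gP c (Bsub _ _) => [|gd gc].
  by rewrite (le_trans (ltW cr)) // ler_pMl // ler1n.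
by rewrite /= gc.
Unshelve. all: by end_near. Qed.

End InverseFunction.

(** * Smooth spaces with local coordinates *)

Section SmoothSpaces.
Context {R : realType}.
Implicit Types M N L : smoothSpace R.

(* The properties of C^oo(M) shared by manifolds, their products and subsets. *)
Class sspace M : Prop := SSpace {
  C_local : forall f : M -> R, (forall x : M, exists2 g, Cinf M g & \forall y \near x, f y = g y) ->
    Cinf M f;
  C_comp : forall k (F : 'rV[R]_k -> R) (g : 'I_k -> M -> R), smooth_on setT F ->
    (forall i, Cinf M (g i)) -> Cinf M (fun x => F (\row_i g i x));
  C_cts : forall (f : M -> R) (x : M), Cinf M f -> {for x, continuous f};
  C_bump : forall (p : M) (U : set M), nbhs p U -> exists b, [/\ Cinf M b,
    \forall y \near p, b y = 1 & forall y, ~ U y -> b y = 0] }.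

Definition xv M n (x : 'I_n -> M -> R) (q : M) : 'rV[R]_n := \row_i x i q.

(** The coordinates are smooth functions on all of M, so that tangent vectors, which act on global
    functions only, apply to them. Injectivity on [U] and the openness [co_opn] take the place of a
    named inverse map. *)
Record coords M (p : M) n (x : 'I_n -> M -> R) (U : set M) (r : R) : Prop := Coords {
  co_r : 0 < r;
  co_open : open U;
  co_p : U p;
  co_C : forall i, Cinf M (x i);
  co_inj : forall q q', U q -> U q' -> xv x q = xv x q' -> q = q';
  co_ball : forall q, U q -> `|xv x q - xv x p| < r;
  co_surj : forall y, `|y - xv x p| < r -> exists2 q, U q & xv x q = y;
  co_opn : forall (q : M) (W : set M), U q -> nbhs q W ->
    \forall y \near xv x q, exists q', [/\ U q', W q' & xv x q' = y];
  co_rep : forall (f : M -> R) (q : M), Cinf M f -> U q ->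
    exists2 F, smooth_on setT F & \forall y \near q, f y = F (xv x y) }.

Class nice M : Prop := Nice {
  nice_sspace :: sspace M;
  nice_coords : forall p : M, exists n x U r, @coords M p n x U r }.

Section Algebra.
Context {M : smoothSpace R} {sM : sspace M}.
Implicit Types f g : M -> R.

Lemma C_cst (c : R) : Cinf M (fun=> c).
Proof. by apply: (@C_comp M sM 0 (fun=> c) (fun _ _ => 0)); [exact: smooth_cst|case]. Qed.

Lemma C_comp2 (F : 'rV[R]_2 -> R) f g : smooth_on setT F -> Cinf M f -> Cinf M g ->
  Cinf M (fun x => F (\row_(i < 2) if i == 0 then f x else g x)).
Proof.
move=> sF Cf Cg; have := @C_comp M sM 2 F (fun i => if i == 0 then f else g) sF.
have H i : Cinf M (if (i : 'I_2) == 0 then f else g) by case: ifP.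
move=> /(_ H); congr (Cinf M _); apply/funext => x; congr F.
by apply/rowP => i; rewrite !mxE; case: ifP.
Qed.

Lemma C_add f g : Cinf M f -> Cinf M g -> Cinf M (fun x => f x + g x).
Proof.
move=> Cf Cg; have := @C_comp2 (fun y => y 0 0 + y 0 1) f g _ Cf Cg.
have H : smooth_on setT (fun y : 'rV[R]_2 => y 0 0 + y 0 1).
  by apply: smooth_add; [exact: openT|exact: smooth_coord..].
by move=> /(_ H); congr (Cinf M _); apply/funext => x; rewrite !mxE.
Qed.

Lemma C_mul f g : Cinf M f -> Cinf M g -> Cinf M (fun x => f x * g x).
Proof.
move=> Cf Cg; have := @C_comp2 (fun y => y 0 0 * y 0 1) f g _ Cf Cg.
have H : smooth_on setT (fun y : 'rV[R]_2 => y 0 0 * y 0 1).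
  by apply: smooth_mul; [exact: openT|exact: smooth_coord..].
by move=> /(_ H); congr (Cinf M _); apply/funext => x; rewrite !mxE.
Qed.

Lemma C_scale (c : R) f : Cinf M f -> Cinf M (fun x => c * f x).
Proof. by move=> Cf; apply: C_mul => //; exact: C_cst. Qed.

Lemma C_opp f : Cinf M f -> Cinf M (fun x => - f x).
Proof.
move=> Cf; have := C_scale (-1) Cf; congr (Cinf M _); apply/funext => x.
by rewrite mulN1r.
Qed.

Lemma C_sub f g : Cinf M f -> Cinf M g -> Cinf M (fun x => f x - g x).
Proof. by move=> Cf Cg; apply: C_add => //; exact: C_opp. Qed.

Lemma C_sum (I : Type) (r : seq I) (P : pred I) (F : I -> M -> R) :
  (forall i, P i -> Cinf M (F i)) -> Cinf M (fun x => \sum_(i <- r | P i) F i x).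
Proof.
move=> CF; have -> : (fun x => \sum_(i <- r | P i) F i x) = \sum_(i <- r | P i) F i.
  by apply/funext => x; rewrite fct_sumE.
by apply: (big_ind (Cinf M)) => //; [exact: C_cst|move=> f g; exact: C_add].
Qed.

Lemma C_prod (I : Type) (r : seq I) (P : pred I) (F : I -> M -> R) :
  (forall i, P i -> Cinf M (F i)) -> Cinf M (fun x => \prod_(i <- r | P i) F i x).
Proof.
move=> CF; have -> : (fun x => \prod_(i <- r | P i) F i x) = \prod_(i <- r | P i) F i.
  by apply/funext => x; elim/big_rec2: _ => // i y1 y2 _ ->.
by apply: (big_ind (Cinf M)) => //; [exact: C_cst|move=> f g; exact: C_mul].
Qed.

Lemma C_xv_cts n (x : 'I_n -> M -> R) (q : M) : (forall i, Cinf M (x i)) ->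
  {for q, continuous (xv x)}.
Proof. by move=> Cx; apply: continuous_row => i; exact: C_cts. Qed.

(** Whatever the shape of [U], its image contains a ball around [xv x p]; restriction to the
    preimage of a ball supplies [co_ball] and [co_surj]. *)
Lemma coords_build (p : M) n (x : 'I_n -> M -> R) (U : set M) :
  open U -> U p -> (forall i, Cinf M (x i)) ->
  (forall q q', U q -> U q' -> xv x q = xv x q' -> q = q') ->
  (forall (q : M) (W : set M), U q -> nbhs q W ->
     \forall y \near xv x q, exists q', W q' /\ xv x q' = y) ->
  (forall (f : M -> R) (q : M), Cinf M f -> U q ->
    exists2 F, smooth_on setT F & \forall y \near q, f y = F (xv x y)) ->
  exists U' r, [/\ U' `<=` U, @coords M p n x U' r & forall r', 0 < r' <= r ->
     coords p x (U' `&` [set q | `|xv x q - xv x p| < r']) r'].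
Proof.
move=> oU Up Cx inj opn rep.
have nU : nbhs p U by exact: open_nbhs_nbhs.
have /nbhs_ballP [r r0 Hr] := opn p U Up nU.
have ob e : open [set q | `|xv x q - xv x p| < e].
  have : open (xv x @^-1` [set y : 'rV[R]_n | `|y - xv x p| < e]).
    by apply: open_comp; [move=> q _; exact: C_xv_cts|exact: open_nball].
  by [].
have H r' : 0 < r' <= r -> coords p x (U `&` [set q | `|xv x q - xv x p| < r']) r'.
  move=> /andP[r'0 rr]; split=> //.
  - exact: openI.
  - by split=> //=; rewrite subrr normr0.
  - by move=> q q' [Uq _] [Uq' _]; exact: inj.
  - by move=> q [].
  - move=> y yr; have [|q [Uq qy]] := Hr y.
      by rewrite -ball_normE /= distrC (lt_le_trans yr).
    by exists q => //; split=> //=; rewrite qy.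
  - move=> q W Uq nW; have nU' : nbhs q (W `&` (U `&` [set q | `|xv x q - xv x p| < r'])).
      by apply: filterI => //; apply: open_nbhs_nbhs; split=> //; exact: openI.
    have := opn q _ Uq.1 nU'; apply: filterS => y [q' [[Wq' Uq'] qy]].
    by exists q'.
  - by move=> f q Cf [Uq _]; exact: rep.
exists (U `&` [set q | `|xv x q - xv x p| < r]), r; split.
- by move=> q [].
- by apply: H; rewrite r0 lexx.
move=> r' /[dup] /andP[r'0 rr] /H.
congr (coords p x _ r'); apply/seteqP; split=> q /=; first by move=> [Uq qr]; split=> //; split=> //; exact: lt_le_trans rr.
by move=> [[]].
Qed.

Lemma coords_sub (p : M) n (x : 'I_n -> M -> R) U r (W : set M) :
  coords p x U r -> nbhs p W -> exists U' r', U' `<=` W /\ U' `<=` U /\ coords p x U' r'.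
Proof.
move=> co nW; rewrite nbhsE in nW; have [W' [oW' W'p] W'W] := nW.
have [||||||U' [r' [sU co' _]]] := @coords_build p n x (U `&` W').
- by apply: openI => //; exact: co_open co.
- by split=> //; exact: co_p co.
- exact: co_C co.
- by move=> q q' [Uq _] [Uq' _]; exact: co_inj co _ _ Uq Uq'.
- move=> q W0 [Uq W'q] nW0; have := co_opn co Uq nW0.
  by apply: filterS => y [q' [_ ? ?]]; exists q'.
- by move=> f q Cf [Uq _]; exact: co_rep co _ _ Cf Uq.
by exists U', r'; split=> [q /sU [_ /W'W]|] //; split=> // q /sU [].
Qed.

End Algebra.

(** A bump at f x supported in the given neighbourhood pulls back to a continuous function which is
    positive near x. *)
Lemma smooth_cts M N {sM : sspace M} {sN : sspace N} (f : M -> N) : smooth_map f -> continuous f.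
Proof.
move=> sf x W nW; have [b [Cb b1 b0]] := C_bump nW.
have c : {for x, continuous (b \o f)} by apply: C_cts; exact: sf.
have bx : b (f x) = 1 by exact: nbhs_singleton b1.
have : \forall y \near x, 0 < (b \o f) y.
  by apply: (@cvgr_gt _ _ (nbhs x) _ _ _ c) => /=; rewrite bx.
apply: filterS => y /= by0; apply: contrapT => nWy.
by rewrite b0 ?ltxx in by0.
Qed.

Lemma smooth_map_local M N (f : M -> N) (sM : sspace M) :
  (forall g (x : M), Cinf N g -> exists2 h, Cinf M h & \forall y \near x, g (f y) = h y) ->
  smooth_map f.
Proof. by move=> H g Cg; apply: C_local => x; exact: H. Qed.

Lemma smooth_id M : smooth_map (@id M).
Proof. by []. Qed.

Lemma smooth_comp M N L (f : M -> N) (g : N -> L) : smooth_map f -> smooth_map g ->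
  smooth_map (g \o f).
Proof. by move=> sf sg h Ch; exact: sf _ (sg _ Ch). Qed.

Lemma smooth_cstmap M N (c : N) (sM : sspace M) : smooth_map (fun _ : M => c).
Proof. by move=> g _; exact: C_cst. Qed.

End SmoothSpaces.

(** * Subsets of smooth spaces *)

Section SubSpaces.
Context {R : realType} {M : smoothSpace R} {sM : sspace M} (A : set M).

Lemma val_cts (x : subS A) : {for x, continuous (set_val : subS A -> M)}.
Proof. exact: initial_continuous. Qed.

Lemma near_subS (x : subS A) (U : set (subS A)) : nbhs x U ->
  exists2 W, nbhs (set_val x) W & forall y : subS A, W (set_val y) -> U y.
Proof.
rewrite (@nbhsE (subS A)) => -[B [oB Bx] BU]; have [C oC CB] := oB.
exists C; first by apply: open_nbhs_nbhs; split=> //; rewrite -CB in Bx.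
by move=> y Cy; apply: BU; rewrite -CB.
Qed.

Lemma val_smooth : smooth_map (set_val : subS A -> M).
Proof. by move=> g Cg x; exists g => //; near=> y. Unshelve. all: by end_near. Qed.

(* The low priority prevents looping on goals [sspace ?M]. *)
#[global] Instance subS_sspace : sspace (subS A) | 10.
Proof.
split.
- move=> f H x; have [g Cg fg] := H x; have [F CF gF] := Cg x; exists F => //.
  by apply: filterS2 fg gF => y -> ->.
- move=> k F g sF Cg x.
  pose h i := sval (cid2 (Cg i x)).
  have Ch i : Cinf M (h i) by rewrite /h; case: cid2.
  have gh i : \forall y \near x, g i y = h i (set_val y) by rewrite /h; case: cid2.
  exists (fun y => F (\row_i h i y)); first exact: C_comp.
  apply: filterS (filter_forall (nbhs_filter x) gh) => y gy; congr F.
  by apply/rowP => i; rewrite !mxE gy.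
- move=> f x Cf; have [F CF fF] := Cf x.
  have c : {for x, continuous (F \o set_val)}.
    by apply: continuous_comp; [exact: val_cts|exact: C_cts].
  have fx : f x = F (set_val x) by exact: nbhs_singleton fF.
  rewrite /prop_for /continuous_at fx; apply: cvg_trans c; apply: (@near_eq_cvg _ _ (nbhs x)).
  by apply: filterS fF => y ->.
move=> p U nU; have [W nW WU] := near_subS nU.
have [b [Cb b1 b0]] := C_bump nW; exists (b \o set_val); split.
- exact: val_smooth.
- exact: (@val_cts p _ b1).
by move=> y nUy; apply: b0 => /WU.
Qed.

Lemma subS_smooth L (sL : sspace L) (f : L -> subS A) :
  smooth_map (set_val \o f) -> smooth_map f.
Proof.
move=> sf; have cf : continuous (set_val \o f) by exact: smooth_cts.
apply: smooth_map_local => g x Cg; have [F CF gF] := Cg (f x).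
exists (F \o (set_val \o f)); first exact: sf.
have [W nW WU] := near_subS gF.
have nW' : nbhs x ((set_val \o f) @^-1` W) by exact: cf x _ nW.
by apply: filterS nW' => y Wy; exact: WU.
Qed.

End SubSpaces.

(** * Manifolds: bump functions and global coordinate functions *)

Section ManifoldNice.
Context {R : realType} (M : manifold R).

Lemma chart_open_pre (c : chart R (mtop M) (mdim M)) (U : set (mtop M)) : open U ->
  open ((cmap c @` cdom c) `&` (cinv c @^-1` U)).
Proof.
move=> oU; have := @cinv_cts _ _ _ c; rewrite continuous_open_subspace; last exact: cimg_open.
move=> H; rewrite openE => y [Vy Uy]; apply: filterI.
  by apply: open_nbhs_nbhs; split=> //; exact: cimg_open.
by apply: H; [rewrite inE|exact: open_nbhs_nbhs].
Qed.

Lemma chart_cts (c : chart R (mtop M) (mdim M)) q : cdom c q -> {for q, continuous (cmap c)}.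
Proof.
have := @cmap_cts _ _ _ c; rewrite continuous_open_subspace; last exact: cdom_open.
by move=> H cq; apply: H; rewrite inE.
Qed.

Lemma chart_inv_cts (c : chart R (mtop M) (mdim M)) y : (cmap c @` cdom c) y ->
  {for y, continuous (cinv c)}.
Proof.
have := @cinv_cts _ _ _ c; rewrite continuous_open_subspace; last exact: cimg_open.
by move=> H cq; apply: H; rewrite inE.
Qed.

Definition transfer (c : chart R (mtop M) (mdim M)) (h : 'rV[R]_(mdim M) -> R) (q : M) : R :=
  if `[< cdom c q >] then h (cmap c q) else 0.

Lemma transferE c h q : cdom c q -> transfer c h q = h (cmap c q).
Proof. by rewrite /transfer => cq; case: asboolP. Qed.

(** The delicate points are those outside the chart domain. The support lies in the image [K] of a
    closed ball, which is compact and hence closed because M is Hausdorff; off [K] the function is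
    zero. *)
Lemma transfer_C (c : chart R (mtop M) (mdim M)) (z0 : 'rV[R]_(mdim M)) r h : atlas c ->
  (forall z, `|z - z0| <= r -> (cmap c @` cdom c) z) -> smooth_on setT h ->
  (forall z, r <= `|z - z0| -> h z = 0) -> Cinf M (transfer c h).
Proof.
move=> ac rV sh h0 d ad.
pose K := cinv c @` [set z | `|z - z0| <= r].
have cK : closed K.
  apply: compact_closed; first exact: mhausdorff.
  apply: continuous_compact.
    apply: continuous_subspaceW (@cinv_cts _ _ _ c) => z; exact: rV.
  apply: bounded_closed_compact; last exact: closed_nball.
  exists (`|z0| + r); split=> [|M0 hM y yU]; first exact: num_real.
  apply: ltW; apply: le_lt_trans hM.
  by rewrite -(subrK z0 y) addrC; apply: le_trans (ler_normD _ _) _; rewrite lerD2l.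
apply: smooth_on_local => y [q dq qy].
have [cq|ncq] := pselect (cdom c q).
  exists ((cmap d @` cdom d) `&` (cinv d @^-1` cdom c)), (fun y => h (\row_i cmap c (cinv d y) 0 i)).
  have oW := chart_open_pre (c := d) (cdom_open c).
  split=> //.
  - by split; [exists q|rewrite /= -qy cmapK].
  - apply: (smooth_on_comp oW _ _ sh) => // i.
    apply: smooth_sub (atlas_compat ad ac i) => z [[q' dq' <-]]; rewrite /= cmapK // => cq'.
    by exists q'.
  move=> z [_ cz]; rewrite /= transferE //; congr h.
  by apply/rowP => i; rewrite mxE.
exists ((cmap d @` cdom d) `&` (cinv d @^-1` (~` K))), (fun=> 0); split.
- by apply: chart_open_pre; exact: closed_openC.
- split; first by exists q.
  rewrite /= -qy cmapK // => -[z /rV [q' cq' <-]]; rewrite cmapK // => qq'.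
  by rewrite -qq' in ncq.
- exact: smooth_cst.
move=> z [_ nK]; rewrite /= /transfer; case: asboolP => // cz.
have [le|gt] := leP r `|cmap c (cinv d z) - z0|; first exact: h0.
by case: nK; exists (cmap c (cinv d z)); [exact: ltW|rewrite cmapK].
Qed.

Lemma chart_ball (c : chart R (mtop M) (mdim M)) (p : M) (U : set M) : cdom c p -> nbhs p U ->
  exists2 r, 0 < r & forall z, `|z - cmap c p| <= 2 * r ->
    (cmap c @` cdom c) z /\ U (cinv c z).
Proof.
move=> cp; rewrite nbhsE => -[U' [oU' U'p] U'U].
have : \forall z \near cmap c p, (cmap c @` cdom c) z /\ U' (cinv c z).
  apply: (@open_nbhs_nbhs _ _ ((cmap c @` cdom c) `&` (cinv c @^-1` U'))).
  by split; [exact: chart_open_pre|split; [exists p|rewrite /= cmapK]].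
move=> /nbhs_ballP [r r0 Hr]; exists (r / 4); first by rewrite divr_gt0.
move=> z zr; have [|Vz Uz] := Hr z; last by split=> //; exact: U'U.
rewrite -ball_normE /= distrC; apply: le_lt_trans zr _.
by move: r0; rewrite /= => r0; lra.
Qed.

#[global] Instance manifold_nice : nice M | 5.
Proof.
have bump (p : M) (U : set M) : nbhs p U -> exists b, [/\ Cinf M b,
    \forall y \near p, b y = 1 & forall y, ~ U y -> b y = 0].
  move=> nU; have [c ac cp] := atlas_cover p.
  have [r r0 Hr] := chart_ball cp nU.
  have [b [sb b1 b0]] := bump_exists (cmap c p) r0.
  exists (transfer c b); split.
  - by apply: (transfer_C ac _ sb b0) => z /Hr [].
  - have ccp := chart_cts cp.
    have nc : nbhs p (cdom c) by apply: open_nbhs_nbhs; split=> //; exact: cdom_open.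
    have nb : nbhs (cmap c p) [set z | `|z - cmap c p| < r].
      by apply: open_nbhs_nbhs; split; [exact: open_nball|rewrite /= subrr normr0].
    by apply: filterS2 nc (ccp _ nb) => q cq qr; rewrite transferE // b1 // ltW.
  move=> q nUq; rewrite /transfer; case: asboolP => // cq.
  have [le|gt] := leP (2 * r) `|cmap c q - cmap c p|; first exact: b0.
  by have [_] := Hr _ (ltW gt); rewrite cmapK.
have cts (f : M -> R) (x : M) : Cinf M f -> {for x, continuous f}.
  move=> Cf; have [c ac cx] := atlas_cover x.
  have h : {for x, continuous ((f \o cinv c) \o cmap c)}.
    apply: continuous_comp; first exact: chart_cts.
    by apply: smooth_on_cts (Cf c ac) _; exists x.
  have nc : nbhs x (cdom c) by apply: open_nbhs_nbhs; split=> //; exact: cdom_open.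
  rewrite /prop_for /continuous_at -{2}(cmapK cx); apply: cvg_trans h.
  by apply: near_eq_cvg; apply: filterS nc => y cy /=; rewrite cmapK.
have SM : sspace M.
  split=> //.
  - move=> f H d ad; apply: smooth_on_local => y [q dq qy].
    have [g Cg fg'] := H q.
    have : nbhs q [set y | f y = g y] by exact: fg'.
    rewrite nbhsE => -[U [oU Uq] fg].
    exists ((cmap d @` cdom d) `&` (cinv d @^-1` U)), (g \o cinv d); split.
    + exact: chart_open_pre.
    + by split; [exists q|rewrite /= -qy cmapK].
    + apply: smooth_sub (Cg d ad); exact: subIsetl.
    + by move=> z [_ /fg].
  - move=> k F g sF Cg d ad.
    have sg i : smooth_on (cmap d @` cdom d) (fun y => g i (cinv d y)) by exact: (Cg i d ad).
    have H := smooth_on_comp (@cimg_open _ _ _ d) (fun _ _ => Logic.I) sg sF.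
    by apply: smooth_eq (@cimg_open _ _ _ d) _ H.
split=> // p; have [c ac cp] := atlas_cover p.
have [r r0 Hr] := chart_ball cp (filterT : nbhs p setT).
have [b [sb b1 b0]] := bump_exists (cmap c p) r0.
(* The chart coordinates, cut off so as to become smooth on all of M; on [U] the cutoff is 1. *)
pose x i := transfer c (fun z => b z * z 0 i).
pose U : set M := cdom c `&` [set q | `|cmap c q - cmap c p| < r].
have xE q : U q -> xv x q = cmap c q.
  move=> [cq qr]; apply/rowP => i; rewrite mxE /x transferE // b1 ?mul1r //; exact: ltW.
have oU : open U.
  rewrite openE => q [cq qr]; apply: filterI.
    by apply: open_nbhs_nbhs; split=> //; exact: cdom_open.
  have nb : nbhs (cmap c q) [set z | `|z - cmap c p| < r].
    by apply: open_nbhs_nbhs; split=> //; exact: open_nball.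
  exact: (chart_cts cq nb).
have Up : U p by split=> //=; rewrite subrr normr0.
have [||||U' [r' [_ co _]]] := @coords_build R M SM p _ x U oU Up.
- move=> i; apply: (transfer_C (z0 := cmap c p) (r := 2 * r) ac) => [z /Hr []//||z zr].
    by apply: smooth_mul; [exact: openT|exact: sb|exact: smooth_coord].
  by rewrite b0 // mul0r.
- move=> q q' Uq Uq'; rewrite !xE // => /(congr1 (cinv c)); rewrite !cmapK //.
    by case: Uq'.
  by case: Uq.
- move=> q W Uq nW; rewrite xE //; have [cq qr] := Uq.
  have nWU : nbhs q (W `&` U) by apply: filterI => //; exact: open_nbhs_nbhs.
  have Vq : (cmap c @` cdom c) (cmap c q) by exists q.
  have : nbhs (cinv c (cmap c q)) (W `&` U) by rewrite cmapK.
  move=> /(chart_inv_cts Vq); apply: filterS2 (open_nbhs_nbhs (conj (@cimg_open _ _ _ c) Vq)).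
  move=> y [q' cq' <-]; rewrite /= cmapK // => -[Wq' Uq'].
  by exists q'; split=> //; exact: xE.
- move=> f q Cf Uq; have [cq qr] := Uq.
  have [e e0 He] := chart_ball cq (filterT : nbhs q setT).
  have [G sG GE] := smooth_extend (@cimg_open _ _ _ c) e0 (fun z ze => (He z ze).1) (Cf c ac).
  exists G => //; have nU : nbhs q U by exact: open_nbhs_nbhs.
  have nb : nbhs (cmap c q) [set z | `|z - cmap c q| < e].
    by apply: open_nbhs_nbhs; split; [exact: open_nball|rewrite /= subrr normr0].
  apply: filterS2 nU (chart_cts cq nb) => q' Uq' q'e; rewrite xE // GE //; last exact: ltW.
  by rewrite /= cmapK //; case: Uq'.
by exists _, x, U', r'.
Qed.

End ManifoldNice.

(** * Products of smooth spaces *)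

Section Products.
Context {R : realType}.

Section Generated.
Context {T : topologicalType} (G : set (T -> R)).

Lemma gen_in g : G g -> generated G g.
Proof.
move=> Gg x; exists 1, (fun=> g), (fun y => y 0 0); split=> //.
  exact: smooth_coord.
by near=> y; rewrite mxE.
Unshelve. all: by end_near. Qed.

Lemma gen_local f : (forall x : T, exists2 g, generated G g & \forall y \near x, f y = g y) ->
  generated G f.
Proof.
move=> H x; have [g /(_ x) [k [h [F [Gh sF gF]]]] fg] := H x.
by exists k, h, F; split=> //; apply: filterS2 fg gF => y -> ->.
Qed.

Lemma gen_comp k (F : 'rV[R]_k -> R) (g : 'I_k -> T -> R) : smooth_on setT F ->
  (forall i, generated G (g i)) -> generated G (fun x => F (\row_i g i x)).
Proof.
move=> sF Gg x.
have H0 i : exists d : {k : nat & (('I_k -> T -> R) * ('rV[R]_k -> R))%type},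
    [/\ forall j, G ((tagged d).1 j), smooth_on setT (tagged d).2 &
        \forall y \near x, g i y = (tagged d).2 (\row_j (tagged d).1 j y)].
  by have [k' [h [F' PF]]] := Gg i x; exists (existT _ k' (h, F')).
(* The generators occurring in all the [g i] are collected in one sum type, which is then renumbered
   by an ordinal. *)
have {H0} [d Hd] := choice H0; pose kk i := tag (d i).
pose I : finType := {i : 'I_k & 'I_(kk i)}.
pose g' (j : 'I_#|I|) : T -> R := let t := enum_val j in (tagged (d (tag t))).1 (tagged t).
pose F' (y : 'rV[R]_#|I|) :=
  F (\row_i (tagged (d i)).2 (\row_l y 0 (enum_rank (Tagged (fun i => 'I_(kk i)) l : I)))).
exists #|I|, g', F'; split.
- by move=> j; have [+ _ _] := Hd (tag (enum_val j)); apply.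
- apply: (smooth_on_comp openT (fun _ _ => Logic.I) _ sF) => i.
  have [_ sFi _] := Hd i.
  by apply: (smooth_on_comp openT (fun _ _ => Logic.I) _ sFi) => l; exact: smooth_coord.
have H i : \forall y \near x, g i y = (tagged (d i)).2 (\row_j (tagged (d i)).1 j y) by have [] := Hd i.
apply: filterS (filter_forall (nbhs_filter x) H) => y Hy; congr F.
apply/rowP => i; rewrite !mxE Hy; congr ((tagged (d i)).2 _); apply/rowP => l.
by rewrite !mxE /g' enum_rankK.
Qed.

End Generated.

(** Each generator depends on one factor only; the two families get the same length by padding with
    zero functions. The alternative [a i = 0] is stated apart because constants are not known to be
    smooth on a bare [smoothSpace]. *)
Lemma prod_repr (M N : smoothSpace R) (h : prodS M N -> R) (p : prodS M N) : Cinf (prodS M N) h ->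
  exists k (a : 'I_k -> M -> R) (b : 'I_k -> N -> R) (F : 'rV[R]_(k + k) -> R),
  [/\ forall i, Cinf M (a i) \/ a i = fun=> 0, forall i, Cinf N (b i) \/ b i = fun=> 0, smooth_on setT F &
    \forall y \near p, h y = F (row_mx (xv a y.1) (xv b y.2))].
Proof.
move=> /(_ p) [k [g [F [Gg sF hF]]]].
pose isl i := `[< exists2 f, Cinf M f & f \o fst = g i >].
have H i : exists ab : (M -> R) * (N -> R),
   [/\ Cinf M ab.1 \/ ab.1 = fun=> 0, Cinf N ab.2 \/ ab.2 = fun=> 0 &
       forall y, g i y = if isl i then ab.1 y.1 else ab.2 y.2].
  rewrite /isl; case: asboolP => [[f Cf fg]|nl].
    by exists (f, fun=> 0); split; [left|right|move=> y; rewrite -fg].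
  have [//|[f Cf fg]] := Gg i.
  by exists (fun=> 0, f); split; [right|left|move=> y; rewrite -fg].
pose ab i := sval (cid (H i)); have Hab i := svalP (cid (H i)).
exists k, (fun i => (ab i).1), (fun i => (ab i).2),
  (fun y => F (\row_i (if isl i then y 0 (lshift k i) else y 0 (rshift k i)))); split.
- by move=> i; have [] := Hab i.
- by move=> i; have [] := Hab i.
- apply: (smooth_on_comp openT (fun _ _ => Logic.I) _ sF) => i.
  by case: (isl i); exact: smooth_coord.
apply: filterS hF => y ->; congr F; apply/rowP => i; rewrite [LHS]mxE [RHS]mxE.
by have [_ _ ->] := Hab i; case: ifP => _; rewrite ?row_mxEl ?row_mxEr mxE.
Qed.

Section Two.
Context {M N : smoothSpace R} {sM : sspace M} {sN : sspace N}.

Lemma fst_smooth : smooth_map (M := prodS M N) (N := M) fst.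
Proof. by move=> g Cg; apply: gen_in; left; exists g. Qed.

Lemma snd_smooth : smooth_map (M := prodS M N) (N := N) snd.
Proof. by move=> g Cg; apply: gen_in; right; exists g. Qed.

#[global] Instance prodS_sspace : sspace (prodS M N) | 10.
Proof.
have cts f x : Cinf (prodS M N) f -> {for x, continuous f}.
  move=> /(_ x) [k [g [F [Gg sF fF]]]].
  have cg i : {for x, continuous (g i)}.
    have [[f' Cf' <-]|[f' Cf' <-]] := Gg i.
      apply: (@continuous_comp _ _ _ fst f'); [exact: cvg_fst|exact: C_cts].
    apply: (@continuous_comp _ _ _ snd f'); [exact: cvg_snd|exact: C_cts].
  have c : {for x, continuous (fun y => F (\row_i g i y))}.
    apply: (@continuous_comp _ _ _ (fun y => \row_i g i y) F).
      exact: continuous_row.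
    exact: smooth_on_cts sF _.
  rewrite /prop_for /continuous_at (nbhs_singleton fF); apply: cvg_trans c.
  by apply: (@near_eq_cvg _ _ (nbhs x)); apply: filterS fF => y ->.
split=> //; [exact: gen_local|by move=> *; exact: gen_comp|].
move=> [p q] U [[A B] /= [nA nB] AB].
have [a [Ca a1 a0]] := C_bump nA; have [b [Cb b1 b0]] := C_bump nB.
exists (fun y => a y.1 * b y.2); split.
- pose g (i : 'I_2) (y : prodS M N) := if i == 0 then a y.1 else b y.2.
  have := @gen_comp _ _ 2 (fun y => y 0 0 * y 0 1) g _.
  have sF : smooth_on setT (fun y : 'rV[R]_2 => y 0 0 * y 0 1).
    by apply: smooth_mul; [exact: openT|exact: smooth_coord..].
  move=> /(_ _ sF); have := (fst_smooth Ca, snd_smooth Cb); move=> [H1 H2].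
  move=> /(_ ([set f \o fst | f in Cinf M] `|` [set f \o snd | f in Cinf N])) H.
  have Gg i : generated ([set f \o fst | f in Cinf M] `|` [set f \o snd | f in Cinf N]) (g i).
    by rewrite /g; case: (i == 0).
  by move: (H Gg); congr (Cinf (prodS M N) _); apply/funext => y; rewrite !mxE.
- exists ([set y | a y = 1], [set y | b y = 1]) => // -[y z] [/= -> ->]; by rewrite mulr1.
move=> [y z] nU /=; have [Ay|nAy] := pselect (A y); last by rewrite a0 // mul0r.
have [Bz|nBz] := pselect (B z); last by rewrite b0 // mulr0.
by case: nU; apply: (AB (y, z)).
Qed.

Lemma pair_smooth (L : smoothSpace R) {sL : sspace L} (f : L -> M) (g : L -> N) :
  smooth_map f -> smooth_map g -> smooth_map (N := prodS M N) (fun l => (f l, g l)).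
Proof.
move=> sf sg; have cf := @smooth_cts _ _ _ sL sM _ sf; have cg := @smooth_cts _ _ _ sL sN _ sg.
apply: smooth_map_local => h x Ch; have [k [h' [F [Gh sF hF]]]] := Ch (f x, g x).
exists (fun l => F (\row_i h' i (f l, g l))).
  apply: C_comp => // i; have [[a Ca <-]|[a Ca <-]] := Gh i; [exact: (sf _ Ca)|exact: (sg _ Ca)].
have c : (fun l => (f l, g l)) @ x --> (f x, g x) by apply: cvg_pair; [exact: cf|exact: cg].
exact: c _ hF.
Qed.

End Two.

#[global] Instance prodS_nice (M N : smoothSpace R) {nM : nice M} {nN : nice N} : nice (prodS M N) | 10.
Proof.
split; first exact: prodS_sspace.
move=> [p1 p2]; have [n [x [U [r co1]]]] := nice_coords p1.
have [m [z [V [s co2]]]] := nice_coords p2.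
pose w (i : 'I_(n + m)) (y : prodS M N) := match fintype.split i with inl j => x j y.1 | inr j => z j y.2 end.
have wE y : xv w y = row_mx (xv x y.1) (xv z y.2).
  by apply/rowP => i; rewrite !mxE /w; case: (fintype.split i) => j; rewrite mxE.
have [||||||U' [r' [_ co _]]] := @coords_build R (prodS M N) _ (p1, p2) _ w [set y | U y.1 /\ V y.2].
- have -> : [set y : M * N | U y.1 /\ V y.2] = (fst @^-1` U) `&` (snd @^-1` V) by [].
  apply: openI; apply: open_comp => [y _|].
  + exact: cvg_fst. + exact: co_open co1. + exact: cvg_snd. + exact: co_open co2.
- by split; [exact: co_p co1|exact: co_p co2].
- move=> i; rewrite /w; case: (fintype.split i) => j.
    by apply: fst_smooth; exact: co_C co1 j.
  by apply: snd_smooth; exact: co_C co2 j.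
- move=> [q1 q2] [q1' q2'] [/= U1 V1] [/= U2 V2]; rewrite !wE /= => /eq_row_mx [E1 E2].
  by rewrite (co_inj co1 U1 U2 E1) (co_inj co2 V1 V2 E2).
- move=> [q1 q2] W [/= Uq Vq] [[A B] /= [nA nB] AB]; rewrite wE /=.
  have H1 : \forall y \near row_mx (xv x q1) (xv z q2), exists q', [/\ U q', A q' & xv x q' = lsubmx y].
    have := co_opn co1 Uq nA; rewrite -{1}(row_mxKl (xv x q1) (xv z q2)).
    exact: continuous_lsubmx.
  have H2 : \forall y \near row_mx (xv x q1) (xv z q2), exists q', [/\ V q', B q' & xv z q' = rsubmx y].
    have := co_opn co2 Vq nB; rewrite -{1}(row_mxKr (xv x q1) (xv z q2)).
    exact: continuous_rsubmx.
  apply: filterS2 H1 H2 => y [q1' [_ A1 E1]] [q2' [_ B2 E2]].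
  exists (q1', q2'); split; first exact: (AB (q1', q2')).
  by rewrite wE /= E1 E2 hsubmxK.
- move=> f [q1 q2] Cf [/= Uq Vq].
  have [k [a [b [F [Ca Cb sF hF]]]]] := prod_repr (q1, q2) Cf.
  have {}Ca i : Cinf M (a i) by case: (Ca i) => [Cai|->]; [exact: Cai|exact: C_cst].
  have {}Cb i : Cinf N (b i) by case: (Cb i) => [Cbi|->]; [exact: Cbi|exact: C_cst].
  have HA i := co_rep co1 (Ca i) Uq; have HB i := co_rep co2 (Cb i) Vq.
  pose A i := sval (cid2 (HA i)); pose B i := sval (cid2 (HB i)).
  have sA i : smooth_on setT (A i) by rewrite /A; case: cid2.
  have sB i : smooth_on setT (B i) by rewrite /B; case: cid2.
  have aA i : \forall y \near q1, a i y = A i (xv x y) by rewrite /A; case: cid2.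
  have bB i : \forall y \near q2, b i y = B i (xv z y) by rewrite /B; case: cid2.
  pose g (i : 'I_(k + k)) (y : 'rV[R]_(n + m)) :=
    match fintype.split i with inl j => A j (\row_l y 0 (lshift m l)) | inr j => B j (\row_l y 0 (rshift n l)) end.
  exists (fun y => F (\row_i g i y)).
    apply: (smooth_on_comp openT (fun _ _ => Logic.I) _ sF) => i; rewrite /g.
    case: (fintype.split i) => j; [apply: (smooth_on_comp openT (fun _ _ => Logic.I) _ (sA j))|
      apply: (smooth_on_comp openT (fun _ _ => Logic.I) _ (sB j))] => l; exact: smooth_coord.
  have aA' := filter_forall (nbhs_filter q1) aA; have bB' := filter_forall (nbhs_filter q2) bB.
  have H3 : \forall y \near ((q1, q2) : prodS M N), (forall i, a i y.1 = A i (xv x y.1)) /\ (forall i, b i y.2 = B i (xv z y.2)).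
    exists ([set y | forall i, a i y = A i (xv x y)], [set y | forall i, b i y = B i (xv z y)]) => //.
  apply: (@filterS2 _ (nbhs ((q1, q2) : prodS M N)) _ _ _ _ _ hF H3) => y -> [E1 E2]; congr F; apply/rowP => i; rewrite !mxE /g.
  case: (fintype.split i) => j; rewrite mxE.
    by rewrite E1; congr (A j _); apply/rowP => l; rewrite [RHS]mxE wE row_mxEl.
  by rewrite E2; congr (B j _); apply/rowP => l; rewrite [RHS]mxE wE row_mxEr.
by exists _, w, U', r'.
Qed.

End Products.

(** * Tangent vectors and frames *)

Section TangentVectors.
Context {R : realType}.
Implicit Types M N L : smoothSpace R.

Section TvecE.
Context {M : smoothSpace R}.
Implicit Types (v w : tvec M) (f : M -> R).

Lemma tvD v w f : (v + w) f = v f + w f. Proof. by []. Qed.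
Lemma tvZ (a : R) v f : (a *: v) f = a * v f. Proof. by []. Qed.
Lemma tvN v f : (- v) f = - v f. Proof. by []. Qed.
Lemma tv0 f : (0 : tvec M) f = 0. Proof. by []. Qed.

Lemma tv_sum (I : Type) (r : seq I) (P : pred I) (F : I -> tvec M) f :
  (\sum_(i <- r | P i) F i) f = \sum_(i <- r | P i) F i f.
Proof. by elim/big_rec2: _ => // i y1 y2 _ <-. Qed.

Lemma on_smoothE D f : Cinf M f -> on_smooth D f = D f.
Proof. by move=> Cf; rewrite /on_smooth patchE mem_set. Qed.

Lemma on_smooth_out D f : ~ Cinf M f -> on_smooth D f = 0.
Proof. by move=> Cf; rewrite /on_smooth patchE memNset. Qed.

Lemma tan_ext p q v w : tangent p v -> tangent q w -> (forall f, Cinf M f -> v f = w f) -> v = w.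
Proof.
move=> [v0 _ _] [w0 _ _] H; apply/funext => f.
by have [Cf|nCf] := pselect (Cinf M f); [exact: H|rewrite v0 // w0].
Qed.

Lemma tan0 p : tangent p (0 : tvec M).
Proof. by split=> [//|a f g _ _|f g _ _]; rewrite !tv0 ?mulr0 ?mul0r addr0. Qed.

Lemma tan_comb p (a : R) v w : tangent p v -> tangent p w -> tangent p (a *: v + w).
Proof.
move=> [v0 v1 v2] [w0 w1 w2]; split.
- by move=> f nf; rewrite tvD tvZ v0 // w0 // mulr0 addr0.
- by move=> b f g Cf Cg; rewrite !tvD !tvZ v1 // w1 //; ring.
- by move=> f g Cf Cg; rewrite !tvD !tvZ v2 // w2 //; ring.
Qed.

Lemma tanZ p (a : R) v : tangent p v -> tangent p (a *: v).
Proof. by move=> tv; rewrite -[_ *: _]addr0; apply: tan_comb => //; exact: tan0. Qed.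

Lemma tanD p v w : tangent p v -> tangent p w -> tangent p (v + w).
Proof. by move=> tv tw; rewrite -[v]scale1r; exact: tan_comb. Qed.

Lemma tanN p v : tangent p v -> tangent p (- v).
Proof. by rewrite -scaleN1r; exact: tanZ. Qed.

Lemma tanB p v w : tangent p v -> tangent p w -> tangent p (v - w).
Proof. by move=> tv tw; apply: tanD => //; exact: tanN. Qed.

Lemma tan_sum p (I : Type) (r : seq I) (P : pred I) (F : I -> tvec M) :
  (forall i, P i -> tangent p (F i)) -> tangent p (\sum_(i <- r | P i) F i).
Proof. by move=> H; apply: (big_ind (tangent p)) => //; [exact: tan0|exact: tanD]. Qed.

Context {sM : sspace M}.
Variables (p : M) (v : tvec M).
Hypothesis tv : tangent p v.

Lemma tan_lin (a : R) f g : Cinf M f -> Cinf M g -> v (fun x => a * f x + g x) = a * v f + v g.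
Proof. by have [_ + _] := tv; apply. Qed.

Lemma tan_mul f g : Cinf M f -> Cinf M g -> v (fun x => f x * g x) = f p * v g + v f * g p.
Proof. by have [_ _] := tv; apply. Qed.

Lemma tan_cst (c : R) : v (fun=> c) = 0.
Proof.
have C1 := @C_cst R M sM 1; have C0 := @C_cst R M sM 0.
have v1 : v (fun=> 1) = 0.
  have := tan_mul C1 C1; rewrite mulr1 mul1r mulr1 => /eqP.
  by rewrite eq_sym -subr_eq0 addrK => /eqP.
have v0 : v (fun=> 0) = 0 by have := tan_mul C0 C0; rewrite !mulr0 mul0r addr0.
transitivity (c * v (fun=> 1) + v (fun=> 0)); last by rewrite v1 v0 mulr0 addr0.
rewrite -(tan_lin c C1 C0); congr v; by apply/funext => x; rewrite mulr1 addr0.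
Qed.

Lemma tan_add f g : Cinf M f -> Cinf M g -> v (fun x => f x + g x) = v f + v g.
Proof.
move=> Cf Cg; have := tan_lin 1 Cf Cg; rewrite mul1r => <-; congr v.
by apply/funext => x; rewrite mul1r.
Qed.

Lemma tan_scale (c : R) f : Cinf M f -> v (fun x => c * f x) = c * v f.
Proof. by move=> Cf; rewrite tan_mul ?tan_cst ?mul0r ?addr0 //; exact: C_cst. Qed.

Lemma tan_opp f : Cinf M f -> v (fun x => - f x) = - v f.
Proof.
move=> Cf; rewrite -[RHS]mulN1r -tan_scale //; congr v.
by apply/funext => x; rewrite mulN1r.
Qed.

Lemma tan_sub f g : Cinf M f -> Cinf M g -> v (fun x => f x - g x) = v f - v g.
Proof. by move=> Cf Cg; rewrite tan_add ?tan_opp //; exact: C_opp. Qed.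

Lemma tan_sumf (I : Type) (r : seq I) (F : I -> M -> R) :
  (forall i, Cinf M (F i)) -> v (fun x => \sum_(i <- r) F i x) = \sum_(i <- r) v (F i).
Proof.
move=> CF; elim: r => [|i r IH].
  rewrite big_nil; have -> : (fun x => \sum_(i <- [::]) F i x) = fun=> 0 by apply/funext => x; rewrite big_nil.
  exact: tan_cst.
rewrite big_cons -IH -tan_add //; last by apply: C_sum.
by congr v; apply/funext => x; rewrite big_cons.
Qed.

(** Locality of derivations: with a bump b supported where f = g, one has f - g = (1 - b)(f - g), a
    product of two functions vanishing at p. *)
Lemma tan_near f g : Cinf M f -> Cinf M g -> (\forall y \near p, f y = g y) -> v f = v g.
Proof.
move=> Cf Cg fg; have [b [Cb b1 b0]] := C_bump fg.
have Cfg : Cinf M (fun x => f x - g x) by exact: C_sub.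
have bp : b p = 1 by exact: nbhs_singleton b1.
apply/eqP; rewrite -subr_eq0 -tan_sub //; apply/eqP.
have -> : (fun x => f x - g x) = fun x => (1 - b x) * (f x - g x).
  apply/funext => x; have [->|nE] := pselect (f x = g x); first by rewrite subrr mulr0.
  by rewrite b0 // subr0 mul1r.
have C1b : Cinf M (fun x => 1 - b x) by apply: C_sub => //; exact: C_cst.
by rewrite tan_mul // bp (nbhs_singleton fg) !subrr mul0r mulr0 addr0.
Qed.

(** Hadamard's lemma writes F as its value at the base point plus a sum of products with one factor
    vanishing there, to which the Leibniz rule applies. *)
Lemma tan_chain k (F : 'rV[R]_k -> R) (g : 'I_k -> M -> R) : smooth_on setT F ->
  (forall i, Cinf M (g i)) ->
  v (fun x => F (\row_i g i x)) = \sum_i pd i F (\row_i g i p) * v (g i).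
Proof.
move=> sF Cg; have [G [sG FG GF]] := hadamard (\row_i g i p) sF.
have CG i : Cinf M (fun x => G i (\row_j g j x)) by exact: C_comp.
have Cgi i : Cinf M (fun x => g i x - g i p) by apply: C_sub => //; exact: C_cst.
have -> : (fun x => F (\row_i g i x)) = fun x => F (\row_i g i p) +
    \sum_i (g i x - g i p) * G i (\row_j g j x).
  apply/funext => x; rewrite FG; congr (_ + _); apply: eq_bigr => i _.
  by rewrite !mxE.
rewrite tan_add; [|exact: C_cst|by apply: C_sum => i _; exact: C_mul].
rewrite tan_cst add0r tan_sumf; last by move=> i; exact: C_mul.
apply: eq_bigr => i _; rewrite tan_mul // subrr mul0r add0r GF tan_sub ?tan_cst ?subr0 1?mulrC //.
exact: C_cst.
Qed.

End TvecE.

Section TmapE.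
Context {M N : smoothSpace R}.
Variable f : M -> N.

Lemma TmapE v g : Cinf N g -> Tmap f v g = v (g \o f).
Proof. by move=> Cg; rewrite /Tmap on_smoothE. Qed.

Lemma Tmap_comb (a : R) v w : Tmap f (a *: v + w) = a *: Tmap f v + Tmap f w.
Proof.
apply/funext => g; rewrite tvD tvZ.
have [Cg|nC] := pselect (Cinf N g); first by rewrite !TmapE.
by rewrite /Tmap !on_smooth_out // mulr0 addr0.
Qed.

Lemma Tmap0 : Tmap f 0 = 0.
Proof.
apply/funext => g; have [Cg|nC] := pselect (Cinf N g); first by rewrite TmapE.
by rewrite /Tmap on_smooth_out.
Qed.

Lemma TmapZ (a : R) v : Tmap f (a *: v) = a *: Tmap f v.
Proof. by rewrite -[_ *: v]addr0 Tmap_comb Tmap0 addr0. Qed.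

Lemma TmapD v w : Tmap f (v + w) = Tmap f v + Tmap f w.
Proof. by rewrite -{1}[v]scale1r Tmap_comb scale1r. Qed.

Lemma TmapN v : Tmap f (- v) = - Tmap f v.
Proof. by rewrite -[- v]scaleN1r TmapZ scaleN1r. Qed.

Lemma TmapB v w : Tmap f (v - w) = Tmap f v - Tmap f w.
Proof. by rewrite TmapD TmapN. Qed.

Lemma Tmap_sum (I : Type) (r : seq I) (P : pred I) (F : I -> tvec M) :
  Tmap f (\sum_(i <- r | P i) F i) = \sum_(i <- r | P i) Tmap f (F i).
Proof. by elim/big_rec2: _ => [|i y1 y2 _ <-]; [exact: Tmap0|exact: TmapD]. Qed.

Lemma Tmap_tan {sN : sspace N} p v : smooth_map f -> tangent p v -> tangent (f p) (Tmap f v).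
Proof.
move=> sf [_ v1 v2]; split.
- by move=> g ng; rewrite /Tmap on_smooth_out.
- move=> a g h Cg Ch; rewrite !TmapE //; first exact: v1 (sf _ Cg) (sf _ Ch).
  by apply: C_add => //; exact: C_scale.
- move=> g h Cg Ch; rewrite !TmapE //; first exact: v2 (sf _ Cg) (sf _ Ch).
  exact: C_mul.
Qed.

End TmapE.

Lemma Tmap_comp M N L (f : M -> N) (g : N -> L) v : smooth_map g ->
  Tmap g (Tmap f v) = Tmap (g \o f) v.
Proof.
move=> sg; apply/funext => h; have [Ch|nC] := pselect (Cinf L h).
  by rewrite !TmapE //; exact: sg.
by rewrite /Tmap !on_smooth_out.
Qed.

Lemma Tmap_id M p (v : tvec M) : tangent p v -> Tmap id v = v.
Proof.
move=> [v0 _ _]; apply/funext => h; have [Ch|nC] := pselect (Cinf M h).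
  by rewrite TmapE.
by rewrite /Tmap on_smooth_out // v0.
Qed.

Lemma Tmap_cst M N {sM : sspace M} (c : N) p (v : tvec M) : tangent p v -> Tmap (fun=> c) v = 0.
Proof.
move=> tv; apply/funext => h; have [Ch|nC] := pselect (Cinf N h).
  by rewrite TmapE //; exact: (tan_cst tv).
by rewrite /Tmap on_smooth_out.
Qed.

Lemma tan_prod_ext M N {sM : sspace M} {sN : sspace N} (p : prodS M N) v w :
  tangent p v -> tangent p w ->
  Tmap (M := prodS M N) (N := M) fst v = Tmap (M := prodS M N) (N := M) fst w -> Tmap (M := prodS M N) (N := N) snd v = Tmap (M := prodS M N) (N := N) snd w -> v = w.
Proof.
move=> tv tw E1 E2; apply: (tan_ext tv tw) => h Ch.
have [k [g [F [Gg sF hF]]]] := Ch p.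
have Cg i : Cinf (prodS M N) (g i) by apply: gen_in; exact: Gg.
have CF : Cinf (prodS M N) (fun y => F (\row_i g i y)) by exact: C_comp.
rewrite (tan_near tv Ch CF hF) (tan_near tw Ch CF hF) (tan_chain tv sF Cg) (tan_chain tw sF Cg).
apply: eq_bigr => i _; congr (_ * _).
have [[f Cf <-]|[f Cf <-]] := Gg i; first by rewrite -!(TmapE (M := prodS M N) (N := M) fst) // E1.
by rewrite -!(TmapE (M := prodS M N) (N := N) snd) // E2.
Qed.

Lemma tan_sub_ext M {sM : sspace M} (A : set M) (p : subS A) v w :
  tangent p v -> tangent p w ->
  Tmap (M := subS A) (N := M) set_val v = Tmap (M := subS A) (N := M) set_val w -> v = w.
Proof.
move=> tv tw E; apply: (tan_ext tv tw) => h Ch; have [F CF hF] := Ch p.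
have CF' : Cinf (subS A) (F \o set_val) by exact: val_smooth.
by rewrite (tan_near tv Ch CF' hF) (tan_near tw Ch CF' hF) -!(TmapE (M := subS A) set_val) // E.
Qed.

End TangentVectors.

(** * Vector fields, brackets and coordinate frames *)

Section Frames.
Context {R : realType}.

Section Local.
Context {M : smoothSpace R} {sM : sspace M}.
Implicit Types (p q : M) (f : M -> R).

Lemma C_compv k (F : 'rV[R]_k -> R) (g : M -> 'rV[R]_k) : smooth_on setT F ->
  (forall i, Cinf M (fun x => g x 0 i)) -> Cinf M (fun x => F (g x)).
Proof.
move=> sF Cg; have -> : (fun x => F (g x)) = fun x => F (\row_i g x 0 i).
  by apply/funext => x; congr F; apply/rowP => i; rewrite mxE.
exact: C_comp.
Qed.

Lemma C_neq0_near p f : Cinf M f -> f p != 0 -> \forall y \near p, f y != 0.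
Proof.
move=> Cf fp; have cf : {for p, continuous f} by exact: C_cts.
have fp0 : 0 < `|f p| by rewrite normr_gt0.
have : \forall y \near p, `|f p - f y| < `|f p| by move/cvgr_dist_lt: cf; apply.
by apply: filterS => y; apply: contraTneq => ->; rewrite subr0 ltxx.
Qed.

(** The composite step(2 b - 1) vanishes where b < 1/2, which is a neighbourhood of every point
    outside [U]. Multiplied by such a bump, an object that is smooth on [U] only extends by zero. *)
Lemma bump_near p (U : set M) : nbhs p U -> exists b, [/\ Cinf M b,
  \forall y \near p, b y = 1 & forall y, ~ U y -> \forall z \near y, b z = 0].
Proof.
move=> nU; have [b [Cb b1 b0]] := C_bump nU.
have Cs : Cinf M (fun x => step (2 * b x - 1)).
  have sF : smooth_on setT (fun y : 'rV[R]_1 => step (2 * y 0 0 - 1)).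
    apply: step_smooth; first exact: openT.
    apply: smooth_add; [exact: openT| |exact: smooth_cst].
    by apply: smooth_mul; [exact: openT|exact: smooth_cst|exact: smooth_coord].
  have -> : (fun x => step (2 * b x - 1)) =
      (fun x => (fun y : 'rV[R]_1 => step (2 * y 0 0 - 1)) (\row_(i < 1) b x)).
    by apply/funext => x; rewrite mxE.
  exact: (C_comp (g := fun=> b) sF (fun=> Cb)).
exists (fun x => step (2 * b x - 1)); split=> // [|y nUy].
  by apply: filterS b1 => y ->; rewrite step1 //; lra.
have c : {for y, continuous b} by exact: C_cts.
have : \forall z \near y, b z < 1 / 2.
  by apply: (@cvgr_lt _ _ (nbhs y) _ _ _ c); rewrite b0 // divr_gt0.
by apply: filterS => z bz; rewrite step0 //; lra.
Qed.

Lemma C_inv_near p f : Cinf M f -> f p != 0 ->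
  exists2 g, Cinf M g & \forall y \near p, f y * g y = 1.
Proof.
move=> Cf fp; have cf : {for p, continuous f} by exact: C_cts.
have [b [Cb b1 b0]] := bump_near (p := p) (C_neq0_near Cf fp).
pose h y := b y * (f y)^-1.
exists h; last first.
  have := C_neq0_near Cf fp.
  by apply: filterS2 b1 => y b1' f0; rewrite /h b1' mul1r divff.
apply: C_local => q; have [Uq|nUq] := pselect (f q != 0); last first.
  exists (fun=> 0); first exact: C_cst.
  by apply: filterS (b0 q nUq) => y b0'; rewrite /h b0' mul0r.
have cq : {for q, continuous f} by exact: C_cts.
have [G sG GE] : exists2 G : 'rV[R]_1 -> R, smooth_on setT G & forall y : 'rV[R]_1,
    `|y - const_mx (f q)| <= `|f q| / 4 -> G y = (y 0 0)^-1.
  apply: (@smooth_extend R 1 [set y : 'rV[R]_1 | y 0 0 != 0] (fun y => (y 0 0)^-1)).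
  - have : open ((fun y : 'rV[R]_1 => y 0 0) @^-1` [set x : R | x != 0]).
      by apply: open_comp => [y _|]; [exact: coord_continuous|exact: open_neq].
    by [].
  - by rewrite divr_gt0 // normr_gt0.
  - move=> y yq; apply/eqP => y0.
    have : `|(y - const_mx (f q)) 0 0| <= 2 * (`|f q| / 4) by apply: (mx_norm_leP _ _ yq).
    rewrite !mxE y0 sub0r normrN; apply/negP; rewrite -ltNge.
    by have : 0 < `|f q| by [rewrite normr_gt0]; lra.
  - apply: smooth_inv => [|y //|]; last exact: smooth_coord.
    have : open ((fun y : 'rV[R]_1 => y 0 0) @^-1` [set x : R | x != 0]).
      by apply: open_comp => [y _|]; [exact: coord_continuous|exact: open_neq].
    by [].
exists (fun y => b y * G (\row_(i < 1) f y)); first by apply: C_mul => //; exact: C_comp.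
have : \forall y \near q, `|f q - f y| < `|f q| / 4.
  by move/cvgr_dist_lt: cq; apply; rewrite divr_gt0 // normr_gt0.
apply: filterS => y fy; rewrite /h GE ?mxE //; apply/mx_norm_leP => [|i].
  by rewrite divr_ge0.
by rewrite !mxE distrC ltW.
Qed.

Lemma vf_tan (X : M -> tvec M) p : vfield X -> tangent p (X p).
Proof. by case. Qed.

Lemma vf_C (X : M -> tvec M) f : vfield X -> Cinf M f -> Cinf M (fun q => X q f).
Proof. by case=> _; apply. Qed.

Lemma vf0 : vfield (fun _ : M => (0 : tvec M)).
Proof. by split=> [p|f Cf]; [exact: tan0|exact: C_cst]. Qed.

Lemma vf_scale (a : M -> R) (X : M -> tvec M) : Cinf M a -> vfield X -> vfield (fun q => a q *: X q).
Proof.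
move=> Ca vX; split=> [p|f Cf]; first by apply: tanZ; exact: vf_tan.
by apply: C_mul => //; exact: vf_C.
Qed.

Lemma vf_sum (I : Type) (r : seq I) (P : pred I) (X : I -> M -> tvec M) :
  (forall i, P i -> vfield (X i)) -> vfield (fun q => \sum_(i <- r | P i) X i q).
Proof.
move=> vX; split=> [p|f Cf]; first by apply: tan_sum => i Pi; exact: vf_tan (vX i Pi).
have -> : (fun q => (\sum_(i <- r | P i) X i q) f) = fun q => \sum_(i <- r | P i) X i q f.
  by apply/funext => q; rewrite tv_sum.
by apply: C_sum => i Pi; exact: vf_C (vX i Pi) Cf.
Qed.

Lemma bracketE (X Y : M -> tvec M) p f : Cinf M f ->
  bracket X Y p f = X p (fun q => Y q f) - Y p (fun q => X q f).
Proof. by move=> Cf; rewrite /bracket on_smoothE. Qed.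

Lemma vf_bracket (X Y : M -> tvec M) : vfield X -> vfield Y -> vfield (bracket X Y).
Proof.
move=> vX vY; split=> [p|f Cf]; last first.
  have -> : (fun p => bracket X Y p f) = fun p => X p (fun q => Y q f) - Y p (fun q => X q f).
    by apply/funext => p; rewrite bracketE.
  by apply: C_sub; apply: vf_C => //; exact: vf_C.
have tX := vf_tan p vX; have tY := vf_tan p vY.
split.
- by move=> f nC; rewrite /bracket on_smooth_out.
- move=> a f g Cf Cg; have Cfg : Cinf M (fun x => a * f x + g x).
    by apply: C_add => //; exact: C_scale.
  have lin (Z : M -> tvec M) : vfield Z ->
      (fun q => Z q (fun x => a * f x + g x)) = fun q => a * Z q f + Z q g.
    by move=> vZ; apply/funext => q; rewrite (tan_lin (vf_tan q vZ)).
  rewrite !bracketE // !lin // (tan_lin tX) ?(tan_lin tY); try exact: vf_C.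
  by ring.
- move=> f g Cf Cg; have Cfg : Cinf M (fun x => f x * g x) by exact: C_mul.
  have lin (Z : M -> tvec M) : vfield Z ->
      (fun q => Z q (fun x => f x * g x)) = fun q => f q * Z q g + Z q f * g q.
    by move=> vZ; apply/funext => q; rewrite (tan_mul (vf_tan q vZ)).
  rewrite !bracketE // !lin //.
  have C1 := vf_C vX Cf; have C2 := vf_C vX Cg; have C3 := vf_C vY Cf; have C4 := vf_C vY Cg.
  rewrite (tan_add tX) ?(tan_add tY) ?(tan_mul tX) ?(tan_mul tY) //; try exact: C_mul.
  by ring.
Qed.

Lemma bracket_tan (X Y : M -> tvec M) p : vfield X -> vfield Y -> tangent p (bracket X Y p).
Proof. by move=> vX vY; exact: vf_tan (vf_bracket vX vY). Qed.

End Local.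

Section Related.
Context {M N : smoothSpace R} {sM : sspace M} {sN : sspace N}.

Lemma bracket_related (f : M -> N) (X Y : M -> tvec M) (X' Y' : N -> tvec N) p :
  smooth_map f -> vfield X' -> vfield Y' ->
  (forall q, Tmap f (X q) = X' (f q)) -> (forall q, Tmap f (Y q) = Y' (f q)) ->
  Tmap f (bracket X Y p) = bracket X' Y' (f p).
Proof.
move=> sf vX' vY' fX fY; apply/funext => h.
have [Ch|nC] := pselect (Cinf N h); last by rewrite /Tmap /bracket !on_smooth_out.
rewrite TmapE // !bracketE //; last exact: sf.
have rel (Z : M -> tvec M) (Z' : N -> tvec N) g : (forall q, Tmap f (Z q) = Z' (f q)) -> Cinf N g ->
    (fun q => Z q (g \o f)) = (fun y => Z' y g) \o f.
  by move=> fZ Cg; apply/funext => q /=; rewrite -fZ TmapE.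
rewrite (rel Y Y') // (rel X X') //.
by rewrite -(TmapE f (X p)) ?fX -?(TmapE f (Y p)) ?fY //; exact: vf_C.
Qed.

End Related.

Section CoordVectors.
Context {M : smoothSpace R} {sM : sspace M} (p : M) (n : nat) (x : 'I_n -> M -> R) (U : set M) (r : R).
Hypothesis co : coords p x U r.

(** The coordinate vector d/dx_i at q, computed from an arbitrary local expression of f; any two
    such expressions agree near [xv x q] by [co_opn], see [dcoE]. *)
Definition dco (q : M) (i : 'I_n) : tvec M := on_smooth (fun f =>
  pd i (xget (fun=> 0) [set F | smooth_on setT F /\ \forall y \near q, f y = F (xv x y)]) (xv x q)).

Lemma dcoE q i f F : U q -> smooth_on setT F -> Cinf M f ->
  (\forall y \near q, f y = F (xv x y)) -> dco q i f = pd i F (xv x q).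
Proof.
move=> Uq sF Cf fF; rewrite /dco on_smoothE //.
set G := xget _ _.
have [sG fG] : smooth_on setT G /\ \forall y \near q, f y = G (xv x y).
  by rewrite /G; case: xgetP => [G' _ //|/(_ F)[]//].
have nW : nbhs q [set y | G (xv x y) = F (xv x y)] by apply: filterS2 fF fG => y /= fy gy; rewrite -fy -gy.
have E : \forall y \near xv x q, G y = F y.
  by have := co_opn co Uq nW; apply: filterS => y [q' [_ W <-]].
have [_ dE] := near_eq_differentiable E (smooth_on_diff sG I).
have dG : differentiable G (xv x q) by exact: smooth_on_diff sG I.
have dF : differentiable F (xv x q) by exact: smooth_on_diff sF I.
by rewrite /pd (deriveE _ dG) (deriveE _ dF) dE.
Qed.

Lemma dco_x q i j : U q -> dco q i (x j) = (j == i)%:R.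
Proof.
move=> Uq; rewrite (@dcoE _ _ _ (fun y => y 0 j)) //; first exact: pd_coord.
- exact: smooth_coord.
- exact: co_C co _.
- by near=> y; rewrite mxE.
Unshelve. all: by end_near. Qed.

Lemma dco_tan q i : U q -> tangent q (dco q i).
Proof.
move=> Uq; split=> [f nC|a f g Cf Cg|f g Cf Cg]; first by rewrite /dco on_smooth_out.
- have [F sF fF] := co_rep co Cf Uq; have [G sG gG] := co_rep co Cg Uq.
  have dF : differentiable F (xv x q) by exact: smooth_on_diff sF I.
  have dG : differentiable G (xv x q) by exact: smooth_on_diff sG I.
  rewrite (dcoE i Uq sF Cf fF) (dcoE i Uq sG Cg gG) (@dcoE _ _ _ (fun y => a * F y + G y)) //.
  + rewrite /pd deriveD; [|exact: derivableZ (diff_derivable dF)|exact: diff_derivable].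
    by rewrite deriveZ //; exact: diff_derivable.
  + apply: smooth_add => //; first exact: openT.
    by apply: smooth_mul => //; [exact: openT|exact: smooth_cst].
  + by apply: C_add => //; exact: C_scale.
  + by apply: filterS2 fF gG => y -> ->.
- have [F sF fF] := co_rep co Cf Uq; have [G sG gG] := co_rep co Cg Uq.
  have dF : differentiable F (xv x q) by exact: smooth_on_diff sF I.
  have dG : differentiable G (xv x q) by exact: smooth_on_diff sG I.
  rewrite (dcoE i Uq sF Cf fF) (dcoE i Uq sG Cg gG) (@dcoE _ _ _ (fun y => F y * G y)) //.
  + rewrite /pd deriveM; [|exact: diff_derivable..].
    rewrite /GRing.scale /= (nbhs_singleton fF) (nbhs_singleton gG); ring.
  + by apply: smooth_mul => //; exact: openT.
  + exact: C_mul.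
  + by apply: filterS2 fF gG => y -> ->.
Qed.

Lemma dco_span q v : U q -> tangent q v -> v = \sum_i v (x i) *: dco q i.
Proof.
move=> Uq tv; apply: (tan_ext tv).
  by apply: tan_sum => i _; apply: tanZ; exact: dco_tan.
move=> f Cf; have [F sF fF] := co_rep co Cf Uq.
have CF : Cinf M (fun y => F (xv x y)) by apply: C_comp => // i; exact: co_C co i.
rewrite (tan_near tv Cf CF fF) (tan_chain tv sF); last exact: co_C co.
rewrite tv_sum; apply: eq_bigr => i _; rewrite tvZ (dcoE i Uq sF Cf fF) mulrC //.
Qed.

Lemma dco_C q i f : U q -> Cinf M f -> exists2 g, Cinf M g & \forall y \near q, dco y i f = g y.
Proof.
move=> Uq Cf; have [F sF fF] := co_rep co Cf Uq.
exists (fun y => pd i F (xv x y)).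
  by apply: C_comp => [|j]; [exact: smooth_on_pd|exact: co_C co j].
have nU : nbhs q U by apply: open_nbhs_nbhs; split=> //; exact: co_open co.
have := nbhs_interior fF; apply: filterS2 nU => y Uy fFy.
exact: dcoE.
Qed.

End CoordVectors.

(** The [E i] are global vector fields that coincide with the coordinate fields on [U]. Being
    global, they can be inserted into brackets and Koszul's formula; on [U] they commute, see
    [frame_bracket]. *)
Record frame (M : smoothSpace R) (p : M) n (x : 'I_n -> M -> R) (E : 'I_n -> M -> tvec M)
    (U : set M) (r : R) : Prop := Frame {
  fr_co : coords p x U r;
  fr_vf : forall i, vfield (E i);
  fr_x : forall q i j, U q -> E i q (x j) = (j == i)%:R }.

Section FrameTheory.
Context {M : smoothSpace R} {sM : sspace M}.

Lemma frame_of_coords (p : M) n (x : 'I_n -> M -> R) U r (W : set M) : coords p x U r -> nbhs p W ->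
  exists E U' r', [/\ frame p x E U' r', U' `<=` U & U' `<=` W].
Proof.
move=> co nW; have nU : nbhs p U by apply: open_nbhs_nbhs; split; [exact: co_open co|exact: co_p co].
have [b [Cb b1 b0]] := bump_near nU.
have [U' [r' [UW [UU co']]]] := coords_sub co (filterI b1 nW).
exists (fun i q => b q *: dco x q i), U', r'; split=> //; last by move=> q /UW[].
split=> //.
  move=> i; split=> [q|f Cf].
    have [Uq|nUq] := pselect (U q); first by apply: tanZ; exact: (dco_tan co).
    by rewrite (nbhs_singleton (b0 q nUq)) scale0r; exact: tan0.
  apply: C_local => q; have [Uq|nUq] := pselect (U q).
    have [g Cg gE] := dco_C co i Uq Cf; exists (fun y => b y * g y); first exact: C_mul.
    by apply: filterS gE => y; rewrite tvZ => ->.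
  exists (fun=> 0); first exact: C_cst.
  by apply: filterS (b0 q nUq) => y; rewrite tvZ => ->; rewrite mul0r.
move=> q i j U'q; rewrite tvZ (dco_x co); last exact: UU.
by have [-> _] := UW q U'q; rewrite mul1r.
Qed.

Context (p : M) (n : nat) (x : 'I_n -> M -> R) (E : 'I_n -> M -> tvec M) {U : set M} {r : R}.
Hypothesis fr : frame p x E U r.

Lemma frame_span q v : U q -> tangent q v -> v = \sum_i v (x i) *: E i q.
Proof.
move=> Uq tv; have co := fr_co fr; rewrite {1}(dco_span co Uq tv).
apply: eq_bigr => i _; congr (_ *: _).
rewrite [RHS](dco_span co Uq (vf_tan q (fr_vf fr i))) (bigD1 i) //= (fr_x fr) // eqxx scale1r.
rewrite big1 ?addr0 // => j /negPf ji; rewrite (fr_x fr) // ji scale0r //.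
Qed.

Lemma frame_tan_ext q v w : U q -> tangent q v -> tangent q w -> (forall i, v (x i) = w (x i)) -> v = w.
Proof.
move=> Uq tv tw H; rewrite (frame_span Uq tv) (frame_span Uq tw).
by apply: eq_bigr => i _; rewrite H.
Qed.

Lemma frame_nbhs q : U q -> nbhs q U.
Proof. by move=> Uq; apply: open_nbhs_nbhs; split=> //; exact: co_open (fr_co fr). Qed.

Lemma frame_bracket q i j : U q -> bracket (E i) (E j) q = 0.
Proof.
move=> Uq; apply: (frame_tan_ext Uq); [apply: bracket_tan; exact: fr_vf fr _|exact: tan0|].
move=> k; rewrite bracketE ?tv0; last exact: co_C (fr_co fr) k.
have Z i' j' : E i' q (fun q => E j' q (x k)) = 0.
  have t := vf_tan q (fr_vf fr i'); rewrite -(tan_cst t (k == j')%:R).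
  apply: (tan_near t); [|exact: C_cst|].
    by apply: vf_C; [exact: fr_vf fr j'|exact: co_C (fr_co fr) k].
  by apply: filterS (frame_nbhs Uq) => y Uy; rewrite (fr_x fr).
by rewrite !Z subrr.
Qed.

End FrameTheory.

Lemma frame_exists (M : smoothSpace R) {nM : nice M} (p : M) (W : set M) : nbhs p W ->
  exists n (x : 'I_n -> M -> R) E U r, frame p x E U r /\ U `<=` W.
Proof.
move=> nW; have [n [x [U [r co]]]] := nice_coords p.
have [E [U' [r' [fr _ UW]]]] := frame_of_coords co nW.
by exists n, x, E, U', r'.
Qed.

Lemma tan_extend (M : smoothSpace R) {nM : nice M} (p : M) v : tangent p v ->
  exists X : M -> tvec M, vfield X /\ X p = v.
Proof.
move=> tv; have [n [x [E [U [r [fr _]]]]]] := frame_exists (@filter_nbhsT _ (nbhs p) _).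
exists (fun q => \sum_i v (x i) *: E i q); split.
  apply: vf_sum => i _; apply: (vf_scale (a := fun=> v (x i))); [exact: C_cst|exact: fr_vf fr i].
by rewrite -(frame_span fr) //; exact: co_p (fr_co fr).
Qed.

(** A partial derivative along a vector that depends on the parameter is smooth: in a local
    expression of h as a function of a's on L and b's on M, the chain rule differentiates the a's
    only. Right-invariant fields owe their smoothness to this. *)
Lemma prod_deriv_C (L M : smoothSpace R) {sL : sspace L} {sM : sspace M}
    (pi : M -> L) (xi : M -> tvec L) (h : prodS L M -> R) : smooth_map pi ->
  (forall y, tangent (pi y) (xi y)) -> (forall f, Cinf L f -> Cinf M (fun y => xi y f)) ->
  Cinf (prodS L M) h -> Cinf M (fun y => xi y (fun l => h (l, y))).
Proof.
move=> spi txi Cxi Ch; apply: C_local => y0.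
have [k [a [b [F [Ca Cb sF hF]]]]] := prod_repr (pi y0, y0) Ch.
have Ca' i : Cinf L (a i) by have [//|->] := Ca i; exact: C_cst.
have Cb' i : Cinf M (b i) by have [//|->] := Cb i; exact: C_cst.
have Cab y i : Cinf L (fun l => row_mx (xv a l) (xv b y) 0 i).
  have -> : (fun l => row_mx (xv a l) (xv b y) 0 i) =
      match fintype.split i with inl j => a j | inr j => fun=> b j y end.
    by apply/funext => l; rewrite mxE; case: (fintype.split i) => j; rewrite mxE.
  by case: (fintype.split i) => j; [exact: Ca'|exact: C_cst].
have Cab2 i : Cinf M (fun y => row_mx (xv a (pi y)) (xv b y) 0 i).
  have -> : (fun y => row_mx (xv a (pi y)) (xv b y) 0 i) =
      match fintype.split i with inl j => a j \o pi | inr j => b j end.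
    by apply/funext => l; rewrite mxE; case: (fintype.split i) => j; rewrite mxE.
  by case: (fintype.split i) => j; [exact: spi|exact: Cb'].
exists (fun y => \sum_i pd (lshift k i) F (row_mx (xv a (pi y)) (xv b y)) * xi y (a i)).
  apply: C_sum => i _; apply: C_mul; last exact: Cxi.
  exact: (C_compv (smooth_on_pd (lshift k i) sF)).
have cpi := @smooth_cts _ _ _ sM sL _ spi.
have [AB [nA nB] ABh] := hF.
have H : \forall y \near y0, nbhs (pi y) AB.1 := cpi y0 _ (nbhs_interior nA).
apply: filterS2 H nB => y nAy By.
have -> : xi y (fun l => h (l, y)) = xi y (fun l => F (row_mx (xv a l) (xv b y))).
  have CF : Cinf L (fun l => F (row_mx (xv a l) (xv b y))).
    exact: (C_compv sF).
  apply: (tan_near (txi y)) => //.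
    have := pair_smooth (@smooth_id _ L) (smooth_cstmap (M := L) y sL); exact.
  by apply: filterS nAy => l Al; apply: (ABh (l, y)).
have -> : (fun l => F (row_mx (xv a l) (xv b y))) = (fun l => F (\row_i row_mx (xv a l) (xv b y) 0 i)).
  by apply/funext => l; congr F; apply/rowP => j; rewrite [RHS]mxE.
rewrite (tan_chain (txi y) sF (Cab y)) big_split_ord /= [X in _ + X]big1 ?addr0.
  apply: eq_bigr => i _; congr (_ * _).
    by congr (pd _ F _); apply/rowP => j; rewrite [LHS]mxE.
  by congr (xi y); apply/funext => l; rewrite row_mxEl mxE.
move=> i _.
have -> : (fun l => row_mx (xv a l) (xv b y) 0 (rshift k i)) = fun=> b i y.
  by apply/funext => l; rewrite row_mxEr mxE.
by rewrite (tan_cst (txi y)) mulr0.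
Qed.

End Frames.

(** * Differential forms *)

Section VC.
Context {T : Type}.

(** Prepends a vector. The body is that of the argument in [iprod], so that the two are
    convertible. *)
Definition vc k (u : T) (v : 'I_k -> T) : 'I_k.+1 -> T :=
  fun l => if unlift ord0 l is Some j then v j else u.

Lemma vc0 k (u : T) (v : 'I_k -> T) : vc u v ord0 = u.
Proof. by rewrite /vc unlift_none. Qed.

Lemma vcS k (u : T) (v : 'I_k -> T) j : vc u v (lift ord0 j) = v j.
Proof. by rewrite /vc liftK. Qed.

Lemma vcE k (v : 'I_k.+1 -> T) : vc (v ord0) (fun j => v (lift ord0 j)) = v.
Proof. by apply/funext => l; case: (unliftP ord0 l) => [j|] ->; rewrite ?vc0 ?vcS. Qed.

Lemma vcP k (P : T -> Prop) (u : T) (v : 'I_k -> T) : P u -> (forall j, P (v j)) -> forall l, P (vc u v l).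
Proof. by move=> Pu Pv l; case: (unliftP ord0 l) => [j|] ->; rewrite ?vc0 ?vcS. Qed.

End VC.

Lemma vc_map k (T T' : Type) (f : T -> T') (u : T) (v : 'I_k -> T) :
  (fun l => f (vc u v l)) = vc (f u) (fun j => f (v j)).
Proof. by apply/funext => l; rewrite /vc; case: unlift. Qed.

Section DForms.
Context {R : realType}.

(** The value of db_1 /\ ... /\ db_k, normalized without factorials in accordance with [koszul]. *)
Definition dwedge (M : smoothSpace R) k (b : 'I_k -> M -> R) (v : 'I_k -> tvec M) : R :=
  \det (\matrix_(i, j) v i (b j)).

Section Koszul.
Context {M : smoothSpace R} {sM : sspace M}.

Lemma tan_prodf p (v : tvec M) k (f : 'I_k -> M -> R) : tangent p v -> (forall i, Cinf M (f i)) ->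
  v (fun q => \prod_i f i q) = \sum_l \prod_i (if i == l then v (f i) else f i p).
Proof.
move=> tv; elim: k f => [|k IH] f Cf.
  rewrite big_ord0; have -> : (fun q => \prod_(i < 0) f i q) = fun=> 1.
    by apply/funext => q; rewrite big_ord0.
  exact: tan_cst tv _.
have -> : (fun q => \prod_i f i q) = fun q => f ord0 q * \prod_(i < k) f (lift ord0 i) q.
  by apply/funext => q; rewrite big_ord_recl.
rewrite (tan_mul tv) //; last by apply: C_prod.
rewrite IH // big_ord_recl addrC; congr (_ + _).
  by rewrite big_ord_recl eqxx; congr (_ * _); apply: eq_bigr.
rewrite mulr_sumr; apply: eq_bigr => l _; by rewrite big_ord_recl /=.
Qed.

Lemma tan_det p (v : tvec M) k (A : M -> 'M[R]_k) : tangent p v ->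
  (forall i j, Cinf M (fun q => A q i j)) ->
  v (fun q => \det (A q)) = \sum_l \det (\matrix_(i, j) if i == l then v (fun q => A q i j) else A p i j).
Proof.
move=> tv CA; rewrite /determinant (tan_sumf tv); last first.
  by move=> s; apply: C_scale; apply: C_prod.
rewrite exchange_big /=; apply: eq_bigr => s _; rewrite (tan_scale tv); last exact: C_prod.
rewrite (tan_prodf tv) // mulr_sumr; apply: eq_bigr => l _; congr (_ * _).
by apply: eq_bigr => i _; rewrite mxE.
Qed.

Lemma dwedge_vc k (a : M -> R) (b : 'I_k -> M -> R) (v : 'I_k.+1 -> tvec M) :
  dwedge (vc a b) v = \sum_(i < k.+1) (-1) ^+ i * v i a * dwedge b (fun l => v (lift i l)).
Proof.
rewrite /dwedge (expand_det_col _ ord0); apply: eq_bigr => i _.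
rewrite /cofactor mxE vc0 addn0 mulrA [v i a * _]mulrC; congr (_ * _ * \det _).
by apply/matrixP => l j; rewrite !mxE vcS.
Qed.

Lemma dwedge_C k (b : 'I_k -> M -> R) (X : 'I_k -> M -> tvec M) : (forall j, Cinf M (b j)) ->
  (forall i, vfield (X i)) -> Cinf M (fun q => dwedge b (fun i => X i q)).
Proof.
move=> Cb vX; apply: C_sum => s _; apply: C_scale; apply: C_prod => i _.
under [X in Cinf M X]funext do rewrite mxE.
exact: vf_C.
Qed.

(* The two determinants are the minors, along the first column, of a matrix
   whose rows i and j coincide. *)
Lemma swap_minor k (Z : 'I_k.+1 -> 'I_k -> R) (y : 'I_k -> R) (i j : 'I_k.+1) : i != j ->
  (-1) ^+ i * \det (\matrix_(l, m) if lift i l == j then y m else Z (lift i l) m) +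
  (-1) ^+ j * \det (\matrix_(l, m) if lift j l == i then y m else Z (lift j l) m) = 0.
Proof.
move=> ij; pose B : 'M[R]_k.+1 := \matrix_(l, c)
  if unlift ord0 c is Some m then (if (l == i) || (l == j) then y m else Z l m)
  else ((l == i) || (l == j))%:R.
have B0 : \det B = 0.
  by apply: (determinant_alternate ij) => c; rewrite !mxE !eqxx orbT.
rewrite (expand_det_col _ ord0) (bigD1 i) //= (bigD1 j) 1?eq_sym //= big1 ?addr0 in B0; last first.
  by move=> l /andP[/negPf li /negPf lj]; rewrite mxE unlift_none li lj mul0r.
have E a a' : ((a == i) && (a' == j)) || ((a == j) && (a' == i)) ->
    B a ord0 * cofactor B a ord0 =
    (-1) ^+ a * \det (\matrix_(l, m) if lift a l == a' then y m else Z (lift a l) m).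
  move=> aa; rewrite /cofactor addn0 mxE unlift_none.
  have -> : (a == i) || (a == j) by case/orP: aa => /andP[-> _]; rewrite ?orbT.
  rewrite mul1r; congr (_ * \det _); apply/matrixP => l m; rewrite !mxE liftK.
  suff -> : (lift a l == i) || (lift a l == j) = (lift a l == a') by [].
  have La : lift a l == a = false by apply/negbTE; rewrite eq_sym neq_lift.
  by case/orP: aa => /andP[/eqP <- /eqP <-]; rewrite La ?orbF.
by rewrite -(E i j) ?eqxx // -(E j i) ?eqxx ?orbT.
Qed.

(** This is d(db_1 /\ ... /\ db_k) = 0. [T i j] has the second derivatives X_i X_j b_m in the row of
    X_j, and the bracket terms contribute [T' i j - T j i]. The [T j i] cancel at once, [T i j] and
    [T' i j] by [swap_minor]. *)
Lemma koszul_dwedge k (b : 'I_k -> M -> R) (X : 'I_k.+1 -> M -> tvec M) p :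
  (forall j, Cinf M (b j)) -> (forall i, vfield (X i)) ->
  koszul (fun _ v => dwedge b v) X p = 0.
Proof.
move=> Cb vX; pose Z l m := X l p (b m); pose Y i j m := X i p (fun q => X j q (b m)).
pose T i j := \det (\matrix_(l, m) if lift i l == j then Y i j m else Z (lift i l) m).
pose T' i j := \det (\matrix_(l, m) if lift j l == i then Y i j m else Z (lift j l) m).
have E1 (i : 'I_k.+1) : X i p (fun q => dwedge b (fun l => X (lift i l) q)) = \sum_(j | j != i) T i j.
  rewrite /dwedge (tan_det (vf_tan p (vX i))); last first.
    by move=> l m; under [X in Cinf M X]funext do rewrite mxE; exact: vf_C.
  have -> : \sum_(j | j != i) T i j = \sum_(l < k) T i (lift i l).
    rewrite (reindex_omap (lift i) (unlift i)) /=; last first.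
      by move=> j ji; case: unliftP => [l ->|jE] //=; rewrite jE eqxx in ji.
    by apply: eq_bigl => l; rewrite liftK eqxx eq_sym neq_lift.
  apply: eq_bigr => l _; congr (\det _); apply/matrixP => l' m; rewrite !mxE (inj_eq lift_inj).
  case: eqP => // ->; congr (X i p _); apply/funext => q; by rewrite mxE.
have E2 (i j : 'I_k.+1) : i != j -> dwedge b (fun l => if lift j l == i then bracket (X i) (X j) p
    else X (lift j l) p) = T' i j - T j i.
  move=> ij; have [l0 l0E] : exists l, lift j l = i.
    by case: (unliftP j i) => [l ->|E]; [exists l|rewrite E eqxx in ij].
  transitivity (1 * T' i j + (-1) * T j i); last by rewrite mul1r mulN1r.
  apply: (determinant_multilinear (i0 := l0)).
  - by apply/rowP => m; rewrite !mxE l0E eqxx bracketE // mul1r mulN1r.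
  - apply/matrixP => l m; rewrite !mxE -l0E (inj_eq lift_inj).
    by rewrite eq_sym (negPf (neq_lift _ _)).
  - apply/matrixP => l m; rewrite !mxE -l0E (inj_eq lift_inj).
    by rewrite eq_sym (negPf (neq_lift _ _)).
rewrite /koszul (eq_bigr _ (fun i _ => congr1 _ (E1 i))).
have -> : \sum_(i < k.+1) (-1) ^+ i * (\sum_(j | j != i) T i j) =
    \sum_(i < k.+1) \sum_(j < k.+1 | (i < j)%N) ((-1) ^+ i * T i j + (-1) ^+ j * T j i).
  rewrite (eq_bigr (fun i : 'I_k.+1 => \sum_(j < k.+1 | (i < j)%N) (-1) ^+ i * T i j +
     \sum_(j < k.+1 | (j < i)%N) (-1) ^+ i * T i j)).
    rewrite big_split /= [X in _ + X](exchange_big_dep xpredT) //= -big_split /=.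
    by apply: eq_bigr => i _; rewrite -big_split.
  move=> i _; rewrite mulr_sumr (bigID (fun j : 'I_k.+1 => (i < j)%N)) /=; congr (_ + _).
    by apply: eq_bigl => j; rewrite andb_idl // => ij; rewrite -val_eqE /= gtn_eqF.
  by apply: eq_bigl => j; rewrite -leqNgt -val_eqE /= ltn_neqAle.
rewrite -big_split /= big1 // => i _; rewrite -big_split /= big1 // => j ij.
have nij : i != j by rewrite -val_eqE /= ltn_eqF.
rewrite E2 //; have := swap_minor Z (Y i j) nij; rewrite -/(T i j) -/(T' i j) => H.
by move: ((-1) ^+ i) ((-1) ^+ j) H => s1 s2 H; rewrite -[RHS]H; ring.
Qed.

End Koszul.

Section DecForms.
Context {M : smoothSpace R} {nM : nice M}.

Definition rep k (w : preform M k) (p : M) (I : finType) (a : I -> M -> R)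
    (b : I -> 'I_k -> M -> R) : Prop :=
  [/\ forall i, Cinf M (a i), forall i j, Cinf M (b i j) &
      \forall q \near p, forall v, (forall i, tangent q (v i)) -> w q v = \sum_i a i q * dwedge (b i) v].

(* The differential of such an expression is computed termwise, so that forms
   are handled through local expressions sum a db_1 /\ ... /\ db_k. *)
Definition decform k (w : preform M k) : Prop :=
  forall p, exists (I : finType) (a : I -> M -> R) (b : I -> 'I_k -> M -> R), rep w p a b.

Lemma rep_near k (w : preform M k) p (I : finType) (a : I -> M -> R) b :
  rep w p a b -> \forall q \near p, rep w q a b.
Proof. by move=> [Ca Cb /nbhs_interior]; apply: filterS => q H; split. Qed.

Lemma rep_C k (w : preform M k) (X : 'I_k -> M -> tvec M) : decform w -> (forall i, vfield (X i)) ->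
  Cinf M (fun q => w q (fun i => X i q)).
Proof.
move=> dw vX; apply: C_local => p; have [I [a [b [Ca Cb H]]]] := dw p.
exists (fun q => \sum_i a i q * dwedge (b i) (fun j => X j q)).
  by apply: C_sum => i _; apply: C_mul => //; exact: dwedge_C.
by apply: filterS H => q -> // i; exact: vf_tan.
Qed.

(** The Leibniz rule splits off a_i times Koszul's formula for a product of exact forms, which
    vanishes; what remains is the expansion of da_i /\ db_1 /\ ... /\ db_k along its first
    factor. *)
Lemma koszul_rep k (w : preform M k) (X : 'I_k.+1 -> M -> tvec M) p (I : finType) (a : I -> M -> R) b :
  decform w -> (forall i, vfield (X i)) -> rep w p a b ->
  koszul w X p = \sum_i dwedge (vc (a i) (b i)) (fun j => X j p).
Proof.
move=> dw vX [Ca Cb H]; have Hp := nbhs_singleton H.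
pose T i l := X l p (fun q => dwedge (b i) (fun m => X (lift l m) q)).
have E1 (l : 'I_k.+1) : X l p (fun q => w q (fun m => X (lift l m) q)) =
    \sum_i (a i p * T i l + X l p (a i) * dwedge (b i) (fun m => X (lift l m) p)).
  have t := vf_tan p (vX l); have CD i : Cinf M (fun q => dwedge (b i) (fun m => X (lift l m) q)).
    exact: dwedge_C.
  rewrite (tan_near t (g := fun q => \sum_i a i q * dwedge (b i) (fun m => X (lift l m) q))).
  - rewrite (tan_sumf t); last by move=> i; exact: C_mul.
    by apply: eq_bigr => i _; rewrite (tan_mul t).
  - exact: rep_C.
  - by apply: C_sum => i _; exact: C_mul.
  - by apply: filterS H => q -> // i; exact: vf_tan.
have K0 i : koszul (fun _ v => dwedge (b i) v) X p = 0 by exact: koszul_dwedge.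
rewrite /koszul; under eq_bigr => l _ do rewrite E1 mulr_sumr.
have E2 (i j : 'I_k.+1) : w p (fun l => if lift j l == i then bracket (X i) (X j) p else X (lift j l) p)
   = \sum_m a m p * dwedge (b m) (fun l => if lift j l == i then bracket (X i) (X j) p else X (lift j l) p).
  apply: Hp => l; case: ifP => _; [exact: bracket_tan|exact: vf_tan].
under [X in _ + X]eq_bigr => i _ do under eq_bigr => j _ do rewrite E2 mulr_sumr.
rewrite exchange_big /=.
under [X in _ + X]eq_bigr => i _ do rewrite exchange_big /=.
rewrite [X in _ + X]exchange_big /= -big_split /=; apply: eq_bigr => m _.
rewrite dwedge_vc; have := K0 m; rewrite /koszul -/(T m _) => {}K0.
under eq_bigr => i _ do rewrite mulrDr mulrCA mulrA.
rewrite big_split /= addrAC [X in _ + X + _](_ : _ = a m p * 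
  (\sum_(i < k.+1) \sum_(j < k.+1 | (i < j)%N) (-1) ^+ j * dwedge (b m) (fun l =>
     if lift j l == i then bracket (X i) (X j) p else X (lift j l) p))); last first.
  rewrite mulr_sumr; apply: eq_bigr => i _; rewrite mulr_sumr; apply: eq_bigr => j _.
  by rewrite mulrCA.
rewrite [X in X + _ + _](_ : _ = a m p * (\sum_(i < k.+1) (-1) ^+ i * T m i)); last first.
  by rewrite mulr_sumr; apply: eq_bigr => i _; rewrite mulrA.
rewrite -mulrDr [X in _ * X + _]K0 mulr0 add0r; apply: eq_bigr => i _.
by rewrite mulrA.
Qed.

Lemma extd_ext k (w : preform M k) p (v : 'I_k.+1 -> tvec M) : (forall i, tangent p (v i)) ->
  exists X : 'I_k.+1 -> M -> tvec M, [/\ forall i, vfield (X i), forall i, X i p = v i &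
    extd w p v = koszul w X p].
Proof.
move=> tv; pose X i := xget (fun=> 0) [set X | vfield X /\ X p = v i].
have H i : vfield (X i) /\ X i p = v i.
  rewrite /X; case: xgetP => [Y _ //|].
  by have [Y HY] := tan_extend (tv i) => /(_ Y).
by exists X; split=> // i; have [] := H i.
Qed.

Lemma extd_rep k (w : preform M k) p (I : finType) (a : I -> M -> R) b (v : 'I_k.+1 -> tvec M) :
  decform w -> rep w p a b -> (forall i, tangent p (v i)) ->
  extd w p v = \sum_i dwedge (vc (a i) (b i)) v.
Proof.
move=> dw rw tv; have [X [vX Xv ->]] := extd_ext w tv.
rewrite (koszul_rep dw vX rw); apply: eq_bigr => i _; congr dwedge.
by apply/funext => j.
Qed.

Lemma extd_koszul k (w : preform M k) (X : 'I_k.+1 -> M -> tvec M) p : decform w ->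
  (forall i, vfield (X i)) -> extd w p (fun i => X i p) = koszul w X p.
Proof.
move=> dw vX; have [I [a [b rw]]] := dw p.
by rewrite (extd_rep dw rw) ?(koszul_rep dw vX rw) // => i; exact: vf_tan.
Qed.

Lemma rep_extd k (w : preform M k) p (I : finType) (a : I -> M -> R) b :
  decform w -> rep w p a b -> rep (extd w) p (fun _ _ => 1) (fun i => vc (a i) (b i)).
Proof.
move=> dw rw; have [Ca Cb _] := rw; split.
- by move=> i; exact: C_cst.
- by move=> i; apply: vcP.
- apply: filterS (rep_near rw) => q rq v tv; rewrite (extd_rep dw rq tv).
  by apply: eq_bigr => i _; rewrite mul1r.
Qed.

Lemma dec_extd k (w : preform M k) : decform w -> decform (extd w).
Proof.
by move=> dw p; have [I [a [b rw]]] := dw p; do 3!eexists; exact: rep_extd dw rw.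
Qed.

Lemma dwedge_cst k (c : R) (b : 'I_k -> M -> R) p (v : 'I_k.+1 -> tvec M) : (forall i, tangent p (v i)) ->
  dwedge (vc (fun=> c) b) v = 0.
Proof.
move=> tv; rewrite dwedge_vc big1 // => i _.
by rewrite (tan_cst (tv i)) mulr0 mul0r.
Qed.

Lemma extd_extd k (w : preform M k) p v : decform w -> (forall i, tangent p (v i)) ->
  extd (extd w) p v = 0.
Proof.
move=> dw tv; have [I [a [b rw]]] := dw p.
rewrite (extd_rep (dec_extd dw) (rep_extd dw rw) tv) big1 // => i _; exact: dwedge_cst tv.
Qed.

Lemma rep_eq k (w w' : preform M k) p (I : finType) (a : I -> M -> R) b :
  (\forall q \near p, forall v, (forall i, tangent q (v i)) -> w q v = w' q v) -> rep w' p a b -> rep w p a b.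
Proof.
move=> ww' [Ca Cb H]; split=> //; apply: filterS2 ww' H => q E H v tv.
by rewrite E // H.
Qed.

Lemma dec_eq k (w w' : preform M k) : form_eq w w' -> decform w' -> decform w.
Proof.
move=> ww' dw p; have [I [a [b rw]]] := dw p; exists I, a, b; apply: rep_eq rw.
by near=> q; exact: ww'.
Unshelve. all: by end_near. Qed.

Lemma extd_local k (w w' : preform M k) p v : decform w -> decform w' ->
  (\forall q \near p, forall v, (forall i, tangent q (v i)) -> w q v = w' q v) ->
  (forall i, tangent p (v i)) -> extd w p v = extd w' p v.
Proof.
move=> dw dw' ww' tv; have [I [a [b rw']]] := dw' p.
by rewrite (extd_rep dw (rep_eq ww' rw') tv) (extd_rep dw' rw' tv).
Qed.

Lemma extd_eq k (w w' : preform M k) : decform w -> form_eq w w' -> form_eq (extd w) (extd w').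
Proof.
move=> dw ww' p v tv; apply: extd_local => //.
  by apply: dec_eq dw => q u tu; rewrite ww'.
by near=> q; exact: ww'.
Unshelve. all: by end_near. Qed.

Lemma rep_add k (w w' : preform M k) p (I I' : finType) (a : I -> M -> R) b (a' : I' -> M -> R) b' :
  rep w p a b -> rep w' p a' b' ->
  rep (w + w') p (fun i => match i with inl i => a i | inr i => a' i end)
    (fun i => match i with inl i => b i | inr i => b' i end).
Proof.
move=> [Ca Cb H] [Ca' Cb' H']; split=> [[]//|[]//|].
by apply: filterS2 H H' => q H H' v tv; rewrite big_sumType /= -H // -H'.
Qed.

Lemma dec_add k (w w' : preform M k) : decform w -> decform w' -> decform (w + w').
Proof.
move=> dw dw' p; have [I [a [b rw]]] := dw p; have [I' [a' [b' rw']]] := dw' p.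
by do 3!eexists; exact: rep_add rw rw'.
Qed.

Lemma extd_add k (w w' : preform M k) p v : decform w -> decform w' -> (forall i, tangent p (v i)) ->
  extd (w + w') p v = extd w p v + extd w' p v.
Proof.
move=> dw dw' tv; have [I [a [b rw]]] := dw p; have [I' [a' [b' rw']]] := dw' p.
rewrite (extd_rep (dec_add dw dw') (rep_add rw rw') tv) big_sumType /=.
by rewrite (extd_rep dw rw tv) (extd_rep dw' rw' tv).
Qed.

Lemma rep_scale k (w : preform M k) (f : M -> R) p (I : finType) (a : I -> M -> R) b : Cinf M f ->
  rep w p a b -> rep (fun q v => f q * w q v) p (fun i q => f q * a i q) b.
Proof.
move=> Cf [Ca Cb H]; split=> // [i|]; first exact: C_mul.
apply: filterS H => q H v tv; rewrite H // mulr_sumr; apply: eq_bigr => i _.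
by rewrite mulrA.
Qed.

Lemma dec_scale k (w : preform M k) (f : M -> R) : Cinf M f -> decform w ->
  decform (fun q v => f q * w q v).
Proof.
move=> Cf dw p; have [I [a [b rw]]] := dw p.
by do 3!eexists; exact: rep_scale Cf rw.
Qed.

Lemma extd_scale k (w : preform M k) (f : M -> R) p v : Cinf M f -> decform w -> (forall i, tangent p (v i)) ->
  extd (fun q v => f q * w q v) p v =
  f p * extd w p v + \sum_(i < k.+1) (-1) ^+ i * v i f * w p (fun l => v (lift i l)).
Proof.
move=> Cf dw tv; have [I [a [b rw]]] := dw p; have [Ca Cb H] := rw.
rewrite (extd_rep (dec_scale Cf dw) (rep_scale Cf rw) tv) (extd_rep dw rw tv) mulr_sumr.
under [X in _ = _ + X]eq_bigr => i _ do rewrite (nbhs_singleton H) // mulr_sumr.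
rewrite [X in _ = _ + X]exchange_big -big_split /=; apply: eq_bigr => i _.
rewrite !dwedge_vc mulr_sumr -big_split /=; apply: eq_bigr => j _.
by rewrite (tan_mul (tv j)) //; ring.
Qed.

Lemma rep_opp k (w : preform M k) p (I : finType) (a : I -> M -> R) b :
  rep w p a b -> rep (- w) p (fun i q => - a i q) b.
Proof.
move=> [Ca Cb H]; split=> // [i|]; first exact: C_opp.
apply: filterS H => q H v tv; rewrite [LHS](_ : _ = - w q v) // H // -sumrN; apply: eq_bigr => i _.
by rewrite mulNr.
Qed.

Lemma dec_opp k (w : preform M k) : decform w -> decform (- w).
Proof.
by move=> dw p; have [I [a [b rw]]] := dw p; do 3!eexists; exact: rep_opp rw.
Qed.

Lemma extd_opp k (w : preform M k) p v : decform w -> (forall i, tangent p (v i)) ->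
  extd (- w) p v = - extd w p v.
Proof.
move=> dw tv; have [I [a [b rw]]] := dw p; have [Ca Cb H] := rw.
rewrite (extd_rep (dec_opp dw) (rep_opp rw) tv) (extd_rep dw rw tv) -sumrN.
apply: eq_bigr => i _; rewrite !dwedge_vc -sumrN; apply: eq_bigr => j _.
by rewrite (tan_opp (tv j)) // mulrN mulNr.
Qed.

Lemma dec_sub k (w w' : preform M k) : decform w -> decform w' -> decform (w - w').
Proof. by move=> dw dw'; apply: dec_add => //; exact: dec_opp. Qed.

Lemma extd_sub k (w w' : preform M k) p v : decform w -> decform w' -> (forall i, tangent p (v i)) ->
  extd (w - w') p v = extd w p v - extd w' p v.
Proof.
by move=> dw dw' tv; rewrite extd_add // ?extd_opp //; exact: dec_opp.
Qed.

Lemma dec0 k : decform (0 : preform M k).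
Proof.
move=> p; exists void, (fun _ _ => 0), (fun _ _ _ => 0); split=> [||] //.
by near=> q => v _; rewrite big1 //; case.
Unshelve. all: by end_near. Qed.

Lemma dec_sum k (I : Type) (r : seq I) (w : I -> preform M k) :
  (forall i, decform (w i)) -> decform (\sum_(i <- r) w i).
Proof. by move=> dw; apply: (big_ind (@decform k)) => //; [exact: dec0|exact: dec_add]. Qed.

Lemma form_sumE k (I : Type) (r : seq I) (w : I -> preform M k) p v :
  (\sum_(i <- r) w i) p v = \sum_(i <- r) w i p v.
Proof. by elim/big_rec2: _ => // i y1 y2 _ <-. Qed.

Lemma dec_iprod k (X : M -> tvec M) (w : preform M k.+1) : vfield X -> decform w -> decform (iprod X w).
Proof.
move=> vX dw p; have [I [a [b [Ca Cb H]]]] := dw p.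
exists (I * 'I_k.+1)%type, (fun (ij : I * 'I_k.+1) q => a ij.1 q * ((-1) ^+ ij.2 * X q (b ij.1 ij.2))),
  (fun (ij : I * 'I_k.+1) l => b ij.1 (lift ij.2 l)); split=> //.
  by move=> [i j] /=; apply: C_mul => //; apply: C_scale; exact: vf_C.
apply: filterS H => q H v tv; rewrite /iprod H; last first.
  by apply: (vcP (P := tangent q)) => //; exact: vf_tan.
rewrite -(pair_bigA _ (fun (i : I) (j : 'I_k.+1) => a i q * ((-1) ^+ j * X q (b i j)) * dwedge (fun l => b i (lift j l)) v)).
apply: eq_bigr => i _; rewrite [dwedge _ _](expand_det_row _ ord0) mulr_sumr.
apply: eq_bigr => j _; rewrite /cofactor !mxE unlift_none add0n -!mulrA.
congr (_ * _); rewrite mulrCA; congr (_ * (_ * \det _)).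
by apply/matrixP => l m; rewrite !mxE liftK.
Qed.

Lemma dwedge_lin k (b : 'I_k -> M -> R) v i (c : R) x y :
  dwedge b [eta v with i |-> c *: x + y] = c * dwedge b [eta v with i |-> x] + dwedge b [eta v with i |-> y].
Proof.
rewrite /dwedge -[X in _ = _ + X]mul1r; apply: (determinant_multilinear (i0 := i)).
- by apply/rowP => j; rewrite !mxE /= eqxx tvD tvZ mul1r.
- by apply/matrixP => l j; rewrite !mxE /= eq_sym (negPf (neq_lift _ _)).
- by apply/matrixP => l j; rewrite !mxE /= eq_sym (negPf (neq_lift _ _)).
Qed.

Lemma eta_tan k p (v : 'I_k -> tvec M) i x : (forall j, tangent p (v j)) -> tangent p x ->
  forall j, tangent p ([eta v with i |-> x] j).
Proof. by move=> tv tx j /=; case: eqP. Qed.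

Lemma dec_lin k (w : preform M k) p (v : 'I_k -> tvec M) i (c : R) x y : decform w ->
  (forall j, tangent p (v j)) -> tangent p x -> tangent p y ->
  w p [eta v with i |-> c *: x + y] = c * w p [eta v with i |-> x] + w p [eta v with i |-> y].
Proof.
move=> dw tv tx ty; have [I [a [b [_ _ /nbhs_singleton H]]]] := dw p.
rewrite !H; try by apply: eta_tan => //; exact: tan_comb.
rewrite mulr_sumr -big_split /=; apply: eq_bigr => j _.
by rewrite dwedge_lin; ring.
Qed.

Lemma dec_alt k (w : preform M k) p (v : 'I_k -> tvec M) i j : decform w ->
  (forall l, tangent p (v l)) -> i != j -> v i = v j -> w p v = 0.
Proof.
move=> dw tv ij vij; have [I [a [b [_ _ /nbhs_singleton H]]]] := dw p.
rewrite H // big1 // => m _; rewrite [dwedge _ _](determinant_alternate ij) ?mulr0 // => l.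
by rewrite !mxE vij.
Qed.

Lemma dec_form k (w : preform M k) : decform w ->
  (forall p v, ~ (forall i, tangent p (v i)) -> w p v = 0) -> is_form w.
Proof.
move=> dw w0; split=> //.
- by move=> p v i c x y; exact: dec_lin.
- by move=> p v i j; exact: dec_alt.
- by move=> X; exact: rep_C.
Qed.

End DecForms.

Section Pullback.
Context {M N : smoothSpace R} {nM : nice M} {nN : nice N} (f : M -> N) (sf : smooth_map f).

Lemma dwedge_pull k (b : 'I_k -> N -> R) v : (forall j, Cinf N (b j)) ->
  dwedge b (fun i => Tmap f (v i)) = dwedge (fun j => b j \o f) v.
Proof. by move=> Cb; congr (\det _); apply/matrixP => i j; rewrite !mxE TmapE. Qed.

Lemma rep_pull k (w : preform N k) p (I : finType) (a : I -> N -> R) b : rep w (f p) a b ->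
  rep (pullback f w) p (fun i => a i \o f) (fun i j => b i j \o f).
Proof.
move=> [Ca Cb H]; split=> [i|i j|]; try exact: sf.
have cf : continuous f by exact: smooth_cts.
have H' : nbhs p (f @^-1` _) := cf p _ H.
apply: filterS H' => q Hq v tv; rewrite /pullback Hq.
  by apply: eq_bigr => i _; rewrite dwedge_pull.
by move=> i; apply: Tmap_tan.
Qed.

Lemma dec_pull k (w : preform N k) : decform w -> decform (pullback f w).
Proof. by move=> dw p; have [I [a [b rw]]] := dw (f p); do 3!eexists; exact: rep_pull rw. Qed.

Lemma extd_pull k (w : preform N k) p v : decform w -> (forall i, tangent p (v i)) ->
  extd (pullback f w) p v = pullback f (extd w) p v.
Proof.
move=> dw tv; have [I [a [b rw]]] := dw (f p); have [Ca Cb _] := rw.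
rewrite (extd_rep (dec_pull dw) (rep_pull rw) tv) /pullback (extd_rep dw rw).
  apply: eq_bigr => i _; rewrite dwedge_pull; last exact: vcP.
  congr (dwedge _ v); apply/funext => j; rewrite /vc; by case: unlift.
by move=> i; apply: Tmap_tan.
Qed.

End Pullback.

End DForms.

(** * Differential forms as local sums of a db_1 /\ ... /\ db_k *)

Section FormDec.
Context {R : realType} {M : smoothSpace R} {nM : nice M}.

Lemma vc_eta (T : Type) k (u z : T) (v : 'I_k -> T) i :
  vc u [eta v with i |-> z] = [eta (vc u v) with lift ord0 i |-> z].
Proof.
apply/funext => l /=; case: (unliftP ord0 l) => [j|] ->; last first.
  by rewrite !vc0 (negPf (neq_lift _ _)).
by rewrite !vcS /= (inj_eq lift_inj).
Qed.

Lemma eta_vc0 (T : Type) k (u z : T) (v : 'I_k -> T) : vc z v = [eta (vc u v) with ord0 |-> z].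
Proof.
apply/funext => l /=; case: (unliftP ord0 l) => [j|] ->; last by rewrite !vc0 eqxx.
by rewrite !vcS eq_sym (negPf (neq_lift _ _)).
Qed.

Lemma form_iprod k (X : M -> tvec M) (w : preform M k.+1) : vfield X -> is_form w -> is_form (iprod X w).
Proof.
move=> vX [w0 w1 w2 w3]; have tX p (v : 'I_k -> tvec M) : (forall j, tangent p (v j)) ->
    forall l, tangent p (vc (X p) v l).
  by move=> tv; apply: vcP => //; exact: vf_tan.
split.
- move=> p v nv; apply: (w0 p (vc (X p) v)) => H; apply: nv => i.
  by have := H (lift ord0 i); rewrite vcS.
- move=> p v i a x y tv tx ty; have := w1 p (vc (X p) v) (lift ord0 i) a x y (tX p v tv) tx ty.
  by rewrite -!vc_eta.
- move=> p v i j tv ij vij; apply: (w2 p (vc (X p) v) (lift ord0 i) (lift ord0 j)).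
  + exact: tX.
  + by rewrite (inj_eq lift_inj).
  + by rewrite !vcS.
- move=> Y vY; have := w3 (vc X Y) (vcP (P := @vfield R M) vX vY); congr (Cinf M _).
  by apply/funext => p; rewrite /iprod /vc; congr (w p); apply/funext => l; case: unlift.
Qed.

Lemma form_swap k (w : preform M k) p (v : 'I_k -> tvec M) i j : is_form w -> (forall l, tangent p (v l)) -> i != j ->
  w p [eta [eta v with i |-> v j] with j |-> v i] = - w p v.
Proof.
move=> fw tv ij; have [_ w1 w2 _] := fw.
pose F x y := w p [eta [eta v with i |-> x] with j |-> y].
have FC x y : F x y = w p [eta [eta v with j |-> y] with i |-> x].
  congr (w p); apply/funext => l /=; case: (l =P i) => [->|//].
  by rewrite (negPf ij).
have F0 x : tangent p x -> F x x = 0.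
  move=> tx; apply: (w2 _ _ i j) => //=; last by rewrite eqxx (negPf ij) eqxx.
  by apply: eta_tan => //; exact: eta_tan.
have Fr x y z : tangent p x -> tangent p y -> tangent p z -> F x (y + z) = F x y + F x z.
  move=> tx ty tz; rewrite -{1}[y]scale1r /F w1 ?mul1r //.
  exact: eta_tan.
have Fl x y z : tangent p x -> tangent p y -> tangent p z -> F (y + z) x = F y x + F z x.
  move=> tx ty tz; rewrite !FC -{1}[y]scale1r w1 ?mul1r //.
  exact: eta_tan.
have ti := tv i; have tj := tv j; have tij := tanD ti tj.
have := F0 _ tij; rewrite Fr // !Fl // !F0 // add0r addr0.
have -> : F (v i) (v j) = w p v.
  by congr (w p); apply/funext => l /=; case: eqP => [->//|]; case: eqP => [->|].
by move=> /eqP; rewrite addr_eq0 => /eqP.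
Qed.

Lemma form_lin_sum k (w : preform M k) p (v : 'I_k -> tvec M) i n (c : 'I_n -> R) (e : 'I_n -> tvec M) :
  is_form w -> (forall l, tangent p (v l)) -> (forall l, tangent p (e l)) ->
  w p [eta v with i |-> \sum_j c j *: e j] = \sum_j c j * w p [eta v with i |-> e j].
Proof.
move=> fw tv te; have [_ w1 _ _] := fw.
have w00 : w p [eta v with i |-> 0] = 0.
  have := w1 p v i 1 0 0 tv (tan0 p) (tan0 p); rewrite scaler0 addr0 mul1r => /eqP.
  by rewrite eq_sym -subr_eq0 addrK => /eqP.
suff H r : w p [eta v with i |-> \sum_(j <- r) c j *: e j] = \sum_(j <- r) c j * w p [eta v with i |-> e j].
  exact: H.
elim: r => [|j r IH]; first by rewrite !big_nil w00.
rewrite !big_cons w1 // ?IH //; apply: tan_sum => l _; exact: tanZ.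
Qed.

Lemma form_front k (w : preform M k.+1) p (v : 'I_k.+1 -> tvec M) (i : 'I_k.+1) : is_form w ->
  (forall l, tangent p (v l)) -> w p v = (-1) ^+ i * w p (vc (v i) (fun l => v (lift i l))).
Proof.
move=> fw tv; case: i => m; elim: m => [|m IH] im.
  by rewrite expr0 mul1r (_ : Ordinal im = ord0) ?vcE //; exact: val_inj.
pose i' := Ordinal (ltnW im); pose i := Ordinal im; have {IH} -> := IH (ltnW im).
rewrite -/i' -/i /= exprS mulN1r mulNr -mulrN; congr (_ * _).
have i0 : i != ord0 by [].
pose l : 'I_k := Ordinal (im : (m < k)%N).
have il : i = lift ord0 l by apply: val_inj.
(* In [u] the vector [v i'] has been brought to the front; exchanging slots 0 and i of [u] brings
   [v i] to the front instead. *)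
pose u := vc (v i') (fun l => v (lift i' l)).
have tu x : tangent p (u x) by apply: vcP.
rewrite -/u -[w p u]opprK; congr (- _); rewrite -(form_swap fw tu i0); congr (w p).
apply/funext => x /=; rewrite [u ord0]vc0.
case: (unliftP ord0 x) => [y ->|->]; last first.
  rewrite vc0 eqxx {1}il /u vcS; congr v.
  by apply: val_inj; rewrite /= /bump leqnn.
have y0 : (lift ord0 y == ord0) = false by rewrite eq_sym; apply/negbTE; exact: neq_lift.
rewrite vcS y0 {1}il (inj_eq lift_inj); case: eqP => [->|yl].
  by congr v; apply: val_inj; rewrite /= /bump ltnn.
rewrite /u vcS; congr v; apply: val_inj; rewrite /= /bump; congr (_ + _)%N.
have /eqP : (y : nat) <> m by move=> E; apply: yl; exact: val_inj.
by rewrite ltn_neqAle eq_sym => ->.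
Qed.

(** Induction on the degree by means of (k+1) w = sum_j dx_j /\ i_(E_j) w, valid on the domain of a
    frame; this explains the factor 1/(k+1). *)
Lemma form_dec k (w : preform M k) : is_form w -> decform w.
Proof.
elim: k w => [|k IH] w fw p.
  exists 'I_1, (fun _ q => w q (fun=> 0)), (fun _ _ _ => 0); have [_ _ _ w3] := fw; split.
  - by move=> _; apply: (w3 (fun _ _ => 0)) => i; exact: vf0.
  - by move=> _ []; case.
  - by near=> q => v _; rewrite big_ord1 /dwedge det_mx00 mulr1; congr (w q); apply/funext; case.
have [n [x [E [U [r [fr _]]]]]] := frame_exists (@filter_nbhsT _ (nbhs p) _).
have H j : exists Iab : {I : finType & ((I -> M -> R) * (I -> 'I_k -> M -> R))%type},
    rep (iprod (E j) w) p (tagged Iab).1 (tagged Iab).2.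
  have [I [a [b H]]] := IH _ (form_iprod (fr_vf fr j) fw) p.
  by exists (Tagged (fun I : finType => ((I -> M -> R) * (I -> 'I_k -> M -> R))%type) (a, b)).
have [F HF] := choice H.
pose I : finType := {j : 'I_n & tag (F j)}.
exists I, (fun (t : I) q => (k.+1%:R)^-1 * (tagged (F (tag t))).1 (tagged t) q),
  (fun (t : I) => vc (x (tag t)) ((tagged (F (tag t))).2 (tagged t))); split.
- by move=> t; have [Ca _ _] := HF (tag t); exact: C_scale.
- move=> t; have [_ Cb _] := HF (tag t); apply: vcP; last exact: Cb.
  exact: co_C (fr_co fr) _.
have HF' j : \forall q \near p, forall v, (forall i, tangent q (v i)) ->
    iprod (E j) w q v = \sum_i (tagged (F j)).1 i q * dwedge ((tagged (F j)).2 i) v.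
  by have [] := HF j.
apply: filterS2 (frame_nbhs fr (co_p (fr_co fr))) (filter_forall (nbhs_filter p) HF') => q Uq Hq v tv.
have k0 : (k.+1%:R : R) != 0 by rewrite pnatr_eq0.
apply: (mulfI k0); rewrite mulr_sumr.
have -> : k.+1%:R * w q v = \sum_(i < k.+1) w q v by rewrite sumr_const card_ord mulr_natl.
under [RHS]eq_bigr => t _ do rewrite mulrA mulrA divff // mul1r dwedge_vc mulr_sumr.
rewrite exchange_big /=; apply: eq_bigr => i _.
rewrite (form_front i fw tv) [X in vc X _](frame_span fr Uq (tv i)) (eta_vc0 0).
rewrite form_lin_sum //; last first.
- by move=> l; exact: vf_tan (fr_vf fr l).
- by apply: (vcP (P := tangent q)) => //; exact: tan0.
rewrite mulr_sumr; transitivity (\sum_j \sum_(y : tag (F j)) (tagged (F j)).1 y q *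
  ((-1) ^+ i * v i (x j) * dwedge ((tagged (F j)).2 y) (fun l => v (lift i l)))); last first.
  by rewrite sig_big_dep.
apply: eq_bigr => j _; rewrite -eta_vc0 -[w q _]/(iprod (E j) w q _) Hq //.
rewrite !mulr_sumr; apply: eq_bigr => y _; ring.
Unshelve. all: by end_near. Qed.

End FormDec.

(** * Forms of degree at most two and Cartan's formula *)

Section LowDegree.
Context {R : realType} {M : smoothSpace R} {nM : nice M}.

Definition v1 (T : Type) (u : T) : 'I_1 -> T := fun=> u.
Definition v2 (T : Type) (u v : T) : 'I_2 -> T := vc u (v1 v).
Definition v3 (T : Type) (u v w : T) : 'I_3 -> T := vc u (v2 v w).

Lemma v1E (T : Type) (v : 'I_1 -> T) : v = v1 (v ord0).
Proof. by apply/funext => i; rewrite ord1. Qed.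

Lemma v2E (T : Type) (v : 'I_2 -> T) : v = v2 (v ord0) (v (lift ord0 ord0)).
Proof. by rewrite -{1}(vcE v) /v2; congr vc; exact: v1E. Qed.

Lemma v1P (T : Type) (P : T -> Prop) u : P u -> forall i, P (v1 u i). Proof. by []. Qed.

Lemma v2P (T : Type) (P : T -> Prop) u v : P u -> P v -> forall i, P (v2 u v i).
Proof. by move=> Pu Pv; apply: vcP. Qed.

Lemma v3P (T : Type) (P : T -> Prop) u v w : P u -> P v -> P w -> forall i, P (v3 u v w i).
Proof. by move=> Pu Pv Pw; apply: vcP => //; apply: v2P. Qed.

Lemma v2_tuple (T : Type) (u v : T) : tnth [tuple u; v] = v2 u v.
Proof.
apply/funext => i; case: (unliftP ord0 i) => [j|] ->; last by rewrite /v2 vc0.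
by rewrite /v2 vcS ord1.
Qed.

Lemma v2_map (T T' : Type) (f : T -> T') u v : (fun i => f (v2 u v i)) = v2 (f u) (f v).
Proof. by rewrite /v2 vc_map. Qed.

Lemma v3_map (T T' : Type) (f : T -> T') u v w : (fun i => f (v3 u v w i)) = v3 (f u) (f v) (f w).
Proof. by rewrite /v3 vc_map v2_map. Qed.

Lemma iprod1E (X : M -> tvec M) (w : preform M 2) p u : iprod X w p (v1 u) = w p (v2 (X p) u).
Proof. by []. Qed.

Lemma iprod2E (X : M -> tvec M) (w : preform M 3) p u v : iprod X w p (v2 u v) = w p (v3 (X p) u v).
Proof. by []. Qed.

Lemma pull1E (N : smoothSpace R) (f : M -> N) (w : preform N 1) p u :
  pullback f w p (v1 u) = w (f p) (v1 (Tmap f u)).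
Proof. by []. Qed.

Lemma pull2E (N : smoothSpace R) (f : M -> N) (w : preform N 2) p u v :
  pullback f w p (v2 u v) = w (f p) (v2 (Tmap f u) (Tmap f v)).
Proof. by rewrite /pullback v2_map. Qed.

Lemma pull3E (N : smoothSpace R) (f : M -> N) (w : preform N 3) p u v x :
  pullback f w p (v3 u v x) = w (f p) (v3 (Tmap f u) (Tmap f v) (Tmap f x)).
Proof. by rewrite /pullback v3_map. Qed.

Section Linear.
Context (p : M).

Lemma lin1 (w : preform M 1) (a : R) u v : decform w -> tangent p u -> tangent p v ->
  w p (v1 (a *: u + v)) = a * w p (v1 u) + w p (v1 v).
Proof.
move=> dw tu tv; have E x : ([eta v1 u with ord0 |-> x] : 'I_1 -> tvec M) = v1 x.
  by apply/funext => i /=; rewrite [i]ord1 eqxx.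
by have := dec_lin ord0 a dw (v1P (P := tangent p) tu) tu tv; rewrite !E.
Qed.

Lemma lin2l (w : preform M 2) (a : R) u v x : decform w -> tangent p u -> tangent p v -> tangent p x ->
  w p (v2 (a *: u + v) x) = a * w p (v2 u x) + w p (v2 v x).
Proof.
move=> dw tu tv tx.
by have := dec_lin ord0 a dw (v2P (P := tangent p) tu tx) tu tv; rewrite -!eta_vc0.
Qed.

Lemma alt2 (w : preform M 2) u : decform w -> tangent p u -> w p (v2 u u) = 0.
Proof.
move=> dw tu; apply: (dec_alt (i := ord0) (j := lift ord0 ord0)) => //; first exact: v2P.
by rewrite /v2 vc0 vcS.
Qed.

Lemma lin2r (w : preform M 2) (a : R) u v x : decform w -> tangent p u -> tangent p v -> tangent p x ->
  w p (v2 x (a *: u + v)) = a * w p (v2 x u) + w p (v2 x v).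
Proof.
move=> dw tu tv tx; have E y : ([eta v2 x u with lift ord0 ord0 |-> y] : 'I_2 -> tvec M) = v2 x y.
  by rewrite -vc_eta; congr vc; apply/funext => i /=; rewrite [i]ord1 eqxx.
by have := dec_lin (lift ord0 ord0) a dw (v2P (P := tangent p) tx tu) tu tv; rewrite !E.
Qed.

Lemma skew2 (w : preform M 2) u v : decform w -> tangent p u -> tangent p v ->
  w p (v2 v u) = - w p (v2 u v).
Proof.
move=> dw tu tv; have tuv := tanD tu tv.
have E1 := lin2l 1 dw tu tv tuv; have E2 := lin2r 1 dw tu tv tu; have E3 := lin2r 1 dw tu tv tv.
rewrite scale1r alt2 // in E1; rewrite scale1r alt2 // in E2; rewrite scale1r alt2 // in E3.
lra.
Qed.

Lemma lin3l (w : preform M 3) (a : R) u v x y : decform w -> tangent p u -> tangent p v ->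
  tangent p x -> tangent p y ->
  w p (v3 (a *: u + v) x y) = a * w p (v3 u x y) + w p (v3 v x y).
Proof.
move=> dw tu tv tx ty.
by have := dec_lin ord0 a dw (v3P (P := tangent p) tu tx ty) tu tv; rewrite -!eta_vc0.
Qed.

Lemma skew3 (w : preform M 3) u v x : decform w -> tangent p u -> tangent p v -> tangent p x ->
  w p (v3 u x v) = - w p (v3 u v x).
Proof.
move=> dw tu tv tx; have [X [vX <-]] := tan_extend tu.
by rewrite -2!iprod2E skew2 //; exact: dec_iprod.
Qed.

Lemma skew3' (w : preform M 3) u v x : decform w -> tangent p u -> tangent p v -> tangent p x ->
  w p (v3 v u x) = - w p (v3 u v x).
Proof.
move=> dw tu tv tx; have tuv := tanD tu tv.
have A a b : tangent p a -> tangent p b -> w p (v3 a a b) = 0.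
  move=> ta tb; apply: (dec_alt (i := ord0) (j := lift ord0 ord0)) => //; first exact: v3P.
  by rewrite /v3 vc0 vcS /v2 vc0.
have B a c : tangent p a -> tangent p c -> w p (v3 a (u + v) c) = w p (v3 a u c) + w p (v3 a v c).
  move=> ta tc; have [X [vX <-]] := tan_extend ta; rewrite -3!iprod2E.
  by rewrite -{1}[u]scale1r lin2l ?mul1r //; exact: dec_iprod.
have E1 := lin3l 1 dw tu tv tuv tx; have E2 := B u x tu tx; have E3 := B v x tv tx.
rewrite scale1r A // in E1; rewrite A // in E2; rewrite [w p (v3 v v x)]A // in E3.
lra.
Qed.

End Linear.

Lemma C1 (w : preform M 1) X : decform w -> vfield X -> Cinf M (fun q => w q (v1 (X q))).
Proof. by move=> dw vX; apply: (rep_C (X := fun=> X)). Qed.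

Lemma C2 (w : preform M 2) X Y : decform w -> vfield X -> vfield Y -> Cinf M (fun q => w q (v2 (X q) (Y q))).
Proof.
move=> dw vX vY; have H : Cinf M (fun q => w q (fun i => v2 X Y i q)).
  by apply: rep_C => //; apply: v2P.
suff -> : (fun q => w q (v2 (X q) (Y q))) = fun q => w q (fun i => v2 X Y i q) by [].
by apply/funext => q; rewrite (v2_map (fun X => X q)).
Qed.

Lemma extd1E (w : preform M 1) X Y p : decform w -> vfield X -> vfield Y ->
  extd w p (v2 (X p) (Y p)) = X p (fun q => w q (v1 (Y q))) - Y p (fun q => w q (v1 (X q)))
    - w p (v1 (bracket X Y p)).
Proof.
move=> dw vX vY; have := extd_koszul p dw (v2P (P := @vfield R M) vX vY).
rewrite (v2_map (fun X => X p)) => ->.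
have l10 : lift (lift ord0 ord0 : 'I_2) (ord0 : 'I_1) = ord0 by exact: val_inj.
rewrite /koszul; under [X in _ + X]eq_bigr => i _ do rewrite big_mkcond.
rewrite !big_ord_recl !big_ord0 /= ?addr0 ?add0r expr0 mul1r !expr1 !mulN1r.
have E (i : 'I_2) : (fun q => w q (fun l => v2 X Y (lift i l) q)) =
    fun q => w q (v1 (v2 X Y (lift i ord0) q)).
  by apply/funext => q; congr (w q); exact: v1E.
rewrite !E.
by rewrite l10 [X in w p X]v1E l10 /v2 vcS vc0 eqxx.
Qed.

Lemma extd2E (w : preform M 2) X Y Z p : decform w -> vfield X -> vfield Y -> vfield Z ->
  extd w p (v3 (X p) (Y p) (Z p)) =
    X p (fun q => w q (v2 (Y q) (Z q))) - Y p (fun q => w q (v2 (X q) (Z q)))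
    + Z p (fun q => w q (v2 (X q) (Y q))) - w p (v2 (bracket X Y p) (Z p))
    + w p (v2 (bracket X Z p) (Y p)) + w p (v2 (X p) (bracket Y Z p)).
Proof.
move=> dw vX vY vZ; have := extd_koszul p dw (v3P (P := @vfield R M) vX vY vZ).
rewrite (v3_map (fun X => X p)) => ->.
pose o0 : 'I_3 := ord0; pose o1 : 'I_3 := lift ord0 ord0; pose o2 : 'I_3 := lift ord0 (lift ord0 ord0).
have l10 : lift o1 ord0 = o0 by exact: val_inj.
have l11 : lift o1 (lift ord0 ord0) = o2 by exact: val_inj.
have l20 : lift o2 ord0 = o0 by exact: val_inj.
have l21 : lift o2 (lift ord0 ord0) = o1 by exact: val_inj.
rewrite /koszul; under [X in _ + X]eq_bigr => i _ do rewrite big_mkcond.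
rewrite !big_ord_recl !big_ord0 /= ?addr0 ?add0r expr0 mul1r !expr1 !mulN1r.
rewrite -/o0 -/o1 -/o2 [(-1) ^+ _](_ : _ = 1) ?mul1r; last by rewrite /bump /= sqrrN expr1n.
have E (i : 'I_3) : (fun q => w q (fun l => v3 X Y Z (lift i l) q)) =
    fun q => w q (v2 (v3 X Y Z (lift i ord0) q) (v3 X Y Z (lift i (lift ord0 ord0)) q)).
  by apply/funext => q; congr (w q); exact: v2E.
rewrite !E.
have V0 : v3 X Y Z o0 = X by rewrite /v3 vc0.
have V1 : v3 X Y Z o1 = Y by rewrite /v3 vcS /v2 vc0.
have V2 : v3 X Y Z o2 = Z by rewrite /v3 vcS /v2 vcS.
rewrite l10 l11 l20 l21 -/o1 -/o2 V0 V1 V2.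
rewrite [X in _ + (- w p X + _ + _)]v2E l10 l11.
rewrite [X in _ + (_ + w p X + _)]v2E l20 l21.
rewrite [X in _ + (_ + _ + w p X)]v2E l20 l21.
rewrite !eqxx V0 V1 V2 /=; ring.
Qed.

(** This is how the equations for the contractions i_(u^R) sigma are differentiated: the right side
    involves [w] only through contractions with X, Y and their bracket. *)
Lemma cartan2 (w : preform M 2) X Y p z : decform w -> vfield X -> vfield Y -> tangent p z ->
  extd w p (v3 (X p) (Y p) z) = extd (iprod Y w) p (v2 (X p) z) - extd (iprod X w) p (v2 (Y p) z)
    - z (fun q => w q (v2 (X q) (Y q))) - w p (v2 (bracket X Y p) z).
Proof.
move=> dw vX vY tz; have [Z [vZ <-]] := tan_extend tz.
rewrite extd2E // !extd1E //; try exact: dec_iprod.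
have tX := vf_tan p vX; have tY := vf_tan p vY; have tZ := vf_tan p vZ.
have tXZ : tangent p (bracket X Z p) by exact: bracket_tan.
rewrite !iprod1E -[fun q => iprod Y w q (v1 (Z q))]/(fun q => w q (v2 (Y q) (Z q))).
rewrite -[fun q => iprod Y w q (v1 (X q))]/(fun q => w q (v2 (Y q) (X q))).
rewrite -[fun q => iprod X w q (v1 (Z q))]/(fun q => w q (v2 (X q) (Z q))).
rewrite -[fun q => iprod X w q (v1 (Y q))]/(fun q => w q (v2 (X q) (Y q))).
have -> : (fun q => w q (v2 (Y q) (X q))) = fun q => - w q (v2 (X q) (Y q)).
  by apply/funext => q; rewrite skew2 //; exact: vf_tan.
rewrite (tan_opp tZ); last exact: C2.
rewrite (skew2 dw tY tXZ); ring.
Qed.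

End LowDegree.

(** * Submersions and basic forms *)

Section Submersions.
Context {R : realType}.

Definition joinc (M : Type) n k (a : 'I_n -> M -> R) (b : 'I_k -> M -> R) (j : 'I_(n + k)) : M -> R :=
  match fintype.split j with inl i => a i | inr i => b i end.

Lemma joincl (M : Type) n k (a : 'I_n -> M -> R) (b : 'I_k -> M -> R) i : joinc a b (lshift k i) = a i.
Proof. by rewrite /joinc -[lshift k i]/(unsplit (inl i)) unsplitK. Qed.

Lemma joincr (M : Type) n k (a : 'I_n -> M -> R) (b : 'I_k -> M -> R) i : joinc a b (rshift n i) = b i.
Proof. by rewrite /joinc -[rshift n i]/(unsplit (inr i)) unsplitK. Qed.

Lemma joinc_C (M : smoothSpace R) n k (a : 'I_n -> M -> R) (b : 'I_k -> M -> R) :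
  (forall i, Cinf M (a i)) -> (forall i, Cinf M (b i)) -> forall j, Cinf M (joinc a b j).
Proof. by move=> Ca Cb j; rewrite /joinc; case: fintype.split. Qed.

Lemma xv_joinc (M : smoothSpace R) n k (a : 'I_n -> M -> R) (b : 'I_k -> M -> R) q :
  xv (joinc a b) q = row_mx (xv a q) (xv b q).
Proof.
by apply/rowP => j; rewrite !mxE /joinc; case: fintype.split => i; rewrite mxE.
Qed.

Lemma norm_row_mx n k (a : 'rV[R]_n) (b : 'rV[R]_k) (e : R) : 0 < e ->
  (`|row_mx a b| < e) = (`|a| < e) && (`|b| < e).
Proof.
move=> e0; apply/(mx_norm_ltP _ e0)/andP => [H|[/(mx_norm_ltP _ e0) Ha /(mx_norm_ltP _ e0) Hb] j].
  split; apply/(mx_norm_ltP _ e0) => i.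
    by have := H (lshift k i); rewrite row_mxEl.
  by have := H (rshift n i); rewrite row_mxEr.
by rewrite mxE; case: fintype.split.
Qed.

Lemma complete_rows n m (A : 'M[R]_(n, m)) : row_free A ->
  exists k (C : 'M[R]_(k, m)), m = (n + k)%N /\ row_full (col_mx A C).
Proof.
move=> fA; exists (\rank (A^C)%MS), (row_base (A^C)%MS).
have rA : \rank A = n by apply/eqP.
have E : (m = n + \rank (A^C)%MS)%N by rewrite mxrank_compl rA subnKC // -rA rank_leq_col.
split=> //; rewrite -sub1mx; apply: (@submx_trans _ _ _ _ _ _ (A + A^C)%MS).
  by rewrite sub1mx addsmx_compl_full.
by rewrite -addsmxE addsmxS // eq_row_base.
Qed.

Section Shrink.
Context {M : smoothSpace R} {sM : sspace M} (p : M) n (x : 'I_n -> M -> R) (U : set M) (r : R).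
Hypothesis co : coords p x U r.

Lemma xball_open e : open [set q | `|xv x q - xv x p| < e].
Proof.
have : open (xv x @^-1` [set y : 'rV[R]_n | `|y - xv x p| < e]).
  apply: open_comp; last exact: open_nball.
  by move=> q _; apply: C_xv_cts => i; exact: co_C co i.
by [].
Qed.

Lemma coords_shrink r' : 0 < r' <= r -> coords p x (U `&` [set q | `|xv x q - xv x p| < r']) r'.
Proof.
move=> /andP[r'0 rr]; have oU' : open (U `&` [set q | `|xv x q - xv x p| < r']).
  by apply: openI; [exact: co_open co|exact: xball_open].
split=> //.
- by split; [exact: co_p co|rewrite /= subrr normr0].
- exact: co_C co.
- by move=> q q' [Uq _] [Uq' _]; exact: co_inj co _ _ Uq Uq'.
- by move=> q [].
- move=> y yr; have [|q Uq qy] := co_surj co (y := y); first exact: lt_le_trans rr.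
  by exists q => //; split=> //=; rewrite qy.
- move=> q W Uq nW; have nU' : nbhs q (W `&` (U `&` [set q | `|xv x q - xv x p| < r'])).
    by apply: filterI => //; apply: open_nbhs_nbhs; split.
  have := co_opn co Uq.1 nU'; apply: filterS => y [q' [_ [Wq' Uq'] qy]].
  by exists q'.
- by move=> f q Cf [Uq _]; exact: co_rep co _ _ Cf Uq.
Qed.

(** [co_rep] represents germs only; here one F serves on the whole box, as integration along the
    fibres demands. The inverse of the coordinates makes h a smooth function on the ball of radius
    r; a third of the radius leaves room for [smooth_extend], which doubles it. *)
Lemma coords_glob : exists U' r', [/\ U' `<=` U, coords p x U' r' &
  forall h, Cinf M h -> exists2 F, smooth_on setT F & forall q, U' q -> h q = F (xv x q)].
Proof.
have r0 := co_r co; have r30 : 0 < r / 3 by rewrite divr_gt0.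
exists (U `&` [set q | `|xv x q - xv x p| < r / 3]), (r / 3); split; first by move=> q [].
  by apply: coords_shrink; rewrite r30 /=; lra.
move=> h Ch; pose psi y := xget p [set q | U q /\ xv x q = y].
have psiE q : U q -> psi (xv x q) = q.
  move=> Uq; rewrite /psi; case: xgetP => [q' _ [Uq' /(co_inj co Uq' Uq)]//|/(_ q)[]//].
have sh : smooth_on [set y | `|y - xv x p| < r] (h \o psi).
  apply: smooth_on_local => y yr; have [q Uq qy] := co_surj co yr.
  have [F sF hF] := co_rep co Ch Uq; have nW : nbhs y [set y | exists q', [/\ U q', h q' = F (xv x q') & xv x q' = y]].
    by have := co_opn co Uq hF; rewrite qy; exact.
  move: nW; rewrite nbhsE => -[W [oW Wy] WF].
  exists W, F; split=> //; first exact: smooth_sub sF.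
  by move=> y' /WF [q' [Uq' hq' <-]] /=; rewrite psiE.
have [y yr|F sF FE] := smooth_extend (p := xv x p) (open_nball (p := xv x p) (r := r)) r30 _ sh.
  by apply: le_lt_trans yr _; lra.
exists F => // q [Uq qr]; rewrite FE /= ?psiE //; exact: ltW.
Qed.

End Shrink.

Lemma frame_shrink (M : smoothSpace R) (p : M) n (x : 'I_n -> M -> R) E U r U' r' :
  frame p x E U r -> U' `<=` U -> coords p x U' r' -> frame p x E U' r'.
Proof.
move=> fr UU co; split=> // [|q i j Uq]; first exact: fr_vf fr.
by apply: fr_x fr _ _ _ _; exact: UU.
Qed.

Section AtPoint.
Context {M N : smoothSpace R} {nM : nice M} {nN : nice N} (f : M -> N) (sf : smooth_map f) (p : M).
Hypothesis sub : forall w, tangent (f p) w -> exists2 v, tangent p v & Tmap f v = w.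

(** The differential of f is onto, so its matrix [A] has independent rows and can be completed by
    constant rows [C] to an invertible matrix. The inverse function theorem then applies to the
    functions x o f together with the linear combinations [C] of the old coordinates. *)
Lemma submersion_coords : exists n k (x : 'I_n -> N -> R) V s (y : 'I_k -> M -> R) U r,
  coords (f p) x V s /\ coords p (joinc (fun i => x i \o f) y) U r.
Proof.
have [n [x [D [V [s [frN _]]]]]] := frame_exists (@filter_nbhsT _ (nbhs (f p)) _).
have [m [z [E [U [r [frM _]]]]]] := frame_exists (@filter_nbhsT _ (nbhs p) _).
have coN := fr_co frN; have coM := fr_co frM; have Vp := co_p coN; have Up := co_p coM.
have Cx i : Cinf N (x i) by exact: co_C coN i.
have Cz i : Cinf M (z i) by exact: co_C coM i.
have Cxf i : Cinf M (x i \o f) by exact: sf.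
pose A : 'M[R]_(n, m) := \matrix_(i, a) E a p (x i \o f).
have fA : row_free A.
  have H i : exists v, tangent p v /\ Tmap f v = D i (f p).
    by have [v tv vE] := sub (vf_tan (f p) (fr_vf frN i)); exists v.
  have [v Hv] := choice H.
  apply/row_freeP; exists ((\matrix_(i, a) v i (z a))^T); apply/matrixP => j i.
  rewrite !mxE; have [tv vE] := Hv i.
  have := congr1 (fun w : tvec N => w (x j)) vE.
  rewrite /= TmapE // (fr_x frN) // {1}(frame_span frM Up tv) tv_sum => <-.
  by apply: eq_bigr => a _; rewrite !mxE tvZ mulrC.
have [k [C [mE full]]] := complete_rows fA; subst m.
have HF i : exists F, smooth_on setT F /\ \forall q \near p, x i (f q) = F (xv z q).
  by have [F sF HF] := co_rep coM (Cxf i) Up; exists F.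
have [F HF'] := choice HF.
pose W (j : 'I_(n + k)) : 'rV[R]_(n + k) -> R :=
  match fintype.split j with inl i => F i | inr a => fun y => \sum_b C a b * y 0 b end.
have sW j : smooth_on setT (W j).
  rewrite /W; case: fintype.split => i; first by have [] := HF' i.
  apply: smooth_sum; first exact: openT.
  by move=> b _; apply: smooth_mul; [exact: openT|exact: smooth_cst|exact: smooth_coord].
pose y (a : 'I_k) q := \sum_b C a b * z b q.
have Cy a : Cinf M (y a) by apply: C_sum => b _; exact: C_scale.
pose w := joinc (fun i => x i \o f) y.
have Cw j : Cinf M (w j) by exact: joinc_C.
have wW : \forall q \near p, forall j, w j q = W j (xv z q).
  have H i : \forall q \near p, x i (f q) = F i (xv z q) by have [] := HF' i.
  apply: filterS (filter_forall (nbhs_filter p) H) => q Hq j.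
  rewrite /w /joinc /W; case: fintype.split => i /=; first exact: Hq.
  by apply: eq_bigr => b _; rewrite mxE.
have CW j : Cinf M (fun q => W j (xv z q)) by apply: C_comp; [exact: sW|exact: Cz].
have Jac : (\matrix_(i, j) pd i (W j) (xv z p)) \in unitmx.
  have -> : (\matrix_(i, j) pd i (W j) (xv z p)) = (col_mx A C)^T.
    apply/matrixP => i j; rewrite !mxE.
    have <- : E i p (w j) = pd i (W j) (xv z p).
      rewrite (tan_near (vf_tan p (fr_vf frM i)) (Cw j) (CW j)); last first.
        by apply: filterS wW => q.
      rewrite (tan_chain (vf_tan p (fr_vf frM i)) (sW j) Cz) (bigD1 i) //= (fr_x frM) // eqxx mulr1.
      by rewrite big1 ?addr0 // => l /negPf li; rewrite (fr_x frM) // li mulr0.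
    rewrite /w /joinc; case: fintype.split => l; rewrite ?mxE //.
    rewrite (tan_sumf (vf_tan p (fr_vf frM i))); last by move=> b; exact: C_scale.
    rewrite (bigD1 i) //= (tan_scale (vf_tan p (fr_vf frM i))) // (fr_x frM) // eqxx mulr1.
    by rewrite big1 ?addr0 // => b /negPf bi; rewrite (tan_scale (vf_tan p (fr_vf frM i))) // (fr_x frM) // bi mulr0.
  by rewrite unitmx_tr -row_full_unit.
have [G [A' [e [e0 [oA' A'p] sG GW WG]]]] := inverse_function sW Jac.
pose Wv (c : 'rV[R]_(n + k)) := \row_i W i c.
have cz q : {for q, continuous (xv z)} by exact: C_xv_cts.
have cWz q : {for q, continuous (fun q => Wv (xv z q))}.
  by apply: continuous_row => i; exact: C_cts (CW i).
have [W0 [oW0 W0p] W0E] : exists2 W0, open_nbhs p W0 & forall q, W0 q -> forall j, w j q = W j (xv z q).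
  have : nbhs p [set q | forall j, w j q = W j (xv z q)] := wW.
  by rewrite nbhsE => -[W0 oW0 H]; exists W0.
have oB : open ((fun q => Wv (xv z q)) @^-1` [set c | `|c - Wv (xv z p)| < e]).
  by apply: open_comp => [q _|]; [exact: cWz|exact: open_nball].
have oA : open (xv z @^-1` A') by apply: open_comp => // q _; exact: cz.
pose U' := U `&` W0 `&` (xv z @^-1` A' `&` (fun q => Wv (xv z q)) @^-1` [set c | `|c - Wv (xv z p)| < e]).
have oU' : open U'.
  by apply: openI; apply: openI => //; exact: co_open coM.
have wv q : U' q -> xv w q = Wv (xv z q).
  by move=> [[_ W0q] _]; apply/rowP => j; rewrite !mxE W0E.
have zG q : U' q -> xv z q = \row_i G i (xv w q).
  move=> Uq; rewrite wv //; have [_ [Aq _]] := Uq.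
  by rewrite [RHS](_ : _ = xv z q) // -[RHS](GW _ Aq).
have [|||||U'' [r'' [_ co _]]] := @coords_build R M _ p _ w U' oU'.
- by split; split=> //=; rewrite subrr normr0.
- exact: Cw.
- move=> q q' Uq Uq' E1; have [[Uq1 _] _] := Uq; have [[Uq1' _] _] := Uq'.
  by apply: (co_inj coM) => //; rewrite zG // [RHS]zG // E1.
- move=> q B Uq nB; have [[Uq1 _] [_ Wq]] := Uq.
  have nBU : nbhs q (B `&` U') by apply: filterI => //; apply: open_nbhs_nbhs.
  have := co_opn coM Uq1 nBU; rewrite zG // => nG.
  have cG : {for xv w q, continuous (fun c => \row_i G i c)}.
    by apply: continuous_row => i; exact: smooth_on_cts (sG i) I.
  have : nbhs (xv w q) [set c | `|c - Wv (xv z p)| < e].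
    by apply: open_nbhs_nbhs; split; [exact: open_nball|rewrite /= wv].
  have cG' : nbhs (xv w q) _ := cG _ nG; move=> nE.
  apply: filterS2 cG' nE => c [q' [_ [Bq' Uq'] q'c]] ce.
  exists q'; split=> //; rewrite wv // q'c.
  by have [] := WG c ce.
- move=> h q Ch Uq; have [[Uq1 _] _] := Uq; have [H sH hH] := co_rep coM Ch Uq1.
  exists (fun c => H (\row_i G i c)).
    by apply: (smooth_on_comp openT (fun _ _ => Logic.I) _ sH) => i; exact: sG.
  have nU' : nbhs q U' by apply: open_nbhs_nbhs.
  by apply: filterS2 hH nU' => q' -> Uq'; rewrite -zG.
by exists n, k, x, V, s, y, U'', r''.
Qed.

End AtPoint.

(* Coordinates adapted to a submersion f: coordinates x of the base pulled
   back along f, together with coordinates y along the fibres. *)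
Record sframe (M N : smoothSpace R) (f : M -> N) (p : M) n k (x : 'I_n -> N -> R) (V : set N) (s : R)
    (y : 'I_k -> M -> R) (E : 'I_(n + k) -> M -> tvec M) (U : set M) (r : R) : Prop := SFrame {
  sf_base : coords (f p) x V s;
  sf_fr : frame p (joinc (fun i => x i \o f) y) E U r;
  sf_V : forall q, U q -> V (f q);
  sf_glob : forall h, Cinf M h -> exists2 F, smooth_on setT F &
    forall q, U q -> h q = F (xv (joinc (fun i => x i \o f) y) q) }.

Section SFrames.
Context {M N : smoothSpace R} {nM : nice M} {nN : nice N} (f : M -> N) (sf : smooth_map f).

Lemma sframe_exists p (W : set M) : nbhs p W ->
  (forall w, tangent (f p) w -> exists2 v, tangent p v & Tmap f v = w) ->
  exists n k x V s y E U r, @sframe M N f p n k x V s y E U r /\ U `<=` W.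
Proof.
move=> nW sub; have [n [k [x [V [s [y [U [r [coN coM]]]]]]]]] := submersion_coords sf sub.
have cf : continuous f by exact: smooth_cts.
have nV : nbhs p (f @^-1` V).
  by apply: cf; apply: open_nbhs_nbhs; split; [exact: co_open coN|exact: co_p coN].
have [E [U1 [r1 [fr1 _ UW]]]] := frame_of_coords coM (filterI nW nV).
have [U2 [r2 [UU co2 glob]]] := coords_glob (fr_co fr1).
exists n, k, x, V, s, y, E, U2, r2; split; last by move=> q /UU /UW[].
split=> //; first exact: frame_shrink fr1 UU co2.
by move=> q /UU /UW[].
Qed.

Context (p : M) n k (x : 'I_n -> N -> R) (V : set N) (s : R) (y : 'I_k -> M -> R)
  (E : 'I_(n + k) -> M -> tvec M) (U : set M) (r : R).
Hypothesis fr : sframe f p x V s y E U r.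
Let w := joinc (fun i => x i \o f) y.
Let frM := sf_fr fr.
Let coM := fr_co frM.
Let coN := sf_base fr.

Definition vert (a : 'I_k) : M -> tvec M := E (rshift n a).

Lemma sf_Cx i : Cinf N (x i). Proof. exact: co_C coN i. Qed.
Lemma sf_Cxf i : Cinf M (x i \o f). Proof. exact: sf (sf_Cx i). Qed.
Lemma sf_Cy i : Cinf M (y i). Proof. by have := co_C coM (rshift n i); rewrite joincr. Qed.
Lemma sf_Cw j : Cinf M (w j). Proof. exact: co_C coM j. Qed.
Lemma vert_vf a : vfield (vert a). Proof. exact: fr_vf frM _. Qed.

Lemma sf_Ey q j b : U q -> E j q (y b) = (rshift n b == j)%:R.
Proof. by move=> Uq; rewrite -(joincr (fun i => x i \o f) y) (fr_x frM). Qed.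

Lemma sf_Ex q j i : U q -> E j q (x i \o f) = (lshift k i == j)%:R.
Proof. by move=> Uq; rewrite -(joincl (fun i => x i \o f) y) (fr_x frM). Qed.

Lemma vert_y q a b : U q -> vert a q (y b) = (b == a)%:R.
Proof. by move=> Uq; rewrite /vert sf_Ey // (inj_eq (@rshift_inj _ _)). Qed.

Lemma base_tan_ext q v v' : V q -> tangent q v -> tangent q v' -> (forall i, v (x i) = v' (x i)) -> v = v'.
Proof.
move=> Vq tv tv' H; rewrite (dco_span coN Vq tv) (dco_span coN Vq tv').
by apply: eq_bigr => i _; rewrite H.
Qed.

Lemma Tf_eqP q v v' : U q -> tangent q v -> tangent q v' ->
  Tmap f v = Tmap f v' <-> forall i, v (x i \o f) = v' (x i \o f).
Proof.
move=> Uq tv tv'; split=> [H i|H].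
  by rewrite -(TmapE f v (sf_Cx i)) H TmapE //; exact: sf_Cx.
apply: (base_tan_ext (sf_V fr Uq)); [exact: Tmap_tan|exact: Tmap_tan|].
by move=> i; rewrite !TmapE //; exact: sf_Cx.
Qed.

Lemma vert_f q a : U q -> Tmap f (vert a q) = 0.
Proof.
move=> Uq; rewrite -(Tmap0 f); apply/(Tf_eqP Uq); [exact: vf_tan (vert_vf a)|exact: tan0|].
by move=> i; rewrite /vert sf_Ex // tv0 eq_lrshift.
Qed.

Lemma vert_span q v : U q -> tangent q v -> Tmap f v = 0 -> v = \sum_a v (y a) *: vert a q.
Proof.
move=> Uq tv v0; rewrite {1}(frame_span frM Uq tv) big_split_ord /= big1 ?add0r; last first.
  move=> i _; rewrite joincl -TmapE; [by rewrite v0 tv0 scale0r|exact: sf_Cx].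
by apply: eq_bigr => a _; rewrite joincr.
Qed.

Lemma sf_xvf q q' : U q -> U q' -> xv (fun i => x i \o f) q = xv (fun i => x i \o f) q' <-> f q = f q'.
Proof.
move=> Uq Uq'; split=> [H|H]; last by apply/rowP => i; rewrite !mxE /= H.
apply: (co_inj coN); [exact: sf_V fr _ Uq|exact: sf_V fr _ Uq'|].
by apply/rowP => i; have := congr1 (fun m : 'rV_n => m 0 i) H; rewrite !mxE.
Qed.

Lemma sf_ball q : U q -> `|xv (fun i => x i \o f) q - xv (fun i => x i \o f) p| < r /\ `|xv y q - xv y p| < r.
Proof.
move=> Uq; have := co_ball coM Uq; rewrite !xv_joinc opp_row_mx add_row_mx norm_row_mx; last exact: co_r coM.
by move=> /andP.
Qed.

Lemma sf_pt q (c : 'rV[R]_k) : U q -> `|c - xv y p| < r -> exists q', [/\ U q', f q' = f q & xv y q' = c].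
Proof.
move=> Uq cr; have [xr yr] := sf_ball Uq.
have [|q' Uq'] := co_surj coM (y := row_mx (xv (fun i => x i \o f) q) c).
  by rewrite xv_joinc opp_row_mx add_row_mx norm_row_mx ?xr //; exact: co_r coM.
rewrite xv_joinc => /eq_row_mx [E1 E2]; exists q'; split=> //.
by apply/sf_xvf.
Qed.

Lemma sf_eq q q' : U q -> U q' -> f q = f q' -> xv y q = xv y q' -> q = q'.
Proof.
move=> Uq Uq' E1 E2; apply: (co_inj coM) => //; rewrite !xv_joinc E2.
by have /sf_xvf -> : f q = f q'.
Qed.

Lemma vert_pd q h F a : U q -> Cinf M h -> smooth_on setT F -> (forall q, U q -> h q = F (xv w q)) ->
  vert a q h = pd (rshift n a) F (xv w q).
Proof.
move=> Uq Ch sF hF; have tE := vf_tan q (vert_vf a).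
have CF : Cinf M (fun q => F (xv w q)) by apply: C_comp => //; exact: sf_Cw.
rewrite (tan_near tE Ch CF); last by apply: filterS (frame_nbhs frM Uq) => q'; exact: hF.
rewrite (tan_chain tE sF sf_Cw) (bigD1 (rshift n a)) //= /vert /w (fr_x frM) // eqxx mulr1.
by rewrite big1 ?addr0 // => l /negPf li; rewrite (fr_x frM) // li mulr0.
Qed.

(** In the coordinates y a slice of the box is convex, so the mean value theorem applies to the
    segment joining the two points. *)
Lemma slice_const h : Cinf M h -> (forall q a, U q -> vert a q h = 0) ->
  forall q q', U q -> U q' -> f q = f q' -> h q = h q'.
Proof.
move=> Ch h0 q q' Uq Uq' fqq; have [F sF hF] := sf_glob fr Ch.
have [_ yq] := sf_ball Uq; have [_ yq'] := sf_ball Uq'.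
pose K := xv w q' - xv w q.
have Kl i : K 0 (lshift k i) = 0 by rewrite !mxE /w joincl /= fqq subrr.
have [t t01] := line_MVT (F := F) (w := xv w q) (k := K) (fun t _ => smooth_on_diff sF I).
rewrite /K subrKC -!hF // => /eqP; rewrite subr_eq => /eqP ->.
rewrite derive_pd; last exact: smooth_on_diff sF I.
rewrite big_split_ord /= big1 ?add0r; last by move=> i _; rewrite Kl mul0r.
rewrite big1 ?add0r // => a _.
have [|q1 [Uq1 fq1 yq1]] := @sf_pt q (xv y q + t *: (xv y q' - xv y q)) Uq.
  have -> : xv y q + t *: (xv y q' - xv y q) - xv y p =
      (1 - t) *: (xv y q - xv y p) + t *: (xv y q' - xv y p).
    by apply/rowP => i; rewrite !mxE; ring.
  have /andP[t0 t1] := t01; have r0 := co_r coM.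
  apply: le_lt_trans (ler_normD _ _) _; rewrite !normrZ (ger0_norm t0) (ger0_norm (_ : 0 <= 1 - t)) ?subr_ge0 //.
  have : (1 - t) * `|xv y q - xv y p| <= (1 - t) * r by rewrite ler_wpM2l ?subr_ge0 // ltW.
  have : t * `|xv y q' - xv y p| <= t * r by rewrite ler_wpM2l // ltW.
  have [->|tn0] := eqVneq t 0; first by rewrite !subr0 !mul1r !mul0r addr0.
  have tp : 0 < t by rewrite lt0r tn0.
  have : t * `|xv y q' - xv y p| < t * r by rewrite ltr_pM2l.
  by lra.
have -> : xv w q + t *: K = xv w q1.
  rewrite /K /w !xv_joinc opp_row_mx add_row_mx scale_row_mx add_row_mx yq1.
  have /(sf_xvf Uq1 Uq) -> : f q1 = f q by [].
  have /(sf_xvf Uq Uq') -> : f q = f q' by [].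
  by rewrite subrr scaler0 addr0.
by rewrite -(vert_pd _ Uq1 Ch sF hF) h0 // mulr0.
Qed.

(** [d] is read off on the slice y = y(p), which meets every fibre of the box. *)
Lemma descend h : Cinf M h -> (forall q a, U q -> vert a q h = 0) ->
  exists2 d, Cinf N d & forall q, U q -> h q = d (f q).
Proof.
move=> Ch h0; have [F sF hF] := sf_glob fr Ch.
exists (fun z => F (row_mx (xv x z) (xv y p))).
  apply: (C_compv sF (g := fun z => row_mx (xv x z) (xv y p))) => j.
  have -> : (fun z => row_mx (xv x z) (xv y p) 0 j) =
      match fintype.split j with inl i => x i | inr i => fun=> y i p end.
    by apply/funext => z; rewrite mxE; case: fintype.split => i; rewrite mxE.
  by case: fintype.split => i; [exact: sf_Cx|exact: C_cst].
move=> q Uq; have [|q' [Uq' fq' yq']] := @sf_pt q (xv y p) Uq.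
  by rewrite subrr normr0; exact: co_r coM.
rewrite (slice_const Ch h0 Uq Uq') // hF // /w xv_joinc yq' -fq'.
by congr (F (row_mx _ _)); apply/rowP => i; rewrite !mxE.
Qed.

Lemma vert_path q q' : U q -> U q' -> f q = f q' -> exists c : R -> M,
  [/\ c 0 = q, c 1 = q', forall t : R, 0 <= t <= 1 -> U (c t) /\ f (c t) = f q &
      forall t : R, 0 <= t <= 1 -> {for t, continuous c}].
Proof.
move=> Uq Uq' fqq; pose psi z := xget p [set q | U q /\ xv w q = z].
have psiE q1 : U q1 -> psi (xv w q1) = q1.
  move=> Uq1; rewrite /psi; case: xgetP => [q2 _ [Uq2 /(co_inj coM Uq2 Uq1)]//|/(_ q1)[]//].
pose z (t : R) := xv w q + t *: (xv w q' - xv w q).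
have zr t : 0 <= t <= 1 -> `|z t - xv w p| < r.
  move=> /andP[t0 t1]; have r0 := co_r coM.
  have b1 := co_ball coM Uq; have b2 := co_ball coM Uq'.
  have -> : z t - xv w p = (1 - t) *: (xv w q - xv w p) + t *: (xv w q' - xv w p).
    by apply/rowP => i; rewrite !mxE; ring.
  apply: le_lt_trans (ler_normD _ _) _; rewrite !normrZ (ger0_norm t0) (ger0_norm (_ : 0 <= 1 - t)) ?subr_ge0 //.
  have : (1 - t) * `|xv w q - xv w p| <= (1 - t) * r by rewrite ler_wpM2l ?subr_ge0 // ltW.
  have [->|tn0] := eqVneq t 0; first by rewrite !subr0 !mul1r !mul0r addr0.
  have tp : 0 < t by rewrite lt0r tn0.
  have : t * `|xv w q' - xv w p| < t * r by rewrite ltr_pM2l.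
  by lra.
have Hc t : 0 <= t <= 1 -> U (psi (z t)) /\ xv w (psi (z t)) = z t.
  by move=> /zr /(co_surj coM) [q1 Uq1 <-]; rewrite psiE.
exists (psi \o z); split.
- by rewrite /= /z scale0r addr0 psiE.
- by rewrite /= /z scale1r subrKC psiE.
- move=> t /Hc [Ut wt]; split=> //; apply/(sf_xvf Ut Uq)/rowP => i; rewrite !mxE /=.
  have := congr1 (fun m : 'rV[R]_(n + k) => m 0 (lshift k i)) wt.
  by rewrite !mxE /w joincl /= fqq subrr mulr0 addr0.
- move=> t /[dup] t01 /Hc [Ut wt] W nW.
  have cz : {for t, continuous z}.
    apply: (@continuousD _ _ _ (fun=> xv w q)); first exact: cst_continuous.
    by apply: continuousZl; exact: cvg_id.
  have := co_opn coM Ut nW; rewrite wt => H.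
  have H' : nbhs t (z @^-1` _) := cz _ H.
  by apply: filterS H' => t' /= [q1 [Uq1 Wq1 <-]]; rewrite psiE.
Qed.

End SFrames.
End Submersions.

(** * Induction along paths *)

Section Intervals.
Context {R : realType}.

(** The supremum of the t with Q 0 t is attained and cannot be less than 1. This replaces
    subdivisions by a Lebesgue number. *)
Lemma bisection (Q : R -> R -> Prop) : (forall a b c : R, Q a b -> Q b c -> Q a c) ->
  (forall t : R, 0 <= t <= 1 -> exists2 e : R, 0 < e & forall a b : R, 0 <= a -> a <= b -> b <= 1 ->
     `|a - t| < e -> `|b - t| < e -> Q a b) -> Q 0 1.
Proof.
move=> Qtr Qloc; pose S : set R := [set t | [/\ 0 <= t, t <= 1 & Q 0 t]].
have S0 : S 0.
  have [|e e0 He] := Qloc 0; first by rewrite lexx ler01.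
  by split=> //; apply: He; rewrite ?subrr ?normr0.
have hS : has_sup S by split; [exists 0|exists 1 => t []].
set s := sup S; have s0 : 0 <= s by exact: (sup_upper_bound hS).
have s1 : s <= 1 by apply: sup_le_ub => [|t []]; first by exists 0.
have [|e e0 He] := Qloc s; first by rewrite s0.
have [t [t0 t1 Q0t] st] := sup_adherent e0 hS; rewrite -/s in st.
have ts : t <= s by exact: (sup_upper_bound hS).
pose b := Num.min (s + e / 2) 1.
have sb : s <= b by rewrite /b le_min s1 andbT; lra.
have Q0b : Q 0 b.
  apply: Qtr Q0t _; apply: He => //; first exact: le_trans sb.
  - by rewrite /b ge_min lexx orbT.
  - by rewrite ler0_norm ?subr_le0 //; lra.
  - rewrite ger0_norm ?subr_ge0 //; have : b <= s + e / 2 by rewrite /b ge_min lexx.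
    by lra.
have bS : b <= s.
  by apply: (sup_upper_bound hS); split=> //; [exact: le_trans sb|rewrite /b ge_min lexx orbT].
suff b1 : b = 1 by rewrite -b1.
move: bS; rewrite /b; case: (leP (s + e / 2) 1) => //; lra.
Qed.

Lemma within_near (T : topologicalType) (c : R -> T) (t : R) (W : set T) :
  {within `[0, 1]%classic, continuous c} -> 0 <= t <= 1 -> nbhs (c t) W ->
  exists2 e : R, 0 < e & forall a : R, 0 <= a <= 1 -> `|a - t| < e -> W (c a).
Proof.
move=> cc t01 nW; have := cc t W nW.
rewrite -[nbhs (_ : subspace _)]/(nbhs_subspace _) -nbhs_subspace_in; last by rewrite /= in_itv.
rewrite /within /= => -[e e0 He]; exists e => // a a01 at_; apply: He; rewrite /= ?in_itv //.
by rewrite distrC.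
Qed.

(** The form in which connectedness of the fibres is used throughout: each point of [S] has a
    neighbourhood on which [P] passes from any point of [S] to any other. *)
Lemma path_ind (T : topologicalType) (S : set T) (P : T -> Prop) (c : R -> T) :
  {within `[0, 1]%classic, continuous c} -> (forall t : R, 0 <= t <= 1 -> S (c t)) ->
  (forall p, S p -> exists2 W, nbhs p W & forall q q', S q -> S q' -> W q -> W q' -> P q -> P q') ->
  P (c 0) -> P (c 1).
Proof.
move=> cc Sc H; apply: (bisection (Q := fun a b => P (c a) -> P (c b))); first by move=> a b d H1 H2 /H1/H2.
move=> t t01; have [W nW HW] := H _ (Sc t t01); have [e e0 He] := within_near cc t01 nW.
exists e => // a b a0 ab b1 at_ bt; have a01 : 0 <= a <= 1 by rewrite a0 (le_trans ab).
have b01 : 0 <= b <= 1 by rewrite b1 (le_trans a0).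
by apply: HW; [exact: Sc|exact: Sc|exact: He|exact: He].
Qed.

End Intervals.

(** * Vectors tangent to the fibres of a submersion *)

Section Vertical.
Context {R : realType} {M N : smoothSpace R} {nM : nice M} {nN : nice N} (f : M -> N) (sf : smooth_map f).

Lemma derive_line0 n (F : 'rV[R]_n -> R) (z k : 'rV[R]_n) : smooth_on setT F ->
  (\forall t \near (0 : R), F (z + t *: k) = 0) -> 'D_k F z = 0.
Proof.
move=> sF H; have := line_derive (t := 0) (w := z) (k := k) (smooth_on_diff sF I).
rewrite scale0r addr0 => D1; have D2 : is_derive (0 : R) (1 : R) (fun t => F (z + t *: k)) 0.
  by apply: (@near_eq_is_derive R R R (fun=> 0)); apply: filterS H => t ->.
by rewrite -(@derive_val _ _ _ _ _ _ _ D1) (@derive_val _ _ _ _ _ _ _ D2).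
Qed.

(** In adapted coordinates v is a combination of derivatives along lines that stay in the fibre
    through p, where h is zero. *)
Lemma vert_kill p (h : M -> R) v : (forall w, tangent (f p) w -> exists2 v, tangent p v & Tmap f v = w) ->
  Cinf M h -> tangent p v -> Tmap f v = 0 -> (\forall q \near p, f q = f p -> h q = 0) -> v h = 0.
Proof.
move=> sub Ch tv v0 h0.
have [n [k [x [V [s [y [E [U [r [fr _]]]]]]]]]] := sframe_exists sf (@filter_nbhsT _ (nbhs p) _) sub.
have coM := fr_co (sf_fr fr); have Up := co_p coM.
have [F sF hF] := sf_glob fr Ch.
rewrite (vert_span fr Up tv v0) tv_sum big1 // => a _; rewrite tvZ (vert_pd fr a Up Ch sF hF).
rewrite [pd _ _ _]derive_line0 ?mulr0 //.
have H := co_opn coM Up h0.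
set w := xv _ p; have cz : {for (0 : R), continuous (fun t : R => w + t *: (delta_mx 0 (rshift n a) : 'rV[R]_(n + k)))}.
  apply: (@continuousD _ _ _ (fun=> w)); first exact: cst_continuous.
  by apply: continuousZl; exact: cvg_id.
have H' : nbhs (w + (0 : R) *: (delta_mx 0 (rshift n a) : 'rV[R]_(n + k)))
    [set z | exists q', [/\ U q', f q' = f p -> h q' = 0 &
      xv (joinc (fun i => x i \o f) y) q' = z]].
  by rewrite scale0r addr0; exact: H.
have {}cz : nbhs (0 : R) _ := cz _ H'.
apply: filterS cz => t /= [q' [Uq' hq' wq']]; rewrite -wq' -hF //; apply: hq'.
apply/(sf_xvf fr Uq' Up)/rowP => i.
have := congr1 (fun m : 'rV[R]_(n + k) => m 0 (lshift k i)) wq'.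
by rewrite /w !mxE !joincl /= eq_lrshift mulr0 addr0.
Qed.

Section Fibre.
Context (subf : submersion f) (x0 : N).
Let F : set M := [set g | f g = x0].

(** Smooth functions on the fibre are local restrictions of functions on M, and [vert_kill] makes
    the value of v independent of the chosen extension. *)
Lemma fib_lift (p : subS F) v : tangent (set_val p) v -> Tmap f v = 0 ->
  exists2 w, tangent p w & Tmap (M := subS F) (N := M) set_val w = v.
Proof.
move=> tv v0; pose ext (u : subS F -> R) := [set U : M -> R | Cinf M U /\ \forall q \near p, u q = U (set_val q)].
pose w : tvec (subS F) := on_smooth (fun u => v (xget (fun=> 0) (ext u))).
have wE u U : Cinf (subS F) u -> Cinf M U -> (\forall q \near p, u q = U (set_val q)) -> w u = v U.
  move=> Cu CU uU; rewrite /w on_smoothE //; set U' := xget _ _.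
  have [CU' uU'] : ext u U' by rewrite /U'; case: xgetP => [U'' _ //|/(_ U)[]//].
  apply/eqP; rewrite -subr_eq0 -(tan_sub tv) //; apply/eqP.
  have C : Cinf M (fun x => U' x - U x) by exact: C_sub.
  apply: (vert_kill (@subf (set_val p)) C tv v0).
  have [W nW WE] := near_subS (filterI uU uU').
  apply: filterS nW => q Wq fq; have Fq : F q by rewrite /F /= fq; exact: (set_valP p).
  have [] := WE (SigSub (mem_set Fq)) Wq; rewrite /= => <- <-.
  exact: subrr.
exists w.
  split=> [u nC|a u u' Cu Cu'|u u' Cu Cu']; first by rewrite /w on_smooth_out.
  - have [U CU uU] := Cu p; have [U' CU' uU'] := Cu' p.
    rewrite (wE _ _ Cu CU uU) (wE _ _ Cu' CU' uU') -(tan_lin tv) //; apply: wE.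
    + by apply: C_add => //; exact: C_scale.
    + by apply: C_add => //; exact: C_scale.
    + by apply: filterS2 uU uU' => q -> ->.
  - have [U CU uU] := Cu p; have [U' CU' uU'] := Cu' p.
    rewrite (wE _ _ Cu CU uU) (wE _ _ Cu' CU' uU') (nbhs_singleton uU) (nbhs_singleton uU') -(tan_mul tv) //.
    apply: wE; [exact: C_mul|exact: C_mul|].
    by apply: filterS2 uU uU' => q -> ->.
apply/funext => h; have [Ch|nC] := pselect (Cinf M h).
  rewrite TmapE //; apply: wE => //; first exact: val_smooth.
  by near=> q.
by rewrite /Tmap on_smooth_out //; have [-> //] := tv.
Unshelve. all: by end_near. Qed.

End Fibre.
End Vertical.

Section Gate.
Context {R : realType} {M : smoothSpace R} {nM : nice M}.

(** Enforces the first clause of [is_form], that a form vanishes off tangent vectors. *)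
Definition gate k (w : preform M k) : preform M k :=
  fun p v => if `[< forall i, tangent p (v i) >] then w p v else 0.

Lemma gateE k (w : preform M k) : form_eq (gate w) w.
Proof. by move=> p v tv; rewrite /gate asboolT. Qed.

Lemma dec_gate k (w : preform M k) : decform w -> decform (gate w).
Proof. by move=> dw; apply: dec_eq dw; exact: gateE. Qed.

Lemma gate_form k (w : preform M k) : decform w -> is_form (gate w).
Proof.
by move=> dw; apply: dec_form => [|p v nv]; [exact: dec_gate|rewrite /gate asboolF].
Qed.

Lemma slot0 k (w : preform M k.+1) p (V : set (tvec M)) (v : 'I_k.+1 -> tvec M) i : decform w ->
  (forall u (v : 'I_k -> tvec M), V u -> tangent p u -> (forall j, tangent p (v j)) -> w p (vc u v) = 0) ->
  (forall j, tangent p (v j)) -> V (v i) -> w p v = 0.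
Proof.
move=> dw H tv Vi; rewrite -(gateE w tv) (form_front i (gate_form dw) tv) gateE.
  by rewrite H ?mulr0.
by apply: vcP.
Qed.

(** The vectors are exchanged one slot at a time; each exchange alters the value by a term with an
    argument in [V]. *)
Lemma slots_congr k (w : preform M k.+1) p (V : set (tvec M)) (v v' : 'I_k.+1 -> tvec M) : decform w ->
  (forall u (v : 'I_k -> tvec M), V u -> tangent p u -> (forall j, tangent p (v j)) -> w p (vc u v) = 0) ->
  (forall j, tangent p (v j)) -> (forall j, tangent p (v' j)) -> (forall j, V (v j - v' j)) ->
  w p v = w p v'.
Proof.
move=> dw H tv tv' Vv.
pose u m (l : 'I_k.+1) := if (l < m)%N then v l else v' l.
have tu m l : tangent p (u m l) by rewrite /u; case: ifP.
have -> : v = u k.+1 by apply/funext => l; rewrite /u ltn_ord.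
have -> : v' = u 0 by apply/funext => l.
suff Hm m : (m <= k.+1)%N -> w p (u m) = w p (u 0) by exact: Hm.
elim: m => // m IH mk; rewrite -IH ?(ltnW mk) //; pose i := Ordinal mk.
have E1 : u m.+1 = [eta (u m) with i |-> (1 : R) *: (v i - v' i) + v' i].
  apply/funext => l /=; rewrite scale1r subrK; case: eqP => [->|li]; first by rewrite /u ltnSn.
  rewrite /u ltnS leq_eqVlt; case: eqP => //= lm; case: li; exact: val_inj.
have E2 : u m = [eta (u m) with i |-> v' i].
  by apply/funext => l /=; case: eqP => // ->; rewrite /u ltnn.
have L := dec_lin i 1 dw (tu m) (tanB (tv i) (tv' i)) (tv' i).
rewrite E1 L mul1r -E2 (slot0 (V := V) (i := i) dw H) ?add0r //=; last by rewrite eqxx.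
by move=> j; case: eqP => // _; exact: tanB.
Qed.

End Gate.

(** * Forms that are horizontal together with their differential *)

Section Basic.
Context {R : realType} {M N : smoothSpace R} {nM : nice M} {nN : nice N} (f : M -> N) (sf : smooth_map f).

Definition horizontal_at k (w : preform M k.+1) (q : M) : Prop := forall u (v : 'I_k -> tvec M),
  Tmap f u = 0 -> tangent q u -> (forall j, tangent q (v j)) -> w q (vc u v) = 0.

Lemma horizontal_congr k (w : preform M k.+1) q v v' : decform w -> horizontal_at w q ->
  (forall j, tangent q (v j)) -> (forall j, tangent q (v' j)) ->
  (forall j, Tmap f (v j) = Tmap f (v' j)) -> w q v = w q v'.
Proof.
move=> dw H tv tv' E; apply: (slots_congr (V := [set u | Tmap f u = 0])) => // j /=.
by rewrite TmapB E subrr.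
Qed.

Section Box.
Context (p : M) n k (x : 'I_n -> N -> R) (V : set N) (s : R) (y : 'I_k -> M -> R)
  (E : 'I_(n + k) -> M -> tvec M) (U : set M) (r : R).
Hypothesis fr : sframe f p x V s y E U r.
Let frM := sf_fr fr.

(** The Lie derivative of w along a vertical field V is i_V dw + d i_V w = 0. Concretely, V is a
    coordinate field and the base vectors are extended by combinations, with constant coefficients,
    of coordinate fields, so that Koszul's formula for dw(V, X) reduces to V(w(X)). *)
Lemma basic_const m (w : preform M m.+1) : decform w ->
  (forall q, U q -> horizontal_at w q) -> (forall q, U q -> horizontal_at (extd w) q) ->
  forall q q' v v', U q -> U q' -> f q = f q' ->
  (forall j, tangent q (v j)) -> (forall j, tangent q' (v' j)) ->
  (forall j, Tmap f (v j) = Tmap f (v' j)) -> w q v = w q' v'.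
Proof.
move=> dw Hw Hdw q q' v v' Uq Uq' fqq tv tv' Tv.
pose X j (z : M) := \sum_i v j (x i \o f) *: E (lshift k i) z.
have vX j : vfield (X j).
  apply: vf_sum => i _; apply: (vf_scale (a := fun=> v j (x i \o f))); first exact: C_cst.
  exact: fr_vf frM _.
have XE j z i : U z -> X j z (x i \o f) = v j (x i \o f).
  move=> Uz; rewrite /X tv_sum (bigD1 i) //= tvZ (sf_Ex fr) // eqxx mulr1 big1 ?addr0 // => i' i'i.
  by rewrite tvZ (sf_Ex fr) // (inj_eq (@lshift_inj _ _)) eq_sym (negPf i'i) mulr0.
have tX j z : tangent z (X j z) by exact: vf_tan.
rewrite (@horizontal_congr _ w q v (fun j => X j q)) //; last first.
- by move=> j; apply/(Tf_eqP sf fr Uq) => // i; rewrite XE.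
- exact: Hw.
rewrite [RHS](@horizontal_congr _ w q' v' (fun j => X j q')) //; last first.
- move=> j; apply/(Tf_eqP sf fr Uq') => // i; rewrite XE //.
  by rewrite -(TmapE f (v j)) ?Tv ?TmapE //; exact: sf_Cx fr i.
- exact: Hw.
have CX : Cinf M (fun z => w z (fun j => X j z)) by exact: rep_C.
apply: (slice_const fr CX _ Uq Uq' fqq) => z a Uz.
pose Y := vc (vert E a) X; have vY j : vfield (Y j) by apply: vcP => //; exact: vert_vf fr a.
have Yt z' j : tangent z' (Y j z') by exact: vf_tan.
have : extd w z (fun j => Y j z) = koszul w Y z by exact: extd_koszul.
have -> : (fun i => Y i z) = vc (vert E a z) (fun j => X j z).
  by rewrite /Y (vc_map (fun A : M -> tvec M => A z)).
have V0 z' : U z' -> Tmap f (vert E a z') = 0 by apply: (vert_f sf fr).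
have Vt z' : tangent z' (vert E a z') by exact: vf_tan (vert_vf fr a).
rewrite (Hdw z Uz _ _ (V0 z Uz) (Vt z) (fun j => tX j z)).
rewrite /koszul big_ord_recl /= expr0 mul1r.
have z0 (u : 'I_m.+1 -> tvec M) : (forall j, tangent z (u j)) -> Tmap f (u ord0) = 0 -> w z u = 0.
  by move=> tu u0; rewrite -(vcE u); apply: Hw.
rewrite [X in _ + X + _]big1 ?addr0; last first.
  move=> i _; have -> : Y (lift ord0 i) z (fun q => w q (fun l => Y (lift (lift ord0 i) l) q)) = 0; last by rewrite mulr0.
  have t := vf_tan z (vY (lift ord0 i)); rewrite -(tan_cst t 0); apply: (tan_near t); [|exact: C_cst|].
    by apply: rep_C.
  apply: filterS (frame_nbhs frM Uz) => z' Uz'; rewrite -(vcE (fun l => Y (lift (lift ord0 i) l) z')).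
  have -> : lift (lift ord0 i) ord0 = ord0 by exact: val_inj.
  by rewrite /Y vc0; apply: Hw => //; exact: V0.
(* Every bracket term has a vertical vector in slot 0: either V itself or its bracket with one of
   the X j, which f maps to zero. *)
rewrite [X in _ + X]big1 ?addr0.
  move=> E0; rewrite [RHS]E0 /Y vc0; congr (vert E a z _); apply/funext => z'; congr (w z'); by apply/funext => l; rewrite vcS.
move=> i _; rewrite big1 // => j ij; rewrite z0 ?mulr0 // => [l|]; first by case: ifP => _; [exact: bracket_tan|].
have j0 : lift j ord0 = ord0.
  by apply: val_inj; rewrite /= /bump leqn0; case: eqP => // jE; rewrite jE in ij.
rewrite j0; case: eqP => [<-|_]; last by rewrite /Y vc0; exact: V0.
have [j' ->] : exists j', j = lift ord0 j'.
  by case: (unliftP ord0 j) => [j' ->|E0]; [exists j'|rewrite E0 ltn0 in ij].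
rewrite /Y vc0 vcS -(Tmap0 f); apply/(Tf_eqP sf fr Uz); [|exact: tan0|].
  by apply: bracket_tan => //; exact: vert_vf fr a.
move=> l; have Cl : Cinf M (x l \o f) by exact: sf_Cxf fr l.
have Z0 (A B : M -> tvec M) (c : R) : vfield A -> vfield B -> (forall q, U q -> B q (x l \o f) = c) ->
    A z (fun q => B q (x l \o f)) = 0.
  move=> vA vB H; have t := vf_tan z vA; rewrite -(tan_cst t c).
  apply: (tan_near t); [exact: vf_C|exact: C_cst|].
  by apply: filterS (frame_nbhs frM Uz) => z'; exact: H.
rewrite bracketE // tv0 (Z0 _ _ (v j' (x l \o f))) ?(Z0 _ _ 0) ?subrr //.
- exact: vert_vf fr a.
- by move=> z' Uz'; rewrite /vert (sf_Ex fr) // eq_lrshift.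
- exact: vert_vf fr a.
- by move=> z' Uz'; exact: XE.
Qed.

End Box.

(** At e(f q) a horizontal form sees its arguments only through f, so it is determined by its
    pullback along e. Vanishing then spreads along a path in the fibre, from box to box by
    [basic_const]. *)
Lemma basic_zero m (w : preform M m.+1) (e : N -> M) : submersion f -> smooth_map e -> (forall x, f (e x) = x) ->
  (forall q, exists c : R -> M, [/\ {within `[0, 1]%classic, continuous c}, c 0 = e (f q), c 1 = q &
     forall t : R, 0 <= t <= 1 -> f (c t) = f q]) ->
  decform w -> (forall q, horizontal_at w q) -> (forall q, horizontal_at (extd w) q) ->
  form_eq (pullback e w) 0 -> form_eq w 0.
Proof.
move=> subf se fe path dw Hw Hdw ew q.
pose P z := forall v, (forall i, tangent z (v i)) -> w z v = 0.
suff : P q by [].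
have [c [cc c0 c1 fc]] := path q; rewrite -c1.
suff H0 : P (c 0) /\ forall p, f p = f q -> exists2 W, nbhs p W &
    forall z z', f z = f q -> f z' = f q -> W z -> W z' -> P z -> P z'.
  by apply: (@path_ind R M [set z | f z = f q] P c cc fc); case: H0.
split.
  rewrite c0 => v tv; pose v' i := Tmap e (Tmap f (v i)).
  have tfe i : tangent (f (e (f q))) (Tmap f (v i)) by exact: Tmap_tan.
  rewrite (@horizontal_congr _ w _ v v') //.
  - by have := ew (f q) (fun i => Tmap f (v i)); apply=> i; rewrite -[f q]fe.
  - by move=> i; apply: Tmap_tan => //; rewrite -[f q]fe.
  - move=> i; rewrite /v' Tmap_comp // (_ : f \o e = id); last by apply/funext => z /=; rewrite fe.
    by rewrite (Tmap_id (tfe i)).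
move=> p fp; have [n [k [x [V [s [y [E [U [r [fr _]]]]]]]]]] := sframe_exists sf (@filter_nbhsT _ (nbhs p) _) (@subf p).
have frM := sf_fr fr; have Up := co_p (fr_co frM); exists U.
  by have := frame_nbhs frM Up.
move=> z z' fz fz' Uz Uz' Pz v' tv'.
have H i : exists v, tangent z v /\ Tmap f v = Tmap f (v' i).
  have [|v tv vE] := @subf z (Tmap f (v' i)); last by exists v.
  by rewrite fz -fz'; exact: Tmap_tan.
have [v Hv] := choice H.
rewrite -(basic_const fr dw (fun q _ => Hw q) (fun q _ => Hdw q) (q := z) (v := v)) //.
- by apply: Pz => i; have [] := Hv i.
- by rewrite fz fz'.
- by move=> i; have [] := Hv i.
- by move=> i; have [] := Hv i.
Qed.

End Basic.

(** * Lie groupoids and right-invariant vector fields *)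

Section FibreProduct.
Context {R : realType} {M M' N : smoothSpace R} {nM : nice M} {nM' : nice M'} {nN : nice N}.
Context (f : M -> N) (g : M' -> N) (sf : smooth_map f) (sg : smooth_map g) (subf : submersion f).
Let F := subS (M := prodS M M') [set p | f p.1 = g p.2].

Definition fp1 (q : F) : M := (set_val q).1.
Definition fp2 (q : F) : M' := (set_val q).2.

Lemma fp1_smooth : smooth_map fp1.
Proof.
move=> h Ch; have C1 : Cinf (prodS M M') (h \o fst) by exact: fst_smooth Ch.
exact: val_smooth C1.
Qed.

Lemma fp2_smooth : smooth_map fp2.
Proof.
move=> h Ch; have C1 : Cinf (prodS M M') (h \o snd) by exact: snd_smooth Ch.
exact: val_smooth C1.
Qed.

Lemma fp_eq (q : F) : f (fp1 q) = g (fp2 q).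
Proof. exact: (set_valP q). Qed.

Lemma fp_inj (q q' : F) : fp1 q = fp1 q' -> fp2 q = fp2 q' -> q = q'.
Proof.
rewrite /fp1 /fp2 => E1 E2; apply: val_inj.
have : set_val q = set_val q' by rewrite [LHS]surjective_pairing E1 E2 -surjective_pairing.
exact.
Qed.

Lemma fp_tan_ext (q : F) v w : tangent q v -> tangent q w -> Tmap fp1 v = Tmap fp1 w ->
  Tmap fp2 v = Tmap fp2 w -> v = w.
Proof.
move=> tv tw E1 E2; apply: (@tan_sub_ext _ _ _ _ q v w tv tw).
have tV (x : tvec F) : tangent q x -> tangent (set_val q) (Tmap (M := F) (N := prodS M M') set_val x).
  by move=> tx; apply: Tmap_tan => //; exact: val_smooth.
apply: (@tan_prod_ext _ M M' _ _ (set_val q)); [exact: tV|exact: tV| |].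
  by rewrite !Tmap_comp //; exact: fst_smooth.
by rewrite !Tmap_comp //; exact: snd_smooth.
Qed.

Lemma fp_map (L : smoothSpace R) (sL : sspace L) (a : L -> M) (b : L -> M') : smooth_map a -> smooth_map b ->
  (forall l, f (a l) = g (b l)) ->
  exists2 c : L -> F, smooth_map c & (forall l, fp1 (c l) = a l) /\ (forall l, fp2 (c l) = b l).
Proof.
move=> sa sb E; have H l : [set p : prodS M M' | f p.1 = g p.2] (a l, b l) by exact: E.
exists (fun l => SigSub (mem_set (H l)) : F); last by split.
by apply: subS_smooth; exact: pair_smooth.
Qed.

Definition reps (T : smoothSpace R) n (w : 'I_n -> T -> R) (q : T) (u : T -> R) : Prop :=
  exists2 G, smooth_on setT G & \forall z \near q, u z = G (xv w z).

Lemma reps_coord (T : smoothSpace R) n (w : 'I_n -> T -> R) q j : reps w q (w j).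
Proof.
exists (fun y => y 0 j); first exact: smooth_coord.
by near=> z; rewrite mxE.
Unshelve. all: by end_near. Qed.

Lemma reps_comp (T : smoothSpace R) n (w : 'I_n -> T -> R) q k (u : 'I_k -> T -> R) Phi h :
  (forall i, reps w q (u i)) -> smooth_on setT Phi -> (\forall z \near q, h z = Phi (\row_i u i z)) -> reps w q h.
Proof.
move=> ru sP hP.
have H i : exists G, smooth_on setT G /\ \forall z \near q, u i z = G (xv w z).
  by have [G sG uG] := ru i; exists G.
have [G HG] := choice H.
exists (fun y => Phi (\row_i G i y)).
  by apply: (smooth_on_comp openT (fun _ _ => Logic.I) _ sP) => i; have [] := HG i.
have HG' i : \forall z \near q, u i z = G i (xv w z) by have [] := HG i.
apply: filterS2 hP (filter_forall (nbhs_filter q) HG') => z -> H'; congr Phi.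
by apply/rowP => i; rewrite !mxE H'.
Qed.

(** Since f o [fp1] = g o [fp2], the base coordinates of the first component are functions of the
    second. The fibre coordinates y of f and the coordinates z of M' remain. *)
Lemma fp_coords (p : F) : exists k m (y : 'I_k -> M -> R) (z : 'I_m -> M' -> R) U r Z e,
  coords (fp2 p) z Z e /\ coords p (joinc (fun i => y i \o fp1) (fun i => z i \o fp2)) U r.
Proof.
have [n [k [x [V [s [y [E [U [r [fr _]]]]]]]]]] := sframe_exists sf (@filter_nbhsT _ (nbhs (fp1 p)) _) (@subf (fp1 p)).
have [m [z [Z [e coz]]]] := nice_coords (fp2 p).
have coM := fr_co (sf_fr fr); have coN := sf_base fr.
have c1 : continuous fp1 by apply: smooth_cts; exact: fp1_smooth.
have c2 : continuous fp2 by apply: smooth_cts; exact: fp2_smooth.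
pose w := joinc (fun i => y i \o fp1) (fun i => z i \o fp2).
have Cw j : Cinf F (w j).
  apply: joinc_C => i; first by apply: fp1_smooth; exact: sf_Cy fr i.
  by apply: fp2_smooth; exact: co_C coz i.
pose U' := [set q : F | U (fp1 q) /\ Z (fp2 q)].
have oU' : open U'.
  have o1 : open (fp1 @^-1` U) by apply: open_comp => [q _|]; [exact: c1|exact: co_open coM].
  have o2 : open (fp2 @^-1` Z) by apply: open_comp => [q _|]; [exact: c2|exact: co_open coz].
  exact: openI.
have [|||||U'' [r'' [_ co _]]] := @coords_build R F _ p _ w U' oU'.
- by split; [exact: co_p coM|exact: co_p coz].
- exact: Cw.
- move=> q q' [Uq Zq] [Uq' Zq']; rewrite /w !xv_joinc => /eq_row_mx [Ey Ez].
  have E2 : fp2 q = fp2 q' by apply: (co_inj coz).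
  apply: fp_inj => //; apply: (sf_eq fr) => //; first by rewrite !fp_eq E2.
- move=> q W [Uq Zq] nW; have [B nB BW] := near_subS nW; have [[B1 B2] [/= n1 n2] BB] := nB.
  have := co_opn coM Uq n1; set w0 := xv _ (fp1 q) => /nbhs_ballP [d d0 Hd].
  (* Points h whose image under g is within d of that of [fp2 q]: a first component over g h with
     prescribed nearby fibre coordinates then exists in the box. *)
  pose T := [set h : M' | B2 h /\ V (g h) /\ `|xv x (g h) - xv x (g (fp2 q))| < d].
  have nT : nbhs (fp2 q) T.
    have cg : continuous g by exact: smooth_cts.
    have nV : nbhs (g (fp2 q)) V.
      by apply: open_nbhs_nbhs; split; [exact: co_open coN|rewrite -fp_eq; exact: sf_V fr _ Uq].
    have cx : {for fp2 q, continuous (fun h => xv x (g h))}.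
      by apply: continuous_row => i; apply: C_cts; exact: sg (sf_Cx fr i).
    have nd : nbhs (xv x (g (fp2 q))) [set c | `|c - xv x (g (fp2 q))| < d].
      by apply: open_nbhs_nbhs; split; [exact: open_nball|rewrite /= subrr normr0].
    have n3 : nbhs (fp2 q) (g @^-1` V) := cg (fp2 q) _ nV.
    have n4 : nbhs (fp2 q) ((fun h => xv x (g h)) @^-1` _) := cx _ nd.
    by apply: filterS (filterI n2 (filterI n3 n4)) => h [].
  have H2 := co_opn coz Zq nT.
  have cl : continuous (fun c : 'rV[R]_(k + m) => rsubmx c).
    have -> : (fun c : 'rV[R]_(k + m) => rsubmx c) = fun c => \row_i c 0 (rshift k i).
      by apply/funext => c; apply/rowP => i; rewrite !mxE.
    move=> c; apply: continuous_row => i.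
    by apply: (@smooth_on_cts R _ setT) => //; exact: smooth_coord.
  have cr : {for xv w q, continuous (fun c : 'rV[R]_(k + m) => rsubmx c)} by exact: cl.
  have H2' : nbhs (xv w q) ((fun c : 'rV[R]_(k + m) => rsubmx c) @^-1` [set y0 | exists q', [/\ Z q', T q' & xv z q' = y0]]).
    by apply: cr; rewrite /w xv_joinc row_mxKr.
  have nd : nbhs (xv w q) [set c | `|c - xv w q| < d].
    by apply: open_nbhs_nbhs; split; [exact: open_nball|rewrite /= subrr normr0].
  apply: filterS2 H2' nd => c [h [Zh [B2h [Vh dh]] zh]] cd.
  have [|q1 [Uq1 B1q1 wq1]] := Hd (row_mx (xv x (g h)) (lsubmx c)).
    rewrite -ball_normE /= distrC /w0 xv_joinc opp_row_mx add_row_mx norm_row_mx //.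
    apply/andP; split.
      have -> : xv (fun i => x i \o f) (fp1 q) = xv x (g (fp2 q)); last by [].
      by apply/rowP => i; rewrite !mxE /= fp_eq.
    have : `|row_mx (lsubmx c) (rsubmx c) - xv w q| < d by rewrite hsubmxK; exact: cd.
    rewrite /w xv_joinc opp_row_mx add_row_mx norm_row_mx // => /andP[+ _].
    by congr (`|_ - _| < _); apply/rowP => i; rewrite !mxE.
  move: wq1; rewrite xv_joinc => /eq_row_mx [Ex Ey].
  have fg : f q1 = g h.
    apply: (co_inj coN); [exact: sf_V fr _ Uq1|exact: Vh|].
    by rewrite -Ex; apply/rowP => i; rewrite !mxE.
  exists (SigSub (mem_set (fg : [set p : prodS M M' | f p.1 = g p.2] (q1, h))) : F); split.
    by apply: BW; apply: BB.
  rewrite -[RHS]hsubmxK -zh -Ey /w xv_joinc; congr row_mx; apply/rowP => i; by rewrite !mxE.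
- move=> h q Ch [Uq Zq]; have [Hb CHb hH] := Ch q; have [l [a [Phi [Ga sP HP]]]] := CHb (set_val q).
  have cv : {for q, continuous (set_val : F -> prodS M M')} by exact: val_cts.
  have zrep (u : M' -> R) : Cinf M' u -> reps w q (u \o fp2).
    move=> Cu; have [G sG uG] := co_rep coz Cu Zq.
    apply: (reps_comp (u := fun i => w (rshift k i)) _ sG) => [i|]; first exact: reps_coord.
    have uG' : nbhs q (fp2 @^-1` _) := c2 q _ uG.
    apply: filterS uG' => q' /= ->; congr G; apply/rowP => i; by rewrite !mxE /w joincr.
  have yrep (u : M -> R) : Cinf M u -> reps w q (u \o fp1).
    move=> Cu; have [G sG uG] := co_rep coM Cu Uq.
    apply: (reps_comp (u := fun j => joinc (fun i => x i \o f) y j \o fp1) _ sG) => [j|].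
      rewrite /joinc; case: fintype.split => i.
        have -> : (x i \o f) \o fp1 = (x i \o g) \o fp2 by apply/funext => q' /=; rewrite fp_eq.
        by apply: zrep; exact: sg (sf_Cx fr i).
      by rewrite -(joincl (fun i => y i \o fp1) (fun i => z i \o fp2)); exact: reps_coord.
    have uG' : nbhs q (fp1 @^-1` _) := c1 q _ uG.
    apply: filterS uG' => q' /= ->; congr G; apply/rowP => i; by rewrite !mxE.
  suff : reps w q h by [].
  apply: (reps_comp (u := fun i (z' : F) => a i (set_val z')) _ sP) => [i|].
    by have [[u Cu <-]|[u Cu <-]] := Ga i; [exact: yrep|exact: zrep].
  have HP' : nbhs q (set_val @^-1` _) := cv _ HP.
  by apply: filterS2 hH HP' => q' ->.
by exists k, m, y, z, U'', r'', Z, e.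
Qed.

#[local] Instance fp_nice : nice F.
Proof.
split; first exact: subS_sspace.
by move=> p; have [k [m [y [z [U [r [Z [e [_ co]]]]]]]]] := fp_coords p; do 4!eexists; exact: co.
Qed.

Lemma fp2_submersion : submersion fp2.
Proof.
move=> p v tv; have [k [m [y [z [U [r [Z [e [coz co]]]]]]]]] := fp_coords p.
have [E [U' [r' [fr _ _]]]] := frame_of_coords co (@filter_nbhsT _ (nbhs p) _).
have Up := co_p (fr_co fr).
have tw : tangent p (\sum_b v (z b) *: E (rshift k b) p).
  by apply: tan_sum => b _; apply: tanZ; exact: vf_tan (fr_vf fr _).
exists (\sum_b v (z b) *: E (rshift k b) p) => //.
have tT : tangent (fp2 p) (Tmap fp2 (\sum_b v (z b) *: E (rshift k b) p)).
  by apply: Tmap_tan => //; exact: fp2_smooth.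
rewrite (dco_span coz (co_p coz) tT) [RHS](dco_span coz (co_p coz) tv).
apply: eq_bigr => i _; congr (_ *: _); rewrite TmapE; last exact: co_C coz i.
rewrite -(joincr (fun i => y i \o fp1) (fun i => z i \o fp2)) tv_sum (bigD1 i) //= tvZ.
rewrite (fr_x fr) // eqxx mulr1 big1 ?addr0 // => j /negPf ji.
by rewrite tvZ (fr_x fr) // (inj_eq (@rshift_inj _ _)) eq_sym ji mulr0.
Qed.

End FibreProduct.

Lemma gmul_map_smooth (R : realType) (K : manifold R) (GK : lieGroup K) (L : smoothSpace R) (sL : sspace L)
    (a b : L -> K) : smooth_map a -> smooth_map b -> smooth_map (fun l => gmul GK (a l) (b l)).
Proof.
move=> sa sb f Cf.
have sp : smooth_map (N := prodS K K) (fun l => (a l, b l)) by apply: pair_smooth.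
exact: (sp _ (@gmul_smooth _ _ GK _ Cf)).
Qed.

(** * Composable pairs and right-invariant vector fields *)

Section Groupoids.
Context {R : realType} {H N : manifold R} (G : lieGroupoid H N).
Local Notation s := (src G).
Local Notation t := (tgt G).
Local Notation e := (unit_at G).
Local Notation C := (composable G).

Lemma s_smooth : smooth_map s. Proof. exact: src_smooth. Qed.
Lemma t_smooth : smooth_map t. Proof. exact: tgt_smooth. Qed.
Lemma e_smooth : smooth_map e. Proof. exact: unit_smooth. Qed.

#[local] Instance C_nice : nice C.
Proof. by apply: fp_nice; [exact: s_smooth|exact: t_smooth|exact: src_submersion]. Qed.

Lemma cf_smooth : smooth_map (@comp_fst _ _ _ G). Proof. exact: fp1_smooth. Qed.
Lemma cs_smooth : smooth_map (@comp_snd _ _ _ G). Proof. exact: fp2_smooth. Qed.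
Lemma cm_smooth : smooth_map (@comp_mul _ _ _ G). Proof. exact: gcomp_smooth. Qed.

Lemma comp_eq (c : C) : s (comp_fst c) = t (comp_snd c). Proof. exact: fp_eq. Qed.

Lemma cs_submersion : submersion (@comp_snd _ _ _ G).
Proof. by apply: fp2_submersion; [exact: s_smooth|exact: t_smooth|exact: src_submersion]. Qed.

Lemma comp_pair (g h : H) : s g = t h -> exists c : C, comp_fst c = g /\ comp_snd c = h.
Proof. by move=> E; exists (SigSub (mem_set (E : [set p : prodS H H | s p.1 = t p.2] (g, h)))). Qed.

Lemma comp_map (L : smoothSpace R) (sL : sspace L) (a b : L -> H) : smooth_map a -> smooth_map b ->
  (forall l, s (a l) = t (b l)) ->
  exists2 c : L -> C, smooth_map c & (forall l, comp_fst (c l) = a l) /\ (forall l, comp_snd (c l) = b l).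
Proof. by move=> sa sb E; exact: (fp_map sL sa sb E). Qed.

Lemma comp_tan_ext (c : C) v w : tangent c v -> tangent c w ->
  Tmap (@comp_fst _ _ _ G) v = Tmap (@comp_fst _ _ _ G) w ->
  Tmap (@comp_snd _ _ _ G) v = Tmap (@comp_snd _ _ _ G) w -> v = w.
Proof. exact: fp_tan_ext. Qed.

Lemma gcomp_map_smooth (L : smoothSpace R) (sL : sspace L) (a b : L -> H) : smooth_map a -> smooth_map b ->
  (forall l, s (a l) = t (b l)) -> smooth_map (fun l => gcomp G (a l) (b l)).
Proof.
move=> sa sb E; have [c sc [c1 c2]] := comp_map sL sa sb E.
have -> : (fun l => gcomp G (a l) (b l)) = (@comp_mul _ _ _ G) \o c.
  by apply/funext => l; rewrite /= /comp_mul c1 c2.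
exact: smooth_comp sc cm_smooth.
Qed.

Section RightInvariant.
Local Notation val_ x := (set_val : source_fibre G x -> H).

Lemma fibre_eq x (k : source_fibre G x) : s (set_val k) = x.
Proof. exact: (set_valP k). Qed.

Lemma fibre_mk (g : H) x : s g = x -> exists k : source_fibre G x, set_val k = g.
Proof. by move=> E; exists (SigSub (mem_set (E : [set g : H | s g = x] g))). Qed.

Lemma fibre_inj x (k k' : source_fibre G x) : set_val k = set_val k' -> k = k'.
Proof. by move=> E; apply: val_inj; exact: E. Qed.

Lemma fibre_val_smooth x : smooth_map (val_ x).
Proof. exact: val_smooth. Qed.

Lemma fibre_map_smooth x (L : smoothSpace R) (sL : sspace L) (a : L -> source_fibre G x) :
  smooth_map (val_ x \o a) -> smooth_map a.
Proof. exact: subS_smooth. Qed.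

Lemma fibre_tan_ext x (k : source_fibre G x) v w : tangent k v -> tangent k w ->
  Tmap (val_ x) v = Tmap (val_ x) w -> v = w.
Proof. exact: tan_sub_ext. Qed.

Lemma fibre_lift x (k : source_fibre G x) v : tangent (set_val k) v -> Tmap s v = 0 ->
  exists2 w, tangent k w & Tmap (val_ x) w = v.
Proof. move=> tv v0.
by have [w tw wv] := @fib_lift R H N _ _ s s_smooth (@src_submersion _ _ _ G) x k v tv v0; exists w. Qed.

Lemma algd_lift x u : algd G x u -> exists (k : source_fibre G x) w,
  [/\ set_val k = e x, tangent k w & Tmap (val_ x) w = u].
Proof.
move=> [tu u0]; have [k kE] := fibre_mk (src_unit G x).
by have [|w tw wE] := @fibre_lift x k u _ u0; [rewrite kE|exists k, w].
Qed.

(** [rtrans] with the source fibre indexed by a free x instead of t g. Base points that are equal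
    but not convertible, such as t (gh) and t g, thereby share one type of fibre. *)
Definition rtr x (g : H) (k : source_fibre G x) : H := gcomp G (set_val k) g.

Lemma rtr_smooth x g : x = t g -> smooth_map (@rtr x g).
Proof.
move=> E; apply: gcomp_map_smooth; [exact: fibre_val_smooth|exact: smooth_cstmap|].
by move=> k; rewrite fibre_eq.
Qed.

Lemma right_invE u x (g : H) (k : source_fibre G x) w : x = t g -> set_val k = e x -> tangent k w ->
  Tmap (val_ x) w = u x -> right_inv G u g = Tmap (@rtr x g) w.
Proof.
move=> E; subst x => kE tw wu; rewrite /right_inv; congr (Tmap _ _).
case: xgetP => [w' _ [[k' k'E tw'] w'u]|/(_ w)]; last by case; split=> //; exists k.
have kk : k' = k by apply: fibre_inj; rewrite k'E kE.
by rewrite kk in tw'; apply: (fibre_tan_ext tw' tw); rewrite wu.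
Qed.

Context (u : N -> tvec H) (au : forall x, algd G x (u x)).

Lemma ri_tan g : tangent g (right_inv G u g).
Proof.
have [k [w [kE tw wu]]] := algd_lift (au (t g)).
rewrite (right_invE (erefl _) kE tw wu).
have gE : @rtr (t g) g k = g by rewrite /rtr kE gcomp_unitl.
have : tangent (@rtr (t g) g k) (Tmap (@rtr (t g) g) w) by apply: Tmap_tan => //; exact: rtr_smooth.
by rewrite gE.
Qed.

Lemma ri_s g : Tmap s (right_inv G u g) = 0.
Proof.
have [k [w [kE tw wu]]] := algd_lift (au (t g)).
rewrite (right_invE (erefl _) kE tw wu) Tmap_comp; last exact: s_smooth.
have -> : s \o @rtr (t g) g = fun=> s g.
  by apply/funext => k' /=; rewrite /rtr src_comp // fibre_eq.
exact: Tmap_cst tw.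
Qed.

Lemma ri_t g : Tmap t (right_inv G u g) = anchor G u (t g).
Proof.
have [k [w [kE tw wu]]] := algd_lift (au (t g)).
rewrite (right_invE (erefl _) kE tw wu) Tmap_comp; last exact: t_smooth.
have -> : t \o @rtr (t g) g = t \o set_val.
  by apply/funext => k' /=; rewrite /rtr tgt_comp // fibre_eq.
by rewrite -Tmap_comp ?wu //; exact: t_smooth.
Qed.

Lemma ri_unit x : right_inv G u (e x) = u x.
Proof.
have [k [w [kE tw wu]]] := algd_lift (au x).
rewrite (right_invE (esym (tgt_unit G x)) kE tw wu) -wu; congr (Tmap _ w).
by apply/funext => k'; rewrite /rtr -[RHS](gcomp_unitr G) fibre_eq.
Qed.

(** The infinitesimal form of (k g) h = k (g h): the vector (u^R, 0) is tangent to the composable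
    pairs, and multiplication maps it to u^R. *)
Lemma ri_mul (c : C) : exists w, [/\ tangent c w,
  Tmap (@comp_fst _ _ _ G) w = right_inv G u (comp_fst c), Tmap (@comp_snd _ _ _ G) w = 0 &
  Tmap (@comp_mul _ _ _ G) w = right_inv G u (comp_mul c)].
Proof.
set g := comp_fst c; set h := comp_snd c; have gh : s g = t h := comp_eq c.
have [k [w [kE tw wu]]] := algd_lift (au (t g)).
have [|||ka ska [k1 k2]] := @comp_map (source_fibre G (t g)) _ (@rtr (t g) g) (fun=> h).
- exact: rtr_smooth.
- exact: smooth_cstmap.
- by move=> l; rewrite /rtr src_comp // fibre_eq.
have kc : ka k = c.
  by apply: fp_inj; [rewrite [LHS]k1 /rtr kE gcomp_unitl|exact: k2].
exists (Tmap ka w); split.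
- by rewrite -kc; exact: Tmap_tan.
- rewrite Tmap_comp; last exact: cf_smooth.
  by rewrite (right_invE (erefl _) kE tw wu); congr (Tmap _ w); apply/funext.
- rewrite Tmap_comp; last exact: cs_smooth.
  have -> : (@comp_snd _ _ _ G) \o ka = fun=> h by apply/funext.
  exact: Tmap_cst tw.
- rewrite Tmap_comp; last exact: cm_smooth.
  rewrite (right_invE _ kE tw wu); last by rewrite /comp_mul tgt_comp.
  congr (Tmap _ w); apply/funext => l /=; rewrite /comp_mul k1 k2 /rtr -gcompA //.
  by rewrite fibre_eq.
Qed.

Lemma ri_morph (K : manifold R) (GK : lieGroup K) (Phi : H -> K) : groupoid_morphism G GK Phi -> forall g,
  Tmap Phi (right_inv G u g) = Tmap (M := K) (fun k => gmul GK k (Phi g)) (Tmap Phi (u (t g))).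
Proof.
move=> [sPhi PhiM] g; have [k [w [kE tw wu]]] := algd_lift (au (t g)).
have sR : smooth_map (M := K) (fun k => gmul GK k (Phi g)).
  by apply: gmul_map_smooth => //; exact: smooth_cstmap.
rewrite (right_invE (erefl _) kE tw wu) Tmap_comp // -wu (Tmap_comp _ _ sR) Tmap_comp; last first.
  exact: smooth_comp sPhi sR.
congr (Tmap _ w); apply/funext => l /=.
by rewrite /rtr PhiM // fibre_eq.
Qed.

End RightInvariant.

(** The composite f o m lives on composable pairs only. Near (1, g0) it extends to a smooth [Fb] on
    H x H, and u^R(g) f is the derivative of [Fb] in its first variable at (1, g), to which
    [prod_deriv_C] applies. *)
Lemma ri_vf u : algd_section G u -> vfield (right_inv G u).
Proof.
move=> [au Cu]; split; first by move=> g; exact: ri_tan.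
move=> f Cf; apply: C_local => g0.
have [c0 [c1 c2]] : exists c : C, comp_fst c = e (t g0) /\ comp_snd c = g0.
  by apply: comp_pair; rewrite src_unit.
have [Fb CF fF] := cm_smooth Cf c0.
have [W [nW WF]] : exists W, nbhs (set_val c0) W /\ forall y : C, W (set_val y) -> f (comp_mul y) = Fb (set_val y).
  by have [W nW HW] := near_subS fF; exists W.
have c0E : set_val c0 = (e (t g0), g0) by rewrite [LHS]surjective_pairing; congr pair.
rewrite c0E in nW; have [[W1 W2] [/= n1 n2] WW] := nW.
exists (fun g => (u (t g)) (fun h => Fb (h, g))).
  have st : smooth_map (e \o t) by apply: smooth_comp; [exact: t_smooth|exact: e_smooth].
  apply: (prod_deriv_C (L := H) (M := H) (pi := e \o t) (xi := fun g => u (t g)) (h := Fb)) => //.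
  - by move=> y; have [] := au (t y).
  - by move=> f' Cf'; exact: (@t_smooth _ (Cu f' Cf')).
have cet : continuous (e \o t).
  by apply: smooth_cts; apply: smooth_comp; [exact: t_smooth|exact: e_smooth].
have n1' : nbhs g0 ((e \o t) @^-1` interior W1) by apply: cet; exact: nbhs_interior.
apply: filterS2 n1' n2 => g W1g W2g.
have [k [w [kE tw wu]]] := algd_lift (au (t g)).
rewrite (right_invE (erefl _) kE tw wu) -wu.
have CF1 : Cinf H (fun h => Fb (h, g)).
  have sp : smooth_map (N := prodS H H) (fun h : H => (h, g)).
    by apply: pair_smooth => //; exact: smooth_cstmap.
  exact: (sp _ CF).
rewrite !TmapE //; apply: (tan_near tw).
- by apply: rtr_smooth.
- by apply: val_smooth.
have W1k : nbhs k (set_val @^-1` W1).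
  by apply: (val_cts (x := k)); rewrite kE; exact: W1g.
apply: filterS W1k => l W1l /=; rewrite /rtr.
have [c [cl cg]] : exists c : C, comp_fst c = set_val l /\ comp_snd c = g.
  by apply: comp_pair; rewrite fibre_eq.
have cE : set_val c = (set_val l, g) by rewrite [LHS]surjective_pairing; congr pair.
have := WF c; rewrite cE /comp_mul cl cg; apply; exact: WW.
Qed.

Lemma vertical_section_ext x0 u0 : algd G x0 u0 -> exists2 u, algd_section G u & u x0 = u0.
Proof.
move=> [tu u00].
have sub : forall w, tangent (s (e x0)) w -> exists2 v, tangent (e x0) v & Tmap s v = w by exact: src_submersion.
have [n [k [x [V [r0 [y [E [U [r [fr _]]]]]]]]]] := sframe_exists s_smooth (@filter_nbhsT _ (nbhs (e x0)) _) sub.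
have frM := sf_fr fr; have Up := co_p (fr_co frM).
have ce : continuous e by apply: smooth_cts; exact: e_smooth.
have nU : nbhs x0 (e @^-1` U) by apply: ce; have := frame_nbhs frM Up.
have [b [Cb b1 b0]] := bump_near nU.
exists (fun z => b z *: \sum_a u0 (y a) *: vert E a (e z)); last first.
  by rewrite (nbhs_singleton b1) scale1r [RHS](vert_span fr Up tu u00).
split=> [z|f Cf].
  have [Uz|nUz] := pselect (U (e z)); last first.
    by rewrite (nbhs_singleton (b0 z nUz)) scale0r; split; [exact: tan0|exact: Tmap0].
  split.
    apply: tanZ; apply: tan_sum => a _; apply: tanZ; exact: vf_tan (vert_vf fr a).
  rewrite TmapZ Tmap_sum big1 ?scaler0 // => a _.
  by rewrite TmapZ (vert_f s_smooth fr) // scaler0.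
have -> : (fun z => (b z *: \sum_a u0 (y a) *: vert E a (e z)) f) =
    fun z => b z * \sum_a u0 (y a) * vert E a (e z) f.
  by apply/funext => z; rewrite tvZ tv_sum; congr (_ * _); apply: eq_bigr => a _; rewrite tvZ.
apply: C_mul => //; apply: C_sum => a _; apply: C_scale.
have Ca : Cinf H (fun q => vert E a q f) by apply: vf_C => //; exact: vert_vf fr a.
exact: e_smooth Ca.
Qed.

(** Right translation by g^-1 carries v to an element of A_H over t g, which extends to a section.
    Horizontality can therefore be tested on right-invariant fields. *)
Lemma vertical_ri g v : tangent g v -> Tmap s v = 0 -> exists2 u, algd_section G u & right_inv G u g = v.
Proof.
move=> tv v0; have [k kE] := fibre_mk (erefl (s g)).
have [|w tw wv] := @fibre_lift (s g) k v _ v0; first by rewrite kE.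
have E : s g = t (inv_of G g) by rewrite tgt_inv.
have sk : smooth_map (@rtr (s g) (inv_of G g)) by exact: rtr_smooth.
have kg : @rtr (s g) (inv_of G g) k = e (t g) by rewrite /rtr kE gcomp_invr.
have alg : algd G (t g) (Tmap (@rtr (s g) (inv_of G g)) w).
  split; first by rewrite -kg; exact: Tmap_tan.
  rewrite Tmap_comp; last exact: s_smooth.
  have -> : s \o @rtr (s g) (inv_of G g) = fun=> s (inv_of G g).
    by apply/funext => l /=; rewrite /rtr src_comp // fibre_eq.
  exact: Tmap_cst tw.
have [u su uE] := vertical_section_ext alg; exists u => //.
have H1 l : exists l', set_val (l' : source_fibre G (t g)) = @rtr (s g) (inv_of G g) l.
  by apply: fibre_mk; rewrite /rtr src_comp ?src_inv // fibre_eq.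
have [ka kaE] := choice H1.
have ska : smooth_map ka.
  by apply: fibre_map_smooth; rewrite (_ : _ \o _ = @rtr (s g) (inv_of G g)) //; apply/funext.
rewrite (right_invE (k := ka k) (w := Tmap ka w) (erefl _)).
- rewrite Tmap_comp; last exact: rtr_smooth.
  rewrite -wv; congr (Tmap _ w); apply/funext => l /=; rewrite /rtr kaE /rtr -gcompA.
  + by rewrite gcomp_invl -[RHS](gcomp_unitr G) fibre_eq.
  + by rewrite fibre_eq.
  + by rewrite src_inv.
- by rewrite kaE.
- exact: Tmap_tan.
- rewrite Tmap_comp; last exact: fibre_val_smooth.
  by rewrite uE; congr (Tmap _ w); apply/funext => l /=.
Qed.

(** On the source fibre over t g, a right-invariant field restricts to a field that is related to it
    both by the inclusion and by right translation by g. The bracket computed at the unit is thus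
    carried to g. *)
Lemma ri_bracket u v g : algd_section G u -> algd_section G v ->
  bracket (right_inv G u) (right_inv G v) g = right_inv G (algd_bracket G u v) g.
Proof.
move=> su sv; have vu := ri_vf su; have vv := ri_vf sv.
pose x := t g; have [k0 k0E] := fibre_mk (src_unit G x).
have lift (z : N -> tvec H) : algd_section G z -> exists Z : source_fibre G x -> tvec (source_fibre G x),
    [/\ vfield Z, forall k, Tmap (M := source_fibre G x) (N := H) set_val (Z k) = right_inv G z (set_val k) &
        forall k, Tmap (@rtr x g) (Z k) = right_inv G z (rtr g k)].
  move=> [az Cz].
  have HZ k : exists w, [/\ tangent (k : source_fibre G x) w, Tmap (M := source_fibre G x) (N := H) set_val w = right_inv G z (set_val k) &
      Tmap (@rtr x g) w = right_inv G z (rtr g k)].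
    have [k1 [w [k1E tw wz]]] := algd_lift (az (t (set_val k))).
    have H1 l : exists l', set_val (l' : source_fibre G x) = @rtr (t (set_val k)) (set_val k) l.
      by apply: fibre_mk; rewrite /rtr src_comp ?fibre_eq.
    have [ka kaE] := choice H1.
    have ska : smooth_map ka.
      apply: fibre_map_smooth; rewrite (_ : _ \o _ = @rtr (t (set_val k)) (set_val k)); last exact/funext.
      exact: rtr_smooth.
    exists (Tmap ka w); split.
    - have kk : ka k1 = k by apply: fibre_inj; rewrite kaE /rtr k1E gcomp_unitl.
      have : tangent (ka k1) (Tmap ka w) by exact: Tmap_tan.
      by rewrite kk.
    - rewrite Tmap_comp; last exact: fibre_val_smooth.
      by rewrite (right_invE (erefl _) k1E tw wz); congr (Tmap _ w); apply/funext.
    - rewrite Tmap_comp; last exact: rtr_smooth.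
      rewrite (right_invE _ k1E tw wz); last by rewrite /rtr tgt_comp // fibre_eq.
      congr (Tmap _ w); apply/funext => l /=; rewrite /rtr kaE /rtr -gcompA //.
        by rewrite fibre_eq.
      by rewrite fibre_eq.
  have [Z HZ'] := choice HZ; exists Z; split=> [|k|k]; try by have [] := HZ' k.
  split=> [k|f Cf]; first by have [] := HZ' k.
  move=> k; have [Fb CF fF] := Cf k; exists (fun h => right_inv G z h Fb).
    by apply: vf_C CF; apply: ri_vf.
  have := nbhs_interior fF; apply: filterS => k' fF'.
  have [tk' <- _] := HZ' k'; rewrite TmapE //; apply: (tan_near tk') => //.
  exact: val_smooth.
have [U [vU U1 U2]] := lift u su; have [V [vV V1 V2]] := lift v sv.
have B1 := bracket_related k0 (fibre_val_smooth (x := x)) vu vv U1 V1.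
have B2 := bracket_related k0 (rtr_smooth (erefl : x = t g)) vu vv U2 V2.
have -> : g = rtr g k0 by rewrite /rtr k0E gcomp_unitl.
rewrite -B2; have g0 : rtr g k0 = g by rewrite /rtr k0E gcomp_unitl.
rewrite g0 (right_invE (k := k0) (w := bracket U V k0) (erefl _)) //.
- exact: bracket_tan.
- by rewrite B1 k0E.
Qed.

Lemma section_anchor u : algd_section G u -> vfield (anchor G u).
Proof.
move=> [au Cu]; split=> [x|f Cf].
  have [tu _] := au x; rewrite /anchor -[x in tangent x _](tgt_unit G x).
  by apply: Tmap_tan => //; exact: t_smooth.
have -> : (fun x => anchor G u x f) = fun x => u x (f \o t) by apply/funext => x; rewrite /anchor TmapE.
by apply: Cu; exact: t_smooth.
Qed.

Lemma section_bracket u v : algd_section G u -> algd_section G v -> algd_section G (algd_bracket G u v).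
Proof.
move=> su sv; have vu := ri_vf su; have vv := ri_vf sv; have [au _] := su; have [av _] := sv.
split=> [x|f Cf]; last first.
  have C1 : Cinf H (fun g => bracket (right_inv G u) (right_inv G v) g f).
    by apply: vf_C => //; exact: vf_bracket.
  exact: e_smooth C1.
split; first exact: bracket_tan.
rewrite (bracket_related (X' := fun _ : N => 0) (Y' := fun _ : N => 0)).
- apply/funext => f; have [Cf|nC] := pselect (Cinf N f); last by rewrite /bracket on_smooth_out.
  by rewrite bracketE // !tv0 subrr.
- exact: s_smooth.
- exact: vf0.
- exact: vf0.
- by move=> g; exact: ri_s.
- by move=> g; exact: ri_s.
Qed.

End Groupoids.

(** * From isotropic structures on Phi to isotropic structures on Lie(Phi) *)

Section Zeros.
Context {R : realType} {M : smoothSpace R} {nM : nice M} (p : M).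

Lemma zero1 (w : preform M 1) : decform w -> w p (v1 0) = 0.
Proof.
move=> dw; have H : w p (v1 (1 *: 0 + 0)) = 1 * w p (v1 0) + w p (v1 0) by apply: lin1 => //; exact: tan0.
by move: H; rewrite scaler0 addr0 mul1r; lra.
Qed.

Lemma zero2l (w : preform M 2) v : decform w -> tangent p v -> w p (v2 0 v) = 0.
Proof.
move=> dw tv; have H : w p (v2 (1 *: 0 + 0) v) = 1 * w p (v2 0 v) + w p (v2 0 v).
  by apply: lin2l => //; exact: tan0.
by move: H; rewrite scaler0 addr0 mul1r; lra.
Qed.

Lemma zero2r (w : preform M 2) v : decform w -> tangent p v -> w p (v2 v 0) = 0.
Proof.
move=> dw tv; have H : w p (v2 v 0) = - w p (v2 0 v) by apply: skew2 => //; exact: tan0.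
by rewrite H zero2l ?oppr0.
Qed.

Lemma zero3l (w : preform M 3) u v : decform w -> tangent p u -> tangent p v -> w p (v3 0 u v) = 0.
Proof.
move=> dw tu tv; have H : w p (v3 (1 *: 0 + 0) u v) = 1 * w p (v3 0 u v) + w p (v3 0 u v).
  by apply: lin3l => //; exact: tan0.
by move: H; rewrite scaler0 addr0 mul1r; lra.
Qed.

Lemma zero3r (w : preform M 3) u v : decform w -> tangent p u -> tangent p v -> w p (v3 u v 0) = 0.
Proof.
move=> dw tu tv; have t0 := tan0 p.
have H1 : w p (v3 u v 0) = - w p (v3 u 0 v) by exact: skew3.
have H2 : w p (v3 u 0 v) = - w p (v3 0 u v) by exact: skew3'.
by rewrite H1 H2 zero3l // !oppr0.
Qed.

End Zeros.

(** * The forms beta on the 2-shifted symplectic group *)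

Section LieGroupSide.
Context {R : realType} {K : manifold R} (GK : lieGroup K).
Context (Omega : preform (prodS K K) 2) (Theta : preform K 3).
Hypothesis hK : shifted2_symplectic GK Omega Theta.
Local Notation K2 := (prodS K K).
Local Notation mu := (gmul GK).
Local Notation o := (gone GK).
Implicit Types (c d : tvec K).

Lemma dec_Omega : decform Omega.
Proof. by have [[fO _] _ _ _] := hK; exact: form_dec. Qed.

Lemma dec_Theta : decform Theta.
Proof. by have [[_ fT] _ _ _] := hK; exact: form_dec. Qed.

Lemma gmulg1 x : mu x o = x.
Proof.
have E y : mu y (ginv GK y) = o.
  rewrite -[LHS](gmul1g GK) -{1}(gmulVg GK (ginv GK y)) -gmulA [mu (ginv GK y) _]gmulA gmulVg gmul1g.
  exact: gmulVg.
by rewrite -(gmulVg GK x) gmulA E gmul1g.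
Qed.

Definition pl (k x : K) : K2 := (x, k).
Definition pr (k x : K) : K2 := (k, x).
Definition p1 (p : K2) : K := p.1.
Definition p2 (p : K2) : K := p.2.
Definition pm (p : K2) : K := mu p.1 p.2.

Lemma pl_smooth k : smooth_map (pl k).
Proof. by apply: pair_smooth => //; exact: smooth_cstmap. Qed.
Lemma pr_smooth k : smooth_map (pr k).
Proof. by apply: pair_smooth => //; exact: smooth_cstmap. Qed.
Lemma p1_smooth : smooth_map p1. Proof. exact: fst_smooth. Qed.
Lemma p2_smooth : smooth_map p2. Proof. exact: snd_smooth. Qed.
Lemma pm_smooth : smooth_map pm. Proof. exact: gmul_smooth. Qed.

Lemma prod_tan_ext (p : K2) v w : tangent p v -> tangent p w -> Tmap p1 v = Tmap p1 w ->
  Tmap p2 v = Tmap p2 w -> v = w.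
Proof. exact: tan_prod_ext. Qed.

Lemma Tmap_const (M M' : smoothSpace R) {sM : sspace M} (f : M -> M') y q (v : tvec M) : tangent q v ->
  (forall x, f x = y) -> Tmap f v = 0.
Proof. by move=> tv fy; have -> : f = fun=> y by [apply/funext]; exact: Tmap_cst tv. Qed.

Lemma Tmap_idE (M : smoothSpace R) (f : M -> M) q (v : tvec M) : tangent q v -> (forall x, f x = x) -> Tmap f v = v.
Proof. by move=> tv fE; have -> : f = id by [apply/funext]; exact: Tmap_id tv. Qed.

(** [rv c] is the right-invariant field c^R on K, and [CR c] is the field (c^R, 0) on K x K. *)
Definition rv c (k : K) : tvec K := Tmap (fun x : K => mu x k) c.
Definition CR c (p : K2) : tvec K2 := Tmap (fun z : K => (mu z p.1, p.2) : K2) c.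

Lemma rtrans_smooth k : smooth_map (fun x : K => mu x k : K).
Proof. by apply: gmul_map_smooth => //; exact: smooth_cstmap. Qed.

Lemma CRmap_smooth (p : K2) : smooth_map (fun z : K => (mu z p.1, p.2) : K2).
Proof. by apply: pair_smooth; [exact: rtrans_smooth|exact: smooth_cstmap]. Qed.

Section Fixed.
Context (c : tvec K) (tc : tangent o c).

Lemma rv_tan k : tangent k (rv c k).
Proof.
have : tangent (mu o k) (Tmap (fun x : K => mu x k) c) by apply: (Tmap_tan (f := fun x : K => mu x k : K)) => //; exact: rtrans_smooth.
by rewrite gmul1g.
Qed.

Lemma rv_vf : vfield (rv c).
Proof.
split=> [k|f Cf]; first exact: rv_tan.
have -> : (fun k => rv c k f) = fun k => c (fun z => f (pm (z, k))).
  by apply/funext => k; rewrite /rv TmapE.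
apply: (prod_deriv_C (L := K) (M := K) (pi := fun=> o) (xi := fun=> c) (h := fun p => f (pm p))) => //.
- exact: smooth_cstmap.
- by move=> f' Cf'; exact: C_cst.
- exact: pm_smooth Cf.
Qed.

Lemma rv_o : rv c o = c.
Proof. by apply: (Tmap_idE tc) => x; rewrite gmulg1. Qed.

Lemma CR_tan p : tangent p (CR c p).
Proof.
have : tangent ((mu o p.1, p.2) : K2) (CR c p).
  by apply: (Tmap_tan (f := fun z : K => (mu z p.1, p.2) : K2)) => //; exact: CRmap_smooth.
by rewrite gmul1g -surjective_pairing.
Qed.

Lemma CR_vf : vfield (CR c).
Proof.
split=> [k|f Cf]; first exact: CR_tan.
have -> : (fun p => CR c p f) = fun p => c (fun z => f (mu z p.1, p.2)).
  by apply/funext => k; rewrite /CR TmapE.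
apply: (prod_deriv_C (L := K) (M := K2) (pi := fun=> o) (xi := fun=> c)
  (h := fun q => f (mu q.1 q.2.1, q.2.2))) => //.
- exact: smooth_cstmap.
- by move=> f' Cf'; exact: C_cst.
have s1 : smooth_map (fun q : prodS K K2 => q.1 : K) by exact: fst_smooth.
have s2 : smooth_map (fun q : prodS K K2 => q.2 : K2) by exact: snd_smooth.
have s21 : smooth_map (fun q : prodS K K2 => q.2.1 : K) by apply: smooth_comp s2 p1_smooth.
have s22 : smooth_map (fun q : prodS K K2 => q.2.2 : K) by apply: smooth_comp s2 p2_smooth.
have sm : smooth_map (fun q : prodS K K2 => (mu q.1 q.2.1, q.2.2) : K2).
  by apply: pair_smooth => //; exact: gmul_map_smooth.
exact: sm Cf.
Qed.

Lemma CR1 p : Tmap p1 (CR c p) = rv c p.1.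
Proof. by rewrite /CR Tmap_comp //; exact: p1_smooth. Qed.

Lemma CR2 p : Tmap p2 (CR c p) = 0.
Proof. by rewrite /CR Tmap_comp; [exact: Tmap_cst tc|exact: p2_smooth]. Qed.

Lemma CRm p : Tmap pm (CR c p) = rv c (pm p).
Proof.
rewrite /CR Tmap_comp; last exact: pm_smooth.
by congr (Tmap _ c); apply/funext => z; rewrite /= /pm /= gmulA.
Qed.

Lemma CR_o k : CR c (o, k) = Tmap (pl k) c.
Proof. by congr (Tmap _ c); apply/funext => z; rewrite /pl /= gmulg1. Qed.

End Fixed.

(** Written as the pullback of a contraction of Omega with a smooth field, which gives its
    smoothness; [betaE] recovers the pointwise formula. *)
Definition beta c : preform K 1 := pullback (pr o) (iprod (CR c) Omega).

Lemma betaE c k Y : beta c k (v1 Y) = Omega (o, k) (v2 (Tmap (pl k) c) (Tmap (pr o) Y)).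
Proof. by rewrite /beta pull1E iprod1E -/(pr o k) /pr CR_o. Qed.

Lemma dec_beta c : tangent o c -> decform (beta c).
Proof.
move=> tc; apply: dec_pull; first exact: pr_smooth.
by apply: dec_iprod; [exact: CR_vf|exact: dec_Omega].
Qed.

Lemma pl_tan k c : tangent o c -> tangent ((o, k) : K2) (Tmap (pl k) c).
Proof. by move=> tc; apply: (Tmap_tan (f := pl k)) => //; exact: pl_smooth. Qed.

Lemma pr_tan k Y : tangent k Y -> tangent ((o, k) : K2) (Tmap (pr o) Y).
Proof. by move=> tY; apply: (Tmap_tan (f := pr o)) => //; exact: pr_smooth. Qed.

Lemma beta_lin a c d k Y : tangent o c -> tangent o d -> tangent k Y ->
  beta (a *: c + d) k (v1 Y) = a * beta c k (v1 Y) + beta d k (v1 Y).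
Proof.
move=> tc td tY; rewrite !betaE Tmap_comb lin2l //; try exact: pl_tan; last exact: pr_tan.
exact: dec_Omega.
Qed.

Lemma beta_sum n (a : 'I_n -> R) (c : 'I_n -> tvec K) k Y : (forall i, tangent o (c i)) -> tangent k Y ->
  beta (\sum_i a i *: c i) k (v1 Y) = \sum_i a i * beta (c i) k (v1 Y).
Proof.
move=> tc tY.
have b0 : beta 0 k (v1 Y) = 0.
  by have := beta_lin 1 (tan0 o) (tan0 o) tY; rewrite scaler0 addr0 mul1r; lra.
suff H r : beta (\sum_(i <- r) a i *: c i) k (v1 Y) = \sum_(i <- r) a i * beta (c i) k (v1 Y) by exact: H.
elim: r => [|i r IH]; first by rewrite !big_nil.
by rewrite !big_cons beta_lin ?IH //; apply: tan_sum => j _; exact: tanZ.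
Qed.

(* delta Omega = 0 at (1, k1, k2), on the vectors (c, 0, 0) and (0, w) *)
Lemma iprod_CR c p w : tangent o c -> tangent p w ->
  Omega p (v2 (CR c p) w) = beta c (pm p) (v1 (Tmap pm w)) - beta c p.1 (v1 (Tmap p1 w)).
Proof.
move=> tc tw; have [_ _ [dO _ _] _] := hK.
pose K3 := prodS K2 K.
pose A := Tmap (M := K) (N := K3) (fun z => ((z, p.1), p.2)) c.
pose B := Tmap (M := K2) (N := K3) (fun q => ((o, q.1), q.2)) w.
have sA : smooth_map (N := K3) (fun z : K => ((z, p.1), p.2)).
  by apply: (pair_smooth (M := K2)); [exact: (pl_smooth p.1)|exact: smooth_cstmap].
have sB : smooth_map (N := K3) (fun q : K2 => ((o, q.1), q.2)).
  apply: (pair_smooth (M := K2)); last exact: p2_smooth.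
  by apply: pair_smooth; [exact: smooth_cstmap|exact: p1_smooth].
have tA : tangent (((o, p.1), p.2) : K3) A by exact: (Tmap_tan sA).
have tB : tangent (((o, p.1), p.2) : K3) B by exact: (Tmap_tan sB).
have q1 : smooth_map (fun q : K3 => q.1.1 : K).
  by apply: (smooth_comp (fst_smooth (M := K2) (N := K))); exact: p1_smooth.
have q2 : smooth_map (fun q : K3 => q.1.2 : K).
  by apply: (smooth_comp (fst_smooth (M := K2) (N := K))); exact: p2_smooth.
have q3 : smooth_map (fun q : K3 => q.2 : K) by exact: snd_smooth.
have := dO _ _ (v2P (P := tangent (((o, p.1), p.2) : K3)) tA tB).
rewrite /delta2 -[LHS]/(_ - _ + _ - _) -[RHS]/(0 : R).
have E (f : K3 -> K2) : smooth_map f -> pullback f Omega ((o, p.1), p.2) (v2 A B) =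
    Omega (f ((o, p.1), p.2)) (v2 (Tmap (fun z : K => f ((z, p.1), p.2)) c)
      (Tmap (fun q : K2 => f ((o, q.1), q.2)) w)).
  by move=> sf; rewrite pull2E /A /B !Tmap_comp.
rewrite !E /=; try by apply: pair_smooth => //; apply: gmul_map_smooth.
rewrite (Tmap_const (f := fun z : K => (p.1, p.2) : K2) tc (fun=> erefl)).
have dOm := dec_Omega.
rewrite zero2l //; last by apply: (Tmap_tan (p := p) (f := fun q : K2 => (q.1, q.2) : K2)) => //; apply: pair_smooth; [exact: p1_smooth|exact: p2_smooth].
rewrite (Tmap_idE (f := fun q : K2 => (mu o q.1, q.2) : K2) tw); last first.
  by move=> [a b] /=; rewrite gmul1g.
rewrite !betaE /rv gmul1g -surjective_pairing sub0r !Tmap_comp;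
  [|exact: pr_smooth|exact: pr_smooth].
move=> E1; rewrite -[LHS]addr0 -E1 /CR; ring.
Qed.

(** Up to a term constant in k, beta_c(d^R) is the value of Omega at (1, k) on (c, 0) and (d, 0),
    which is skew in c and d. Symmetrizing leaves the constants and hence the pairing, see
    [beta_skew]; differentiating in k removes them, see [key_group]. *)
Lemma beta_rv c d k : tangent o c -> tangent o d ->
  beta c k (v1 (rv d k)) = Omega (o, k) (v2 (CR c (o, k)) (CR d (o, k))) + beta c o (v1 d).
Proof.
move=> tc td; rewrite iprod_CR //; last exact: CR_tan.
by rewrite CRm // CR1 //= /pm /= gmul1g rv_o // subrK.
Qed.

Lemma pairingE c d : tangent o c -> tangent o d -> pairing GK Omega c d = - beta c o (v1 d) - beta d o (v1 c).
Proof.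
move=> tc td; rewrite /pairing !v2_tuple !betaE -/(pl o) -/(pr o).
rewrite [X in _ + X](skew2 dec_Omega) ?opprK //; [exact: pl_tan|exact: pr_tan].
Qed.

Lemma beta_skew c d k : tangent o c -> tangent o d ->
  beta c k (v1 (rv d k)) + beta d k (v1 (rv c k)) = - pairing GK Omega c d.
Proof.
move=> tc td; rewrite pairingE // !beta_rv // (skew2 dec_Omega (CR_tan td (o, k)) (CR_tan tc (o, k))).
by ring.
Qed.

Lemma pairing_sum n (a b : 'I_n -> R) (c : 'I_n -> tvec K) : (forall i, tangent o (c i)) ->
  pairing GK Omega (\sum_i a i *: c i) (\sum_i b i *: c i) =
  \sum_i \sum_j a i * b j * pairing GK Omega (c i) (c j).
Proof.
move=> tc; have ts (a' : 'I_n -> R) : tangent o (\sum_i a' i *: c i) by apply: tan_sum => i _; exact: tanZ.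
have bs (a' : 'I_n -> R) d : tangent o d -> beta d o (v1 (\sum_i a' i *: c i)) = \sum_i a' i * beta d o (v1 (c i)).
  move=> td; have db := dec_beta td.
  have b0 : beta d o (v1 0) = 0 by exact: zero1.
  suff H r : beta d o (v1 (\sum_(i <- r) a' i *: c i)) = \sum_(i <- r) a' i * beta d o (v1 (c i)) by exact: H.
  elim: r => [|i r IH]; first by rewrite !big_nil.
  by rewrite !big_cons lin1 ?IH //; apply: tan_sum => j _; exact: tanZ.
rewrite pairingE // !beta_sum //.
under eq_bigr => i _ do rewrite bs // mulr_sumr.
under [X in _ - X]eq_bigr => i _ do rewrite bs // mulr_sumr.
rewrite [X in _ - X]exchange_big -!sumrN -big_split /=; apply: eq_bigr => i _.
rewrite -!sumrN -big_split /=; apply: eq_bigr => j _; rewrite pairingE //.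
by ring.
Qed.

Definition lbr c d : tvec K := bracket (rv c) (rv d) o.

Lemma lbr_tan c d : tangent o c -> tangent o d -> tangent o (lbr c d).
Proof. by move=> tc td; apply: bracket_tan; exact: rv_vf. Qed.

Lemma bracket_CR c d k : tangent o c -> tangent o d ->
  bracket (CR c) (CR d) (o, k) = Tmap (pl k) (lbr c d).
Proof.
move=> tc td; apply: (@prod_tan_ext (o, k)).
- by apply: bracket_tan; exact: CR_vf.
- by apply: pl_tan; exact: lbr_tan.
- rewrite (bracket_related (X' := rv c) (Y' := rv d)) //; try exact: rv_vf; try exact: p1_smooth.
  + rewrite Tmap_comp; last exact: p1_smooth.
    by rewrite (Tmap_idE (lbr_tan tc td)).
  + by move=> q; rewrite CR1.
  + by move=> q; rewrite CR1.
- rewrite (bracket_related (X' := fun _ : K => 0) (Y' := fun _ : K => 0)) //; try exact: vf0; try exact: p2_smooth.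
  + rewrite Tmap_comp; last exact: p2_smooth.
    rewrite (Tmap_const (y := k) (lbr_tan tc td)) //.
    apply/funext => f; have [Cf|nC] := pselect (Cinf K f); last by rewrite /bracket on_smooth_out.
    by rewrite bracketE // !tv0 subrr.
  + by move=> q; rewrite CR2.
  + by move=> q; rewrite CR2.
Qed.

(** Cartan's formula for Omega on the fields (c^R, 0), (d^R, 0) and the vector (0, Y) at (1, k). On
    these arguments d Omega = - delta Theta has a single surviving term, that of m^* Theta. *)
Lemma key_group c d k Y : tangent o c -> tangent o d -> tangent k Y ->
  extd (beta d) k (v2 (rv c k) Y) - extd (beta c) k (v2 (rv d k) Y)
  - Y (fun k => beta c k (v1 (rv d k))) - beta (lbr c d) k (v1 Y) = Theta k (v3 (rv c k) (rv d k) Y).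
Proof.
move=> tc td tY; have dO := dec_Omega; have dT := dec_Theta.
have tr := pr_tan tY; have [_ _ [_ dTh _] _] := hK.
have tCc := CR_tan tc ((o, k) : K2); have tCd := CR_tan td ((o, k) : K2).
have iE x : tangent o x -> form_eq (iprod (CR x) Omega) (pullback pm (beta x) - pullback p1 (beta x)).
  by move=> tx p v tv; rewrite (v1E v) iprod1E iprod_CR.
have dm x : tangent o x -> decform (pullback pm (beta x)) by move=> tx; apply: dec_pull; [exact: pm_smooth|exact: dec_beta].
have d1 x : tangent o x -> decform (pullback p1 (beta x)) by move=> tx; apply: dec_pull; [exact: p1_smooth|exact: dec_beta].
have p1r : Tmap p1 (Tmap (pr o) Y) = 0.
  by rewrite Tmap_comp; [rewrite (Tmap_const (y := o) tY)|exact: p1_smooth].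
have p2r : Tmap p2 (Tmap (pr o) Y) = Y.
  by rewrite Tmap_comp; [rewrite (Tmap_idE tY)|exact: p2_smooth].
have pmr : Tmap pm (Tmap (pr o) Y) = Y.
  rewrite Tmap_comp; last exact: pm_smooth.
  by rewrite (Tmap_idE tY) // => x; rewrite /= /pm /pr /= gmul1g.
(* The contraction of Omega with (x^R, 0) is m^* beta_x - pr_1^* beta_x by [iprod_CR], and pr_1
   kills (0, Y). *)
have E1 x y : tangent o x -> tangent o y ->
    extd (iprod (CR x) Omega) (o, k) (v2 (CR y (o, k)) (Tmap (pr o) Y)) = extd (beta x) k (v2 (rv y k) Y).
  move=> tx ty; have tCy := CR_tan ty ((o, k) : K2).
  have tv := v2P (P := tangent ((o, k) : K2)) tCy tr.
  rewrite (extd_eq _ (iE x tx)) //; last by apply: dec_iprod => //; exact: CR_vf.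
  rewrite extd_sub //; [|exact: dm|exact: d1].
  rewrite (extd_pull pm_smooth (dec_beta tx) tv) (extd_pull p1_smooth (dec_beta tx) tv) !pull2E.
  rewrite p1r pmr CRm // /pm /= gmul1g.
  have tr1 : tangent o (rv y o) by exact: rv_tan.
  rewrite CR1 //= zero2r ?subr0 //.
  by apply: dec_extd; exact: dec_beta.
have := cartan2 dO (CR_vf tc) (CR_vf td) tr.
rewrite !E1 // (bracket_CR k tc td) -betaE.
have -> : Tmap (pr o) Y (fun q => Omega q (v2 (CR c q) (CR d q))) = Y (fun k => beta c k (v1 (rv d k))).
  have Cf : Cinf K2 (fun q => Omega q (v2 (CR c q) (CR d q))) by apply: C2 => //; exact: CR_vf.
  have Cb : Cinf K (fun k => beta c k (v1 (rv d k))) by apply: C1; [exact: dec_beta|exact: rv_vf].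
  rewrite TmapE // (_ : _ \o _ = fun k => beta c k (v1 (rv d k)) - beta c o (v1 d)).
    by rewrite (tan_sub tY) // ?(tan_cst tY) ?subr0 //; exact: C_cst.
  by apply/funext => x /=; rewrite beta_rv // addrK.
move=> <-.
have := dTh (o, k) _ (v3P (P := tangent ((o, k) : K2)) tCc tCd tr).
rewrite /delta1 -[LHS]/(_ + _ - _) -[RHS]/(- _) !pull3E -/p1 -/p2 -/pm p1r p2r pmr.
rewrite !CR1 // !CR2 // !CRm // /pm /= gmul1g zero3r //; [|exact: rv_tan|exact: rv_tan].
by rewrite zero3l ?add0r //; [move=> /oppr_inj|exact: tan0].
Qed.

End LieGroupSide.

Section FormSums.
Context {R : realType} {M : smoothSpace R} {nM : nice M}.

Lemma extd_sumf k n (w : 'I_n -> preform M k) p v : (forall i, decform (w i)) ->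
  (forall i, tangent p (v i)) -> extd (\sum_i w i) p v = \sum_i extd (w i) p v.
Proof.
move=> dw tv; suff H r : extd (\sum_(i <- r) w i) p v = \sum_(i <- r) extd (w i) p v by exact: H.
elim: r => [|i r IH].
  rewrite !big_nil; have E : form_eq (0 : preform M k) (0 - 0) by move=> q u tu; rewrite subr0.
  by rewrite (extd_eq (@dec0 _ _ k) E tv) extd_sub ?subrr //; exact: dec0.
by rewrite !big_cons extd_add ?IH //; exact: dec_sum.
Qed.

Lemma extd_scale1 (w : preform M 1) (f : M -> R) p a b : Cinf M f -> decform w -> tangent p a -> tangent p b ->
  extd (fun q v => f q * w q v) p (v2 a b) = f p * extd w p (v2 a b) + (a f * w p (v1 b) - b f * w p (v1 a)).
Proof.
move=> Cf dw ta tb; have tv := v2P (P := tangent p) ta tb.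
rewrite extd_scale // !big_ord_recl big_ord0 addr0 /= expr0 expr1 mul1r mulN1r mulNr.
congr (_ + (_ * w p _ - _ * w p _)).
- by rewrite /v2 vc0.
- by apply/funext => i; rewrite /v2 vcS.
- by rewrite /v2 vcS.
- apply/funext => i; have -> : lift (lift ord0 ord0) i = ord0 :> 'I_2 by rewrite [i]ord1; exact: val_inj.
  by rewrite /v2 vc0.
Qed.

Lemma lin1_sum (w : preform M 1) p n (c : 'I_n -> R) (X : 'I_n -> tvec M) : decform w ->
  (forall i, tangent p (X i)) -> w p (v1 (\sum_i c i *: X i)) = \sum_i c i * w p (v1 (X i)).
Proof.
move=> dw tX; suff H r : w p (v1 (\sum_(i <- r) c i *: X i)) = \sum_(i <- r) c i * w p (v1 (X i)) by exact: H.
elim: r => [|i r IH]; first by rewrite !big_nil zero1.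
by rewrite !big_cons lin1 ?IH //; apply: tan_sum => j _; exact: tanZ.
Qed.

Lemma lin2l_sum (w : preform M 2) p n (c : 'I_n -> R) (X : 'I_n -> tvec M) Y : decform w ->
  (forall i, tangent p (X i)) -> tangent p Y -> w p (v2 (\sum_i c i *: X i) Y) = \sum_i c i * w p (v2 (X i) Y).
Proof.
move=> dw tX tY; suff H r : w p (v2 (\sum_(i <- r) c i *: X i) Y) = \sum_(i <- r) c i * w p (v2 (X i) Y) by exact: H.
elim: r => [|i r IH]; first by rewrite !big_nil zero2l.
by rewrite !big_cons lin2l ?IH //; apply: tan_sum => j _; exact: tanZ.
Qed.

Lemma lin3_sum (w : preform M 3) p n (c c' : 'I_n -> R) (X : 'I_n -> tvec M) Y : decform w ->
  (forall i, tangent p (X i)) -> tangent p Y ->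
  w p (v3 (\sum_i c i *: X i) (\sum_j c' j *: X j) Y) = \sum_i \sum_j c i * c' j * w p (v3 (X i) (X j) Y).
Proof.
move=> dw tX tY; have ts (a : 'I_n -> R) r : tangent p (\sum_(i <- r) a i *: X i).
  by apply: tan_sum => i _; exact: tanZ.
have H1 r Z : tangent p Z -> w p (v3 (\sum_(i <- r) c i *: X i) Z Y) = \sum_(i <- r) c i * w p (v3 (X i) Z Y).
  move=> tZ; elim: r => [|i r IH]; first by rewrite !big_nil zero3l.
  by rewrite !big_cons lin3l ?IH.
have H2 r Z : tangent p Z -> w p (v3 Z (\sum_(i <- r) c' i *: X i) Y) = \sum_(i <- r) c' i * w p (v3 Z (X i) Y).
  move=> tZ; have [ZZ [vZ <-]] := tan_extend tZ; rewrite -iprod2E.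
  elim: r => [|i r IH]; first by rewrite !big_nil zero2l //; exact: dec_iprod.
  by rewrite !big_cons lin2l ?IH //; exact: dec_iprod.
rewrite H1; last exact: ts.
by apply: eq_bigr => i _; rewrite H2 // mulr_sumr; apply: eq_bigr => j _; rewrite mulrA.
Qed.

End FormSums.

(** * The forms beta pulled back along Phi *)

Section Alpha.
Context {R : realType} {K : manifold R} (GK : lieGroup K).
Context (Omega : preform (prodS K K) 2) (Theta : preform K 3).
Hypothesis hK : shifted2_symplectic GK Omega Theta.
Context {H N : manifold R} (G : lieGroupoid H N) (Phi : H -> K).
Hypothesis hPhi : groupoid_morphism G GK Phi.
Local Notation s := (src G).
Local Notation t := (tgt G).
Local Notation e := (unit_at G).
Local Notation o := (gone GK).
Local Notation phi := (lie_morphism Phi).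
Local Notation ri := (right_inv G).
Local Notation rv := (rv GK).
Local Notation beta := (beta GK Omega).

Lemma Phi_smooth : smooth_map Phi. Proof. by case: hPhi. Qed.

Lemma Phi_unit x : Phi (e x) = o.
Proof.
have [_ PM] := hPhi; have := PM (e x) (e x); rewrite src_unit tgt_unit => /(_ erefl).
have := gcomp_unitr G (e x); rewrite src_unit => -> E.
by rewrite -[LHS](gmul1g GK) -(gmulVg GK (Phi (e x))) -gmulA -E gmulVg.
Qed.

Lemma phi_tan u x : algd G x (u x) -> tangent o (phi u x).
Proof.
move=> [tu _]; rewrite -(Phi_unit x); apply: Tmap_tan => //; exact: Phi_smooth.
Qed.

Lemma phi_ri u g : (forall x, algd G x (u x)) -> Tmap Phi (ri u g) = rv (phi u (t g)) (Phi g).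
Proof. by move=> au; exact: (ri_morph au hPhi). Qed.

(** The form Phi^* beta_phi(u). As phi(u) is taken at t g and varies with g, this is not the
    pullback of a fixed form on K, and its differential has additional terms. *)
Definition alpha (u : N -> tvec H) : preform H 1 :=
  fun g w => beta (phi u (t g)) (Phi g) (fun i => Tmap Phi (w i)).

Lemma alphaE u g W : alpha u g (v1 W) = beta (phi u (t g)) (Phi g) (v1 (Tmap Phi W)).
Proof. by []. Qed.

(** A basis of k whose coordinates come from functions on all of K. In it alpha_u becomes a sum of
    functions times pullbacks of fixed forms, for which d is known. *)
Lemma phi_basis : exists n (xk : 'I_n -> K -> R) (E : 'I_n -> tvec K), [/\ forall i, Cinf K (xk i),
  forall i, tangent o (E i) & (forall c, tangent o c -> c = \sum_i c (xk i) *: E i)].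
Proof.
have [n [xk [E [U [r [fr _]]]]]] := frame_exists (@filter_nbhsT _ (nbhs (o : K)) _).
have Uo := co_p (fr_co fr); exists n, xk, (fun i => E i o); split.
- by move=> i; exact: co_C (fr_co fr) i.
- by move=> i; exact: vf_tan (fr_vf fr i).
- by move=> c tc; exact: (frame_span fr Uo tc).
Qed.

Section Basis.
Context n (xk : 'I_n -> K -> R) (E : 'I_n -> tvec K).
Hypothesis Cx : forall i, Cinf K (xk i).
Hypothesis tE : forall i, tangent o (E i).
Hypothesis spanE : forall c, tangent o c -> c = \sum_i c (xk i) *: E i.

Definition fc (u : N -> tvec H) i (x : N) : R := u x (xk i \o Phi).

Lemma fc_C u i : algd_section G u -> Cinf N (fc u i).
Proof. by move=> [_ Cu]; apply: Cu; exact: Phi_smooth (Cx i). Qed.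

Lemma phi_span u x : algd G x (u x) -> phi u x = \sum_i fc u i x *: E i.
Proof.
move=> au; rewrite {1}(spanE (phi_tan au)); apply: eq_bigr => i _; congr (_ *: _).
by rewrite /lie_morphism TmapE.
Qed.

Lemma fct_C u i : algd_section G u -> Cinf H (fc u i \o t).
Proof. by move=> su; exact: (@t_smooth _ _ _ G _ (fc_C i su)). Qed.

Lemma dec_pb i : decform (pullback Phi (beta (E i))).
Proof. by apply: dec_pull; [exact: Phi_smooth|exact: (dec_beta hK)]. Qed.

Definition alpha_exp u : preform H 1 :=
  \sum_i (fun g w => (fc u i \o t) g * pullback Phi (beta (E i)) g w : R).

Lemma alpha_expE u : algd_section G u -> form_eq (alpha u) (alpha_exp u).
Proof.
move=> [au Cu] g w tw; rewrite (v1E w) alphaE (phi_span (au _)) (beta_sum hK) //.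
  by rewrite /alpha_exp form_sumE.
by apply: Tmap_tan => //; exact: Phi_smooth.
Qed.

Lemma dec_alpha_exp u : algd_section G u -> decform (alpha_exp u).
Proof. by move=> su; apply: dec_sum => i; apply: dec_scale; [exact: fct_C|exact: dec_pb]. Qed.

Lemma dec_alpha_basis u : algd_section G u -> decform (alpha u).
Proof. by move=> su; apply: dec_eq (dec_alpha_exp su); exact: alpha_expE. Qed.

Lemma rv_lin n' (c : 'I_n' -> R) (X : 'I_n' -> tvec K) k : rv (\sum_i c i *: X i) k = \sum_i c i *: rv (X i) k.
Proof. have rvE c' k' : rv c' k' = Tmap (fun x : K => gmul GK x k') c' by [].
rewrite rvE Tmap_sum; apply: eq_bigr => i _; by rewrite TmapZ rvE. Qed.

Lemma phi_ri_span u g : algd_section G u -> Tmap Phi (ri u g) = \sum_i fc u i (t g) *: rv (E i) (Phi g).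
Proof. by move=> [au _]; rewrite phi_ri // phi_span // rv_lin. Qed.

Lemma extd_alpha u g A B : algd_section G u -> tangent g A -> tangent g B ->
  extd (alpha u) g (v2 A B) = \sum_i (fc u i (t g) * extd (beta (E i)) (Phi g) (v2 (Tmap Phi A) (Tmap Phi B))
    + (A (fc u i \o t) * beta (E i) (Phi g) (v1 (Tmap Phi B)) - B (fc u i \o t) * beta (E i) (Phi g) (v1 (Tmap Phi A)))).
Proof.
move=> su tA tB; have tv := v2P (P := tangent g) tA tB.
rewrite (extd_eq (dec_alpha_basis su) (alpha_expE su) tv) extd_sumf //; last first.
  by move=> i; apply: dec_scale; [exact: fct_C|exact: dec_pb].
apply: eq_bigr => i _; rewrite extd_scale1 //; [|exact: fct_C|exact: dec_pb].
rewrite !pull1E (extd_pull Phi_smooth (dec_beta hK (tE i)) tv) pull2E //.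
Qed.

(** In a basis of k this is phi([u, v]) = a(u) phi(v) - a(v) phi(u) + [phi(u), phi(v)]. It comes
    from differentiating the expansion of Phi_* v^R in right-invariant fields of K, whose
    coefficients are functions of t g. *)
Lemma phi_bracket u v x : algd_section G u -> algd_section G v ->
  phi (algd_bracket G u v) x = \sum_j anchor G u x (fc v j) *: E j - \sum_i anchor G v x (fc u i) *: E i
    + \sum_i \sum_j (fc u i x * fc v j x) *: lbr GK (E i) (E j).
Proof.
move=> su sv; have [au _] := su; have [av _] := sv.
have vu := ri_vf su; have vv := ri_vf sv.
have tl i j : tangent o (lbr GK (E i) (E j)) by exact: lbr_tan.
apply: (@tan_ext _ _ o o).
- by apply: phi_tan; have [ab _] := section_bracket su sv.
- apply: tanD; first by apply: tanB; apply: tan_sum => i _; exact: tanZ.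
  by apply: tan_sum => i _; apply: tan_sum => j _; exact: tanZ.
move=> h Ch; have Chp : Cinf H (h \o Phi) by exact: Phi_smooth Ch.
rewrite tvD (tvD (\sum_j _)) tvN !tv_sum.
under [X in _ = X - _ + _]eq_bigr => j _ do rewrite tvZ.
under [X in _ = _ - X + _]eq_bigr => j _ do rewrite tvZ.
under [X in _ = _ + X]eq_bigr => i _ do (rewrite tv_sum; under eq_bigr => j _ do rewrite tvZ /lbr bracketE // mulrBr).
rewrite /lie_morphism TmapE // /algd_bracket bracketE //.
have Crv i : Cinf K (fun k => rv (E i) k h) by apply: vf_C => //; exact: rv_vf.
have half (a b : N -> tvec H) : algd_section G a -> algd_section G b ->
    ri a (e x) (fun g => ri b g (h \o Phi)) = \sum_j anchor G a x (fc b j) * E j h +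
      \sum_i \sum_j fc a i x * fc b j x * E i (fun k => rv (E j) k h).
  move=> sa sb; have [aa _] := sa; have [ab _] := sb; have ta := vf_tan (e x) (ri_vf sa).
  have -> : (fun g => ri b g (h \o Phi)) = fun g => \sum_j (fc b j \o t) g * ((fun k => rv (E j) k h) \o Phi) g.
    apply/funext => g; rewrite -(TmapE Phi) // phi_ri_span // tv_sum.
    by apply: eq_bigr => j _; rewrite tvZ.
  have CrP j : Cinf H ((fun k => rv (E j) k h) \o Phi) by exact: Phi_smooth (Crv j).
  rewrite (tan_sumf ta); last by move=> j; apply: C_mul => //; exact: fct_C.
  have E1 j : ri a (e x) (fun g => (fc b j \o t) g * ((fun k => rv (E j) k h) \o Phi) g) =
      \sum_i fc a i x * fc b j x * E i (fun k => rv (E j) k h) + anchor G a x (fc b j) * E j h.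
    rewrite (tan_mul ta) //; last exact: fct_C.
    rewrite -(TmapE t _ (fc_C j sb)) ri_t // tgt_unit -(TmapE Phi _ (Crv j)) phi_ri // tgt_unit Phi_unit.
    rewrite rv_o //; last exact: phi_tan.
    rewrite /= tgt_unit Phi_unit rv_o // (phi_span (aa x)) tv_sum mulr_sumr; congr (_ + _).
    by apply: eq_bigr => i _; rewrite tvZ; ring.
  under eq_bigr => j _ do rewrite E1.
  by rewrite big_split /= addrC [X in _ + X]exchange_big.
rewrite (half u v) // (half v u) //.
rewrite [in X in _ - X = _](exchange_big_dep xpredT) //=.
under [X in _ = _ + X]eq_bigr => i _ do rewrite sumrB.
rewrite sumrB opprD addrACA; congr (_ + (_ - _)).
  by apply: eq_bigr => i _; apply: eq_bigr => j _; rewrite rv_o.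
by apply: eq_bigr => i _; apply: eq_bigr => j _; rewrite rv_o // [fc v _ x * _]mulrC.
Qed.

Lemma vec_deriv_span u x z : algd_section G u -> tangent x z ->
  vec_deriv z (phi u) = \sum_i z (fc u i) *: E i.
Proof.
move=> su tz; have [au _] := su; apply/funext => f; rewrite tv_sum.
have [Cf|nC] := pselect (Cinf K f); last first.
  rewrite /vec_deriv on_smooth_out // big1 // => i _; rewrite tvZ.
  by have [-> //] := tE i; rewrite mulr0.
rewrite /vec_deriv on_smoothE //.
have -> : (fun y => phi u y f) = fun y => \sum_i E i f * fc u i y.
  by apply/funext => y; rewrite phi_span // tv_sum; apply: eq_bigr => i _; rewrite tvZ mulrC.
rewrite (tan_sumf tz); last by move=> i; apply: C_scale; exact: fc_C.
by apply: eq_bigr => i _; rewrite (tan_scale tz) ?tvZ 1?mulrC //; exact: fc_C.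
Qed.

(** Bookkeeping for [alpha_key_basis]: F and F' are the coefficients of phi(u) and phi(v); UG, VF,
    WF, WG are their derivatives along u^R, v^R and W. The terms in UG, VF and WF cancel, and those
    in WG combine through the pairing. *)
Lemma key_sums (F F' UG VF WF WG B : 'I_n -> R) (b db Yb L T P : 'I_n -> 'I_n -> R) :
  (forall i j, db j i - db i j - Yb i j - L i j = T i j) -> (forall i j, b i j + b j i = - P i j) ->
  \sum_j (F' j * (\sum_i F i * db j i) + (UG j * B j - WG j * (\sum_i F i * b j i)))
  - \sum_i (F i * (\sum_j F' j * db i j) + (VF i * B i - WF i * (\sum_j F' j * b i j)))
  - \sum_i \sum_j (WF i * F' j * b i j + F i * WG j * b i j + F i * F' j * Yb i j)
  - (\sum_j UG j * B j - \sum_i VF i * B i + \sum_i \sum_j F i * F' j * L i j)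
  = \sum_i \sum_j F i * F' j * T i j + \sum_i \sum_j WG i * F j * P i j.
Proof.
move=> HT HP.
have -> : \sum_j (F' j * (\sum_i F i * db j i) + (UG j * B j - WG j * (\sum_i F i * b j i))) =
    \sum_i \sum_j (F i * F' j * db j i - F i * WG j * b j i) + \sum_j UG j * B j.
  rewrite exchange_big -big_split /=; apply: eq_bigr => j _.
  rewrite sumrB !mulr_sumr.
  have -> : \sum_i F i * F' j * db j i = \sum_i F' j * (F i * db j i) by apply: eq_bigr => i _; ring.
  have -> : \sum_i F i * WG j * b j i = \sum_i WG j * (F i * b j i) by apply: eq_bigr => i _; ring.
  by ring.
have -> : \sum_i (F i * (\sum_j F' j * db i j) + (VF i * B i - WF i * (\sum_j F' j * b i j))) =
    \sum_i \sum_j (F i * F' j * db i j - WF i * F' j * b i j) + \sum_i VF i * B i.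
  rewrite -big_split /=; apply: eq_bigr => i _.
  rewrite sumrB !mulr_sumr.
  have -> : \sum_j F i * F' j * db i j = \sum_j F i * (F' j * db i j) by apply: eq_bigr => j _; ring.
  have -> : \sum_j WF i * F' j * b i j = \sum_j WF i * (F' j * b i j) by apply: eq_bigr => j _; ring.
  by ring.
have -> : \sum_i \sum_j WG i * F j * P i j = \sum_i \sum_j F i * WG j * P j i.
  by rewrite exchange_big; apply: eq_bigr => i _; apply: eq_bigr => j _; ring.
set S1 := \sum_j UG j * B j; set S2 := \sum_i VF i * B i.
set X1 := \sum_i \sum_j _; set X2 := \sum_i \sum_j _; set X3 := \sum_i \sum_j _; set X4 := \sum_i \sum_j _.
have -> : X1 + S1 - (X2 + S2) - X3 - (S1 - S2 + X4) = X1 - X2 - X3 - X4 by ring.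
rewrite /X1 /X2 /X3 /X4 -!sumrB -big_split /=; apply: eq_bigr => i _.
rewrite -!sumrB -big_split /=; apply: eq_bigr => j _.
rewrite -HT; have := HP j i => HPji; have -> : P j i = - (b j i + b i j) by rewrite HPji opprK.
by ring.
Qed.

(** [key_group] pulled back along Phi, with coefficients phi(u) and phi(v) that vary over N; their
    variation leaves the term <d phi(v), phi(u)>. *)
Lemma alpha_key_basis u v g W : algd_section G u -> algd_section G v -> tangent g W ->
  extd (alpha v) g (v2 (ri u g) W) - extd (alpha u) g (v2 (ri v g) W) - W (fun g => alpha u g (v1 (ri v g)))
  - alpha (algd_bracket G u v) g (v1 W) =
  Theta (Phi g) (v3 (Tmap Phi (ri u g)) (Tmap Phi (ri v g)) (Tmap Phi W))
  + dpairing GK Omega Phi v u (t g) (v1 (Tmap t W)).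
Proof.
move=> su sv tW; have [au _] := su; have [av _] := sv; have dT := dec_Theta hK.
have tU := vf_tan g (ri_vf su); have tV := vf_tan g (ri_vf sv).
have tY : tangent (Phi g) (Tmap Phi W) by apply: Tmap_tan => //; exact: Phi_smooth.
have tz : tangent (t g) (Tmap t W) by apply: Tmap_tan => //; exact: t_smooth.
have trv i k : tangent k (rv (E i) k) by exact: rv_tan.
have db i : decform (beta (E i)) by exact: (dec_beta hK).
have Cb i j : Cinf K (fun k => beta (E i) k (v1 (rv (E j) k))) by apply: C1 => //; exact: rv_vf.
have [sb1 sb2] := section_bracket su sv.
rewrite (extd_alpha sv tU tW) (extd_alpha su tV tW) alphaE phi_bracket //.
rewrite !phi_ri_span // lin3_sum // /dpairing (vec_deriv_span sv tz) (phi_span (au (t g))) (pairing_sum hK) //.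
have -> : W (fun g => alpha u g (v1 (ri v g))) = \sum_i \sum_j
   (W (fc u i \o t) * fc v j (t g) * beta (E i) (Phi g) (v1 (rv (E j) (Phi g)))
   + fc u i (t g) * W (fc v j \o t) * beta (E i) (Phi g) (v1 (rv (E j) (Phi g)))
   + fc u i (t g) * fc v j (t g) * Tmap Phi W (fun k => beta (E i) k (v1 (rv (E j) k)))).
  have -> : (fun g => alpha u g (v1 (ri v g))) = fun g => \sum_i \sum_j ((fc u i \o t) g * (fc v j \o t) g *
      ((fun k => beta (E i) k (v1 (rv (E j) k))) \o Phi) g).
    apply/funext => g'; rewrite alphaE phi_span // (beta_sum hK) //; last first.
      by apply: Tmap_tan; [exact: Phi_smooth|exact: vf_tan (ri_vf sv)].
    apply: eq_bigr => i _; rewrite phi_ri_span // lin1_sum // mulr_sumr; apply: eq_bigr => j _ /=.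
    by rewrite mulrA.
  have Cij i j : Cinf H (fun g => (fc u i \o t) g * (fc v j \o t) g) by apply: C_mul; exact: fct_C.
  have Cbj i j : Cinf H ((fun k => beta (E i) k (v1 (rv (E j) k))) \o Phi) by exact: Phi_smooth (Cb i j).
  rewrite (tan_sumf tW); last by move=> i; apply: C_sum => j _; exact: C_mul.
  apply: eq_bigr => i _; rewrite (tan_sumf tW); last by move=> j; exact: C_mul.
  apply: eq_bigr => j _; rewrite (tan_mul tW) // (tan_mul tW); [|exact: fct_C|exact: fct_C].
  by rewrite (TmapE Phi W (Cb i j)) /=; ring.
have tsum (a : 'I_n -> R) : tangent o (\sum_i a i *: E i) by apply: tan_sum => i _; exact: tanZ.
have tl i j : tangent o (lbr GK (E i) (E j)) by exact: lbr_tan.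
have -> : beta (\sum_j anchor G u (t g) (fc v j) *: E j - \sum_i anchor G v (t g) (fc u i) *: E i
    + \sum_i \sum_j (fc u i (t g) * fc v j (t g)) *: lbr GK (E i) (E j)) (Phi g) (v1 (Tmap Phi W)) =
  \sum_j anchor G u (t g) (fc v j) * beta (E j) (Phi g) (v1 (Tmap Phi W))
  - \sum_i anchor G v (t g) (fc u i) * beta (E i) (Phi g) (v1 (Tmap Phi W))
  + \sum_i \sum_j fc u i (t g) * fc v j (t g) * beta (lbr GK (E i) (E j)) (Phi g) (v1 (Tmap Phi W)).
  rewrite -[X in X - _]scale1r -addrA (beta_lin hK) //; last first.
    by apply: tanD; [exact: tanN|apply: tan_sum => i _; apply: tan_sum => j _; exact: tanZ].
  rewrite -scaleN1r (beta_lin hK) //; last by apply: tan_sum => i _; apply: tan_sum => j _; exact: tanZ.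
  rewrite mul1r mulN1r !(beta_sum hK) // addrA; congr (_ + _).
  rewrite (eq_bigr (fun i => 1 *: \sum_j (fc u i (t g) * fc v j (t g)) *: lbr GK (E i) (E j))); last first.
    by move=> i _; rewrite scale1r.
  rewrite (beta_sum hK) //; last by move=> i; apply: tan_sum => j _; exact: tanZ.
  by apply: eq_bigr => i _; rewrite mul1r (beta_sum hK).
have ddb i : decform (extd (beta (E i))) by exact: dec_extd.
have eU j : ri u g (fc v j \o t) = anchor G u (t g) (fc v j).
  by rewrite -(TmapE t _ (fc_C j sv)) ri_t.
have eV i : ri v g (fc u i \o t) = anchor G v (t g) (fc u i).
  by rewrite -(TmapE t _ (fc_C i su)) ri_t.
have eW i : Tmap t W (fc v i) = W (fc v i \o t) by rewrite TmapE //; exact: fc_C.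
under [X in X - _ - _ - _ = _]eq_bigr => j _ do rewrite eU (lin2l_sum _ (ddb j) (fun i => trv i _) tY) (lin1_sum _ (db j) (fun i => trv i _)).
under [X in _ - X - _ - _ = _]eq_bigr => j _ do rewrite eV (lin2l_sum _ (ddb j) (fun i => trv i _) tY) (lin1_sum _ (db j) (fun i => trv i _)).
under [X in _ = _ + X]eq_bigr => i _ do under eq_bigr => j _ do rewrite eW.
apply: key_sums => i j; first by apply: (key_group hK).
exact: (beta_skew hK).
Qed.

End Basis.

Lemma dec_alpha u : algd_section G u -> decform (alpha u).
Proof. by move=> su; have [n [xk [E [Cx tE spanE]]]] := phi_basis; exact: (dec_alpha_basis Cx tE spanE). Qed.

Lemma alpha_key u v g W : algd_section G u -> algd_section G v -> tangent g W ->
  extd (alpha v) g (v2 (ri u g) W) - extd (alpha u) g (v2 (ri v g) W) - W (fun g => alpha u g (v1 (ri v g)))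
  - alpha (algd_bracket G u v) g (v1 W) =
  Theta (Phi g) (v3 (Tmap Phi (ri u g)) (Tmap Phi (ri v g)) (Tmap Phi W))
  + dpairing GK Omega Phi v u (t g) (v1 (Tmap t W)).
Proof. by have [n [xk [E [Cx tE spanE]]]] := phi_basis; exact: (alpha_key_basis Cx tE spanE). Qed.

Lemma pairing_deriv u v x z : algd_section G u -> algd_section G v -> tangent x z ->
  z (fun y => pairing GK Omega (phi u y) (phi v y)) =
  dpairing GK Omega Phi u v x (v1 z) + dpairing GK Omega Phi v u x (v1 z).
Proof.
move=> su sv tz; have [n [xk [E [Cx tE spanE]]]] := phi_basis.
have [au _] := su; have [av _] := sv.
have -> : (fun y => pairing GK Omega (phi u y) (phi v y)) =
    fun y => \sum_i \sum_j fc xk u i y * fc xk v j y * pairing GK Omega (E i) (E j).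
  by apply/funext => y; rewrite (phi_span Cx spanE (au y)) (phi_span Cx spanE (av y)) (pairing_sum hK).
have Cf w i : algd_section G w -> Cinf N (fc xk w i) by move=> sw; exact: fc_C.
have Cm i j : Cinf N (fun y => fc xk u i y * fc xk v j y) by apply: C_mul; exact: Cf.
rewrite /dpairing (vec_deriv_span Cx tE spanE su tz) (vec_deriv_span Cx tE spanE sv tz).
rewrite (phi_span Cx spanE (au x)) (phi_span Cx spanE (av x)) !(pairing_sum hK) //.
rewrite [X in _ = _ + X]exchange_big -big_split /= (tan_sumf tz); last first.
  by move=> i; apply: C_sum => j _; apply: C_mul => //; exact: C_cst.
apply: eq_bigr => i _; rewrite (tan_sumf tz); last by move=> j; apply: C_mul => //; exact: C_cst.
rewrite -big_split /=; apply: eq_bigr => j _.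
rewrite (tan_mul tz) //; last exact: C_cst.
rewrite (tan_cst tz) (tan_mul tz) //; try exact: Cf.
rewrite [pairing GK Omega (E j) (E i)](_ : _ = pairing GK Omega (E i) (E j)); first by ring.
by rewrite !(pairingE hK) // addrC.
Qed.

Lemma alpha_skew u v g : algd_section G u -> algd_section G v ->
  alpha u g (v1 (ri v g)) + alpha v g (v1 (ri u g)) = - pairing GK Omega (phi u (t g)) (phi v (t g)).
Proof.
move=> [au _] [av _]; rewrite !alphaE !phi_ri //.
by apply: (beta_skew hK) => //; exact: phi_tan.
Qed.

End Alpha.

(** * The forms theta and chi, and part (a) *)

Section Theta.
Context {R : realType} {K : manifold R} (GK : lieGroup K).
Context (Omega : preform (prodS K K) 2) (Theta : preform K 3).
Hypothesis hK : shifted2_symplectic GK Omega Theta.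
Context {H N : manifold R} (G : lieGroupoid H N) (Phi : H -> K).
Hypothesis hPhi : groupoid_morphism G GK Phi.
Local Notation s := (src G).
Local Notation t := (tgt G).
Local Notation e := (unit_at G).
Local Notation o := (gone GK).
Local Notation phi := (lie_morphism Phi).
Local Notation ri := (right_inv G).
Local Notation al := (alpha GK Omega G Phi).

Lemma comp_inj (c c' : composable G) : comp_fst c = comp_fst c' -> comp_snd c = comp_snd c' -> c = c'.
Proof. exact: fp_inj. Qed.

Lemma extd0E (M : smoothSpace R) {nM : nice M} (w : preform M 0) p z : decform w -> tangent p z ->
  extd w p (v1 z) = z (fun q => w q (fun=> 0)).
Proof.
move=> dw tz; have [Z [vZ <-]] := tan_extend tz.
have := extd_koszul p dw (v1P (P := @vfield R M) vZ); rewrite /koszul !big_ord1 expr0 mul1r => ->.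
rewrite big_pred0 ?addr0; last by move=> j; rewrite [j]ord1.
by congr (Z p _); apply/funext => q; congr (w q); apply/funext; case.
Qed.

Section Bundle.
Context (lam : N -> tvec H -> tvec N -> R).
Hypothesis bl : is_bundle_map G lam.

Lemma dec_lam u : algd_section G u -> decform (lam_form lam u).
Proof.
move=> su; have [au _] := su; have [l0 l1 l2 l3] := bl; apply: form_dec; split.
- move=> p v nv; apply: l0 => -[_ tv]; apply: nv => i; by rewrite [i]ord1.
- move=> p v i a x y tv tx ty; rewrite [i]ord1 /lam_form /= l2 //.
- by move=> p v i j; rewrite [i]ord1 [j]ord1 eqxx.
- by move=> X vX; exact: l3.
Qed.

(* The value which multiplicativity and [lambda_sigma = lam] force on the
   contraction of sigma with the right-invariant field of u. *)
Definition theta (u : N -> tvec H) : preform H 1 := pullback t (lam_form lam u) - al u.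

Lemma thetaE u g W : theta u g (v1 W) = lam (t g) (u (t g)) (Tmap t W) - al u g (v1 W).
Proof. by []. Qed.

Lemma dec_tlam u : algd_section G u -> decform (pullback t (lam_form lam u)).
Proof. by move=> su; apply: dec_pull; [exact: t_smooth|exact: dec_lam]. Qed.

Lemma dec_theta u : algd_section G u -> decform (theta u).
Proof. by move=> su; apply: dec_sub; [exact: dec_tlam|exact: (dec_alpha hK hPhi)]. Qed.

(** The left side is d sigma(u^R, v^R, W) as [cartan2] computes it when every i_(u^R) sigma is
    theta_u. The part coming from t^* lambda descends to N, the other one is [alpha_key]. *)
Lemma theta_M u v g W : algd_section G u -> algd_section G v -> tangent g W ->
  extd (theta v) g (v2 (ri u g) W) - extd (theta u) g (v2 (ri v g) W) - W (fun g => theta u g (v1 (ri v g)))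
  - theta (algd_bracket G u v) g (v1 W) =
  (extd (lam_form lam v) (t g) (v2 (anchor G u (t g)) (Tmap t W))
   - extd (lam_form lam u) (t g) (v2 (anchor G v (t g)) (Tmap t W))
   - Tmap t W (fun x => lam x (u x) (anchor G v x))
   - lam (t g) (algd_bracket G u v (t g)) (Tmap t W))
  - (Theta (Phi g) (v3 (Tmap Phi (ri u g)) (Tmap Phi (ri v g)) (Tmap Phi W))
     + dpairing GK Omega Phi v u (t g) (v1 (Tmap t W))).
Proof.
move=> su sv tW; have tU := vf_tan g (ri_vf su); have tV := vf_tan g (ri_vf sv).
have [au _] := su; have [av _] := sv.
have E a b B : algd_section G a -> algd_section G b -> tangent g B ->
    extd (theta a) g (v2 (ri b g) B) = extd (lam_form lam a) (t g) (v2 (anchor G b (t g)) (Tmap t B))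
      - extd (al a) g (v2 (ri b g) B).
  move=> sa sb tB; have tA := vf_tan g (ri_vf sb); have [ab _] := sb.
  have tv := v2P (P := tangent g) tA tB.
  rewrite /theta extd_sub //; [|exact: dec_tlam|exact: (dec_alpha hK hPhi)].
  by rewrite (extd_pull (@t_smooth _ _ _ G) (dec_lam sa) tv) pull2E ri_t.
rewrite !E // -(alpha_key hK hPhi su sv tW) thetaE.
have Cl : Cinf N (fun x => lam x (u x) (anchor G v x)).
  by have [_ _ _ l3] := bl; apply: l3 => //; exact: section_anchor.
have -> : (fun g => theta u g (v1 (ri v g))) =
    fun g => ((fun x => lam x (u x) (anchor G v x)) \o t) g - al u g (v1 (ri v g)).
  by apply/funext => g'; rewrite thetaE ri_t.
rewrite (tan_sub tW); [|exact: (@t_smooth _ _ _ G _ Cl)|apply: C1; [exact: (dec_alpha hK hPhi)|exact: ri_vf]].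
rewrite TmapE //; ring.
Qed.

(* The value of d sigma for an isotropic structure sigma + eta. *)
Definition chi (eta : preform N 3) : preform H 3 := pullback s eta - pullback t eta - pullback Phi Theta.

Lemma dec_chi eta : decform eta -> decform (chi eta).
Proof.
move=> de; apply: dec_sub; first by apply: dec_sub; apply: dec_pull => //; [exact: s_smooth|exact: t_smooth].
by apply: dec_pull; [exact: Phi_smooth hPhi|exact: dec_Theta hK].
Qed.

Lemma extd_chi eta : decform eta -> form_eq (extd eta) 0 -> form_eq (extd (chi eta)) 0.
Proof.
move=> de de0 g v tv; have dT := dec_Theta hK; have sP := Phi_smooth hPhi.
have [_ _ [_ _ dT0] _] := hK.
have ds : decform (pullback s eta) by apply: dec_pull => //; exact: s_smooth.
have dt : decform (pullback t eta) by apply: dec_pull => //; exact: t_smooth.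
have dp : decform (pullback Phi Theta) by exact: dec_pull.
rewrite /chi (extd_sub (dec_sub ds dt) dp tv) (extd_sub ds dt tv).
rewrite (extd_pull (@s_smooth _ _ _ G) de tv) (extd_pull (@t_smooth _ _ _ G) de tv) (extd_pull sP dT tv).
rewrite /pullback de0 ?de0 ?dT0 ?subr0 //.
- by move=> i; apply: Tmap_tan => //; exact: Phi_smooth hPhi.
- by move=> i; apply: Tmap_tan => //; exact: t_smooth.
- by move=> i; apply: Tmap_tan => //; exact: s_smooth.
Qed.

Lemma chiE eta u v g W : decform eta -> algd_section G u -> algd_section G v -> tangent g W ->
  chi eta g (v3 (ri u g) (ri v g) W) = - eta (t g) (v3 (anchor G u (t g)) (anchor G v (t g)) (Tmap t W))
    - Theta (Phi g) (v3 (Tmap Phi (ri u g)) (Tmap Phi (ri v g)) (Tmap Phi W)).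
Proof.
move=> de [au _] [av _] tW; rewrite /chi -[LHS]/(_ - _ - _) !pull3E !ri_s // !ri_t // zero3l ?sub0r //.
- exact: tan0.
- by apply: Tmap_tan => //; exact: s_smooth.
Qed.

End Bundle.

Lemma algebroid_dec lam eta : isotropic_algebroid GK Omega G Phi (lam, eta) ->
  [/\ is_bundle_map G lam, decform eta & form_eq (extd eta) 0].
Proof. by move=> [bl fe de _ _]; split=> //; exact: form_dec. Qed.

Lemma lie_derivE (X : N -> tvec N) (w : preform N 1) x z : vfield X -> decform w -> tangent x z ->
  lie_deriv X w x (v1 z) = z (fun y => w y (v1 (X y))) + extd w x (v2 (X x) z).
Proof.
move=> vX dw tz; rewrite /lie_deriv -[LHS]/(_ + _) iprod1E extd0E //; last exact: dec_iprod.
by congr (z _ + _); apply/funext => y; rewrite /iprod; congr (w y); rewrite [LHS]v1E; congr v1; rewrite unlift_none.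
Qed.

Lemma algebroid_eq1 lam (eta : preform N 3) u v x z : is_bundle_map G lam -> decform eta -> algd_section G u -> algd_section G v ->
  tangent x z ->
  (lie_deriv (anchor G u) (lam_form lam v) - iprod (anchor G v) (extd (lam_form lam u))
     + iprod (anchor G v) (iprod (anchor G u) eta) + dpairing GK Omega Phi u v) x (v1 z) =
  z (fun y => lam y (v y) (anchor G u y)) + extd (lam_form lam v) x (v2 (anchor G u x) z)
  - extd (lam_form lam u) x (v2 (anchor G v x) z) + eta x (v3 (anchor G u x) (anchor G v x) z)
  + dpairing GK Omega Phi u v x (v1 z).
Proof.
move=> bl de su sv tz; have va := section_anchor su; have dv := dec_lam bl sv.
by rewrite -[LHS]/(_ - _ + _ + _) (lie_derivE va dv tz) iprod1E.
Qed.

(** The axioms as an integrability condition for i_(u^R) sigma = theta_u. They contain <d phi(u),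
    phi(v)>, whereas [theta_M] contains <d phi(v), phi(u)>; the two add up to the differential of
    the pairing, which the second axiom expresses through lambda. *)
Lemma theta_key lam eta u v g W : isotropic_algebroid GK Omega G Phi (lam, eta) ->
  algd_section G u -> algd_section G v -> tangent g W ->
  extd (theta lam v) g (v2 (ri u g) W) - extd (theta lam u) g (v2 (ri v g) W)
  - W (fun g => theta lam u g (v1 (ri v g))) - theta lam (algd_bracket G u v) g (v1 W) =
  chi eta g (v3 (ri u g) (ri v g) W).
Proof.
move=> IM su sv tW; have [bl de _] := algebroid_dec IM; have [_ _ _ eq1 eq2] := IM; rewrite /= in eq1 eq2.
have tz : tangent (t g) (Tmap t W) by apply: Tmap_tan => //; exact: t_smooth.
rewrite theta_M // chiE //.
have := eq1 u v su sv (t g) _ (v1P (P := tangent (t g)) tz).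
rewrite algebroid_eq1 // -[LHS]/(lam (t g) (algd_bracket G u v (t g)) (Tmap t W)) => ->.
have := pairing_deriv hK hPhi su sv tz.
have -> : (fun y => pairing GK Omega (phi u y) (phi v y)) =
    fun y => - (lam y (v y) (anchor G u y) + lam y (u y) (anchor G v y)).
  by apply/funext => y; rewrite -eq2 // opprK.
have [_ _ _ l3] := bl.
have C1' : Cinf N (fun y => lam y (v y) (anchor G u y)) by apply: l3 => //; exact: section_anchor.
have C2' : Cinf N (fun y => lam y (u y) (anchor G v y)) by apply: l3 => //; exact: section_anchor.
rewrite (tan_opp tz) ?(tan_add tz) //; last exact: C_add.
move: (dpairing _ _ _ u v _ _) => A; move: (dpairing _ _ _ v u _ _) => B E.
have -> : A = - (Tmap t W (fun y => lam y (v y) (anchor G u y)) + Tmap t W (fun y => lam y (u y) (anchor G v y))) - B.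
  by rewrite E addrK.
ring.
Qed.

Lemma theta_skew lam eta u v g : isotropic_algebroid GK Omega G Phi (lam, eta) ->
  algd_section G u -> algd_section G v -> theta lam u g (v1 (ri v g)) = - theta lam v g (v1 (ri u g)).
Proof.
move=> [_ _ _ _ /= eq2] su sv; have := alpha_skew hK hPhi g su sv; have [au _] := su; have [av _] := sv.
rewrite (eq2 u v su sv) !thetaE !ri_t // => E; apply/eqP; rewrite -addr_eq0; apply/eqP.
have -> : lam (t g) (v (t g)) (anchor G u (t g)) = al u g (v1 (ri v g)) + al v g (v1 (ri u g)) -
    lam (t g) (u (t g)) (anchor G v (t g)) by rewrite E addrK.
ring.
Qed.

Section FromSigma.
Context (sigma : preform H 2) (eta : preform N 3).
Hypothesis iso : isotropic_groupoid Omega Theta G Phi (sigma, eta).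
Let lam := lambda_of G sigma.

Lemma iso_dec : decform sigma /\ decform eta.
Proof. by have [[f1 f2] _ _ _ _] := iso; split; exact: form_dec. Qed.

Lemma lambda_ofE x u w : algd G x u -> tangent x w -> lam x u w = sigma (e x) (v2 u (Tmap e w)).
Proof. by move=> au tw; rewrite /lam /lambda_of asboolT ?v2_tuple. Qed.

Lemma lambda_bundle : is_bundle_map G lam.
Proof.
have [ds _] := iso_dec; have tTe x w : tangent x w -> tangent (e x) (Tmap e w).
  by move=> tw; apply: Tmap_tan => //; exact: e_smooth.
split.
- by move=> x u w nP; rewrite /lam /lambda_of asboolF.
- move=> x a u v w au av tw; have [tu u0] := au; have [tv v0] := av.
  rewrite !lambda_ofE // ?lin2l //; first exact: tTe.
  by split; [exact: tan_comb|rewrite Tmap_comb u0 v0 scaler0 addr0].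
- move=> x a u w z au tw tz; have [tu u0] := au.
  by rewrite !lambda_ofE // ?Tmap_comb ?lin2r //; [exact: tTe|exact: tTe|exact: tan_comb].
- move=> u X su vX; have [au _] := su.
  have dp : decform (pullback e (iprod (ri u) sigma)).
    by apply: dec_pull; [exact: e_smooth|apply: dec_iprod => //; exact: ri_vf].
  have -> : (fun x => lam x (u x) (X x)) = fun x => pullback e (iprod (ri u) sigma) x (v1 (X x)).
    apply/funext => x; rewrite lambda_ofE //; last exact: vf_tan.
    by rewrite pull1E iprod1E ri_unit.
  exact: C1.
Qed.

Lemma iprod_sigma u : algd_section G u -> form_eq (iprod (ri u) sigma) (theta lam u).
Proof.
move=> su g w; rewrite (v1E w); move: (w ord0) => W {w} tW'; have {tW'} tW : tangent g W := tW' ord0.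
have [au _] := su; have [ds _] := iso_dec; have [_ _ mult _ _] := iso.
have [c [c1 c2]] := comp_pair (src_unit G (t g)).
have cm : comp_mul c = g by rewrite /comp_mul c1 c2 gcomp_unitl.
have [A [tA A1 A2 Am]] := ri_mul au c.
(* [k] is the map g |-> (1, g). Its differential takes W to the vector with components e_* t_* W and
   W, on which multiplicativity is evaluated against (u^R, 0). *)
have [|||k sk [k1 k2]] := @comp_map _ _ _ G H _ (e \o t) id.
- by apply: smooth_comp; [exact: t_smooth|exact: e_smooth].
- exact: smooth_id.
- by move=> l; rewrite /= src_unit.
have kc : k g = c by apply: comp_inj; rewrite ?k1 ?k2 ?c1 ?c2.
have tB : tangent c (Tmap k W) by rewrite -kc; exact: Tmap_tan.
have tz : tangent (t g) (Tmap t W) by apply: Tmap_tan => //; exact: t_smooth.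
have B1 : Tmap (@comp_fst _ _ _ G) (Tmap k W) = Tmap e (Tmap t W).
  rewrite Tmap_comp; last exact: cf_smooth.
  by rewrite Tmap_comp; [congr (Tmap _ W); apply/funext|exact: e_smooth].
have B2 : Tmap (@comp_snd _ _ _ G) (Tmap k W) = W.
  rewrite Tmap_comp; last exact: cs_smooth.
  by rewrite (Tmap_idE tW).
have Bm : Tmap (@comp_mul _ _ _ G) (Tmap k W) = W.
  rewrite Tmap_comp; last exact: cm_smooth.
  by rewrite (Tmap_idE tW) // => l; rewrite /= /comp_mul k1 k2 /= gcomp_unitl.
have := mult c _ (v2P (P := tangent c) tA tB).
rewrite -[LHS]/(_ + _ - _) !pull2E A1 A2 Am B1 B2 Bm c1 c2 cm (ri_unit au).
have sP := Phi_smooth hPhi.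
have sPP : smooth_map (M := composable G) (N := prodS K K) (fun p => (Phi (comp_fst p), Phi (comp_snd p))).
  by apply: pair_smooth; [exact: smooth_comp (cf_smooth (G := G)) sP|exact: smooth_comp (cs_smooth (G := G)) sP].
rewrite zero2l // addr0 thetaE lambda_ofE // alphaE betaE (Phi_unit hPhi) // iprod1E.
have tPu := phi_tan hPhi (au (t g)).
have tPW : tangent (Phi g) (Tmap Phi W) by exact: Tmap_tan.
have tC : tangent ((o, Phi g) : prodS K K) (Tmap (M := composable G) (N := prodS K K) (fun p => (Phi (comp_fst p), Phi (comp_snd p))) A).
  have : tangent ((Phi (comp_fst c), Phi (comp_snd c)) : prodS K K) (Tmap (M := composable G) (N := prodS K K)
    (fun p => (Phi (comp_fst p), Phi (comp_snd p))) A) by exact: (Tmap_tan sPP tA).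
  by rewrite c1 c2 (Phi_unit hPhi).
have tD : tangent ((o, Phi g) : prodS K K) (Tmap (M := composable G) (N := prodS K K) (fun p => (Phi (comp_fst p), Phi (comp_snd p))) (Tmap k W)).
  have : tangent ((Phi (comp_fst c), Phi (comp_snd c)) : prodS K K) (Tmap (M := composable G) (N := prodS K K)
    (fun p => (Phi (comp_fst p), Phi (comp_snd p))) (Tmap k W)) by exact: (Tmap_tan sPP tB).
  by rewrite c1 c2 (Phi_unit hPhi).
(* In K x K the two vectors become (phi(u), 0) and (0, Phi_* W), the arguments of Omega in beta. *)
have -> : Tmap (M := composable G) (N := prodS K K) (fun p => (Phi (comp_fst p), Phi (comp_snd p))) A = Tmap (pl (Phi g)) (phi u (t g)).
  apply: (prod_tan_ext tC); first by apply: pl_tan.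
    rewrite [LHS]Tmap_comp; last exact: p1_smooth.
    rewrite [RHS]Tmap_comp; last exact: p1_smooth.
    rewrite (Tmap_idE (f := p1 \o pl (Phi g)) tPu) //.
    by rewrite -[p1 \o _]/(Phi \o @comp_fst _ _ _ G) -Tmap_comp // A1 c1 ri_unit.
  rewrite [LHS]Tmap_comp; last exact: p2_smooth.
  rewrite [RHS]Tmap_comp; last exact: p2_smooth.
  rewrite (Tmap_const (y := Phi g) tPu) //.
  by rewrite -[p2 \o _]/(Phi \o @comp_snd _ _ _ G) -Tmap_comp // A2 Tmap0.
have -> : Tmap (M := composable G) (N := prodS K K) (fun p => (Phi (comp_fst p), Phi (comp_snd p))) (Tmap k W) = Tmap (pr o) (Tmap Phi W).
  apply: (prod_tan_ext tD); first by apply: pr_tan.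
    rewrite [LHS]Tmap_comp; last exact: p1_smooth.
    rewrite [RHS]Tmap_comp; last exact: p1_smooth.
    rewrite (Tmap_const (y := o) tPW) //.
    rewrite -[p1 \o _]/(Phi \o @comp_fst _ _ _ G) -Tmap_comp // B1 Tmap_comp //.
    by rewrite (Tmap_const (y := o) tz) // => x; exact: (Phi_unit hPhi).
  rewrite [LHS]Tmap_comp; last exact: p2_smooth.
  rewrite [RHS]Tmap_comp; last exact: p2_smooth.
  rewrite (Tmap_idE (f := p2 \o pr o) tPW) //.
  by rewrite -[p2 \o _]/(Phi \o @comp_snd _ _ _ G) -Tmap_comp // B2.
by rewrite -[(sigma, eta).1]/sigma => <-; ring.
Qed.

Lemma dsigma : form_eq (extd sigma) (chi eta).
Proof.
have [_ _ _ E _] := iso; move=> g v tv.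
have E' : pullback Phi Theta g v = pullback s eta g v - pullback t eta g v - extd sigma g v := E g v tv.
by rewrite /chi -[RHS]/(_ - _ - _) E'; ring.
Qed.

Lemma iso_algebroid : isotropic_algebroid GK Omega G Phi (lam, eta).
Proof.
have [ds de] := iso_dec; have [[_ fe] _ _ _ de0] := iso; have bl := lambda_bundle.
(* The pairing axiom is the skew-symmetry of sigma on u^R and v^R at a unit, combined with
   [alpha_skew]. *)
have eq2 u v : algd_section G u -> algd_section G v -> forall x,
    - pairing GK Omega (phi u x) (phi v x) = lam x (v x) (anchor G u x) + lam x (u x) (anchor G v x).
  move=> su sv x; have [au _] := su; have [av _] := sv.
  have tu := vf_tan (e x) (ri_vf su); have tv := vf_tan (e x) (ri_vf sv).
  have := skew2 ds tu tv; rewrite -!iprod1E.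
  rewrite (iprod_sigma sv) ?(iprod_sigma su) //.
  rewrite !thetaE tgt_unit !ri_t // tgt_unit => E.
  have := alpha_skew hK hPhi (e x) su sv; rewrite tgt_unit => <-.
  have -> : lam x (v x) (anchor G u x) = al v (e x) (v1 (ri u (e x))) - (lam x (u x) (anchor G v x) - al u (e x) (v1 (ri v (e x)))).
    by rewrite -E addrC subrK.
  ring.
split=> // u v su sv x w; rewrite (v1E w); move: (w ord0) => z {w} tz'; have {tz'} tz : tangent x z := tz' ord0.
have tW : tangent (e x) (Tmap e z) by apply: Tmap_tan => //; exact: e_smooth.
have vu := ri_vf su; have vv := ri_vf sv; have tu := vf_tan (e x) vu; have tv := vf_tan (e x) vv.
have teE : Tmap t (Tmap e z) = z.
  rewrite Tmap_comp; last exact: t_smooth.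
  by rewrite (Tmap_idE tz) // => y /=; rewrite tgt_unit.
have nH : nice H by exact: _.
(* The bracket axiom is Cartan's formula at the unit of x, with third argument e_* z. *)
have := @cartan2 R H nH sigma _ _ _ _ ds vu vv tW.
have di a : algd_section G a -> decform (iprod (ri a) sigma) by move=> sa; apply: dec_iprod => //; exact: ri_vf.
rewrite (extd_eq (di v sv) (iprod_sigma sv)); last exact: v2P.
rewrite (extd_eq (di u su) (iprod_sigma su)); last exact: v2P.
have -> : (fun q => sigma q (v2 (ri u q) (ri v q))) = fun q => theta lam u q (v1 (ri v q)).
  by apply/funext => q; rewrite -(iprod_sigma su) //; move=> i; exact: vf_tan.
have IS : sigma (e x) (v2 (ri (algd_bracket G u v) (e x)) (Tmap e z)) =
    theta lam (algd_bracket G u v) (e x) (v1 (Tmap e z)).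
  exact: (iprod_sigma (section_bracket su sv) (v1P (P := tangent (e x)) tW)).
rewrite ri_bracket // IS.
rewrite dsigma; last by apply: v3P.
rewrite theta_M // chiE // tgt_unit teE algebroid_eq1 //.
rewrite -[X in _ -> X = _]/(lam x (algd_bracket G u v x) z).
(* Trades the term <d phi(v), phi(u)> of [theta_M] for the term <d phi(u), phi(v)> of the axiom. *)
have := pairing_deriv hK hPhi su sv tz.
have -> : (fun y => pairing GK Omega (phi u y) (phi v y)) =
    fun y => - (lam y (v y) (anchor G u y) + lam y (u y) (anchor G v y)).
  by apply/funext => y; rewrite -eq2 // opprK.
have [_ _ _ l3] := bl.
have C1' : Cinf N (fun y => lam y (v y) (anchor G u y)) by apply: l3 => //; exact: section_anchor.
have C2' : Cinf N (fun y => lam y (u y) (anchor G v y)) by apply: l3 => //; exact: section_anchor.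
rewrite (tan_opp tz) ?(tan_add tz) //; last exact: C_add.
move: (dpairing _ _ _ u v _ _) => A; move: (dpairing _ _ _ v u _ _) => B E1 E2.
have -> : A = - (z (fun y => lam y (v y) (anchor G u y)) + z (fun y => lam y (u y) (anchor G v y))) - B.
  by rewrite E1 addrK.
rewrite -[(lam, eta).1]/lam -[(lam, eta).2]/eta.
move: E2; set L := lam x _ z; set T := Theta _ _; set e3 := eta x _; set x1 := extd _ _ _; set x2 := extd _ _ _.
set z1 := z (fun y => lam y (u y) _); set z2 := z _ => E2.
by move: L T e3 x1 x2 z1 z2 E2 => L T e3 x1 x2 z1 z2; lra.
Qed.

End FromSigma.
End Theta.

(** * Gluing local solutions along simply connected fibres *)

Section Monodromy.
Context {R : realType} {X : topologicalType} (S : set X) (Kf : X -> X -> R).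
Local Notation I01 := (`[0, 1]%classic : set R).

Definition wcont (T : topologicalType) (Y : set T) (h : T -> X) : Prop :=
  forall y, Y y -> forall V, nbhs (h y) V -> \forall y' \near y, Y y' -> V (h y').

Lemma within_wcont (T : topologicalType) (Y : set T) (h : T -> X) : {within Y, continuous h} -> wcont Y h.
Proof.
move=> ch y Yy V nV; have := ch y V nV.
by rewrite -[nbhs (_ : subspace _)]/(nbhs_subspace _) -nbhs_subspace_in.
Qed.

Lemma wcont_within (T : topologicalType) (Y : set T) (h : T -> X) : wcont Y h -> {within Y, continuous h}.
Proof.
move=> wh y V nV; rewrite -[nbhs (_ : subspace _)]/(nbhs_subspace _).
have [Yy|nYy] := pselect (Y y); first by rewrite -nbhs_subspace_in //; exact: wh y Yy V nV.
have Q (Z : set T) : Z y -> nbhs_subspace (y : subspace Y) Z by move=> Zy; have -> : nbhs_subspace (y : subspace Y) = globally [set y] := esym (@nbhs_subspace_out T Y y nYy); move=> z ->.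
exact: Q _ (nbhs_singleton nV).
Qed.

(** The functions [Kf p] are local potentials on [S]: near each r close to p, those based at p and
    at r differ by a constant. They play the part of local primitives of a closed 1-form. *)
Hypothesis Kloc : forall p, S p -> exists2 W, nbhs p W & forall r, S r -> W r ->
  \forall q \near r, S q -> Kf p q - Kf r q = Kf p r - Kf r r.

(* A potential along h: a function k whose germ at every y is K (h y) o h up to
   a constant. *)
Definition lifts (T : topologicalType) (Y : set T) (h : T -> X) (k : T -> R) : Prop :=
  forall y, Y y -> \forall y' \near y, Y y' -> k y' - Kf (h y) (h y') = k y - Kf (h y) (h y).

Lemma lifts_sub (T : topologicalType) (Y Y' : set T) (h h' : T -> X) k : Y' `<=` Y ->
  (forall y, Y' y -> h y = h' y) -> lifts Y h k -> lifts Y' h' k.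
Proof.
move=> YY hh lk y Y'y; have := lk y (YY y Y'y); apply: filterS => y' H Y'y'.
by rewrite -!hh // H //; exact: YY.
Qed.

Lemma lifts_add (T : topologicalType) (Y : set T) (h : T -> X) k (c : R) :
  lifts Y h k -> lifts Y h (fun y => k y + c).
Proof.
move=> lk y Yy; have := lk y Yy; apply: filterS => y' H Yy'.
by rewrite addrAC H // addrAC.
Qed.

Lemma lifts_reparam (T T' : topologicalType) (Y : set T) (Y' : set T') (f : T' -> T) (h : T -> X) k :
  continuous f -> (forall y, Y' y -> Y (f y)) -> lifts Y h k -> lifts Y' (h \o f) (k \o f).
Proof.
move=> cf fY lk y Y'y; have H : nbhs y (f @^-1` _) := cf y _ (lk (f y) (fY y Y'y)).
by apply: filterS H => y' H Y'y' /=; rewrite H //; exact: fY.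
Qed.

Lemma lifts_glue (T : topologicalType) (Y1 Y2 : set T) (h : T -> X) k1 k2 : closed Y1 -> closed Y2 ->
  lifts Y1 h k1 -> lifts Y2 h k2 -> (forall y, Y1 y -> Y2 y -> k1 y = k2 y) ->
  exists k, [/\ lifts (Y1 `|` Y2) h k, forall y, Y1 y -> k y = k1 y & forall y, Y2 y -> k y = k2 y].
Proof.
move=> cY1 cY2 l1 l2 E; pose k y := if `[< Y1 y >] then k1 y else k2 y.
have kE1 y : Y1 y -> k y = k1 y by move=> H; rewrite /k asboolT.
have kE2 y : Y2 y -> k y = k2 y.
  by move=> H; rewrite /k; case: asboolP => // H1; exact: E.
exists k; split=> // y Y12.
have n1 : \forall y' \near y, Y1 y' -> k y' - Kf (h y) (h y') = k y - Kf (h y) (h y).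
  have [H1|H1] := pselect (Y1 y).
    by have := l1 y H1; apply: filterS => y' H Y1y'; rewrite !kE1 // H.
  have : \forall y' \near y, (~` Y1) y' by apply: open_nbhs_nbhs; split=> //; exact: closed_openC.
  by apply: filterS => y'.
have n2 : \forall y' \near y, Y2 y' -> k y' - Kf (h y) (h y') = k y - Kf (h y) (h y).
  have [H2|H2] := pselect (Y2 y).
    by have := l2 y H2; apply: filterS => y' H Y2y'; rewrite !kE2 // H.
  have : \forall y' \near y, (~` Y2) y' by apply: open_nbhs_nbhs; split=> //; exact: closed_openC.
  by apply: filterS => y'.
by apply: filterS2 n1 n2 => y' H1 H2 [/H1|/H2].
Qed.

Lemma lifts_diff (T : topologicalType) (Y : set T) (h : T -> X) k1 k2 (c : R -> T) : lifts Y h k1 -> lifts Y h k2 ->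
  continuous c -> (forall t : R, 0 <= t <= 1 -> Y (c t)) -> k1 (c 1) - k2 (c 1) = k1 (c 0) - k2 (c 0).
Proof.
move=> l1 l2 cc Yc.
apply: (@path_ind R T Y (fun y => k1 y - k2 y = k1 (c 0) - k2 (c 0)) c) => //.
  exact: continuous_subspaceT.
move=> p Yp; exists [set y | Y y -> k1 y - k2 y = k1 p - k2 p].
  apply: filterS2 (l1 p Yp) (l2 p Yp) => y H1 H2 Yy.
  have := H1 Yy; have := H2 Yy; move: (Kf _ _) (Kf _ _) => A B E2 E1.
  have -> : k1 y = k1 p - A + B by rewrite -E1 subrK.
  have -> : k2 y = k2 p - A + B by rewrite -E2 subrK.
  by ring.
by move=> q q' Yq Yq' Wq Wq'; rewrite (Wq Yq) (Wq' Yq').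
Qed.

Lemma lifts_local (T : topologicalType) (Y : set T) (h : T -> X) p W : S p ->
  (forall r, S r -> W r -> \forall q \near r, S q -> Kf p q - Kf r q = Kf p r - Kf r r) ->
  wcont Y h -> (forall y, Y y -> S (h y) /\ W (h y)) -> lifts Y h (fun y => Kf p (h y)).
Proof.
move=> Sp HW ch hY y Yy; have [Sy Wy] := hY y Yy.
have := ch y Yy _ (HW _ Sy Wy); apply: filterS => y' H Yy'; have [Sy' _] := hY y' Yy'.
exact: H.
Qed.

Definition rect (a b c d : R) : set (R * R) := `[a, b]%classic `*` `[c, d]%classic.

Lemma rectE a b c d y : rect a b c d y <-> (a <= y.1 <= b) /\ (c <= y.2 <= d).
Proof. by rewrite /rect /= !in_itv. Qed.

Lemma rect_closed a b c d : closed (rect a b c d).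
Proof.
have -> : rect a b c d = (fst @^-1` `[a, b]%classic) `&` (snd @^-1` `[c, d]%classic) by [].
apply: closedI; apply: preimage_closed; try exact: itv_closed.
- by move=> y _; exact: cvg_fst.
- by move=> y _; exact: cvg_snd.
Qed.

Lemma cts_aff (a b : R) : continuous (fun t : R => a * t + b).
Proof.
move=> t; apply: (@continuousD _ _ _ (fun t : R => a * t)); last exact: cst_continuous.
by apply: continuousM; [exact: cst_continuous|exact: cvg_id].
Qed.

Lemma rect_diff a b c d h k1 k2 y y' : lifts (rect a b c d) h k1 -> lifts (rect a b c d) h k2 ->
  rect a b c d y -> rect a b c d y' -> k1 y' - k2 y' = k1 y - k2 y.
Proof.
move=> l1 l2 /rectE[/andP[a1 a2] /andP[c1 c2]] /rectE[/andP[b1 b2] /andP[d1 d2]].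
pose g (t : R) := ((y'.1 - y.1) * t + y.1, (y'.2 - y.2) * t + y.2).
have g0 : g 0 = y by rewrite /g !mulr0 !add0r -surjective_pairing.
have g1 : g 1 = y' by rewrite /g !mulr1 !subrK -surjective_pairing.
have cg : continuous g by move=> t; exact: (cvg_pair (@cts_aff (y'.1 - y.1) y.1 t) (@cts_aff (y'.2 - y.2) y.2 t)).
rewrite -g0 -g1; apply: (lifts_diff l1 l2 cg) => t /andP[t0 t1]; apply/rectE; rewrite /g /=.
have conv (A B x z : R) : A <= x -> x <= B -> A <= z -> z <= B -> A <= (z - x) * t + x <= B.
  move=> H1 H2 H3 H4; have -> : (z - x) * t + x = (1 - t) * x + t * z by ring.
  have s0 : 0 <= 1 - t by rewrite subr_ge0.
  have := ler_wpM2l s0 H1; have := ler_wpM2l s0 H2; have := ler_wpM2l t0 H3; have := ler_wpM2l t0 H4.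
  by move=> *; apply/andP; split; lra.
by split; apply: conv.
Qed.

(** The intersection is a rectangle, hence connected: once a constant makes the two potentials agree
    at y0, they agree on all of it. *)
Lemma rect_glue (Y1 Y2 Y : set (R * R)) h a b c d k1 k2 y0 : closed Y1 -> closed Y2 ->
  lifts Y1 h k1 -> lifts Y2 h k2 -> Y1 `&` Y2 = rect a b c d -> rect a b c d y0 -> Y `<=` Y1 `|` Y2 ->
  exists k, lifts Y h k.
Proof.
move=> c1 c2 l1 l2 E y00 YY.
have l2' := lifts_add (k1 y0 - k2 y0) l2.
have [|k [lk _ _]] := lifts_glue c1 c2 l1 l2'.
  move=> y H1 H2; have Ry : rect a b c d y by rewrite -E.
  have s1 : lifts (rect a b c d) h k1 by apply: lifts_sub l1 => // z; rewrite -E => -[].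
  have s2 : lifts (rect a b c d) h k2 by apply: lifts_sub l2 => // z; rewrite -E => -[].
  by have := rect_diff s1 s2 y00 Ry; move=> <-; rewrite addrC subrK.
by exists k; apply: lifts_sub lk.
Qed.

(** Two nested applications of [bisection]: over the first coordinate for the whole square, and over
    the second one for a thin strip around each r0. *)
Lemma square_lift (h : R * R -> X) : wcont (I01 `*` I01) h -> (forall y, (I01 `*` I01) y -> S (h y)) ->
  exists k, lifts (I01 `*` I01) h k.
Proof.
move=> wh Sh.
suff [] : 0 <= (1 : R) /\ exists k, lifts (rect 0 1 0 1) h k by [].
apply: (bisection (Q := fun a b => a <= b /\ exists k, lifts (rect a b 0 1) h k)).
  move=> a b c [ab [k1 l1]] [bc [k2 l2]]; split; first exact: le_trans bc.
  apply: (@rect_glue _ _ _ h b b 0 1 k1 k2 (b, 0) (@rect_closed _ _ _ _) (@rect_closed _ _ _ _) l1 l2).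
  - apply/seteqP; split=> y.
      by move=> [/rectE[/andP[_ y1] y2] /rectE[/andP[y3 _] _]]; apply/rectE; rewrite y1 y3.
    by move=> /rectE[/andP[y1 y2] y3]; split; apply/rectE; split=> //; apply/andP; split=> //; lra.
  - by apply/rectE; rewrite /= !lexx ler01.
  - move=> y /rectE[/andP[y1 y2] y3]; have [yb|/ltW yb] := leP y.1 b; [left|right]; apply/rectE; split=> //; exact/andP.
move=> r0 /andP[r00 r01].
suff [_ [e [e0 [k lk]]]] : 0 <= (1 : R) /\ exists e : R, 0 < e /\ exists k,
    lifts ((rect (r0 - e) (r0 + e) 0 1) `&` (I01 `*` I01)) h k.
  exists e => // a b a0 ab b1 ar br; split=> //; exists k; apply: lifts_sub lk => // y /rectE[/andP[y1 y2] y3].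
  have := ler_norm (a - r0); have := ler_norm (r0 - a); have := ler_norm (b - r0); have := ler_norm (r0 - b).
  rewrite (distrC r0 a) (distrC r0 b) => *.
  have /andP[y4 y5] := y3.
  by split; [apply/rectE; split=> //=; apply/andP; split; lra|split; rewrite /= in_itv /=; apply/andP; split; lra].
(* The width e is part of the property, since each gluing may reduce it. *)
apply: (bisection (Q := fun c d => c <= d /\ exists e : R, 0 < e /\ exists k,
    lifts ((rect (r0 - e) (r0 + e) c d) `&` (I01 `*` I01)) h k)).
  move=> a b c [ab [e1 [e10 [k1 l1]]]] [bc [e2 [e20 [k2 l2]]]]; split; first exact: le_trans bc.
  pose e := Num.min e1 e2; have e0 : 0 < e by rewrite lt_min e10.
  have ee1 : e <= e1 by rewrite ge_min lexx.
  have ee2 : e <= e2 by rewrite ge_min lexx orbT.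
  exists e; split=> //.
  (* [bisection] asks for transitivity at all reals b; for b outside [0, 1], one of the two pieces
     already covers what lies in the unit square. *)
  have [bI|nbI] := pselect (0 <= b <= 1); last first.
    exists (if b < 0 then k2 else k1); have [b0|b0] := ltP b 0.
      apply: lifts_sub l2 => // y [/rectE[/andP[y1 y2] /andP[y3 y4]] [/= y5]]; rewrite /= !in_itv /= => y6.
      split; last by split; rewrite //= in_itv.
      by apply/rectE; split; apply/andP; split=> //; lra.
    have b1 : 1 < b by rewrite ltNge; apply/negP => b1; apply: nbI; rewrite b0.
    apply: lifts_sub l1 => // y [/rectE[/andP[y1 y2] /andP[y3 y4]] [/= y5]]; rewrite /= !in_itv /= => y6.
    split; last by split; rewrite //= in_itv.
    by apply/rectE; split; apply/andP; split=> //; lra.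
  have /andP[bI0 bI1] := bI.
  have cl (A : set (R * R)) : closed A -> closed (A `&` (I01 `*` I01)).
    by move=> cA; apply: closedI => //; exact: (@rect_closed 0 1 0 1).
  pose a' := Num.max (r0 - e) 0; pose b' := Num.min (r0 + e) 1.
  have l1' : lifts (rect (r0 - e) (r0 + e) a b `&` (I01 `*` I01)) h k1.
    apply: lifts_sub l1 => // y [/rectE[/andP[y1 y2] y3] y4]; split=> //.
    by apply/rectE; split=> //; apply/andP; split; lra.
  have l2' : lifts (rect (r0 - e) (r0 + e) b c `&` (I01 `*` I01)) h k2.
    apply: lifts_sub l2 => // y [/rectE[/andP[y1 y2] y3] y4]; split=> //.
    by apply/rectE; split=> //; apply/andP; split; lra.
  apply: (@rect_glue _ _ _ h a' b' b b k1 k2 (r0, b) (cl _ (@rect_closed _ _ _ _)) (cl _ (@rect_closed _ _ _ _)) l1' l2').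
  - apply/seteqP; split=> y.
      move=> [[/rectE[/andP[y1 y2] /andP[y3 y4]] [/= y5 y6]] [/rectE[_ /andP[y7 y8]] _]].
      move: y5 y6; rewrite !in_itv /= => /andP[y5 y5'] _.
      by apply/rectE; rewrite /a' /b' ge_max le_min y1 y2 y5 y5' y4 y7.
    move=> /rectE[]; rewrite /a' /b' ge_max le_min => /andP[/andP[y1 y2] /andP[y3 y4]] /andP[y5 y6].
    have I2 : 0 <= y.2 <= 1 by apply/andP; split; lra.
    by split; (split; [apply/rectE; split; apply/andP; split=> //; lra|split; rewrite /= in_itv /= ?y2 ?y4]).
  - apply/rectE; split=> /=; last by rewrite !lexx.
    by rewrite /a' /b' ge_max le_min r00 r01 !andbT; apply/andP; split; lra.
  - move=> y [/rectE[y1 /andP[y2 y3]] yI]; have [yb|/ltW yb] := leP y.2 b; [left|right]; split=> //; apply/rectE; split=> //; exact/andP.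
move=> t0 t01; have Iy : (I01 `*` I01) (r0, t0) by split; rewrite /= in_itv /= ?r00.
have Sp := Sh _ Iy; have [W nW HW] := Kloc Sp.
have := wh _ Iy W nW => -[[A B] [/= nA nB] AB].
move: nA nB => /nbhs_ballP [e1 /= e10 H1] /nbhs_ballP [e2 /= e20 H2].
exists e2 => // a b a0 ab b1 at_ bt; split=> //; exists (e1 / 2); split; first by rewrite divr_gt0.
exists (fun y => Kf (h (r0, t0)) (h y)).
apply: (lifts_local Sp HW).
  move=> y [_ Yy] V nV; have := wh y Yy V nV; apply: filterS => y' H [_ Yy']; exact: H.
move=> y [/rectE[/andP[y1 y2] /andP[y3 y4]] Yy]; split; first exact: Sh.
apply: AB => //; split=> /=.
  apply: H1; rewrite -ball_normE /= ltr_norml; apply/andP; split; lra.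
apply: H2; rewrite -ball_normE /= ltr_norml.
have := ler_norm (a - t0); have := ler_norm (t0 - a); have := ler_norm (b - t0); have := ler_norm (t0 - b).
rewrite (distrC t0 a) (distrC t0 b) => *.
by apply/andP; split; lra.
Qed.

(** The increment of a potential along c, analogous to the integral of a closed 1-form. *)
Definition has_inc (c : R -> X) (d : R) : Prop := exists k, lifts I01 c k /\ k 1 - k 0 = d.

Lemma I01E (t : R) : I01 t <-> 0 <= t <= 1.
Proof. by rewrite /= in_itv. Qed.

Lemma inc_unique c d d' : has_inc c d -> has_inc c d' -> d = d'.
Proof.
move=> [k [lk <-]] [k' [lk' <-]].
have := @lifts_diff _ _ _ _ _ id lk lk' (fun _ => cvg_id) (fun t => proj2 (I01E t)).
by move=> /= E; lra.
Qed.

Lemma inc_exists c : wcont I01 c -> (forall t : R, 0 <= t <= 1 -> S (c t)) -> exists d, has_inc c d.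
Proof.
(* The path is viewed as a square that is constant in the first variable. *)
move=> wc Sc; have [||k lk] := @square_lift (c \o snd).
- move=> y [_ Yy] V nV; have := wc _ Yy V nV => H.
  have H' : \forall y' \near y, I01 y'.2 -> V (c y'.2) by exact: cvg_snd H.
  by apply: filterS H' => y' H' [_ /H'].
- by move=> y [_ /I01E]; exact: Sc.
exists (k (0, 1) - k (0, 0)), (fun t => k (0, t)); split=> //.
have cp : continuous (fun t : R => ((0 : R), t)).
  by move=> t; exact: (cvg_pair (@cst_continuous _ _ 0 t) (@cvg_id _ (nbhs t))).
apply: (lifts_reparam (f := fun t : R => ((0 : R), t)) cp _ lk) => t It; split=> //=.
by rewrite in_itv /= lexx ler01.
Qed.

Lemma lifts_const (T : topologicalType) (Y : set T) x : lifts Y (fun=> x) (fun=> 0).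
Proof. by move=> y Yy; near=> y'. Unshelve. all: by end_near. Qed.

(** A potential on the null-homotopy is constant on the three sides that are sent to c 0, so its
    increment on the fourth side, which is c, is zero. *)
Lemma inc_null (c : R -> X) (h : R * R -> X) : wcont (I01 `*` I01) h -> (forall y, (I01 `*` I01) y -> S (h y)) ->
  (forall r : R, 0 <= r <= 1 -> h (0, r) = c r /\ h (1, r) = c 0) ->
  (forall r : R, 0 <= r <= 1 -> h (r, 0) = c 0 /\ h (r, 1) = c 0) -> has_inc c 0.
Proof.
move=> wh Sh h1 h2; have [k lk] := square_lift wh Sh.
have z01 : 0 <= (0 : R) <= 1 by rewrite lexx ler01.
have o01 : 0 <= (1 : R) <= 1 by rewrite lexx ler01.
have side (f : R -> R * R) : continuous f -> (forall t : R, 0 <= t <= 1 -> (I01 `*` I01) (f t) /\ h (f t) = c 0) ->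
    k (f 1) = k (f 0).
  move=> cf fI; have l1 : lifts I01 (fun=> c 0) (k \o f).
    apply: (lifts_sub (Y := I01) (h := h \o f)) => //.
      by move=> t It; have [] := fI t (proj1 (I01E t) It).
    by apply: (lifts_reparam cf _ lk) => t It; have [] := fI t (proj1 (I01E t) It).
  have := @lifts_diff _ _ _ _ _ id l1 (@lifts_const _ I01 (c 0)) (fun _ => cvg_id) (fun t => proj2 (I01E t)).
  by rewrite /= !subr0.
have cr (a : R) : continuous (fun t : R => (t, a)).
  by move=> t; exact: (cvg_pair (@cvg_id _ (nbhs t)) (@cst_continuous _ _ a t)).
have cl (a : R) : continuous (fun t : R => (a, t)).
  by move=> t; exact: (cvg_pair (@cst_continuous _ _ a t) (@cvg_id _ (nbhs t))).
have s1 := side _ (cr 0) (fun t H => conj (conj (proj2 (I01E t) H) (proj2 (I01E 0) z01)) (proj1 (h2 t H))).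
have s2 := side _ (cr 1) (fun t H => conj (conj (proj2 (I01E t) H) (proj2 (I01E 1) o01)) (proj2 (h2 t H))).
have s3 := side _ (cl 1) (fun t H => conj (conj (proj2 (I01E 1) o01) (proj2 (I01E t) H)) (proj2 (h1 t H))).
exists (fun t => k (0, t)); split; last by move: s1 s2 s3 => /=; lra.
apply: (lifts_sub (Y := I01) (h := fun t => h (0, t))) => //.
  by move=> t /I01E H; have [] := h1 t H.
by apply: (lifts_reparam (cl 0) _ lk) => t It; split=> //; exact/I01E.
Qed.

Definition pcat (c d : R -> X) (t : R) : X := if t <= 1 / 2 then c (2 * t) else d (2 * t - 1).
Definition prev (c : R -> X) (t : R) : X := c (1 - t).

Lemma wcont_reparam (c : R -> X) (Y Y' : set R) (f : R -> R) : continuous f -> (forall t, Y' t -> Y (f t)) ->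
  wcont Y c -> wcont Y' (c \o f).
Proof.
move=> cf fY wc y Yy V nV; have H : nbhs y (f @^-1` _) := cf y _ (wc _ (fY y Yy) V nV).
by apply: filterS H => y' H /fY/H.
Qed.

Lemma pcat_halves (c d : R -> X) : c 1 = d 0 ->
  (forall t : R, 0 <= t <= 1 / 2 -> pcat c d t = c (2 * t)) /\ (forall t : R, 1 / 2 <= t <= 1 -> pcat c d t = d (2 * t - 1)).
Proof.
move=> cd; split=> t /andP[t0 t1]; rewrite /pcat; first by rewrite t1.
case: (leP t (1/2)) => // t2; have -> : t = 1 / 2 by lra.
have -> : 2 * (1 / 2) = 1 :> R by lra.
by rewrite subrr.
Qed.

Lemma halves_union : I01 `<=` (`[0, 1 / 2]%classic : set R) `|` (`[1 / 2, 1]%classic : set R).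
Proof.
move=> t /I01E/andP[t0 t1]; have [H|H] := leP t (1 / 2); [left|right]; rewrite /= in_itv /=; apply/andP; split=> //.
exact: ltW.
Qed.

Lemma pcat_wcont c d : c 1 = d 0 -> wcont I01 c -> wcont I01 d -> wcont I01 (pcat c d).
Proof.
move=> cd wc wd; have [E1 E2] := pcat_halves cd.
have H1 : wcont (`[0, 1 / 2]%classic : set R) (pcat c d).
  have := @wcont_reparam c I01 (`[0, 1/2]%classic : set R) (fun t => 2 * t + 0) (@cts_aff 2 0) _ wc.
  have H t : (`[0, 1/2]%classic : set R) t -> I01 (2 * t + 0).
    by rewrite /= !in_itv /= => /andP[? ?]; apply/andP; split; lra.
  move=> /(_ H) w t It V; rewrite E1; last by move: It; rewrite /= in_itv.
  move=> nV; have := w t It V; rewrite /= addr0 => /(_ nV); apply: filterS => t' Ht' It'.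
  by rewrite E1; [have := Ht' It'; rewrite addr0|move: It'; rewrite /= in_itv].
have H2 : wcont (`[1 / 2, 1]%classic : set R) (pcat c d).
  have := @wcont_reparam d I01 (`[1/2, 1]%classic : set R) (fun t => 2 * t + (- 1)) (@cts_aff 2 (-1)) _ wd.
  have H t : (`[1/2, 1]%classic : set R) t -> I01 (2 * t + (- 1)).
    by rewrite /= !in_itv /= => /andP[? ?]; apply/andP; split; lra.
  move=> /(_ H) w t It V; rewrite E2; last by move: It; rewrite /= in_itv.
  move=> nV; have := w t It V nV; apply: filterS => t' Ht' It'.
  by rewrite E2; [exact: Ht'|move: It'; rewrite /= in_itv].
move=> t It V nV.
have A (Y : set R) : closed Y -> wcont Y (pcat c d) -> \forall t' \near t, Y t' -> V (pcat c d t').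
  move=> cY wY; have [Yt|nYt] := pselect (Y t); first exact: wY.
  have : \forall y' \near t, (~` Y) y' by apply: open_nbhs_nbhs; split=> //; exact: closed_openC.
  by apply: filterS => y'.
have cI (u v : R) : closed (`[u, v]%classic : set R) := @itv_closed _ R u v.
apply: filterS2 (A _ (cI 0 (1 / 2)) H1) (A _ (cI (1 / 2) 1) H2) => t' V1 V2 /halves_union [/V1|/V2] //.
Qed.

Lemma inc_cat c d a b : c 1 = d 0 -> has_inc c a -> has_inc d b -> has_inc (pcat c d) (a + b).
Proof.
move=> cd [k1 [l1 <-]] [k2 [l2 <-]]; have [E1 E2] := pcat_halves cd.
have L1 : lifts (`[0, 1 / 2]%classic : set R) (pcat c d) (fun t => k1 (2 * t + 0)).
  apply: lifts_sub (lifts_reparam (f := fun t => 2 * t + 0) (Y' := (`[0, 1/2]%classic : set R)) (@cts_aff 2 0) _ l1) => // t.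
    by rewrite /= in_itv /= => H; rewrite E1 // addr0.
  by rewrite /= !in_itv /= => /andP[? ?]; apply/andP; split; lra.
have L2 : lifts (`[1 / 2, 1]%classic : set R) (pcat c d) (fun t => k2 (2 * t + (- 1)) + (k1 1 - k2 0)).
  apply: lifts_add.
  apply: lifts_sub (lifts_reparam (f := fun t => 2 * t + (- 1)) (Y' := (`[1/2, 1]%classic : set R)) (@cts_aff 2 (-1)) _ l2) => // t.
    by rewrite /= in_itv /= => H; rewrite E2.
  by rewrite /= !in_itv /= => /andP[? ?]; apply/andP; split; lra.
have cI (u v : R) : closed (`[u, v]%classic : set R) := @itv_closed _ R u v.
have [|k [lk K1 K2]] := lifts_glue (cI 0 (1 / 2)) (cI (1 / 2) 1) L1 L2.
  move=> t; rewrite /= !in_itv /= => /andP[t0 t1] /andP[t2 t3]; have -> : t = 1 / 2 by lra.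
  have -> : 2 * (1 / 2) + 0 = 1 :> R by lra.
  have -> : 2 * (1 / 2) + (- 1) = 0 :> R by lra.
  by ring.
exists k; split; first by apply: lifts_sub lk => //; exact: halves_union.
rewrite K2 ?K1 /= ?in_itv /=; try (apply/andP; split; lra).
have -> : 2 * 1 + (- 1) = 1 :> R by lra.
have -> : 2 * 0 + 0 = 0 :> R by lra.
by ring.
Qed.

Lemma inc_rev c a : has_inc c a -> has_inc (prev c) (- a).
Proof.
move=> [k [lk <-]]; exists (fun t => k ((- 1) * t + 1)); split.
  apply: lifts_sub (lifts_reparam (f := fun t => (- 1) * t + 1) (Y' := I01) (@cts_aff (-1) 1) _ lk) => // t.
    by move=> _; rewrite /prev /=; congr c; ring.
  by rewrite /= !in_itv /= => /andP[? ?]; apply/andP; split; lra.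
have -> : -1 * 1 + 1 = 0 :> R by lra.
have -> : -1 * 0 + 1 = 1 :> R by lra.
by ring.
Qed.

(** [kap q] is c0 plus the increment along any path from x0 to q in [S], which does not depend on
    the path because loops have increment 0. Local connectedness supplies the short paths that
    compare neighbouring points. *)
Lemma monodromy (x0 : X) (c0 : R) : S x0 -> simply_connected (R := R) S ->
  (forall p W, S p -> nbhs p W -> exists2 V, nbhs p V & forall q, S q -> V q ->
    exists d : R -> X, [/\ wcont I01 d, forall t : R, 0 <= t <= 1 -> S (d t) /\ W (d t), d 0 = p & d 1 = q]) ->
  exists2 kap : X -> R, kap x0 = c0 & forall p, S p -> \forall q \near p, S q ->
    kap q - Kf p q = kap p - Kf p p.
Proof.
move=> Sx0 [_ pc sc] lpc.
have Hc q : exists c : R -> X, S q -> [/\ wcont I01 c, forall t : R, 0 <= t <= 1 -> S (c t), c 0 = x0 & c 1 = q].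
  have [Sq|nSq] := pselect (S q); last by exists (fun=> x0).
  have [c [wc cS c00 c1]] := pc x0 q Sx0 Sq; exists c => _; split=> //; first exact: within_wcont.
  by move=> t t01; apply: cS; exists t => //; rewrite /unit_interval /= in_itv.
have [c Hc'] := choice Hc.
have Hi q : exists a, S q -> has_inc (c q) a.
  have [Sq|nSq] := pselect (S q); last by exists 0.
  by have [wc Sc _ _] := Hc' q Sq; have [a Ha] := inc_exists wc Sc; exists a.
have [a Ha] := choice Hi.
have loop_null l : wcont I01 l -> (forall t : R, 0 <= t <= 1 -> S (l t)) -> l 0 = l 1 -> has_inc l 0.
  move=> wl Sl l01; have [|h [wh hS h1 h2]] := sc l (wcont_within wl) _ l01.
    by move=> _ [t /I01E t01 <-]; exact: Sl.
  apply: (inc_null (h := h)).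
  - exact: within_wcont.
  - by move=> y Iy; apply: hS; exists y.
  - by move=> r r01; apply: h1; apply/I01E.
  - by move=> r r01; apply: h2; apply/I01E.
(* The loop formed by d and the reverse of the chosen path [c q] has increment 0. *)
have path_eq q (d : R -> X) b : S q -> wcont I01 d -> (forall t : R, 0 <= t <= 1 -> S (d t)) -> d 0 = x0 -> d 1 = q ->
    has_inc d b -> b = a q.
  move=> Sq wd Sd d0 d1 Hd; have [wc Sc cq0 cq1] := Hc' q Sq.
  have E : d 1 = prev (c q) 0 by rewrite /prev subr0 cq1.
  have L := inc_cat E Hd (inc_rev (Ha q Sq)).
  have [E1 E2] := pcat_halves E.
  suff N : has_inc (pcat d (prev (c q))) 0 by have := inc_unique L N; lra.
  apply: loop_null.
  - apply: pcat_wcont => //; have := @wcont_reparam (c q) I01 I01 (fun t => (- 1) * t + 1) (@cts_aff (-1) 1) _ wc.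
    have H t : I01 t -> I01 ((- 1) * t + 1) by rewrite /= !in_itv /= => /andP[? ?]; apply/andP; split; lra.
    move=> /(_ H); congr (wcont _ _); apply/funext => t; rewrite /prev /=; congr (c q _); ring.
  - move=> t /andP[t0 t1]; have [H|H] := leP t (1 / 2).
      by rewrite E1 ?t0 //; apply: Sd; apply/andP; split; lra.
    rewrite E2 ?(ltW H) //; rewrite /prev; apply: Sc; apply/andP; split; lra.
  - rewrite E1 ?E2; try (apply/andP; split; lra).
    rewrite /prev mulr0 d0; have -> : 1 - (2 * 1 - 1) = 0 :> R by lra.
    by rewrite cq0.
exists (fun q => c0 + a q - a x0); first by rewrite addrK.
move=> p Sp; have [W nW HW] := Kloc Sp; have [V nV HV] := lpc p W Sp nW.
apply: filterS nV => q Vq Sq; have [d [wd Sd d0 d1]] := HV q Sq Vq.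
have [wc Sc cp0 cp1] := Hc' p Sp.
have Id : has_inc d (Kf p q - Kf p p).
  exists (fun t => Kf p (d t)); split; last by rewrite d0 d1.
  by apply: (lifts_local Sp HW wd) => t /I01E; exact: Sd.
have E : c p 1 = d 0 by rewrite cp1 d0.
have L := inc_cat E (Ha p Sp) Id; have [E1 E2] := pcat_halves E.
suff -> : a q = a p + (Kf p q - Kf p p) by ring.
symmetry; apply: (path_eq q _ _ Sq _ _ _ _ L).
- exact: pcat_wcont.
- move=> t /andP[t0 t1]; have [H|H] := leP t (1 / 2).
    by rewrite E1 ?t0 //; apply: Sc; apply/andP; split; lra.
  rewrite E2 ?(ltW H) //; have [|//] := Sd (2 * t - 1); by apply/andP; split; lra.
- rewrite E1 ?mulr0 //; by apply/andP; split; lra.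
- rewrite E2; last by apply/andP; split; lra.
  by have -> : 2 * 1 - 1 = 1 :> R by lra.
Qed.

End Monodromy.

(** * Three-forms and basic two-forms in adapted coordinates *)

Section ThreeForms.
Context {R : realType} {M : smoothSpace R} {nM : nice M}.

Lemma dec_zero k (w : preform M k) p (v : 'I_k -> tvec M) i : decform w ->
  (forall j, tangent p (v j)) -> v i = 0 -> w p v = 0.
Proof.
move=> dw tv vi; have E : ([eta v with i |-> 0] : 'I_k -> tvec M) = v.
  by apply/funext => j /=; case: eqP => // ->.
have := dec_lin i 1 dw tv (tan0 p) (tan0 p); rewrite scaler0 addr0 mul1r E; lra.
Qed.

Lemma v3F (T : Type) (v : 'I_3 -> T) : v = v3 (v ord0) (v (lift ord0 ord0)) (v (lift ord0 (lift ord0 ord0))).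
Proof. by rewrite /v3 -[X in vc _ X](v2E (fun j => v (lift ord0 j))) vcE. Qed.

Lemma lin3l_sum (w : preform M 3) p n (c : 'I_n -> R) (X : 'I_n -> tvec M) Y Z : decform w ->
  (forall i, tangent p (X i)) -> tangent p Y -> tangent p Z ->
  w p (v3 (\sum_i c i *: X i) Y Z) = \sum_i c i * w p (v3 (X i) Y Z).
Proof.
move=> dw tX tY tZ; suff [] : tangent p (\sum_i c i *: X i) /\
  w p (v3 (\sum_i c i *: X i) Y Z) = \sum_i c i * w p (v3 (X i) Y Z) by [].
elim/big_rec2: _ => [|i a b _ [tb IH]]; first by split; [exact: tan0|rewrite zero3l].
by split; [apply: tan_comb|rewrite lin3l // IH].
Qed.

Lemma C3 (w : preform M 3) X Y Z : decform w -> vfield X -> vfield Y -> vfield Z ->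
  Cinf M (fun q => w q (v3 (X q) (Y q) (Z q))).
Proof.
move=> dw vX vY vZ; have H : Cinf M (fun q => w q (fun i => v3 X Y Z i q)).
  by apply: rep_C => //; exact: v3P.
by congr (Cinf M _): H; apply/funext => q; rewrite (v3_map (fun X => X q)).
Qed.

Lemma extd3_comm (w : preform M 3) A B C D p : decform w ->
  vfield A -> vfield B -> vfield C -> vfield D ->
  (forall i j, bracket (vc A (v3 B C D) i) (vc A (v3 B C D) j) p = 0) ->
  extd w p (vc (A p) (v3 (B p) (C p) (D p))) =
    A p (fun q => w q (v3 (B q) (C q) (D q))) - B p (fun q => w q (v3 (A q) (C q) (D q)))
    + C p (fun q => w q (v3 (A q) (B q) (D q))) - D p (fun q => w q (v3 (A q) (B q) (C q))).
Proof.
move=> dw vA vB vC vD br; pose X : 'I_4 -> M -> tvec M := vc A (v3 B C D).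
have vX i : vfield (X i) by apply: vcP => //; exact: v3P.
have := extd_koszul p dw vX.
have -> : (fun i => X i p) = vc (A p) (v3 (B p) (C p) (D p)).
  by rewrite /X (vc_map (fun Z : M -> tvec M => Z p)) (v3_map (fun Z : M -> tvec M => Z p)).
move=> ->; rewrite /koszul [X in _ + X]big1 ?addr0; last first.
  move=> i _; rewrite big1 // => j ij; have ji : i != j by rewrite neq_ltn ij.
  have [l lE] : exists l, lift j l = i.
    by case: (unliftP j i) => [l ->|E]; [exists l|rewrite E eqxx in ji].
  rewrite (dec_zero (p := p) (i := l)) ?mulr0 // ?lE ?eqxx //; first last.
    by move=> l'; case: ifP => _; [exact: bracket_tan|exact: vf_tan].
pose o0 : 'I_4 := ord0; pose o1 : 'I_4 := lift ord0 ord0; pose o2 : 'I_4 := lift ord0 (lift ord0 ord0).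
pose o3 : 'I_4 := lift ord0 (lift ord0 (lift ord0 ord0)).
have V0 : X o0 = A by rewrite /X vc0.
have V1 : X o1 = B by rewrite /X vcS /v3 vc0.
have V2 : X o2 = C by rewrite /X vcS /v3 vcS /v2 vc0.
have V3 : X o3 = D by rewrite /X vcS /v3 vcS /v2 vcS.
have E (i : 'I_4) a b c : X (lift i ord0) = a -> X (lift i (lift ord0 ord0)) = b -> X (lift i (lift ord0 (lift ord0 ord0))) = c ->
    (fun q => w q (fun l => X (lift i l) q)) = fun q => w q (v3 (a q) (b q) (c q)).
  by move=> <- <- <-; apply/funext => q; congr (w q); exact: v3F.
rewrite !big_ord_recl big_ord0 /= -/o0 -/o1 -/o2 -/o3 addr0 V0 V1 V2 V3.
rewrite (E o0 B C D) // (E o1 A C D) ?(E o2 A B D) ?(E o3 A B C) //; try by rewrite -?V0 -?V1 -?V2 -?V3; congr X; apply: val_inj.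
by rewrite /bump /= !exprS !expr0; ring.
Qed.

End ThreeForms.

Section Horizontal2.
Context {R : realType} {M N : smoothSpace R} {nM : nice M} {nN : nice N} (f : M -> N) (sf : smooth_map f).

Lemma horizontal_pull k (w : preform N k.+1) q : decform w -> horizontal_at f (pullback f w) q.
Proof.
move=> dw u v u0 tu tv; apply: (dec_zero (p := f q) (i := ord0)) => //; last by rewrite vc0.
by move=> j; apply: Tmap_tan => //; exact: vcP.
Qed.

Lemma horizontal_pull_extd k (w : preform N k) q : decform w -> horizontal_at f (extd (pullback f w)) q.
Proof.
move=> dw u v u0 tu tv; rewrite extd_pull //; last exact: vcP.
by apply: horizontal_pull => //; exact: dec_extd.
Qed.

Context n (x : 'I_n -> N -> R) (Cx : forall i, Cinf N (x i)).
Let xf i : M -> R := x i \o f.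

(** The 2-form with coefficients r in the differentials of base coordinates. The factor 1/2 is due
    to the sum over all ordered pairs, and suits skew r. *)
Definition basic2 (r : 'I_n -> 'I_n -> M -> R) : preform M 2 := fun q v =>
  \sum_(ij : 'I_n * 'I_n) (2^-1 * r ij.1 ij.2 q) * dwedge (v2 (xf ij.1) (xf ij.2)) v.

Lemma dwedge2 (a b : M -> R) (u v : tvec M) : dwedge (v2 a b) (v2 u v) = u a * v b - v a * u b.
Proof.
rewrite [v2 a b]/v2 dwedge_vc !big_ord_recl big_ord0 addr0 /= expr0 mul1r expr1 mulN1r.
have A0 : v2 u v ord0 = u by rewrite /v2 vc0.
have A1 : v2 u v (lift ord0 ord0) = v by rewrite /v2 vcS.
rewrite A0 A1 /dwedge !det_mx11 !mxE A1 (_ : lift (lift ord0 ord0) ord0 = ord0); last exact: val_inj.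
by rewrite A0 mulNr.
Qed.

Section Coefficients.
Context (r : 'I_n -> 'I_n -> M -> R) (Cr : forall i j, Cinf M (r i j)).

Lemma rep_basic2 p : rep (basic2 r) p (fun (ij : 'I_n * 'I_n) q => 2^-1 * r ij.1 ij.2 q)
  (fun ij => v2 (xf ij.1) (xf ij.2)).
Proof.
split=> [ij|ij j|]; first exact: C_scale.
- by apply: v2P; exact: sf (Cx _).
- exact: nearW.
Qed.

Lemma dec_basic2 : decform (basic2 r).
Proof. by move=> p; do 3!eexists; exact: rep_basic2. Qed.

Lemma basic2E q u v : (forall i j, r j i q = - r i j q) ->
  basic2 r q (v2 u v) = \sum_i \sum_j r i j q * (u (xf i) * v (xf j)).
Proof.
move=> sk; rewrite /basic2 -(pair_bigA _ (fun i j => 2^-1 * r i j q * dwedge (v2 (xf i) (xf j)) (v2 u v))) /=.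
have S : \sum_i \sum_j r i j q * (v (xf i) * u (xf j)) = - \sum_i \sum_j r i j q * (u (xf i) * v (xf j)).
  rewrite exchange_big /= -sumrN; apply: eq_bigr => i _; rewrite -sumrN; apply: eq_bigr => j _.
  by rewrite sk; ring.
transitivity (2^-1 * (\sum_i \sum_j r i j q * (u (xf i) * v (xf j)) - \sum_i \sum_j r i j q * (v (xf i) * u (xf j)))).
  rewrite -sumrB mulr_sumr; apply: eq_bigr => i _; rewrite -sumrB mulr_sumr; apply: eq_bigr => j _.
  by rewrite dwedge2; ring.
by rewrite S; move: (\sum_i _) => A; field.
Qed.

Lemma vert_xf u i : Tmap f u = 0 -> u (xf i) = 0.
Proof. by move=> u0; rewrite -(TmapE f u (Cx i)) u0. Qed.

Lemma basic2_horizontal q : horizontal_at f (basic2 r) q.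
Proof.
move=> u v u0 tu tv; rewrite [v]v1E -/(v2 u _) /basic2 big1 // => ij _.
by rewrite dwedge2 (vert_xf ij.1 u0) (vert_xf ij.2 u0) mul0r mulr0 subrr mulr0.
Qed.

(** Only the coefficients are differentiated: the vertical vector u kills the differentials of base
    coordinates, so it must be paired with dr. *)
Lemma extd_basic2 q u v w : Tmap f u = 0 -> tangent q u -> tangent q v -> tangent q w ->
  extd (basic2 r) q (v3 u v w) = basic2 (fun i j _ => u (r i j)) q (v2 v w).
Proof.
move=> u0 tu tv tw; rewrite (extd_rep dec_basic2 (rep_basic2 q)); last exact: v3P.
apply: eq_bigr => ij _; rewrite dwedge_vc big_ord_recl expr0 mul1r /v3 vc0.
rewrite (tan_scale tu) // [X in _ + X]big1 ?addr0; first by congr (_ * dwedge _ _); apply/funext => l; rewrite vcS.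
move=> l _; suff -> : dwedge (v2 (xf ij.1) (xf ij.2)) (fun l' => vc u (v2 v w) (lift (lift ord0 l) l')) = 0 by rewrite mulr0.
rewrite [X in dwedge _ X]v2E dwedge2 (_ : lift (lift ord0 l) ord0 = ord0); last exact: val_inj.
by rewrite vc0 (vert_xf ij.1 u0) (vert_xf ij.2 u0) mul0r mulr0 subrr.
Qed.

End Coefficients.

Section Box.
Context (p : M) k (V : set N) (s : R) (y : 'I_k -> M -> R)
  (E : 'I_(n + k) -> M -> tvec M) (U : set M) (r : R).
Hypothesis fr : sframe f p x V s y E U r.

Lemma horizontal2_expand (w : preform M 2) q u v : decform w -> U q -> horizontal_at f w q ->
  tangent q u -> tangent q v ->
  w q (v2 u v) = \sum_i \sum_j w q (v2 (E (lshift k i) q) (E (lshift k j) q)) * (u (xf i) * v (xf j)).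
Proof.
move=> dw Uq hw tu tv; have tE i : tangent q (E i q) by exact: vf_tan (fr_vf (sf_fr fr) _).
pose P (u : tvec M) := \sum_i u (xf i) *: E (lshift k i) q.
have tP u' : tangent q (P u') by apply: tan_sum => i _; exact: tanZ.
have PE u' : tangent q u' -> Tmap f u' = Tmap f (P u').
  move=> tu'; apply/(Tf_eqP sf fr Uq) => // i; rewrite /P tv_sum (bigD1 i) //= tvZ (sf_Ex fr) // eqxx mulr1 big1 ?addr0 // => i' i'i.
  by rewrite tvZ (sf_Ex fr) // (inj_eq (@lshift_inj _ _)) eq_sym (negPf i'i) mulr0.
have -> : w q (v2 u v) = w q (v2 (P u) (P v)).
  apply: (horizontal_congr dw hw); try exact: v2P.
  by move=> j; have := congr1 (fun z => z j) (v2_map (Tmap f) u v); rewrite /= => ->; rewrite (PE u) // (PE v) // -v2_map.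
rewrite lin2l_sum //; apply: eq_bigr => i _; rewrite skew2 // lin2l_sum // mulrN -mulNr mulr_sumr.
by apply: eq_bigr => j _; rewrite [w q (v2 (E (lshift k j) q) _)]skew2 //; ring.
Qed.

End Box.
End Horizontal2.

(** * Primitives along the fibres of a submersion *)

Section VerticalPrimitive.
Context {R : realType} {M N : smoothSpace R} {nM : nice M} {nN : nice N} (f : M -> N) (sf : smooth_map f).

(** For fixed i and j, the coefficients z(V_a, E_i, E_j) form a 1-form along the fibres. It is
    closed there because dz = 0 and z vanishes on two vertical vectors, and [poincare] integrates it
    with the base coordinates as parameters. *)
Lemma vertical_primitive (z : preform M 3) p :
  (forall w, tangent (f p) w -> exists2 v, tangent p v & Tmap f v = w) ->
  decform z -> form_eq (extd z) 0 ->
  (\forall q \near p, forall u v w, Tmap f u = 0 -> Tmap f v = 0 -> tangent q u -> tangent q v -> tangent q w ->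
     z q (v3 u v w) = 0) ->
  exists2 w : preform M 2, decform w & \forall q \near p, horizontal_at f w q /\
    forall u v v', Tmap f u = 0 -> tangent q u -> tangent q v -> tangent q v' ->
      extd w q (v3 u v v') = - z q (v3 u v v').
Proof.
move=> sub dz cz Hz; have [n [k [x [V [s [y [E [U [r [fr UW]]]]]]]]]] := sframe_exists sf Hz sub.
have coM := fr_co (sf_fr fr); have Up := co_p coM; have Cx := sf_Cx fr.
have vE i : vfield (E i) by exact: fr_vf (sf_fr fr) i.
have tE i q : tangent q (E i q) by exact: vf_tan.
have tV a q : tangent q (vert E a q) by exact: tE.
pose Z a i j q := z q (v3 (vert E a q) (E (lshift k i) q) (E (lshift k j) q)).
have CZ a i j : Cinf M (Z a i j) by apply: C3; rewrite /vert.
(* Koszul's formula for dz(V_a, V_b, E_i, E_j) = 0 with commuting fields: the terms in which z still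
   has both V_a and V_b vanish, and the other two give the symmetry. *)
have symm a b i j q : U q -> vert E a q (Z b i j) = vert E b q (Z a i j).
  move=> Uq; have Br i' j' : bracket (vc (vert E a) (v3 (vert E b) (E (lshift k i)) (E (lshift k j))) i')
      (vc (vert E a) (v3 (vert E b) (E (lshift k i)) (E (lshift k j))) j') q = 0.
    have Ec l : exists m, vc (vert E a) (v3 (vert E b) (E (lshift k i)) (E (lshift k j))) l = E m.
      by apply: (vcP (P := fun X => exists m, X = E m)); [exists (rshift n a)|apply: (v3P (P := fun X => exists m, X = E m)); [exists (rshift n b)|exists (lshift k i)|exists (lshift k j)]].
    by have [m ->] := Ec i'; have [m' ->] := Ec j'; exact: (frame_bracket (sf_fr fr) _ _ Uq).
  have := @extd3_comm R M nM z _ _ _ _ q dz (vE _) (vE _) (vE _) (vE _) Br.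
  have O i' : tangent q i' -> i' (fun q => z q (v3 (vert E a q) (vert E b q) (E (lshift k i) q))) = 0.
    move=> ti; rewrite -(tan_cst ti 0); apply: (tan_near ti); [exact: (C3 dz (vE _) (vE _) (vE _))|exact: C_cst|].
    apply: filterS (frame_nbhs (sf_fr fr) Uq) => q' Uq'; exact: (UW q' Uq' _ _ _ (vert_f sf fr a Uq') (vert_f sf fr b Uq') (tE _ _) (tE _ _) (tE _ _)).
  have O' i' : tangent q i' -> i' (fun q => z q (v3 (vert E a q) (vert E b q) (E (lshift k j) q))) = 0.
    move=> ti; rewrite -(tan_cst ti 0); apply: (tan_near ti); [exact: (C3 dz (vE _) (vE _) (vE _))|exact: C_cst|].
    apply: filterS (frame_nbhs (sf_fr fr) Uq) => q' Uq'; exact: (UW q' Uq' _ _ _ (vert_f sf fr a Uq') (vert_f sf fr b Uq') (tE _ _) (tE _ _) (tE _ _)).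
  rewrite O // O' // cz; last by apply: vcP; [exact: tE|exact: (v3P (P := tangent q))].
  by rewrite addr0 subr0 => H; apply/eqP; rewrite -subr_eq0; apply/eqP; exact: esym H.
have H i j : exists g, Cinf M g /\ forall q a, U q -> vert E a q g = - Z a i j q.
  have HF a : exists F, smooth_on setT F /\ forall q, U q -> Z a i j q = F (xv (joinc (fun i => x i \o f) y) q).
    by have [F sF hF] := sf_glob fr (CZ a i j); exists F.
  have {HF} [F HF] := choice HF.
  have [||g sg Hg] := @poincare R n k (fun a => F a) (xv (joinc (fun i => x i \o f) y) p) r.
  - by move=> a; have [] := HF a.
  - move=> y' y'r a b; have [q Uq <-] := co_surj coM y'r.
    have [sa ha] := HF a; have [sb hb] := HF b.
    by rewrite -(vert_pd fr a Uq (CZ b i j) sb hb) -(vert_pd fr b Uq (CZ a i j) sa ha) symm.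
  have Cg : Cinf M (fun q => g (xv (joinc (fun i => x i \o f) y) q)).
    by apply: C_comp => // i'; exact: co_C coM i'.
  exists (fun q => - g (xv (joinc (fun i => x i \o f) y) q)); split=> [|q a Uq]; first exact: C_opp.
  rewrite (tan_opp (tV a q)) // (vert_pd fr a Uq Cg sg) // Hg; last exact: co_ball coM _ Uq.
  by have [_ ->] := HF a.
have {H} [g Hg] := choice (fun ij : 'I_n * 'I_n => H ij.1 ij.2).
(* The primitives g (i, j) need not be skew in i and j although the coefficients are;
   skew-symmetrizing preserves their vertical derivatives. *)
pose r' i j q := 2^-1 * (g (i, j) q - g (j, i) q).
have Cr' i j : Cinf M (r' i j).
  by apply: C_scale; apply: C_sub; [have [] := Hg (i, j)|have [] := Hg (j, i)].
exists (basic2 f x r'); first exact: dec_basic2.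
apply: filterS (frame_nbhs (sf_fr fr) Up) => q Uq; split; first exact: basic2_horizontal.
move=> u v v' u0 tu tv tv'; rewrite extd_basic2 //.
have Zsk a i j : Z a j i q = - Z a i j q by exact: skew3.
have ur a i j : vert E a q (r' i j) = - Z a i j q.
  rewrite (tan_scale (tV a q)); last by apply: C_sub; [have [] := Hg (i, j)|have [] := Hg (j, i)].
  rewrite (tan_sub (tV a q)); [|by have [] := Hg (i, j)|by have [] := Hg (j, i)].
  by have [_ ->//] := Hg (i, j); have [_ ->//] := Hg (j, i); rewrite /= Zsk; field.
have uE : u = \sum_a u (y a) *: vert E a q by exact: (vert_span fr Uq tu u0).
rewrite basic2E // => [|i j]; last first.
  by rewrite uE !tv_sum -sumrN; apply: eq_bigr => a _; rewrite !tvZ !ur Zsk; ring.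
have hz a : horizontal_at f (iprod (vert E a) z) q.
  move=> u' v1' u'0 tu' tv1'; rewrite [v1']v1E -/(v2 _ _) iprod2E; exact: (UW q Uq _ _ _ (vert_f sf fr a Uq) u'0 (tE _ _) tu' (tv1' _)).
have zE : z q (v3 u v v') = \sum_a u (y a) * iprod (vert E a) z q (v2 v v').
  by rewrite {1}uE lin3l_sum // => a; exact: tE.
rewrite zE -sumrN (eq_bigr (fun i => \sum_j \sum_a - (u (y a) * (Z a i j q * (v (x i \o f) * v' (x j \o f)))))); last first.
  move=> i _; apply: eq_bigr => j _; rewrite {1}uE tv_sum mulr_suml; apply: eq_bigr => a _.
  by rewrite tvZ ur; ring.
under eq_bigr do rewrite exchange_big /=.
rewrite exchange_big /=; apply: eq_bigr => a _.
rewrite (horizontal2_expand sf fr (dec_iprod (vE _) dz) Uq (hz a) tv tv') mulr_sumr -sumrN.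
by apply: eq_bigr => i _; rewrite mulr_sumr -sumrN; apply: eq_bigr => j _; rewrite iprod2E.
Qed.

End VerticalPrimitive.

Section Openness.
Context {R : realType} {M N : smoothSpace R} {nM : nice M} {nN : nice N} (f : M -> N) (sf : smooth_map f).
Context (p : M) n k (x : 'I_n -> N -> R) (V : set N) (s : R) (y : 'I_k -> M -> R)
  (E : 'I_(n + k) -> M -> tvec M) (U : set M) (r : R).
Hypothesis fr : sframe f p x V s y E U r.

Lemma sf_open q : U q -> nbhs (f q) [set z | exists2 q', U q' & f q' = z].
Proof.
move=> Uq; have coN := sf_base fr; have Vq := sf_V fr Uq.
pose g z : 'rV[R]_(n + k) := row_mx (xv x z) (xv y q).
have gq : g (f q) = xv (joinc (fun i => x i \o f) y) q.
  by rewrite xv_joinc /g; congr row_mx; apply/rowP => i; rewrite !mxE.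
have Cg : {for f q, continuous g}.
  have -> : g = xv (joinc x (fun i _ => y i q)).
    by apply/funext => z; rewrite xv_joinc; congr row_mx; apply/rowP => i; rewrite !mxE.
  by apply: C_xv_cts; apply: joinc_C => i; [exact: (sf_Cx fr)|exact: C_cst].
have nV : nbhs (f q) V by apply: open_nbhs_nbhs; split=> //; exact: co_open coN.
have H : \forall y' \near g (f q), exists q', [/\ U q', [set: M] q' & xv (joinc (fun i => x i \o f) y) q' = y'].
  by rewrite gq; apply: (co_opn (fr_co (sf_fr fr)) Uq); exact: filter_nbhsT.
have H' : nbhs (f q) (g @^-1` _) := Cg _ H.
apply: filterS2 H' nV => z [q' [Uq' _ Eq']] Vz; exists q' => //.
move: Eq'; rewrite xv_joinc => /eq_row_mx [E1 _].
apply: (co_inj coN) => //; first exact: sf_V fr _ Uq'.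
Qed.

End Openness.

(** * From local to global solutions on a submersion with simply connected fibres *)

Section GlobalSolution.
Context {R : realType} {M N : smoothSpace R} {nM : nice M} {nN : nice N} (f : M -> N) (sf : smooth_map f).
Context (subf : submersion f) (e : N -> M) (se : smooth_map e) (fe : forall x, f (e x) = x).
Context (A : M -> tvec M -> tvec M -> R) (B : M -> ('I_3 -> tvec M) -> R).

(** Only contractions with vertical vectors are prescribed, both for the form and for its
    differential; solutions are thus unique up to forms constant along the fibres, see
    [solves_sub]. *)
Definition solves (w : preform M 2) (q : M) : Prop :=
  (forall u v, Tmap f u = 0 -> tangent q u -> tangent q v -> w q (v2 u v) = A q u v) /\
  (forall u v v', Tmap f u = 0 -> tangent q u -> tangent q v -> tangent q v' ->
     extd w q (v3 u v v') = B q (v3 u v v')).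

Lemma solves_sub w w' q : decform w -> decform w' -> solves w q -> solves w' q ->
  horizontal_at f (w - w') q /\ horizontal_at f (extd (w - w')) q.
Proof.
move=> dw dw' [s1 s2] [s1' s2']; split=> u v u0 tu tv.
  rewrite [v]v1E -/(v2 u _) -[LHS]/(w q _ - w' q _) s1 ?s1' ?subrr //; exact: tv.
rewrite extd_sub //; last exact: vcP.
rewrite [v]v2E -/(v3 u _ _) s2 ?s2' ?subrr //; exact: tv.
Qed.

Lemma solves_add w b q : decform w -> decform b -> solves w q ->
  horizontal_at f b q -> horizontal_at f (extd b) q -> solves (w + b) q.
Proof.
move=> dw db [s1 s2] h1 h2; split=> [u v u0 tu tv|u v v' u0 tu tv tv'].
  have z : b q (v2 u v) = 0 by apply: h1.
  by rewrite -[LHS]/(w q _ + b q _) s1 // z addr0.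
have z : extd b q (v3 u v v') = 0 by apply: h2 => //; exact: v2P.
by rewrite extd_add //; [rewrite s2 // z addr0|exact: v3P].
Qed.

Lemma solves_near w w' q : decform w -> decform w' ->
  (\forall z \near q, forall v, (forall i, tangent z (v i)) -> w z v = w' z v) -> solves w q -> solves w' q.
Proof.
move=> dw dw' E [s1 s2]; split=> [u v u0 tu tv|u v v' u0 tu tv tv'].
  by have /= <- := nbhs_singleton E (v2 u v); [exact: s1|exact: v2P].
by rewrite -(extd_local dw dw' E); [exact: s2|exact: v3P].
Qed.

Lemma dec_local k (w : preform M k) : (forall p : M, exists2 w', decform w' &
  \forall q \near p, forall v, (forall i, tangent q (v i)) -> w q v = w' q v) -> decform w.
Proof.
move=> H p; have [w' dw' E] := H p; have [I [a [b rw]]] := dw' p.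
by exists I, a, b; exact: rep_eq E rw.
Qed.

(** An arbitrary lift, with no smoothness in q: horizontal forms are evaluated on it, and they do
    not depend on the choice. *)
Definition hlift (q : M) (z : tvec N) : tvec M := xget 0 [set v | tangent q v /\ Tmap f v = z].

Lemma hlift_tan q z : tangent q (hlift q z).
Proof. by rewrite /hlift; case: xgetP => [v _ []//|_]; exact: tan0. Qed.

Lemma hliftE q z : tangent (f q) z -> Tmap f (hlift q z) = z.
Proof.
move=> tz; rewrite /hlift; case: xgetP => [v _ []//|H].
by have [v tv vE] := subf tz; case: (H v).
Qed.

Lemma hlift_fibre q q' z : f q = f q' -> Tmap f (hlift q z) = Tmap f (hlift q' z).
Proof.
move=> fqq; have [tz|ntz] := pselect (tangent (f q) z); first by rewrite !hliftE // -fqq.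
have N0 q1 : f q1 = f q -> hlift q1 z = 0.
  move=> E; rewrite /hlift; case: xgetP => // v _ [tv vE]; case: ntz.
  by rewrite -E -vE; exact: Tmap_tan.
by rewrite !N0.
Qed.

Hypothesis local_sol : forall p : M, exists2 w : preform M 2, decform w & \forall q \near p, solves w q.
Hypothesis sc : forall x, simply_connected (R := R) [set q | f q = x].

Lemma fibre_path q : exists c : R -> M, [/\ {within `[0, 1]%classic, continuous c}, c 0 = e (f q), c 1 = q &
     forall t : R, 0 <= t <= 1 -> f (c t) = f q].
Proof.
have [_ pc _] := sc (f q); have [|//|c [cc cS c0 c1]] := pc (e (f q)) q; first exact: fe.
exists c; split=> // t t01; have : [set q' | f q' = f q] (c t) by apply: cS; exists t => //; rewrite /unit_interval /= in_itv.
by [].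
Qed.

(** The constants are found for each fibre and each pair of base vectors separately. That the
    resulting pointwise assignment is a smooth 2-form is proved afterwards, by propagation from the
    section e. *)
Lemma global_solution : exists w : preform M 2, [/\ decform w, forall q, solves w q & form_eq (pullback e w) 0].
Proof.
have Hbox p : exists wU : preform M 2 * set M, [/\ decform wU.1, forall q, wU.2 q -> solves wU.1 q &
    exists n k x V s y E r, @sframe R M N f p n k x V s y E wU.2 r].
  have [w dw sw] := local_sol p.
  have [n [k [x [V [s [y [E [U [r [fr UW]]]]]]]]]] := sframe_exists sf sw (@subf p).
  by exists (w, U); split=> //; exists n, k, x, V, s, y, E, r.
have [wU HwU] := choice Hbox; pose w p := (wU p).1; pose U p := (wU p).2.
have dw p : decform (w p) by have [] := HwU p.
have sw p q : U p q -> solves (w p) q by have [_ + _] := HwU p; apply.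
have Uopen p q : U p q -> nbhs q (U p).
  by have [_ _ [n [k [x [V [s [y [E [r fr]]]]]]]]] := HwU p => Uq; exact: (frame_nbhs (sf_fr fr) Uq).
have Up p : U p p.
  by have [_ _ [n [k [x [V [s [y [E [r fr]]]]]]]]] := HwU p; exact: (co_p (fr_co (sf_fr fr))).
(* On the fibre over x, and for fixed vectors z at x, the local solutions differ
   by locally constant functions; [monodromy] makes these a coboundary [kap]. *)
pose Kf (z : 'I_2 -> tvec N) p q := (w p - w q) q (fun i => hlift q (z i)).
have Kloc z x p : forall r, f r = x -> U p r -> \forall q \near r, f q = x -> Kf z p q - Kf z r q = Kf z p r - Kf z r r.
  move=> r fr Ur.
  have [n [k [x' [V [s [y [E [U' [r' [frm UW]]]]]]]]]] := sframe_exists sf (filterI (Uopen p r Ur) (Uopen r r (Up r))) (@subf r).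
  have Ur' := co_p (fr_co (sf_fr frm)).
  apply: filterS (frame_nbhs (sf_fr frm) Ur') => q Uq fq.
  have E1 q' : Kf z p q' - Kf z r q' = (w p - w r) q' (fun i => hlift q' (z i)).
    by rewrite /Kf -![(_ - _) q' _]/(_ q' _ - _ q' _); ring.
  rewrite !E1; apply: (basic_const sf frm (dec_sub (dw p) (dw r))) => //.
  - by move=> q' /UW [Upq' Urq']; have [] := solves_sub (dw p) (dw r) (sw _ _ Upq') (sw _ _ Urq').
  - by move=> q' /UW [Upq' Urq']; have [] := solves_sub (dw p) (dw r) (sw _ _ Upq') (sw _ _ Urq').
  - by rewrite fq.
  - by move=> j; exact: hlift_tan.
  - by move=> j; exact: hlift_tan.
  - by move=> j; apply: hlift_fibre; rewrite fq.
have lpc x p W : f p = x -> nbhs p W -> exists2 V, nbhs p V & forall q, f q = x -> V q ->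
    exists d : R -> M, [/\ wcont (`[0, 1]%classic : set R) d, forall t : R, 0 <= t <= 1 -> f (d t) = x /\ W (d t), d 0 = p & d 1 = q].
  move=> fp nW; have [n [k [x' [V [s [y [E [U' [r' [frm UW]]]]]]]]]] := sframe_exists sf nW (@subf p).
  have Up' := co_p (fr_co (sf_fr frm)); exists U'; first exact: (frame_nbhs (sf_fr frm) Up').
  move=> q fq Uq; have [|d [d0 d1 dU dc]] := vert_path frm Up' Uq; first by rewrite fp.
  exists d; split=> // [t|t t01]; last by have [/UW ? ->] := dU t t01.
  by rewrite /= in_itv /= => t01 Y nY; have HY : nbhs t (d @^-1` Y) := dc t t01 _ nY; apply: filterS HY => t' Yt' _.
(* The initial value cancels e^* w, so that the glued form will vanish on the image of e. *)
have Hk (xz : N * ('I_2 -> tvec N)) : exists kap : M -> R, kap (e xz.1) = - pullback e (w (e xz.1)) xz.1 xz.2 /\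
    forall p, f p = xz.1 -> \forall q \near p, f q = xz.1 -> kap q - Kf xz.2 p q = kap p - Kf xz.2 p p.
  have [||||kap k1 k2] := @monodromy R M [set q | f q = xz.1] (Kf xz.2) _ (e xz.1) (- pullback e (w (e xz.1)) xz.1 xz.2).
  - by move=> p /= fp; exists (U p); [exact: Uopen|exact: Kloc].
  - exact: fe.
  - exact: sc.
  - by move=> p W /= fp; exact: lpc.
  - by exists kap.
have [kap' Hkap'] := choice Hk; pose kap x z := kap' (x, z).
have kap_e x z : kap x z (e x) = - pullback e (w (e x)) x z by have [] := Hkap' (x, z).
have kap_loc x z p : f p = x -> \forall q \near p, f q = x -> kap x z q - Kf z p q = kap x z p - Kf z p p.
  by move=> fp; have [_ H] := Hkap' (x, z); exact: H.
pose sg : preform M 2 := fun q v => w q q v + kap (f q) (fun i => Tmap f (v i)) q.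
have sgE p q v : U p q -> (forall i, tangent q (v i)) ->
    sg q v - w p q v = kap (f q) (fun i => Tmap f (v i)) q - Kf (fun i => Tmap f (v i)) p q.
  move=> Uq tv; rewrite /Kf /sg.
  have [h _] := solves_sub (dw p) (dw q) (sw _ _ Uq) (sw _ _ (Up q)).
  rewrite -(horizontal_congr (dec_sub (dw p) (dw q)) h tv) => [||j].
  - by rewrite -[(w p - w q) q v]/(w p q v - w q q v); ring.
  - by move=> j; exact: hlift_tan.
  - by rewrite hliftE //; exact: Tmap_tan.
(* Along a path inside the slice, [kap] and [Kf z p] have the same local increments. Hence
   [sg - w p] takes equal values at points of the box over the same base point. *)
have box p q q' v v' : U p q -> U p q' -> f q = f q' -> (forall i, tangent q (v i)) -> (forall i, tangent q' (v' i)) ->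
    (forall i, Tmap f (v i) = Tmap f (v' i)) -> sg q v - w p q v = sg q' v' - w p q' v'.
  move=> Uq Uq' fqq tv tv' Tv; rewrite !sgE //.
  have -> : (fun i => Tmap f (v i)) = fun i => Tmap f (v' i) by apply/funext.
  move: (fun i => Tmap f (v' i)) => z; rewrite -fqq.
  have [_ _ [n [k [x [V [s [y [E [r fr]]]]]]]]] := HwU p.
  have [c [c0 c1 cU cc]] := vert_path fr Uq Uq' fqq.
  have := @path_ind R M (U p `&` [set r | f r = f q]) (fun r => kap (f q) z q - Kf z p q = kap (f q) z r - Kf z p r) c.
  rewrite c0 c1; apply=> //.
    by apply: wcont_within => t; rewrite /= in_itv /= => t01 Y nY; have HY : nbhs t (c @^-1` Y) := cc t t01 _ nY; apply: filterS HY => t' Yt' _.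
  move=> r1 [Ur1 fr1]; exists [set r2 | f r2 = f q -> U p r2 -> kap (f q) z r1 - Kf z p r1 = kap (f q) z r2 - Kf z p r2].
    apply: filterS2 (kap_loc (f q) z r1 fr1) (Kloc z (f q) p r1 fr1 Ur1) => r2 H1 H2 fr2 Ur2.
    by have := H1 fr2; have := H2 fr2; move: (Kf z p r1) (Kf z r1 r1) (Kf z p r2) (Kf z r1 r2) => a b c' d; lra.
  by move=> r2 r3 [Ur2 fr2] [Ur3 fr3] /= H2 H3; rewrite -(H2 fr2 Ur2) -(H3 fr3 Ur3).
have fe_id : f \o e = id by apply/funext => x /=; rewrite fe.
have Tfe x z : tangent x z -> Tmap f (Tmap e z) = z by move=> tz; rewrite Tmap_comp // fe_id (Tmap_id tz).
have Tef q v : tangent q v -> tangent (e (f q)) (Tmap e (Tmap f v)).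
  by move=> tv; apply: Tmap_tan => //; exact: Tmap_tan.
have sg_e x z : (forall i, tangent x (z i)) -> sg (e x) (fun i => Tmap e (z i)) = 0.
  move=> tz; rewrite /sg fe (_ : (fun i => Tmap f (Tmap e (z i))) = z) ?kap_e; last by apply/funext => i; exact: Tfe.
  exact: subrr.
(* Smoothness of [sg] near g, expressed as agreement with a smooth local solution. *)
pose P (g : M) := exists2 ws, decform ws & \forall q \near g, solves ws q /\
  forall v, (forall i, tangent q (v i)) -> sg q v = ws q v.
have P_unit x : P (e x).
  (* Near e(x) the correction is explicit, the pullback along f of - e^* w. *)
  pose b := pullback f (- pullback e (w (e x))).
  have de : decform (- pullback e (w (e x))) by apply: dec_opp; exact: dec_pull.
  exists (w (e x) + b); first by apply: dec_add => //; exact: dec_pull.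
  have cef : continuous (e \o f) by apply: smooth_cts; exact: smooth_comp.
  have nU : nbhs (e x) ((e \o f) @^-1` U (e x)) by apply: cef; rewrite /= fe; exact: Uopen.
  apply: filterS2 nU (Uopen _ _ (Up (e x))) => q Uefq Uq; split.
    apply: solves_add => //; [exact: dec_pull|exact: sw|exact: horizontal_pull|exact: horizontal_pull_extd].
  move=> v tv; pose v' i := Tmap e (Tmap f (v i)).
  have E0 : sg q v - w (e x) q v = - w (e x) (e (f q)) v'.
    rewrite (box (e x) q (e (f q)) v v' Uq Uefq (esym (fe _)) tv (fun i => Tef q _ (tv i))).
      by rewrite sg_e ?sub0r // => i; exact: Tmap_tan.
    by move=> i; rewrite /v' (Tfe (f q)) //; exact: Tmap_tan.
  by rewrite -[RHS]/(w (e x) q v + - w (e x) (e (f q)) v') -E0 addrC subrK.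
(* On a small box [U0] around q0 the difference of [ws] and [w p] is basic, and its coefficients
   descend to smooth functions d on N. The basic form b which they define also corrects [w p] near
   q1, because [sg - w p] depends on the base point only. *)
have P_step p q0 q1 : U p q0 -> U p q1 -> f q0 = f q1 -> P q0 -> P q1.
  move=> Uq0 Uq1 fqq [ws dws Hws].
  have [n [k [x [V [s [y [E [U0 [r [fr U0W]]]]]]]]]] := sframe_exists sf (filterI (Uopen p q0 Uq0) Hws) (@subf q0).
  have Uq00 := co_p (fr_co (sf_fr fr)); have Cx := sf_Cx fr.
  pose D := ws - w p; have dD : decform D by exact: dec_sub.
  have hD q : U0 q -> horizontal_at f D q /\ horizontal_at f (extd D) q.
    by move=> /U0W [Upq [swq _]]; apply: solves_sub => //; exact: sw.
  have tE i q : tangent q (E i q) by exact: vf_tan (fr_vf (sf_fr fr) _).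
  pose h i j q := D q (v2 (E (lshift k i) q) (E (lshift k j) q)).
  have Ch i j : Cinf M (h i j) by apply: C2 => //; exact: fr_vf (sf_fr fr) _.
  have TE i q q' : U0 q -> U0 q' -> f q = f q' -> Tmap f (E (lshift k i) q) = Tmap f (E (lshift k i) q').
    move=> Uq Uq' fq; apply: (base_tan_ext fr (sf_V fr Uq)); [exact: Tmap_tan|by rewrite fq; exact: Tmap_tan|].
    by move=> l; rewrite !TmapE // (sf_Ex fr) // (sf_Ex fr).
  have h_const i j q q' : U0 q -> U0 q' -> f q = f q' -> h i j q = h i j q'.
    move=> Uq Uq' fq; apply: (basic_const sf fr dD _ _ Uq Uq' fq); try (exact: (v2P (P := tangent _))).
    - by move=> z /hD [].
    - by move=> z /hD [].
    - move=> l; have := congr1 (fun z => z l) (v2_map (Tmap f) (E (lshift k i) q) (E (lshift k j) q)); rewrite /= => ->.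
      by rewrite (TE i q q') // (TE j q q') // -v2_map.
  have h_vert i j q a : U0 q -> vert E a q (h i j) = 0.
    move=> Uq; have tV : tangent q (vert E a q) by exact: tE.
    have : vert E a q (fun z => h i j z - h i j q) = 0.
      apply: (vert_kill sf (@subf q) _ tV (vert_f sf fr a Uq)); first by apply: C_sub => //; exact: C_cst.
      by apply: filterS (frame_nbhs (sf_fr fr) Uq) => z Uz fz; rewrite (h_const i j z q) // subrr.
    by rewrite (tan_sub tV) ?(tan_cst tV) ?subr0 //; exact: C_cst.
  have Hd (ij : 'I_n * 'I_n) : exists d, Cinf N d /\ forall q, U0 q -> h ij.1 ij.2 q = d (f q).
    by have [d Cd dE] := descend fr (Ch ij.1 ij.2) (fun q a => h_vert ij.1 ij.2 q a); exists d.
  have [d Hd'] := choice Hd; have Cd i j : Cinf N (d (i, j)) by have [] := Hd' (i, j).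
  have dE i j q : U0 q -> h i j q = d (i, j) (f q) by have [_ H] := Hd' (i, j); exact: H.
  pose b := basic2 f x (fun i j => d (i, j) \o f).
  have Cdf i j : Cinf M (d (i, j) \o f) by exact: sf (Cd i j).
  have db : decform b by exact: dec_basic2.
  exists (w p + b); first exact: dec_add.
  (* As f is open on the box, points near q1 lie over images of points of [U0]. *)
  have nf : nbhs q1 (f @^-1` [set z | exists2 q, U0 q & f q = z]).
    by apply: (smooth_cts sf); rewrite -fqq; exact: sf_open fr _ Uq00.
  apply: filterS2 nf (Uopen p q1 Uq1) => q' [q Uq fq] Uq'; split.
    apply: solves_add => //; [exact: sw|exact: basic2_horizontal|].
    move=> u v u0 tu tv; rewrite [v]v2E -/(v3 u _ _) (extd_basic2 sf) // /basic2 big1 // => ij _.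
    by rewrite -(TmapE f u (Cd _ _)) u0 tv0 mulr0 mul0r.
  move=> v tv; have Hl i : exists v', tangent q v' /\ Tmap f v' = Tmap f (v i).
    by have [|v' tv' vE] := @subf q (Tmap f (v i)); [rewrite fq; exact: Tmap_tan|exists v'].
  have [v' Hv'] := choice Hl; have tv' i : tangent q (v' i) by have [] := Hv' i.
  have vv' i : Tmap f (v' i) = Tmap f (v i) by have [] := Hv' i.
  have vx l i : v' l (x i \o f) = v l (x i \o f) by rewrite -(TmapE f (v' l) (Cx i)) vv' TmapE.
  have [Upq [_ sE]] := U0W q Uq.
  have := box p q q' v' v Upq Uq' fq tv' tv vv'; rewrite sE // => H.
  rewrite -[RHS]/(w p q' v + b q' v); suff -> : b q' v = ws q v' - w p q v' by rewrite H addrC subrK.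
  have -> : ws q v' - w p q v' = D q (v2 (v' ord0) (v' (lift ord0 ord0))) by rewrite -v2E.
  rewrite (horizontal2_expand sf fr dD Uq) //; last by have [] := hD q Uq.
  rewrite [X in b _ X]v2E /b basic2E // => [|i j]; last by rewrite /= -fq -!dE //; exact: skew2.
  apply: eq_bigr => i _; apply: eq_bigr => j _; rewrite /= -fq -dE //; by rewrite !vx.
have PP g : P g.
  have [c [cc c0 c1 fc]] := fibre_path g; rewrite -c1.
  apply: (@path_ind R M [set z | f z = f g] P c cc fc); last by rewrite c0.
  move=> p fp; exists (U p); first exact: Uopen.
  by move=> q q' /= fq fq' Uq Uq'; apply: (P_step p) => //; rewrite fq fq'.
have dsg : decform sg.
  by apply: dec_local => p; have [ws dws H] := PP p; exists ws => //; apply: filterS H => q [].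
exists sg; split=> // q.
have [ws dws H] := PP q; apply: (solves_near dws dsg); last by have [] := nbhs_singleton H.
by apply: filterS H => z [_ E] v tv; rewrite E.
Qed.

End GlobalSolution.

(** * Integration of isotropic structures *)

Section Wedge.
Context {R : realType} {M : smoothSpace R} {nM : nice M}.

Definition wedge1 (a b : preform M 1) : preform M 2 := fun q v =>
  a q (v1 (v ord0)) * b q (v1 (v (lift ord0 ord0))) - a q (v1 (v (lift ord0 ord0))) * b q (v1 (v ord0)).

Lemma wedge1E a b q u v : wedge1 a b q (v2 u v) = a q (v1 u) * b q (v1 v) - a q (v1 v) * b q (v1 u).
Proof. by rewrite /wedge1 /v2 vc0 vcS. Qed.

Lemma dwedge1 (a : M -> R) (u : tvec M) : dwedge (v1 a) (v1 u) = u a.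
Proof. by rewrite /dwedge det_mx11 mxE. Qed.

Lemma dec_wedge1 a b : decform a -> decform b -> decform (wedge1 a b).
Proof.
move=> da db p; have [I [f [x [Cf Cx Ha]]]] := da p; have [J [g [y [Cg Cy Hb]]]] := db p.
exists (I * J)%type, (fun ij q => f ij.1 q * g ij.2 q), (fun ij => v2 (x ij.1 ord0) (y ij.2 ord0)); split.
- by move=> ij; exact: C_mul.
- by move=> ij; exact: v2P.
apply: filterS2 Ha Hb => q Ha Hb v tv; rewrite /wedge1 !Ha ?Hb; try by move=> i; exact: tv.
rewrite -(pair_bigA _ (fun i j => f i q * g j q * dwedge (v2 (x i ord0) (y j ord0)) v)) /=.
rewrite !big_distrlr -sumrB; apply: eq_bigr => i _; rewrite -sumrB; apply: eq_bigr => j _.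
by rewrite [X in dwedge (v2 _ _) X]v2E dwedge2 [x i]v1E [y j]v1E !dwedge1 /=; ring.
Qed.

End Wedge.

(** * Local solutions on the groupoid *)

Section LocalSolution.
Context {R : realType} {K : manifold R} (GK : lieGroup K).
Context (Omega : preform (prodS K K) 2) (Theta : preform K 3).
Hypothesis hK : shifted2_symplectic GK Omega Theta.
Context {H N : manifold R} (G : lieGroupoid H N) (Phi : H -> K).
Hypothesis hPhi : groupoid_morphism G GK Phi.
Local Notation s := (src G).
Local Notation t := (tgt G).
Local Notation e := (unit_at G).
Local Notation o := (gone GK).
Local Notation phi := (lie_morphism Phi).
Local Notation ri := (right_inv G).
Context (lam : N -> tvec H -> tvec N -> R) (eta : preform N 3).
Hypothesis im : isotropic_algebroid GK Omega G Phi (lam, eta).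
Local Notation theta := (theta GK Omega G Phi lam).
Local Notation chi := (chi Theta G Phi eta).

(** Multiplication at the pair (g, g^-1) maps (u^R(g), 0) to u^R at the unit over t g, which is u(t
    g); linear relations at g thus pass to t g. *)
Lemma ri_comb u n (c : 'I_n -> R) (U : 'I_n -> N -> tvec H) g : (forall x, algd G x (u x)) ->
  (forall i x, algd G x (U i x)) -> ri u g = \sum_i c i *: ri (U i) g -> u (t g) = \sum_i c i *: U i (t g).
Proof.
move=> au aU E; have [p [pE1 pE2]] := @comp_pair _ _ _ G g (inv_of G g) (esym (tgt_inv G g)).
have mE : comp_mul p = e (t g) by rewrite /comp_mul pE1 pE2 gcomp_invr.
have [w [tw w1 w2 wm]] := ri_mul au p.
have Hw i : exists w, [/\ tangent p w, Tmap (@comp_fst _ _ _ G) w = ri (U i) (comp_fst p),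
    Tmap (@comp_snd _ _ _ G) w = 0 & Tmap (@comp_mul _ _ _ G) w = ri (U i) (comp_mul p)] by exact: ri_mul.
have [W HW] := choice Hw.
have -> : u (t g) = Tmap (@comp_mul _ _ _ G) w by rewrite wm mE (ri_unit au).
have -> : w = \sum_i c i *: W i.
  apply: comp_tan_ext tw _ _ _.
  - by apply: tan_sum => i _; apply: tanZ; have [] := HW i.
  - rewrite w1 pE1 E Tmap_sum; apply: eq_bigr => i _; rewrite TmapZ; have [_ -> _ _] := HW i.
    by rewrite pE1.
  - by rewrite w2 Tmap_sum big1 // => i _; rewrite TmapZ; have [_ _ -> _] := HW i; rewrite scaler0.
rewrite Tmap_sum; apply: eq_bigr => i _; rewrite TmapZ; have [_ _ _ ->] := HW i.
by rewrite mE (ri_unit (aU i)).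
Qed.

Lemma lam_sum x n (c : 'I_n -> R) (U : 'I_n -> tvec H) z : is_bundle_map G lam -> (forall i, algd G x (U i)) ->
  tangent x z -> lam x (\sum_i c i *: U i) z = \sum_i c i * lam x (U i) z.
Proof.
move=> [_ l _ _] aU tz; have a0 : algd G x 0 by split; [exact: tan0|exact: Tmap0].
have l0 : lam x 0 z = 0.
  by have := l x 1 0 0 z a0 a0 tz; rewrite scaler0 addr0 mul1r; lra.
suff [] : algd G x (\sum_i c i *: U i) /\ lam x (\sum_i c i *: U i) z = \sum_i c i * lam x (U i) z by [].
elim/big_rec2: _ => // i a b _ [ab IH]; split; last by rewrite l // IH.
have [tU U0] := aU i; have [tb b0] := ab; split; first exact: tan_comb.
by rewrite Tmap_comb U0 b0 scaler0 addr0.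
Qed.

Lemma theta_comb u n (c : 'I_n -> R) (U : 'I_n -> N -> tvec H) g Y : (forall x, algd G x (u x)) ->
  (forall i x, algd G x (U i x)) -> tangent g Y -> ri u g = \sum_i c i *: ri (U i) g ->
  theta u g (v1 Y) = \sum_i c i * theta (U i) g (v1 Y).
Proof.
move=> au aU tY /(ri_comb au aU) E; have [bl _ _] := algebroid_dec im.
have tt : tangent (t g) (Tmap t Y) by apply: Tmap_tan => //; exact: t_smooth.
have tP : tangent (Phi g) (Tmap Phi Y) by apply: Tmap_tan => //; exact: (Phi_smooth hPhi).
rewrite thetaE alphaE E lam_sum // (_ : phi u (t g) = \sum_i c i *: phi (U i) (t g)); last first.
  by rewrite /lie_morphism E Tmap_sum; apply: eq_bigr => i _; rewrite TmapZ.
rewrite (beta_sum hK) //; last by move=> i; exact: (phi_tan hPhi (aU i _)).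
by rewrite -sumrB; apply: eq_bigr => i _; rewrite thetaE alphaE mulrBr.
Qed.

(** Right-invariant fields that equal the vertical coordinate fields at g0 stay independent nearby.
    The dual forms are combinations of the dy_b, with coefficients from the inverse of the matrix of
    the fields in the coordinates y. *)
Lemma local_coframe (g0 : H) : exists k (U : 'I_k -> N -> tvec H) (c : 'I_k -> preform H 1),
  [/\ forall a, algd_section G (U a), forall a, decform (c a) &
   \forall q \near g0, (forall a b, c a q (v1 (ri (U b) q)) = (a == b)%:R) /\
     forall X, tangent q X -> Tmap s X = 0 -> X = \sum_a c a q (v1 X) *: ri (U a) q].
Proof.
have sub : forall w, tangent (s g0) w -> exists2 v, tangent g0 v & Tmap s v = w by exact: src_submersion.
have ss := s_smooth G.
have [n [k [x [V [r0 [y [E [W [r [fr _]]]]]]]]]] := sframe_exists ss (@filter_nbhsT _ (nbhs g0) _) sub.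
have frM := sf_fr fr; have Wg := co_p (fr_co frM).
have HU a : exists u, algd_section G u /\ ri u g0 = vert E a g0.
  have [||u su uE] := @vertical_ri _ _ _ G g0 (vert E a g0); last by exists u.
    by exact: vf_tan (vert_vf fr a).
  exact: (vert_f ss fr).
have [U HU'] := choice HU; have sU a : algd_section G (U a) by have [] := HU' a.
have tU a q : tangent q (ri (U a) q) by exact: vf_tan (ri_vf (sU a)).
pose A q : 'M[R]_k := \matrix_(a, b) ri (U a) q (y b).
have CA a b : Cinf H (fun q => A q a b).
  have -> : (fun q => A q a b) = fun q => ri (U a) q (y b) by apply/funext => q; rewrite mxE.
  by apply: vf_C; [exact: ri_vf|exact: (sf_Cy fr b)].
have A0 : A g0 = 1%:M by apply/matrixP => a b; rewrite !mxE; have [_ ->] := HU' a; rewrite (vert_y fr) // eq_sym.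
have Cdet : Cinf H (fun q => \det (A q)).
  by apply: C_sum => sg _; apply: C_scale; apply: C_prod.
have [|d Cd dE] := C_inv_near (p := g0) Cdet; first by rewrite A0 det1 oner_neq0.
(* Near g0 these are the entries of the inverse of [A], by Cramer's rule; [d] is a global smooth
   function equal to 1 / det A near g0. *)
pose m b a q := d q * (\adj (A q)) b a.
have Cm b a : Cinf H (m b a).
  apply: C_mul => //; have -> : (fun q => (\adj (A q)) b a) = fun q => cofactor (A q) a b.
    by apply/funext => q; rewrite mxE.
  apply: C_scale; apply: C_sum => sg _; apply: C_scale; apply: C_prod => i _.
  set j := perm.fun_of_perm.body sg i.
  by congr (Cinf H _): (CA (lift a i) (lift b j)); apply/funext => q; rewrite !mxE.
exists k, U, (fun a q v => \sum_b m b a q * dwedge (v1 (y b)) v); split=> //.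
  move=> a p; exists 'I_k, (fun b => m b a), (fun b => v1 (y b)); split=> //.
  - by move=> b j; exact: sf_Cy fr b.
  - exact: nearW.
apply: filterS2 dE (frame_nbhs frM Wg) => q dq Wq.
have mA : A q *m (\matrix_(b, a) m b a q) = 1%:M.
  have -> : \matrix_(b, a) m b a q = d q *: \adj (A q) by apply/matrixP => b a; rewrite /m !mxE.
  by rewrite -scalemxAr mul_mx_adj scale_scalar_mx mulrC dq.
have Am := mulmx1C mA.
split=> [a b|X tX X0].
  have := congr1 (fun B : 'M[R]_k => B b a) mA; rewrite !mxE eq_sym => <-.
  by apply: eq_bigr => b' _; rewrite !mxE dwedge1 mulrC.
set Z := \sum_a _; have tZ : tangent q Z by apply: tan_sum => a _; exact: tanZ.
have Z0 : Tmap s Z = 0.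
  by rewrite /Z Tmap_sum big1 // => a _; rewrite TmapZ (ri_s (sU a).1) scaler0.
rewrite (vert_span fr Wq tX X0) (vert_span fr Wq tZ Z0); apply: eq_bigr => b _; congr (_ *: _).
have -> : Z (y b) = \sum_a (\sum_b' X (y b') * m b' a q) * A q a b.
  rewrite /Z tv_sum; apply: eq_bigr => a _; rewrite tvZ mxE; congr (_ * _).
  by apply: eq_bigr => b' _; rewrite dwedge1 mulrC.
have E1 := congr1 (fun B : 'rV[R]_k => B 0 b) (congr1 (mulmx (\row_b' X (y b'))) Am).
move: E1; rewrite mulmxA mulmx1 !mxE => <-; apply: eq_bigr => a _; rewrite !mxE; congr (_ * _).
by apply: eq_bigr => b' _; rewrite !mxE.
Qed.

Lemma local_contraction (g0 : H) : exists2 w : preform H 2, decform w & \forall q \near g0,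
  forall u Y, algd_section G u -> tangent q Y -> w q (v2 (ri u q) Y) = theta u q (v1 Y).
Proof.
have [bl _ _] := algebroid_dec im.
have [k [U [c [sU dc Hc]]]] := local_coframe g0.
have dth a : decform (theta (U a)) by exact: (dec_theta hK hPhi bl (sU a)).
have vU a : vfield (ri (U a)) by exact: ri_vf.
(* The sum of c_b /\ (theta_b - 1/2 sum_a theta_b(U_a) c_a) has the required
   contractions because theta_b(U_a) is skew in a and b. *)
pose psi b : preform H 1 := theta (U b) - \sum_a (fun q v => (2^-1 * theta (U b) q (v1 (ri (U a) q))) * c a q v).
have Cc b a : Cinf H (fun q => 2^-1 * theta (U b) q (v1 (ri (U a) q))) by apply: C_scale; exact: C1.
have dpsi b : decform (psi b) by apply: dec_sub => //; apply: dec_sum => a; exact: dec_scale.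
exists (\sum_b wedge1 (c b) (psi b)); first by apply: dec_sum => b; exact: dec_wedge1.
apply: filterS Hc => q [cU cX] u Y su tY.
have tU a : tangent q (ri (U a) q) by exact: vf_tan.
have psiE b Z : psi b q (v1 Z) = theta (U b) q (v1 Z) - \sum_a 2^-1 * theta (U b) q (v1 (ri (U a) q)) * c a q (v1 Z).
  by rewrite /psi -[LHS]/(theta (U b) q _ - (\sum_a _) q _) form_sumE.
have psiU b a : psi b q (v1 (ri (U a) q)) = 2^-1 * theta (U b) q (v1 (ri (U a) q)).
  rewrite psiE (bigD1 a) //= cU eqxx mulr1 big1 ?addr0; last by move=> a' a'a; rewrite cU (negPf a'a) mulr0.
  by move: (theta _ _ _) => z; field.
have UE a Z : tangent q Z -> (\sum_b wedge1 (c b) (psi b)) q (v2 (ri (U a) q) Z) = theta (U a) q (v1 Z).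
  move=> tZ; rewrite form_sumE; under eq_bigr do rewrite wedge1E cU.
  rewrite sumrB (bigD1 a) //= eqxx mul1r big1 ?addr0; last by move=> b /negPf ba; rewrite ba mul0r.
  rewrite psiE -addrA -opprD -[RHS]subr0; congr (_ - _).
  rewrite -big_split big1 // => b _; rewrite /= psiU (theta_skew hK hPhi q im (sU b) (sU a)); ring.
have tu := vf_tan q (ri_vf su).
have uE := cX _ tu (ri_s su.1 q).
rewrite (theta_comb su.1 (fun a => (sU a).1) tY uE) {1}uE lin2l_sum //; last first.
  by apply: dec_sum => b; exact: dec_wedge1.
by apply: eq_bigr => a _; rewrite UE.
Qed.

(** [cartan2] and [theta_key] have the same terms: the contraction equation alone forces dw = chi on
    two vertical vectors. *)
Lemma contraction_closed (w : preform H 2) (q : H) u v W : decform w ->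
  (\forall z \near q, forall u Y, algd_section G u -> tangent z Y -> w z (v2 (ri u z) Y) = theta u z (v1 Y)) ->
  algd_section G u -> algd_section G v -> tangent q W ->
  extd w q (v3 (ri u q) (ri v q) W) = chi q (v3 (ri u q) (ri v q) W).
Proof.
move=> dw Hw su sv tW; have [bl _ _] := algebroid_dec im.
have vu := ri_vf su; have vv := ri_vf sv; have tu := vf_tan q vu; have tv := vf_tan q vv.
rewrite -(theta_key hK hPhi im) //.
have nH : nice H by exact: _.
rewrite (@cartan2 R H nH w _ _ _ _ dw vu vv tW).
have I a : algd_section G a -> \forall z \near q, forall v, (forall i, tangent z (v i)) ->
    iprod (ri a) w z v = theta a z v.
  by move=> sa; apply: filterS Hw => z Hz Y tY; rewrite (v1E Y) iprod1E Hz //; exact: tY.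
have dI a : algd_section G a -> decform (iprod (ri a) w) by move=> sa; apply: dec_iprod => //; exact: ri_vf.
rewrite (extd_local (dI v sv) (dec_theta hK hPhi bl sv) (I v sv)); last exact: v2P.
rewrite (extd_local (dI u su) (dec_theta hK hPhi bl su) (I u su)); last exact: v2P.
rewrite ri_bracket // (nbhs_singleton Hw) //; last exact: section_bracket.
congr (_ - _ - _); apply: (tan_near tW).
- exact: C2.
- exact: (C1 (dec_theta hK hPhi bl su) vv).
- by apply: filterS Hw => z Hz; apply: Hz => //; exact: vf_tan.
Qed.

Definition vert_section (q : H) (X : tvec H) : N -> tvec H :=
  xget (fun=> 0) [set u | algd_section G u /\ ri u q = X].

(** Theta as a function of a single vertical vector instead of a section, which is the form [solves]
    requires. By [theta_comb] the choice of the section is immaterial. *)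
Definition vtheta (q : H) (X Y : tvec H) : R := theta (vert_section q X) q (v1 Y).

Lemma vthetaE u q Y : algd_section G u -> tangent q Y -> vtheta q (ri u q) Y = theta u q (v1 Y).
Proof.
move=> su tY; rewrite /vtheta /vert_section; case: xgetP => [u' _ [su' E]|/(_ u)[]//].
rewrite (@theta_comb u' 1 (fun=> 1) (fun=> u)) ?big_ord1 ?mul1r //; [exact: su'.1|by move=> _; exact: su.1|].
by rewrite scale1r.
Qed.

(** After [local_contraction], the error z = d w0 - chi is closed and vanishes on two vertical
    vectors. [vertical_primitive] provides a horizontal correction, which cancels the rest of the
    error and leaves the contractions unchanged. *)
Lemma local_solution (g0 : H) : exists2 w : preform H 2, decform w & \forall q \near g0, solves s vtheta chi w q.
Proof.
have [_ deta ceta] := algebroid_dec im.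
have [w0 dw0 Hw0] := local_contraction g0.
have dchi : decform chi by exact: (dec_chi hK hPhi deta).
pose z := extd w0 - chi; have dz : decform z by apply: dec_sub => //; exact: dec_extd.
have Hn : \forall q \near g0, \forall z \near q, forall u Y, algd_section G u -> tangent z Y ->
    w0 z (v2 (ri u z) Y) = theta u z (v1 Y) by exact: nbhs_interior Hw0.
have ss := s_smooth G.
have sub : forall w, tangent (s g0) w -> exists2 v, tangent g0 v & Tmap s v = w by exact: src_submersion.
have [||t0 dt Ht] := vertical_primitive ss sub dz.
- move=> q v tv; rewrite extd_sub //; last exact: dec_extd.
  by rewrite extd_extd // (extd_chi hK hPhi) // subrr.
- apply: filterS Hn => q Hq u v W u0 v0 tu tv tW.
  have [a sa <-] := vertical_ri tu u0; have [b sb <-] := vertical_ri tv v0.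
  by rewrite -[LHS]/(extd w0 q _ - chi q _) contraction_closed // subrr.
exists (w0 + t0); first exact: dec_add.
apply: filterS2 Hw0 Ht => q Hq [h1 h2]; split=> [u v u0 tu tv|u v v' u0 tu tv tv'].
  have [a sa aE] := vertical_ri tu u0; have z0 : t0 q (v2 u v) = 0 by apply: h1.
  by rewrite -[LHS]/(w0 q _ + t0 q _) z0 addr0 -aE Hq // vthetaE.
rewrite extd_add //; last exact: v3P.
by rewrite h2 // -[z q _]/(extd w0 q _ - chi q _) opprB addrC subrK.
Qed.

End LocalSolution.

(** * Multiplicativity, surjectivity and injectivity *)

Section Integration.
Context {R : realType} {K : manifold R} (GK : lieGroup K).
Context (Omega : preform (prodS K K) 2) (Theta : preform K 3).
Hypothesis hK : shifted2_symplectic GK Omega Theta.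
Context {H N : manifold R} (G : lieGroupoid H N) (Phi : H -> K).
Hypothesis hPhi : groupoid_morphism G GK Phi.
Local Notation s := (src G).
Local Notation t := (tgt G).
Local Notation e := (unit_at G).
Local Notation o := (gone GK).
Local Notation phi := (lie_morphism Phi).
Local Notation ri := (right_inv G).
Local Notation C := (composable G).
Local Notation cf := (@comp_fst _ _ _ G).
Local Notation cs := (@comp_snd _ _ _ G).
Local Notation cm := (@comp_mul _ _ _ G).
Local Notation K2 := (prodS K K).
Hypothesis ssc : source_simply_connected G.

#[local] Existing Instance C_nice.

Lemma source_path q : exists c : R -> H, [/\ {within `[0, 1]%classic, continuous c}, c 0 = e (s q), c 1 = q &
     forall r : R, 0 <= r <= 1 -> s (c r) = s q].
Proof. exact: (fibre_path (src_unit G) ssc q). Qed.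

Lemma source_basic_zero m (w : preform H m.+1) : decform w -> (forall q, horizontal_at s w q) ->
  (forall q, horizontal_at s (extd w) q) -> form_eq (pullback e w) 0 -> form_eq w 0.
Proof.
exact: (basic_zero (s_smooth G) (@src_submersion _ _ _ G) (e_smooth G) (src_unit G) source_path).
Qed.

(** The first component identifies the fibre of [cs] over h with the source fibre over t h, so a
    path there is lifted with constant second component. *)
Lemma comp_path q (e' : H -> C) : (forall h, cf (e' h) = e (t h)) -> (forall h, cs (e' h) = h) ->
  exists c : R -> C, [/\ {within `[0, 1]%classic, continuous c}, c 0 = e' (cs q), c 1 = q &
     forall r : R, 0 <= r <= 1 -> cs (c r) = cs q].
Proof.
move=> e1 e2; have [g [cg g0 g1 sg]] := source_path (cf q).
have H1 (r : R) : exists c : C, 0 <= r <= 1 -> cf c = g r /\ cs c = cs q.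
  have [r01|nr] := pselect (0 <= r <= 1); last by exists q.
  by have [|c cE] := @comp_pair _ _ _ G (g r) (cs q); [rewrite sg // comp_eq|exists c].
have [c cE] := choice H1.
have z01 : 0 <= (0 : R) <= 1 by rewrite lexx ler01.
have o01 : 0 <= (1 : R) <= 1 by rewrite lexx ler01.
exists c; split.
- apply: wcont_within => r; rewrite /= in_itv /= => r01 V nV.
  have [W nW WV] := @near_subS R (prodS H H) [set p | s p.1 = t p.2] (c r) V nV.
  have E (r' : R) : 0 <= r' <= 1 -> set_val (c r') = (g r', cs q).
    by move=> /cE [<- <-]; rewrite -surjective_pairing.
  rewrite E // in nW; case: nW => -[A B] [/= nA nB] AB.
  have := within_wcont cg; rewrite /wcont => /(_ r); rewrite /= in_itv /= => /(_ r01 A nA).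
  apply: filterS => r' Hr' /=; rewrite in_itv /= => r'01; apply: WV; rewrite E //; apply: AB; split=> /=.
    by apply: Hr'; rewrite in_itv.
  exact: nbhs_singleton nB.
- have [c1 c2] := cE 0 z01; apply: comp_inj; rewrite ?e1 ?e2 ?c1 ?c2 //.
  by rewrite g0 comp_eq.
- by have [c1 c2] := cE 1 o01; apply: comp_inj; rewrite ?c1 ?c2.
- by move=> r /cE [_ ->].
Qed.

Definition PhiPhi (p : C) : K2 := (Phi (cf p), Phi (cs p)).

Lemma PhiPhi_smooth : smooth_map (PhiPhi : C -> K2).
Proof.
have sP := Phi_smooth hPhi.
by apply: pair_smooth; [exact: smooth_comp (cf_smooth (G := G)) sP|exact: smooth_comp (cs_smooth (G := G)) sP].
Qed.

Lemma pullback_comp (L M M' : smoothSpace R) (f : L -> M) (g : M -> M') k (w : preform M' k) p v :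
  smooth_map g -> pullback f (pullback g w) p v = pullback (g \o f) w p v.
Proof.
by move=> sg; rewrite /pullback; congr (w _ _); apply/funext => i; rewrite Tmap_comp.
Qed.

Section FromLambda.
Context (lam : N -> tvec H -> tvec N -> R) (eta : preform N 3).
Hypothesis im : isotropic_algebroid GK Omega G Phi (lam, eta).
Local Notation theta := (theta GK Omega G Phi lam).
Local Notation chi := (chi Theta G Phi eta).
Context (sg : preform H 2).
Hypothesis (dsg : decform sg).
Hypothesis sol : forall q, solves s (vtheta GK Omega G Phi lam) chi sg q.
Hypothesis esg : form_eq (pullback e sg) 0.

Let deta : decform eta. Proof. by have [_] := algebroid_dec im. Qed.

Lemma solution_contraction u g Y : algd_section G u -> tangent g Y -> sg g (v2 (ri u g) Y) = theta u g (v1 Y).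
Proof.
move=> su tY; have [s1 _] := sol g; rewrite s1 ?(vthetaE hK hPhi im) //; first exact: ri_s su.1 g.
exact: vf_tan (ri_vf su).
Qed.

Lemma unit_Phi_tan x z : tangent x z -> Tmap Phi (Tmap e z) = 0.
Proof.
move=> tz; rewrite Tmap_comp; last exact: Phi_smooth hPhi.
by apply: (Tmap_const (y := o) tz) => y; exact: Phi_unit hPhi y.
Qed.

(** The difference is horizontal since sg solves the equations, and closed. Its pullback along e is
    zero because e^* sg = 0, s o e = t o e = id, and Phi is constant on units. *)
Lemma extd_solution : form_eq (extd sg) chi.
Proof.
have dchi : decform chi by exact: (dec_chi hK hPhi deta).
have dx : decform (extd sg) by exact: dec_extd.
suff Z : form_eq (extd sg - chi) 0.
  by move=> p v tv; apply/eqP; rewrite -subr_eq0; apply/eqP; exact: Z.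
have dz : decform (extd sg - chi) by exact: dec_sub.
have [_ _ ceta] := algebroid_dec im.
apply: source_basic_zero => //.
- move=> q u v u0 tu tv; rewrite [v]v2E -/(v3 u _ _) -[LHS]/(extd sg q _ - chi q _).
  by have [_ ->] := sol q; rewrite ?subrr //; exact: tv.
- move=> q u v u0 tu tv; have tuv : forall i, tangent q (vc u v i) by exact: vcP.
  by rewrite extd_sub // extd_extd // (extd_chi hK hPhi) // subrr.
move=> x v tv; have tev i : tangent (e x) (Tmap e (v i)) by apply: Tmap_tan => //; exact: e_smooth.
rewrite -[LHS]/(pullback e (extd sg) x v - pullback e chi x v) -extd_pull //; last exact: e_smooth.
have -> : extd (pullback e sg) x v = 0.
  rewrite (extd_eq (dec_pull (e_smooth G) dsg) esg) //.
  have -> : (0 : preform N 2) = (0 : preform N 2) - 0 by rewrite subrr.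
  by rewrite extd_sub ?subrr //; exact: dec0.
have -> : pullback e chi x v = pullback s eta (e x) (fun i => Tmap e (v i)) - pullback t eta (e x) (fun i => Tmap e (v i))
   - pullback Phi Theta (e x) (fun i => Tmap e (v i)) by [].
have -> : pullback Phi Theta (e x) (fun i => Tmap e (v i)) = 0.
  apply: (dec_zero (p := Phi (e x)) (i := ord0) (dec_Theta hK)); last exact: unit_Phi_tan (tv _).
  by move=> j; apply: Tmap_tan => //; exact: Phi_smooth hPhi.
rewrite /pullback src_unit tgt_unit.
have -> : (fun i => Tmap s (Tmap e (v i))) = v.
  apply/funext => i; rewrite Tmap_comp; last exact: s_smooth.
  by rewrite (Tmap_idE (tv i)) // => y /=; rewrite src_unit.
have -> : (fun i => Tmap t (Tmap e (v i))) = v.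
  apply/funext => i; rewrite Tmap_comp; last exact: t_smooth.
  by rewrite (Tmap_idE (tv i)) // => y /=; rewrite tgt_unit.
by rewrite subrr !subr0.
Qed.

(** The defect of multiplicativity of sg. *)
Let W : preform C 2 := pullback cf sg + pullback cs sg - pullback cm sg - pullback (PhiPhi : C -> K2) Omega.

Let WE p v : W p v = sg (cf p) (fun i => Tmap cf (v i)) + sg (cs p) (fun i => Tmap cs (v i)) -
  sg (cm p) (fun i => Tmap cm (v i)) - Omega (PhiPhi p) (fun i => Tmap (PhiPhi : C -> K2) (v i)).
Proof. by []. Qed.

Let dW : decform W.
Proof.
apply: dec_sub; first apply: dec_sub; first apply: dec_add; apply: dec_pull => //.
- exact: cf_smooth.
- exact: cs_smooth.
- exact: cm_smooth.
- exact: PhiPhi_smooth.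
- exact: dec_Omega hK.
Qed.

(** A vector killed by [cs] is of the form (u^R, 0), so all contractions are given by theta_u. The
    lambda terms cancel by t(gh) = t(g), the beta terms by [iprod_CR]. *)
Lemma mult_horizontal p : horizontal_at cs W p.
Proof.
move=> A v A0 tA tv; have [sP PM] := hPhi.
have scf : smooth_map cf by exact: cf_smooth. have scs : smooth_map cs by exact: cs_smooth.
have scm : smooth_map cm by exact: cm_smooth. have sPP := PhiPhi_smooth.
have st := t_smooth G; have ss := s_smooth G.
move: (v ord0) (tv ord0) (v1E v) => B tB -> {v tv}; rewrite -/(v2 A B).
have sA : Tmap s (Tmap cf A) = 0.
  rewrite Tmap_comp // (_ : s \o cf = t \o cs); last by apply/funext => q /=; rewrite comp_eq.
  by rewrite -Tmap_comp // A0 Tmap0.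
have [u su uE] := vertical_ri (Tmap_tan scf tA) sA.
have [w [tw w1 w2 wm]] := ri_mul su.1 p.
have wA : w = A by apply: (comp_tan_ext tw tA); rewrite ?w1 ?w2 ?uE ?A0.
have cA := phi_tan hPhi (su.1 (t (cf p))).
have mt : t (cm p) = t (cf p) by rewrite /comp_mul tgt_comp // comp_eq.
have TtB : Tmap t (Tmap cm B) = Tmap t (Tmap cf B).
  rewrite !Tmap_comp // (_ : t \o cm = t \o cf) //.
  by apply/funext => q; rewrite /= /comp_mul tgt_comp // comp_eq.
rewrite WE !v2_map -wA w1 w2 wm wA; rewrite (zero2l dsg (Tmap_tan scs tB)) addr0.
rewrite !solution_contraction //; [|exact: Tmap_tan|exact: Tmap_tan].
rewrite !thetaE !alphaE mt TtB.
have pA : Tmap (PhiPhi : C -> K2) A = CR GK (phi u (t (cf p))) (PhiPhi p).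
  apply: (@prod_tan_ext R K (PhiPhi p)); [exact: Tmap_tan|exact: CR_tan| |].
  - rewrite CR1 Tmap_comp; last exact: p1_smooth.
    by rewrite -[p1 \o _]/(Phi \o cf) -Tmap_comp // -uE (phi_ri hPhi _ su.1).
  - rewrite CR2 // Tmap_comp; last exact: p2_smooth.
    by rewrite -[p2 \o _]/(Phi \o cs) -Tmap_comp // A0 Tmap0.
rewrite pA (iprod_CR hK) //; last exact: Tmap_tan.
have pmE : pm GK (PhiPhi p) = Phi (cm p) by rewrite /pm /= /comp_mul PM // comp_eq.
rewrite pmE [Tmap (pm GK) _]Tmap_comp; last exact: pm_smooth.
rewrite [Tmap p1 _]Tmap_comp; last exact: p1_smooth.
rewrite (_ : pm GK \o PhiPhi = Phi \o cm); last first.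
  by apply/funext => q; rewrite /= /pm /comp_mul PM // comp_eq.
have C1 : Tmap (Phi \o cm) B = Tmap Phi (Tmap cm B) by rewrite Tmap_comp.
have C2 : Tmap (p1 \o (PhiPhi : C -> K2)) B = Tmap Phi (Tmap cf B) by rewrite Tmap_comp.
rewrite C1 C2 -[(PhiPhi p).1]/(Phi (cf p)); move: (lam _ _ _) => L.
move: (beta GK Omega _ (Phi (cf p)) _) => b1; move: (beta GK Omega _ (Phi (cm p)) _) => b2; ring.
Qed.

(** With d sg = chi, the eta terms cancel in pairs by the source and target rules for composable
    pairs, and the Theta terms leave delta Theta + d Omega = 0 pulled back to them. *)
Lemma mult_extd : form_eq (extd W) 0.
Proof.
move=> p v tv; have [sP PM] := hPhi.
have scf : smooth_map cf by exact: cf_smooth. have scs : smooth_map cs by exact: cs_smooth.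
have scm : smooth_map cm by exact: cm_smooth. have sPP := PhiPhi_smooth.
have st := t_smooth G; have ss := s_smooth G; have dO := dec_Omega hK.
have d1 : decform (pullback cf sg) by exact: dec_pull.
have d2 : decform (pullback cs sg) by exact: dec_pull.
have d3 : decform (pullback cm sg) by exact: dec_pull.
have d4 : decform (pullback (PhiPhi : C -> K2) Omega) by exact: dec_pull.
have d12 : decform (pullback cf sg + pullback cs sg) by exact: dec_add.
have d123 : decform (pullback cf sg + pullback cs sg - pullback cm sg) by exact: dec_sub.
have -> : extd W p v = extd (pullback cf sg) p v + extd (pullback cs sg) p v - extd (pullback cm sg) p v
    - extd (pullback (PhiPhi : C -> K2) Omega) p v.
  have E1 : extd W p v = extd (pullback cf sg + pullback cs sg - pullback cm sg) p v
    - extd (pullback (PhiPhi : C -> K2) Omega) p v by exact: extd_sub.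
  have E2 : extd (pullback cf sg + pullback cs sg - pullback cm sg) p v =
    extd (pullback cf sg + pullback cs sg) p v - extd (pullback cm sg) p v by exact: extd_sub.
  have E3 : extd (pullback cf sg + pullback cs sg) p v = extd (pullback cf sg) p v + extd (pullback cs sg) p v by exact: extd_add.
  by rewrite E1 E2 E3.
rewrite !extd_pull //.
have E (f : C -> H) : smooth_map f -> pullback f (extd sg) p v = pullback f chi p v.
  by move=> sf; apply: extd_solution => i; exact: Tmap_tan.
rewrite !E //; have [_ _ [_ dT _] _] := hK.
have tPP i : tangent (PhiPhi p) (Tmap (PhiPhi : C -> K2) (v i)) by exact: Tmap_tan.
have : delta1 GK Theta (PhiPhi p) (fun i => Tmap (PhiPhi : C -> K2) (v i)) =
    - extd Omega (PhiPhi p) (fun i => Tmap (PhiPhi : C -> K2) (v i)) by exact: dT.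
have X (f : C -> H) : smooth_map f -> pullback f chi p v =
    pullback (s \o f) eta p v - pullback (t \o f) eta p v - pullback (Phi \o f) Theta p v.
  by move=> sf; rewrite -!pullback_comp.
rewrite !X //.
rewrite (_ : s \o cm = s \o cs); last by apply/funext => q; rewrite /= /comp_mul src_comp // comp_eq.
rewrite (_ : t \o cm = t \o cf); last by apply/funext => q; rewrite /= /comp_mul tgt_comp // comp_eq.
rewrite (_ : s \o cf = t \o cs); last by apply/funext => q; rewrite /= comp_eq.
rewrite -[X in X = _ -> _]/(pullback (PhiPhi : C -> K2) (pullback p1 Theta) p v
   + pullback (PhiPhi : C -> K2) (pullback p2 Theta) p v - pullback (PhiPhi : C -> K2) (pullback (pm GK) Theta) p v).
rewrite (@pullback_comp _ _ _ (PhiPhi : C -> K2) p1) ?(@pullback_comp _ _ _ (PhiPhi : C -> K2) p2)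
  ?(@pullback_comp _ _ _ (PhiPhi : C -> K2) (pm GK)); [|exact: pm_smooth|exact: p2_smooth|exact: p1_smooth].
rewrite (_ : pm GK \o PhiPhi = Phi \o cm); last first.
  by apply/funext => q; rewrite /= /pm /comp_mul PM // comp_eq.
rewrite -[p1 \o _]/(Phi \o cf) -[p2 \o _]/(Phi \o cs) -[X in _ = - X -> _]/(pullback (PhiPhi : C -> K2) (extd Omega) p v).
by move=> D; rewrite -[RHS]/(0 : R); move: D; lra.
Qed.

(** The section of [cs] is h |-> (1, h). Along it, the term of the first component vanishes as e^*
    sg = 0, those of the second component and of the product cancel, and Omega vanishes on vectors
    tangent to k |-> (1, k). *)
Lemma mult_zero : form_eq W 0.
Proof.
have scf : smooth_map cf by exact: cf_smooth. have scs : smooth_map cs by exact: cs_smooth.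
have scm : smooth_map cm by exact: cm_smooth. have sPP := PhiPhi_smooth.
have [|||e' se' [e1 e2]] := @comp_map _ _ _ G H _ (e \o t) id.
- by apply: smooth_comp; [exact: t_smooth|exact: e_smooth].
- exact: smooth_id.
- by move=> l; rewrite /= src_unit.
apply: (@basic_zero R C H _ _ cs scs _ W e') => //.
- exact: cs_submersion.
- by move=> q; exact: comp_path.
- by move=> q; exact: mult_horizontal.
- by move=> q u v u0 tu tv; rewrite mult_extd //; exact: vcP.
move=> h v tv; rewrite /pullback WE.
have te : tangent (t h) (Tmap t (v ord0)) by apply: Tmap_tan => //; exact: t_smooth.
have T1 i : Tmap cf (Tmap e' (v i)) = Tmap e (Tmap t (v i)).
  rewrite Tmap_comp // Tmap_comp; last exact: e_smooth.
  by rewrite (_ : cf \o e' = e \o t) //; apply/funext.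
have T2 i : Tmap cs (Tmap e' (v i)) = v i by rewrite Tmap_comp // (Tmap_idE (tv i)).
have T3 i : Tmap cm (Tmap e' (v i)) = v i.
  by rewrite Tmap_comp // (Tmap_idE (tv i)) // => l; rewrite /= /comp_mul e1 e2 /= gcomp_unitl.
have T4 i : Tmap (PhiPhi : C -> K2) (Tmap e' (v i)) = Tmap (pr o) (Tmap Phi (v i)).
  rewrite Tmap_comp // Tmap_comp; last exact: pr_smooth.
  rewrite (_ : PhiPhi \o e' = pr o \o Phi) //.
  by apply/funext => l; rewrite /= /PhiPhi /pr e1 e2 /= (Phi_unit hPhi).
have F1 : (fun i => Tmap cf (Tmap e' (v i))) = fun i => Tmap e (Tmap t (v i)) by apply/funext.
have F2 : (fun i => Tmap cs (Tmap e' (v i))) = v by apply/funext.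
have F3 : (fun i => Tmap cm (Tmap e' (v i))) = v by apply/funext.
have F4 : (fun i => Tmap (PhiPhi : C -> K2) (Tmap e' (v i))) = fun i => Tmap (pr o) (Tmap Phi (v i)) by apply/funext.
have cmE : cm (e' h) = h by rewrite /comp_mul e1 e2 /= gcomp_unitl.
have PE : PhiPhi (e' h) = (o, Phi h) by rewrite /PhiPhi e1 e2 /= (Phi_unit hPhi).
rewrite F1 F2 F3 F4 cmE PE e1 e2 /=.
have -> : sg (e (t h)) (fun i => Tmap e (Tmap t (v i))) = 0.
  by apply: (esg (p := t h) (v := fun i => Tmap t (v i))) => i; apply: Tmap_tan => //; exact: t_smooth.
have -> : Omega (o, Phi h) (fun i => Tmap (pr o) (Tmap Phi (v i))) = 0.
  have [_ O12 _ _] := hK; have [zU _] := O12; apply: (zU (Phi h) (fun i => Tmap Phi (v i))) => i.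
  by apply: Tmap_tan => //; exact: Phi_smooth hPhi.
by rewrite add0r subrr subr0.
Qed.

Lemma solution_isotropic : isotropic_groupoid Omega Theta G Phi (gate sg, eta).
Proof.
have [_ feta ceta _ _] := im; have dgs : decform (gate sg) by exact: dec_gate.
have sP := Phi_smooth hPhi; have sPP := PhiPhi_smooth.
split=> //=.
- by split=> //; exact: gate_form.
- move=> x z tz; rewrite -[RHS](esg tz); apply: gateE => i.
  by apply: Tmap_tan => //; exact: e_smooth.
- move=> p v tv; have T (f : C -> H) : smooth_map f -> pullback f (gate sg) p v = pullback f sg p v.
    by move=> sf; apply: gateE => i; exact: Tmap_tan.
  rewrite -[LHS]/(pullback cf (gate sg) p v + pullback cs (gate sg) p v - pullback cm (gate sg) p v).
  rewrite !T; [|exact: cm_smooth|exact: cs_smooth|exact: cf_smooth].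
  by apply/eqP; rewrite -subr_eq0; apply/eqP; exact: mult_zero.
move=> q v tv; have E : extd (gate sg) q v = chi q v.
  by rewrite (extd_eq dgs (@gateE _ _ _ sg)) //; exact: extd_solution.
rewrite -[RHS]/(pullback s eta q v - pullback t eta q v - extd (gate sg) q v) E -[chi q v]/(pullback s eta q v - pullback t eta q v - pullback Phi Theta q v).
by ring.
Qed.

(** At a unit, theta_u on e_* z is lambda(u)(z): the beta term drops out because Phi is constant on
    units. *)
Lemma lambda_of_solution : lambda_of G (gate sg) = lam.
Proof.
have [[/= l0 _ _ _] _ _ _ _] := im.
apply/funext => x; apply/funext => u; apply/funext => z.
have [[au tz]|nux] := pselect (algd G x u /\ tangent x z); last by rewrite l0 // /lambda_of asboolF.
have [a sa aE] := vertical_section_ext au.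
have te : tangent (e x) (Tmap e z) by apply: Tmap_tan => //; exact: e_smooth.
rewrite lambda_ofE // gateE; last by apply: v2P => //; exact: au.1.
have uE : u = ri a (e x) by rewrite (ri_unit sa.1).
rewrite {1}uE solution_contraction // thetaE alphaE (unit_Phi_tan tz) zero1; last first.
  exact: (dec_beta hK (phi_tan hPhi (sa.1 _))).
rewrite subr0 tgt_unit aE; congr (lam x u _).
rewrite Tmap_comp; last exact: t_smooth.
by rewrite (Tmap_idE tz) // => y /=; rewrite tgt_unit.
Qed.

End FromLambda.

Lemma isotropic_surjective lam eta : isotropic_algebroid GK Omega G Phi (lam, eta) ->
  exists2 sigma, isotropic_groupoid Omega Theta G Phi (sigma, eta) & lambda_of G sigma = lam.
Proof.
move=> im; have loc := local_solution hK hPhi im.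
have [sg [dsg sol esg]] := global_solution (s_smooth G) (@src_submersion _ _ _ G) (e_smooth G) (src_unit G) loc ssc.
by exists (gate sg); [exact: (solution_isotropic im dsg sol esg)|exact: (lambda_of_solution im sol)].
Qed.

(** By [iprod_sigma] the contractions with vertical vectors are determined by lambda, and by
    [dsigma] the differentials agree; the difference is therefore basic, and it vanishes on units by
    normalization. *)
Lemma isotropic_injective sigma sigma' eta : isotropic_groupoid Omega Theta G Phi (sigma, eta) ->
  isotropic_groupoid Omega Theta G Phi (sigma', eta) -> lambda_of G sigma = lambda_of G sigma' -> sigma = sigma'.
Proof.
move=> iso iso' E; have [ds de] := iso_dec iso; have [ds' _] := iso_dec iso'.
have D : form_eq (sigma - sigma') 0.
  apply: source_basic_zero; first exact: dec_sub.
  - move=> q u v u0 tu tv; have [a sa <-] := vertical_ri tu u0.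
    have H1 := iprod_sigma hPhi iso sa tv; have H2 := iprod_sigma hPhi iso' sa tv.
    rewrite -[LHS]/(iprod (ri a) sigma q v - iprod (ri a) sigma' q v) H1 H2 E; exact: subrr.
  - move=> q u v u0 tu tv; have tuv : forall i, tangent q (vc u v i) by exact: vcP.
    by rewrite extd_sub // (dsigma iso) // (dsigma iso') // subrr.
  move=> x z tz; have [_ e1 _ _ _] := iso; have [_ e1' _ _ _] := iso'.
  rewrite -[LHS]/(pullback e sigma x z - pullback e sigma' x z).
  have -> : pullback e sigma x z = 0 by exact: e1.
  have -> : pullback e sigma' x z = 0 by exact: e1'.
  exact: subrr.
have [[[/= f0 _ _ _] _] _ _ _ _] := iso; have [[[/= f0' _ _ _] _] _ _ _ _] := iso'.
apply/funext => p; apply/funext => v.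
have [tv|ntv] := pselect (forall i, tangent p (v i)); last by rewrite f0 // f0'.
by apply/eqP; rewrite -subr_eq0; apply/eqP; exact: D.
Qed.

End Integration.

Theorem theorem3p7 (R : realType)
    (K : manifold R) (GK : lieGroup K)
    (Omega : preform (prodS K K) 2) (Theta : preform K 3)
    (hK : shifted2_symplectic GK Omega Theta)
    (H N : manifold R) (G : lieGroupoid H N)
    (Phi : H -> K) (hPhi : groupoid_morphism G GK Phi) :
  (forall (sigma : preform H 2) (eta : preform N 3),
     isotropic_groupoid Omega Theta G Phi (sigma, eta) ->
     isotropic_algebroid GK Omega G Phi (lambda_of G sigma, eta)) /\
  (source_simply_connected G ->
     set_bij (isotropic_groupoid Omega Theta G Phi)
             (isotropic_algebroid GK Omega G Phi)
             (fun se => (lambda_of G se.1, se.2))).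

Proof.
split=> [sigma eta iso|ssc]; first exact: (iso_algebroid hK hPhi iso).
split=> [[sigma eta] iso|[sigma eta] [sigma' eta'] /set_mem iso /set_mem iso' [E1 E2]|[lam eta] im].
- exact: (iso_algebroid hK hPhi iso).
- move: iso'; rewrite -E2 => iso'; congr (_, _).
  exact: (isotropic_injective hPhi ssc iso iso' E1).
- have [sigma iso E] := isotropic_surjective hK hPhi ssc im.
  by exists (sigma, eta) => //=; rewrite E.
Qed.
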